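(* Fix (small) $\epsilon,\kappa>0$. Let $W,W^{(1)}_G,W^{(2)}_G$ be independent $N\times N$ random matrices of the same symmetry type (all real symmetric or all complex Hermitian), where $W$ is a Wigner-type matrix satisfying the conditions in the context and $W^{(1)}_G,W^{(2)}_G$ are GOE/GUE matrices. Let $0<\alpha<N^{-1-\epsilon}$, let $A$ be any deterministic matrix of the same symmetry type with $\|A\|\le C_0$, and set $$H^{(j)}:=A+W+\sqrt{\alpha}\,W^{(j)}_G,\qquad j=1,2.$$ Then $H^{(1)}$ and $H^{(2)}$ have the same self-consistent density of states $\rho$. Let $E\in\mathbb{R}$ with $\rho(E)\ge\kappa$. Then for any compactly supported smooth test function $F\in C_c^\infty(\mathbb{R}^2)$, $$\int_{\mathbb{R}^2}F(x,y)\,p^{(1,2)}_{1,1}\Big(E+\tfrac{x}{\rho(E)N},E+\tfrac{y}{\rho(E)N}\Big)dx\,dy=\rho(E)\int_{\mathbb{R}}F(x,x)\,p^{(1)}_1\Big(E+\tfrac{x}{\rho(E)N}\Big)dx+\int_{\mathbb{R}^2}F(x,y)\,p^{(1)}_2\Big(E+\tfrac{x}{\rho(E)N},E+\tfrac{y}{\rho(E)N}\Big)dx\,dy+\mathcal{O}(N^{-c}),$$ where the exponent $c>0$ is universal and the implicit constant in $\mathcal{O}$ depends on $F$.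
   Context: All objects depend on $N$; constants called fixed do not. $\langle A\rangle:=N^{-1}\mathrm{Tr}A$; $[N]=\{1,\dots,N\}$. Wigner-type conditions on $W=(w_{ab})_{a,b=1}^N$, real symmetric or complex Hermitian: entries independent up to the symmetry constraint, $\mathbf{E}w_{ab}=0$, $c_0/N\le\mathbf{E}|w_{ab}|^2\le C_0/N$ with fixed $c_0,C_0>0$; in the complex Hermitian case $\Re w_{ab}$ and $\Im w_{ab}$ are independent and $\mathbf{E}w_{ab}^2=0$ for $a\neq b$; for every $p\in\mathbb{N}$ there is a fixed $C_p>0$ with $\mathbf{E}|w_{ab}|^p\le C_pN^{-p/2}$. GOE/GUE normalization: centered Gaussian entries, independent up to symmetry; GOE: real with off-diagonal variance $1/N$ and diagonal variance $2/N$; GUE: $\mathbf{E}|w_{ab}|^2=1/N$ for all $a,b$, and for $a\ne b$ the real and imaginary parts are independent with variance $1/(2N)$ each. Self-consistent density of states of a random matrix $H=A+\widetilde W$ with $A$ deterministic and $\mathbf{E}\widetilde W=0$: with $\mathcal{S}[R]:=\mathbf{E}[\widetilde WR\widetilde W]$, for $z\in\mathbb{C}\setminus\mathbb{R}$ let $M(z)$ be the unique $N\times N$ solution of $-M(z)^{-1}=z-A+\mathcal{S}[M(z)]$ with $\Im z\,\Im M(z)>0$ ($\Im M=(M-M^* )/(2\mathrm{i})$); then $\rho(z)=\pi^{-1}|\langle\Im M(z)\rangle|$ and $\rho(x)=\lim_{\eta\to+0}\rho(x+\mathrm{i}\eta)$ for $x\in\mathbb{R}$. Correlation functions: let $\lambda^{(j)}_1\le\dots\le\lambda^{(j)}_N$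 be the eigenvalues of $H^{(j)}$. $p^{(1,2)}_{m,n}$ is defined implicitly (as a distribution in general) by $$\mathbf{E}\Big[\tfrac{(N-m)!}{N!}\tfrac{(N-n)!}{N!}\sum f(\lambda^{(1)}_{i_1},\dots,\lambda^{(1)}_{i_m},\lambda^{(2)}_{j_1},\dots,\lambda^{(2)}_{j_n})\Big]=\int_{\mathbb{R}^{m+n}}f(\mathbf{x},\mathbf{y})p^{(1,2)}_{m,n}(\mathbf{x},\mathbf{y})\,d\mathbf{x}\,d\mathbf{y}$$ for all smooth compactly supported $f$, the sum being over pairwise distinct $i_1,\dots,i_m\in[N]$ and pairwise distinct $j_1,\dots,j_n\in[N]$ (an $i$ may equal a $j$); $p^{(1)}_m:=p^{(1,2)}_{m,0}$. Integrals against rescaled correlation functions are understood by change of variables. *)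

(* Defs.v *)
From HB Require Import structures.
From mathcomp Require Export all_boot all_order all_algebra.
From mathcomp Require Export complex.
From mathcomp Require Export all_classical all_reals all_analysis.
Export Order.TTheory GRing.Theory Num.Theory.
Export numFieldNormedType.Exports.

Set Implicit Arguments.
Unset Strict Implicit.
Unset Printing Implicit Defensive.

Global Open Scope classical_set_scope.
Global Open Scope ring_scope.
Local Open Scope complex_scope.
Local Open Scope sesquilinear_scope.

Notation cabs := ComplexField.Normc.normc (only parsing).

(* Real matrices are viewed as complex matrices with real entries, so that both
   symmetry types live in 'M[R[i]]_N. *)
Inductive symmetry_type := RealSymmetric | ComplexHermitian.

Section Matrices.
Context {R : realType} {N : nat}.
Implicit Types (A B M : 'M[R[i]]_N).

Definition has_symmetry (beta : symmetry_type) A : Prop :=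
  match beta with
  | RealSymmetric => A \is a realmx /\ A \is symmetricmx
  | ComplexHermitian => A \is hermsymmx
  end.

Definition l2norm (v : 'cV[R[i]]_N) : R := Num.sqrt (\sum_i cabs (v i 0) ^+ 2).

Definition opnorm A : R :=
  sup [set l2norm (A *m v) | v in [set v : 'cV[R[i]]_N | l2norm v = 1]].

Definition ntr A : R[i] := N%:R^-1 * \tr A.

Definition Im_mx A : 'M[R[i]]_N := (2 * 'i%C)^-1 *: (A - A^t*).

(* The order on R[i] makes 0 < c mean that c is real and positive. *)
Definition posdefmx A : Prop :=
  forall v : 'cV[R[i]]_N, v != 0 -> 0 < (v^t* *m A *m v) 0 0.

(* Increasingly ordered with multiplicity; `spectral_diag` is meaningful for
   normal matrices, and is only used here for Hermitian ones. *)
Definition eigs A : seq R :=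
  sort <=%R [seq complex.Re (spectral_diag A 0 i) | i <- enum 'I_N].

End Matrices.

Section Independence.
Context d (T : measurableType d) (R : realType) (P : probability T R).

Definition mutually_independent (I : finType) (F : I -> set_system T) : Prop :=
  forall (J : {set I}) (B : I -> set T),
    (forall i, i \in J -> F i (B i)) ->
    P (\bigcap_(i in [set` J]) B i) = (\prod_(i in J) P (B i))%E.

Definition sigma_gen (I : Type) (X : I -> T -> R) : set_system T :=
  <<s \bigcup_i preimage_set_system setT (X i) measurable >>.

Definition part (b : bool) (z : R[i]) : R :=
  if b then complex.Re z else complex.Im z.

Definition sigma_entry (X : T -> R[i]) : set_system T :=
  sigma_gen (fun b : bool => part b \o X).

Definition sigma_matrix N (W : T -> 'M[R[i]]_N) : set_system T :=
  sigma_gen (fun (x : 'I_N * 'I_N * bool) w => part x.2 (W w x.1.1 x.1.2)).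

Definition indep_Re_Im (X : T -> R[i]) : Prop :=
  mutually_independent (fun b : bool => sigma_gen (fun _ : unit => part b \o X)).

Definition random_matrix N (W : T -> 'M[R[i]]_N) : Prop :=
  forall a b c, measurable_fun setT (fun w => part c (W w a b)).

(* Independence up to the symmetry constraint: only pairs a <= b are used. *)
Definition independent_entries N (W : T -> 'M[R[i]]_N) : Prop :=
  mutually_independent
    (fun ab : {ab : 'I_N * 'I_N | (ab.1 <= ab.2)%N} =>
       sigma_entry (fun w => W w (val ab).1 (val ab).2)).

End Independence.

Section RandomMatrices.
Context d (T : measurableType d) (R : realType) (P : probability T R).

Definition cexpect (X : T -> R[i]) : R[i] :=
  fine 'E_P[fun w => complex.Re (X w)] +i* fine 'E_P[fun w => complex.Im (X w)].

Definition centered_gaussian (variance : R) (X : T -> R) : Prop :=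
  forall B : set R, measurable B ->
    P (X @^-1` B) = normal_prob 0 (Num.sqrt variance) B.

Record wigner_type (beta : symmetry_type) (c0 C0 : R) (Cp : nat -> R)
    (N : nat) (W : T -> 'M[R[i]]_N) : Prop := WignerType {
  wigner_symm : forall w, has_symmetry beta (W w);
  wigner_meas : random_matrix W;
  wigner_indep : independent_entries P W;
  wigner_mean : forall a b, cexpect (fun w => W w a b) = 0;
  wigner_var : forall a b,
    ((c0 / N%:R)%:E <= 'E_P[fun w => (cabs (W w a b) ^+ 2)%R]
                    <= (C0 / N%:R)%:E)%E;
  wigner_cplx : beta = ComplexHermitian -> forall a b, a != b ->
    indep_Re_Im P (fun w => W w a b) /\
    cexpect (fun w => W w a b ^+ 2) = 0;
  wigner_moments : forall (p : nat) a b,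
    ('E_P[fun w => (cabs (W w a b) ^+ p)%R]
       <= (Cp p * N%:R `^ (- (p%:R / 2)))%:E)%E
}.

(* GOE for RealSymmetric, GUE for ComplexHermitian. *)
Record gaussian_ensemble (beta : symmetry_type) (N : nat)
    (W : T -> 'M[R[i]]_N) : Prop := GaussianEnsemble {
  gauss_symm : forall w, has_symmetry beta (W w);
  gauss_meas : random_matrix W;
  gauss_indep : independent_entries P W;
  gauss_goe : beta = RealSymmetric -> forall a b,
    centered_gaussian ((if a == b then 2 else 1) / N%:R)
                      (fun w => complex.Re (W w a b));
  gauss_gue_diag : beta = ComplexHermitian -> forall a,
    centered_gaussian (1 / N%:R) (fun w => complex.Re (W w a a));
  gauss_gue_offdiag : beta = ComplexHermitian -> forall a b, a != b ->
    [/\ centered_gaussian (1 / (2 * N%:R)) (fun w => complex.Re (W w a b)),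
        centered_gaussian (1 / (2 * N%:R)) (fun w => complex.Im (W w a b)) &
        indep_Re_Im P (fun w => W w a b)]
}.

Section SelfConsistentDensity.
Context {N : nat} (A : 'M[R[i]]_N) (W : T -> 'M[R[i]]_N).

Definition self_energy (Q : 'M[R[i]]_N) : 'M[R[i]]_N :=
  \matrix_(a, b) cexpect (fun w => (W w *m Q *m W w) a b).

Definition MDE_solution (z : R[i]) (M : 'M[R[i]]_N) : Prop :=
  [/\ M \in unitmx,
      - invmx M = z%:M - A + self_energy M &
      posdefmx ((complex.Im z)%:C *: Im_mx M)].

Definition MDE_sol (z : R[i]) : 'M[R[i]]_N := xget 0 [set M | MDE_solution z M].

Definition scdos_nonreal (z : R[i]) : R := pi^-1 * cabs (ntr (Im_mx (MDE_sol z))).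

(* Self-consistent density of states of A + W, for W centered. *)
Definition scdos (z : R[i]) : R :=
  if complex.Im z != 0 then scdos_nonreal z
  else lim (scdos_nonreal (complex.Re z +i* eta) @[eta --> (0 : R)^'+]).

End SelfConsistentDensity.

(* The correlation function p^(1,2)_(m,n) is in general a distribution; it is
   encoded by the functional f |-> \int f(x, y) p^(1,2)_(m,n)(x, y) dx dy. *)
Definition correlation N (H1 H2 : T -> 'M[R[i]]_N) (m n : nat)
    (f : 'rV[R]_(m + n) -> R) : R :=
  fine 'E_P[fun w =>
    ((N - m)`!%:R / N`!%:R) * ((N - n)`!%:R / N`!%:R) *
    \sum_(i : {ffun 'I_m -> 'I_N} | injectiveb i)
      \sum_(j : {ffun 'I_n -> 'I_N} | injectiveb j)
        f (row_mx (\row_k (eigs (H1 w))`_(i k)) (\row_k (eigs (H2 w))`_(j k)))].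

End RandomMatrices.

Arguments correlation {d T R} P {N} H1 H2 (m n)%_N f.

Section TestFunctions.
Context {R : realType}.

(* \int F(x) p(E + x_1/s, ..., E + x_k/s) dx after the change of variables
   u_l = E + x_l/s, for the distribution p given by its action on functions. *)
Definition rescaled_integral (k : nat) (p : ('rV[R]_k -> R) -> R) (E s : R)
    (F : 'rV[R]_k -> R) : R :=
  s ^+ k * p (fun u => F (s *: (u - const_mx E))).

Fixpoint Ck (n k : nat) (F : 'rV[R]_n -> R) : Prop :=
  if k is k'.+1 then
    [/\ continuous F,
        forall i x, derivable F x (delta_mx 0 i) &
        forall i, Ck k' (fun x => 'D_(delta_mx 0 i) F x)]
  else continuous F.

Definition Cinfty_c (n : nat) (F : 'rV[R]_n -> R) : Prop :=
  (forall k, Ck k F) /\ compact (closure [set x | F x != 0]).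

End TestFunctions.

(* Main.v *)
Require Import Defs.
From mathcomp Require Import all_boot all_order all_algebra complex.
From mathcomp Require Import all_classical all_reals all_analysis.
From mathcomp Require Import measurable_realfun ring lra.

Import Order.TTheory GRing.Theory Num.Theory numFieldNormedType.Exports.

(** Both sides are expectations of statistics Psi(H, H') = sum_ij f(lam_i(H), lam_j(H')) with
    f(u, v) = F(s (u - E), s (v - E)): the two-point integral for (H1, H2) is E Psi(H1, H2), while
    the right-hand side collects the terms i <> j and i = j of E Psi(H1, H1), up to a relative
    error O(1/N) coming from the normalisation 1/(N (N - 1)) against 1/N^2.  Since the Gaussian
    component has variance alpha/N = o(N^-2), it moves eigenvalues by less than their spacing, and
    each of E Psi(H1, H2) and E Psi(H1, H1) is compared with E Psi(A + W, A + W).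

    The comparison runs the Gaussian component as a heat flow.  To second order along the flow the
    linear part has mean zero, and the quadratic part is a sum over pairs of eigenvalues of divided
    differences of f, controlled by the numbers of eigenvalues of H and H' in windows of width of
    order 1/N, weighted by the inverse distance of the window to E.  The third moments of these
    counts are O(N^(3 delta)), uniformly in the window and in deterministic shifts of W: if a window
    holds more than k = N^delta eigenvalues, then some coordinate a carries a share k/N of their
    spectral weight, which forces the a-th row to be almost orthogonal to the window of the minor
    without a, a space of dimension at least k - 1.  A small-ball estimate for rows with independent
    entries makes this improbable.  Only an upper bound on the density of states is needed, besides
    rho(E) >= kappa; it follows from the trace of the Dyson equation. *)

Set Implicit Arguments.
Unset Strict Implicit.
Unset Printing Implicit Defensive.

Local Open Scope classical_set_scope.
Local Open Scope ring_scope.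

(** Matrices carry no measure structure here. An observable is a bounded function on an additive
    group that is Lipschitz along each real coordinate of the randomness; this alone makes
    compositions measurable, and expectations become iterated integrals that can be permuted. Bounds
    uniform in the base point then treat the Gaussian component, or all rows but one, as a
    deterministic shift. Eigenvalues are never differentiated: two Hermitian matrices are compared
    through the unitary overlap of their eigenbases, whose squared entries are doubly stochastic.
    The cubic remainder of the expansion may have a very bad constant in N, since it disappears when
    the time step of the flow tends to zero. The real coordinates of one row can be degenerate
    against complex eigenvectors. Squaring the probability produces two independent copies c, c' of
    the real row; against c + i c' an orthonormal frame yields orthonormal real linear forms, and
    both symmetry types are treated at once. Powers of N^delta are affordable because alpha N is at
    most N^(-eps). *)

Section Measurability.
Context d (T : measurableType d) (R : realType).

(** Rounding [X] down to multiples of 1/(n+1) leaves countably many frozen values of [u], for which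
    measurability is assumed; the Lipschitz bound makes the roundings converge pointwise. This
    replaces joint measurability of [F]. *)
Lemma measurable_fun_lip_comp (F : T -> R -> R) (X : T -> R) (L : R) :
  measurable_fun setT X -> (forall u, measurable_fun setT (F ^~ u)) ->
  (forall w u v, `|F w u - F w v| <= L * `|u - v|) ->
  measurable_fun setT (fun w => F w (X w)).
Proof.
move=> mX mF lipF.
pose D n w : R := (Num.floor (n.+1%:R * X w))%:~R / n.+1%:R.
apply: (@measurable_fun_cvg _ _ _ setT (fun n w => F w (D n w))).
  move=> n _ B mB; rewrite setTI.
  have -> : (fun w => F w (D n w)) @^-1` B =
    \bigcup_(k in [set: int])
      ([set w | k%:~R <= n.+1%:R * X w < (k + 1)%:~R] `&`
       (fun w => F w (k%:~R / n.+1%:R)) @^-1` B).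
    apply/seteqP; split => w /=.
      move=> Bw; exists (Num.floor (n.+1%:R * X w)) => //=; split => //.
      exact: Num.Theory.floor_itv.
    move=> [k _ /= [/andP[k1 k2]]].
    have -> : k = Num.floor (n.+1%:R * X w).
      by apply/esym/Num.Theory.floor_def; rewrite k1 k2.
    by [].
  apply: countable_bigcupT_measurable; first exact: countableP.
  move=> k; apply: measurableI; last by rewrite -[X in measurable X]setTI; exact: mF.
  have mX' : measurable_fun setT (fun w => n.+1%:R * X w).
    by apply: measurable_funM => //.
  rewrite [X in measurable X](_ : _ = (fun w => n.+1%:R * X w) @^-1` `[k%:~R, (k+1)%:~R[).
    by rewrite -[X in measurable X]setTI; apply: mX'.
  by apply/seteqP; split => w /=; rewrite in_itv.
move=> w _.
apply/cvgrPdist_le => /= e e0.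
near=> n.
rewrite -normrN opprB; apply: (le_trans (lipF _ _ _)).
have h1 : `|D n w - X w| <= n.+1%:R^-1.
  rewrite /D; have := Num.Theory.floor_itv (n.+1%:R * X w).
  set f := (Num.floor _)%:~R; move=> /andP[a]; rewrite intrD => b.
  have p0 : (0 : R) < n.+1%:R by [].
  have -> : f / n.+1%:R - X w = (f - n.+1%:R * X w) / n.+1%:R.
    by rewrite mulrBl [_ * X w]mulrC mulfK // gt_eqF.
  rewrite normrM [X in _ * X]ger0_norm ?invr_ge0 //.
  rewrite -[leRHS]mul1r ler_pM2r ?invr_gt0 // ler_norml; move: a b => /=; lra.
have L0 : L * `|D n w - X w| <= (`|L| + 1) * n.+1%:R^-1.
  apply: (@le_trans _ _ (`|L| * `|D n w - X w|)).
    by rewrite ler_wpM2r // ler_norm.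
  by rewrite ler_pM // lerDl.
apply: (le_trans L0); rewrite ler_pdivrMr // -ler_pdivrMl //.
rewrite mulrC; near: n.
exists (Num.bound ((`|L| + 1) / e)) => // n /= hn.
have h0 : 0 <= (`|L| + 1) / e by rewrite divr_ge0 // ?ltW // addr_ge0.
apply/ltW/(lt_le_trans (archi_boundP h0)); rewrite ler_nat.
exact: (leq_trans hn).
Unshelve. all: by end_near. Qed.

End Measurability.

(** * Expectations of bounded and of integrable variables *)

Section Expectation.
Context d (T : measurableType d) (R : realType) (P : probability T R).

Lemma bounded_integrable (f : T -> R) (M : R) :
  measurable_fun setT f -> (forall w, `|f w| <= M) ->
  P.-integrable setT (EFin \o f).
Proof.
move=> mf bf; apply: measurable_bounded_integrable => //.
  by rewrite (le_lt_trans (probability_le1 P measurableT)) // ltry.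
exists M; split; first by rewrite num_real.
by move=> x Mx w _ /=; apply: (le_trans (bf w)); exact: ltW.
Qed.

Lemma Rintegral_prob_cst (c : R) : \int[P]_w c = c.
Proof. by rewrite Rintegral_cst // [X in fine X](_ : _ = 1%E) ?mulr1 //; exact: probability_setT. Qed.

Lemma Rintegral_bounded (f : T -> R) (M : R) :
  measurable_fun setT f -> (forall w, `|f w| <= M) -> `|\int[P]_w f w| <= M.
Proof.
move=> mf bf; apply: le_trans (le_normr_Rintegral _ _) _ => //.
  exact: bounded_integrable bf.
rewrite -[leRHS]Rintegral_prob_cst; apply: le_Rintegral => //.
- apply: (@bounded_integrable _ M); first exact: measurableT_comp.
  by move=> w; rewrite normr_id.
- by apply: (@bounded_integrable _ `|M|) => // w.
Qed.

Lemma integrableRD (f g : T -> R) : P.-integrable setT (EFin \o f) ->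
  P.-integrable setT (EFin \o g) -> P.-integrable setT (EFin \o (fun w => f w + g w)).
Proof. by move=> hf hg; exact: (integrableD measurableT hf hg). Qed.

Lemma integrableRB (f g : T -> R) : P.-integrable setT (EFin \o f) ->
  P.-integrable setT (EFin \o g) -> P.-integrable setT (EFin \o (fun w => f w - g w)).
Proof. by move=> hf hg; exact: (integrableB measurableT hf hg). Qed.

Lemma integrableRZ (c : R) (f : T -> R) : P.-integrable setT (EFin \o f) ->
  P.-integrable setT (EFin \o (fun w => c * f w)).
Proof. by move=> hf; exact: (integrableZl measurableT c hf). Qed.

Lemma integrableR_cst (c : R) : P.-integrable setT (EFin \o (fun _ : T => c)).
Proof. by apply: (@bounded_integrable _ `|c|). Qed.

Lemma integrableR_norm (f : T -> R) : P.-integrable setT (EFin \o f) ->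
  P.-integrable setT (EFin \o (fun w => `|f w|)).
Proof. by move=> hf; exact: (integrable_abse hf). Qed.

Lemma integrableR_sum (I : Type) (r : seq I) (Q : pred I) (F : I -> T -> R) :
  (forall i, P.-integrable setT (EFin \o F i)) ->
  P.-integrable setT (EFin \o (fun w => \sum_(i <- r | Q i) F i w)).
Proof.
move=> hF; elim: r => [|i r IH].
  rewrite (_ : (fun w => _) = fun _ => 0); first exact: integrableR_cst.
  by apply/funext => w; rewrite big_nil.
rewrite (_ : (fun w => _) = fun w => (if Q i then F i w else 0) + \sum_(j <- r | Q j) F j w); last first.
  by apply/funext => w; rewrite big_cons; case: (Q i) => //; rewrite add0r.
by apply: integrableRD => //; case: (Q i) => //; exact: integrableR_cst.
Qed.

Lemma Rintegral_sum (I : Type) (r : seq I) (Q : pred I) (F : I -> T -> R) :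
  (forall i, P.-integrable setT (EFin \o F i)) ->
  \int[P]_w (\sum_(i <- r | Q i) F i w) = \sum_(i <- r | Q i) \int[P]_w F i w.
Proof.
move=> hF; elim: r => [|i r IH].
  rewrite big_nil; under eq_Rintegral do rewrite big_nil; exact: Rintegral_prob_cst.
rewrite big_cons; under eq_Rintegral do rewrite big_cons.
by case: (Q i) => //; rewrite RintegralD // ?IH //; exact: integrableR_sum.
Qed.

Lemma integrableR_le (f g : T -> R) : measurable_fun setT f -> (forall w, `|f w| <= g w) ->
  P.-integrable setT (EFin \o g) -> P.-integrable setT (EFin \o f).
Proof.
move=> mf fg hg; apply: (le_integrable measurableT _ _ hg); first exact/measurable_EFinP.
by move=> w _ /=; rewrite lee_fin (le_trans (fg w)) // ler_norm.
Qed.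

End Expectation.

(** * Iterated expectations over independent coordinates *)

Section BoundedLipschitz.
Context (R : realType) (V : zmodType) (K : Type) (e : K -> R -> V).

(** [V] needs only addition: [e i t] is the displacement caused by the value [t] of the [i]-th
    random coordinate. The constants are qualitative; they secure measurability and integrability
    and may grow with the dimension. *)
Definition lipschitz_along (L : R) (Phi : V -> R) :=
  forall i x t, `|Phi (x + e i t) - Phi x| <= L * `|t|.

Definition bounded_lip (M L : R) (Phi : V -> R) :=
  (forall x, `|Phi x| <= M) /\ lipschitz_along L Phi.

Hypothesis e_add : forall i s t, e i (s + t) = e i s + e i t.

Lemma lip_along2 L Phi i x s t : lipschitz_along L Phi ->
  `|Phi (x + e i s) - Phi (x + e i t)| <= L * `|s - t|.
Proof.
move=> lP; have -> : x + e i s = (x + e i t) + e i (s - t).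
  by rewrite -addrA -e_add addrC [t + _]addrC subrK addrC.
exact: lP.
Qed.

Lemma bounded_lipD M L M' L' Phi Psi : bounded_lip M L Phi -> bounded_lip M' L' Psi ->
  bounded_lip (M + M') (L + L') (fun x => Phi x + Psi x).
Proof.
move=> [b1 l1] [b2 l2]; split => [x|i x t].
  by apply: le_trans (ler_normD _ _) _; rewrite lerD.
rewrite opprD addrACA mulrDl; apply: le_trans (ler_normD _ _) _.
by rewrite lerD ?l1 ?l2.
Qed.

Lemma bounded_lipM M L M' L' Phi Psi : bounded_lip M L Phi -> bounded_lip M' L' Psi ->
  bounded_lip (M * M') (M * L' + L * M') (fun x => Phi x * Psi x).
Proof.
move=> [b1 l1] [b2 l2]; split => [x|i x t].
  by rewrite normrM ler_pM.
have -> : Phi (x + e i t) * Psi (x + e i t) - Phi x * Psi x =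
  Phi (x + e i t) * (Psi (x + e i t) - Psi x) + (Phi (x + e i t) - Phi x) * Psi x by ring.
apply: le_trans (ler_normD _ _) _; rewrite !normrM mulrDl.
rewrite lerD //.
  by rewrite -mulrA ler_pM.
by rewrite mulrAC ler_pM.
Qed.

Lemma bounded_lip_cst c : bounded_lip `|c| 0 (fun _ => c).
Proof. by split => // i x t; rewrite subrr normr0 mul0r. Qed.

Lemma bounded_lipZ M L c Phi : bounded_lip M L Phi ->
  bounded_lip (`|c| * M) (`|c| * L) (fun x => c * Phi x).
Proof.
move=> [b l]; split => [x|i x t]; first by rewrite normrM ler_wpM2l.
by rewrite -mulrBr normrM -mulrA ler_wpM2l.
Qed.

Lemma bounded_lip_comp M L Lf (f : R -> R) Mf Phi : bounded_lip M L Phi ->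
  (forall x, `|f x| <= Mf) -> (forall x y, `|f x - f y| <= Lf * `|x - y|) -> 0 <= Lf ->
  bounded_lip Mf (Lf * L) (fun x => f (Phi x)).
Proof.
move=> [b l] bf lf Lf0; split => [x|i x t]; first exact: bf.
by apply: (le_trans (lf _ _)); rewrite -mulrA ler_wpM2l.
Qed.

Lemma bounded_lip_sum (J : Type) (s : seq J) (Q : pred J) (F : J -> V -> R) (M L : R) :
  (forall j, bounded_lip M L (F j)) ->
  bounded_lip (\sum_(j <- s | Q j) M) (\sum_(j <- s | Q j) L) (fun x => \sum_(j <- s | Q j) F j x).
Proof.
move=> bF; elim: s => [|j s IH].
  rewrite !big_nil (_ : (fun _ => _) = (fun _ => 0)).
    by split => [x|i x t]; rewrite ?subrr normr0 ?mul0r.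
  by apply/funext => x; rewrite big_nil.
rewrite !big_cons (_ : (fun x => _) = (fun x => if Q j then F j x + \sum_(j <- s | Q j) F j x
    else \sum_(j <- s | Q j) F j x)); last by apply/funext => x; rewrite big_cons.
by case: (Q j) => //; exact: bounded_lipD.
Qed.

Section Conv.
Context d (T : measurableType d) (P : probability T R).
Implicit Types (Z : K -> T -> R) (s : seq K) (Phi : V -> R).

Lemma measurable_lip_comp L Phi (Z : T -> R) i x : lipschitz_along L Phi ->
  measurable_fun setT Z -> measurable_fun setT (fun w => Phi (x + e i (Z w))).
Proof.
move=> lP mZ; apply: (@measurable_fun_lip_comp _ _ _ (fun _ u => Phi (x + e i u)) Z L) => //.
by move=> _ u v; exact: lip_along2.
Qed.

Definition convol1 (Z : T -> R) i Phi x := \int[P]_w Phi (x + e i (Z w)).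

(** The expectation of [Phi] at [x] plus independent displacements along [s]. Each coordinate is
    integrated over its own copy of [P], so independence is built in, and monotonicity or
    permutation follows by induction on [s]. *)
Fixpoint convol Z s Phi : V -> R :=
  if s is i :: s' then convol1 (Z i) i (convol Z s' Phi) else Phi.

Lemma integrable_lip_comp M L Phi (Z : T -> R) i x : bounded_lip M L Phi ->
  measurable_fun setT Z ->
  P.-integrable setT (EFin \o (fun w => Phi (x + e i (Z w)))).
Proof.
move=> [b l] mZ; apply: (@bounded_integrable _ _ _ _ _ M) => //.
exact: measurable_lip_comp l mZ.
Qed.

Lemma bounded_lip_convol1 M L Phi (Z : T -> R) i : measurable_fun setT Z ->
  bounded_lip M L Phi -> bounded_lip M L (convol1 Z i Phi).
Proof.
move=> mZ [b l]; split => [x|j x t].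
  apply: Rintegral_bounded => // .
  exact: measurable_lip_comp l mZ.
have bl : bounded_lip M L Phi by split.
rewrite /convol1 -RintegralB //; try exact: (integrable_lip_comp _ _ bl mZ).
apply: Rintegral_bounded.
  by apply: measurable_funB; exact: measurable_lip_comp l mZ.
by move=> w; rewrite addrAC; exact: l.
Qed.

Section FixZ.
Variable Z : K -> T -> R.
Hypothesis mZ : forall i, measurable_fun setT (Z i).

Lemma bounded_lip_convol M L Phi s : bounded_lip M L Phi -> bounded_lip M L (convol Z s Phi).
Proof. by move=> bP; elim: s => //= i s IH; exact: bounded_lip_convol1. Qed.

(** Restricting comparisons to the points met along [s] lets [convol_le_at] use quantities that the
    displacements leave unchanged, such as a minor during the integration over its row. *)
Fixpoint reachable s x y : Prop :=
  if s is i :: s' then exists u, reachable s' (x + e i u) y else y = x.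

Lemma convol_le_at M L Phi M' L' Psi s x : bounded_lip M L Phi -> bounded_lip M' L' Psi ->
  (forall y, reachable s x y -> Phi y <= Psi y) ->
  convol Z s Phi x <= convol Z s Psi x.
Proof.
move=> bP bQ; elim: s x => [|i s IH] x h /=; first exact: h.
apply: le_Rintegral => //.
- by apply: integrable_lip_comp => //; exact: bounded_lip_convol bP.
- by apply: integrable_lip_comp => //; exact: bounded_lip_convol bQ.
by move=> w _; apply: IH => y ry; apply: h => /=; exists (Z i w).
Qed.

Lemma convol_le M L Phi M' L' Psi s x : bounded_lip M L Phi -> bounded_lip M' L' Psi ->
  (forall x, Phi x <= Psi x) -> convol Z s Phi x <= convol Z s Psi x.
Proof. by move=> bP bQ h; apply: convol_le_at bP bQ _. Qed.

Lemma convol_cst c s x : convol Z s (fun _ => c) x = c.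
Proof.
elim: s x => //= i s IH x; rewrite /convol1; under eq_Rintegral do rewrite IH.
exact: Rintegral_prob_cst.
Qed.

Lemma convol_leM M L Phi B s x : bounded_lip M L Phi -> (forall x, Phi x <= B) ->
  convol Z s Phi x <= B.
Proof.
move=> bP h; rewrite -[leRHS](convol_cst B s x).
exact: convol_le bP (bounded_lip_cst B) _.
Qed.

Lemma convol_ge0 M L Phi s x : bounded_lip M L Phi -> (forall x, 0 <= Phi x) ->
  0 <= convol Z s Phi x.
Proof.
move=> bP h; rewrite -[leLHS](convol_cst 0 s x).
exact: convol_le (bounded_lip_cst 0) bP _.
Qed.

Lemma convolD M L Phi M' L' Psi s x : bounded_lip M L Phi -> bounded_lip M' L' Psi ->
  convol Z s (fun x => Phi x + Psi x) x = convol Z s Phi x + convol Z s Psi x.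
Proof.
move=> bP bQ; elim: s x => //= i s IH x; rewrite /convol1.
under eq_Rintegral do rewrite IH.
by rewrite RintegralD //; apply: integrable_lip_comp => //; apply: bounded_lip_convol; eauto.
Qed.

Lemma convolZ M L c Phi s x : bounded_lip M L Phi ->
  convol Z s (fun x => c * Phi x) x = c * convol Z s Phi x.
Proof.
move=> bP; elim: s x => //= i s IH x; rewrite /convol1.
under eq_Rintegral do rewrite IH.
by rewrite RintegralZl //; apply: integrable_lip_comp => //; apply: bounded_lip_convol; eauto.
Qed.

Lemma convol_sum (J : Type) (r : seq J) (Q : pred J) (F : J -> V -> R) M L s x :
  (forall j, bounded_lip M L (F j)) ->
  convol Z s (fun x => \sum_(j <- r | Q j) F j x) x = \sum_(j <- r | Q j) convol Z s (F j) x.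
Proof.
move=> bF; elim: r => [|j r IH].
  rewrite big_nil (_ : (fun _ => _) = (fun _ => 0)) ?convol_cst //.
  by apply/funext => y; rewrite big_nil.
rewrite big_cons; under eq_fun do rewrite big_cons.
case: (Q j) => //; rewrite -IH.
exact: convolD (bF j) (bounded_lip_sum r Q bF).
Qed.

Lemma convol_norm_le M L Phi M' L' Psi s x : bounded_lip M L Phi -> bounded_lip M' L' Psi ->
  (forall x, `|Phi x| <= Psi x) -> `|convol Z s Phi x| <= convol Z s Psi x.
Proof.
move=> bP bQ h; rewrite ler_norml; apply/andP; split; last first.
  by apply: convol_le bP bQ _ => y; apply: le_trans (h y); rewrite ler_norm.
rewrite -mulN1r -(convolZ _ _ _ bQ).
apply: convol_le (bounded_lipZ (-1) bQ) bP _ => y.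
by rewrite mulN1r lerNl; apply: le_trans (h y); rewrite -normrN ler_norm.
Qed.

Lemma convol_cat s1 s2 Phi : convol Z (s1 ++ s2) Phi = convol Z s1 (convol Z s2 Phi).
Proof. by elim: s1 => //= i s ->. Qed.

End FixZ.

(** Fubini on [T * T]. Joint measurability of the integrand comes from applying
    [measurable_fun_lip_comp] once in each variable. *)
Lemma convol1_swap M L Phi (Z1 Z2 : T -> R) i j x : bounded_lip M L Phi ->
  measurable_fun setT Z1 -> measurable_fun setT Z2 ->
  convol1 Z1 i (convol1 Z2 j Phi) x = convol1 Z2 j (convol1 Z1 i Phi) x.
Proof.
move=> bP m1 m2; have [b l] := bP; rewrite /convol1.
pose f (z : T * T) : \bar R := (Phi (x + e i (Z1 z.1) + e j (Z2 z.2)))%:E.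
have mf : measurable_fun setT f.
  apply/measurable_EFinP.
  apply: (@measurable_fun_lip_comp _ _ _ (fun z u => Phi (x + e i (Z1 z.1) + e j u))
    (fun z => Z2 z.2) L).
  - by apply: measurableT_comp => //; exact: measurable_snd.
  - move=> u; apply: (@measurable_fun_lip_comp _ _ _ (fun z v => Phi (x + e i v + e j u))
      (fun z => Z1 z.1) L).
    + by apply: measurableT_comp => //; exact: measurable_fst.
    + by [].
    + by move=> _ v v'; rewrite ![x + e i _ + _]addrAC; exact: lip_along2.
  - by move=> w u v; exact: lip_along2.
have intf : (P \x P)%E.-integrable setT f.
  apply: (@bounded_integrable _ _ _ (P \x P)%E _ M) => //.
  exact/measurable_EFinP.
have := Fubini intf.
have E1 (g : T -> T -> R) : (forall w, measurable_fun setT (g w)) ->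
    (forall w w', `|g w w'| <= M) ->
    (\int[P]_w \int[P]_w' (g w w')%:E = \int[P]_w (\int[P]_w' g w w')%:E)%E.
  move=> mg bg; apply: eq_integral => w _; rewrite fineK //.
  by apply: integrable_fin_num => //; exact: bounded_integrable (bg w).
move=> Fub.
rewrite /Rintegral.
congr fine; rewrite -E1; last by move=> w w'; exact: b.
  rewrite Fub -E1.
  - apply: eq_integral => w _; apply: eq_integral => w' _.
    by rewrite /f /= addrAC.
  - by move=> w; exact: measurable_lip_comp l m1.
  - by move=> w w'; exact: b.
by move=> w; exact: measurable_lip_comp l m2.
Qed.

Section Perm.
Variable Z : K -> T -> R.
Hypothesis mZ : forall i, measurable_fun setT (Z i).

Lemma convol1_convol M L Phi (Y : T -> R) j s x : bounded_lip M L Phi ->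
  measurable_fun setT Y ->
  convol1 Y j (convol Z s Phi) x = convol Z s (convol1 Y j Phi) x.
Proof.
move=> bP mY; elim: s x => //= i s IH x.
rewrite (convol1_swap (M := M) (L := L)) //; last exact: bounded_lip_convol.
by rewrite /convol1; apply: eq_Rintegral => w _; exact: IH.
Qed.

End Perm.

Lemma convol_swap M L Phi (Z Z' : K -> T -> R) s s' x : bounded_lip M L Phi ->
  (forall i, measurable_fun setT (Z i)) -> (forall i, measurable_fun setT (Z' i)) ->
  convol Z s (convol Z' s' Phi) x = convol Z' s' (convol Z s Phi) x.
Proof.
move=> bP mZ mZ'; elim: s x => //= i s IH x.
have -> : convol Z s (convol Z' s' Phi) = convol Z' s' (convol Z s Phi) by apply/funext.
have bZ : bounded_lip M L (convol Z s Phi) by exact: bounded_lip_convol.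
by apply: (@convol1_convol Z' mZ' M L (convol Z s Phi)).
Qed.

End Conv.

Section ConvPerm.
Context d (T : measurableType d) (P : probability T R).

(** The index passes through [g] because [K] is a bare type, whereas [perm_eq] needs decidable
    equality. *)
Lemma convol_perm M L Phi (KK : eqType) (g : KK -> K) (Z : K -> T -> R) (s s' : seq KK) x :
  bounded_lip M L Phi -> (forall i, measurable_fun setT (Z i)) ->
  perm_eq s s' -> convol P Z (map g s) Phi x = convol P Z (map g s') Phi x.
Proof.
move=> bP mZ; elim: s s' x => [|i s IH] s' x.
  by move/perm_size; case: s'.
move=> pss'.
have is' : i \in s' by rewrite -(perm_mem pss') mem_head.
have [s1 [s2 s'E]] : exists s1 s2, s' = s1 ++ i :: s2.
  by case/splitPr: is' => p1 p2; exists p1, p2.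
rewrite s'E map_cat convol_cat /=.
have -> : convol1 P (Z (g i)) (g i) (convol P Z (map g s2) Phi) =
          convol P Z [:: g i] (convol P Z (map g s2) Phi) by [].
have b2 : bounded_lip M L (convol P Z (map g s2) Phi) by exact: bounded_lip_convol.
rewrite (convol_swap P (map g s1) [:: g i] x b2 mZ mZ).
rewrite /= -convol_cat -map_cat /convol1; apply: eq_Rintegral => w _; apply: IH.
by move: pss'; rewrite s'E perm_sym -cat1s perm_catCA /= perm_cons perm_sym.
Qed.

End ConvPerm.
End BoundedLipschitz.

(** If [p] intertwines the two kinds of displacement, an observable of [p x] may be integrated in
    the target. This restricts a statistic to one row, to one slot of a pair or to the Gaussian
    indices. *)
Lemma convol_map (R : realType) (V V' : zmodType) (K K' : Type) (e : K -> R -> V)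
    (e' : K' -> R -> V') (g : K' -> K) (p : V -> V') d (T : measurableType d)
    (P : probability T R) (Z : K -> T -> R) s (Phi : V' -> R) x :
  (forall i x t, p (x + e (g i) t) = p x + e' i t) ->
  convol e P Z (map g s) (Phi \o p) x = convol e' P (Z \o g) s Phi (p x).
Proof.
move=> h; elim: s x => //= i s IH x; rewrite /convol1.
by apply: eq_Rintegral => w _; rewrite IH h.
Qed.

Lemma eq_convol (R : realType) (V : zmodType) (K : Type) (e : K -> R -> V)
    d (T : measurableType d) (P : probability T R) (Z : K -> T -> R) s (Phi Psi : V -> R) :
  Phi =1 Psi -> convol e P Z s Phi = convol e P Z s Psi.
Proof. by move=> h; congr convol; apply/funext. Qed.

Lemma le_inv_nat_eq0 (R : realType) (a C : R) : (forall n : nat, `|a| <= C / n.+1%:R) -> a = 0.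
Proof.
move=> h; apply/eqP; rewrite -normr_eq0; apply/eqP/le_anti; rewrite normr_ge0 andbT.
apply/ler_addgt0Pr => eps e0; rewrite add0r.
have C0 : 0 <= C by have := h 0; rewrite divr1; apply: le_trans.
have d0 : 0 <= C / eps by rewrite divr_ge0 // ltW.
apply: le_trans (h (Num.bound (C / eps))) _.
rewrite ler_pdivrMr // mulrC -ler_pdivrMr //; apply/ltW/(lt_trans (archi_boundP d0)).
by rewrite ltr_nat.
Qed.

Section Independence.
Context (R : realType).

(** Stands in for conditioning on [zeta]: frozen at a grid value, the integrand averages to zero
    over each cell of the grid, and unfreezing costs at most L/(n+1). *)
Lemma Rintegral_comp_eq0 d (T : measurableType d) (P : probability T R)
    (G : T -> R -> R) (zeta : T -> R) (S : set T) (M L : R) :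
  measurable S -> measurable_fun setT zeta -> (forall u, measurable_fun setT (G ^~ u)) ->
  (forall w u, `|G w u| <= M) -> (forall w u v, `|G w u - G w v| <= L * `|u - v|) ->
  (forall u B, measurable B -> \int[P]_(w in S `&` zeta @^-1` B) G w u = 0) ->
  \int[P]_(w in S) G w (zeta w) = 0.
Proof.
move=> mS mz mG bG lG h0; apply: (@le_inv_nat_eq0 _ _ L) => n.
(* Cells are numbered by naturals through [pickle], so that countable additivity of the integral
   applies. *)
pose idx (u : R) := pickle (Num.floor (n.+1%:R * u)).
pose D (u : R) : R := (Num.floor (n.+1%:R * u))%:~R / n.+1%:R.
have midx k : measurable (idx @^-1` [set k]).
  have [[z zk]|nz] := pselect (exists z : int, pickle z = k); last first.
    rewrite (_ : _ @^-1` _ = set0) //; apply/seteqP; split => // u /= uk.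
    by apply: nz; eexists; exact: uk.
  rewrite (_ : _ @^-1` _ = (fun u => n.+1%:R * u) @^-1` `[z%:~R, (z + 1)%:~R[).
    rewrite -[X in measurable X]setTI; apply: measurable_funM => //.
  apply/seteqP; split => u /=; rewrite in_itv /= -zk.
    move=> /(pcan_inj pickleK) <-; exact: Num.Theory.floor_itv.
  by move=> h; congr pickle; exact: Num.Theory.floor_def.
have Dle u : `|u - D u| <= n.+1%:R^-1.
  rewrite /D; have := Num.Theory.floor_itv (n.+1%:R * u).
  set f := (Num.floor _)%:~R; move=> /andP[a]; rewrite intrD => b.
  have p0 : (0 : R) < n.+1%:R by [].
  have -> : u - f / n.+1%:R = (n.+1%:R * u - f) / n.+1%:R.
    by rewrite mulrBl [_ * u]mulrC mulfK // gt_eqF.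
  rewrite normrM [X in _ * X]ger0_norm ?invr_ge0 //.
  rewrite -[leRHS]mul1r ler_pM2r ?invr_gt0 // ler_norml; move: a b => /=; lra.
have L0 : 0 <= L.
  have [w|nT] := pselect (inhabited T); last first.
    have T0 : [set: T] = set0 by apply/seteqP; split => // x; case: nT.
    have := probability_setT P; rewrite T0 measure0 => /eqP.
    by rewrite eq_sym onee_eq0.
  case: w => w; have := lG w 0 1; rewrite sub0r normrN normr1 mulr1.
  exact: le_trans.
have mz' B : measurable B -> measurable (zeta @^-1` B).
  by move=> mB; rewrite -[X in measurable X]setTI; exact: mz.
have mD : measurable_fun setT D.
  move=> _ B mB; rewrite setTI.
  rewrite (_ : _ @^-1` _ = \bigcup_(k in [set k | exists2 u, idx u = k & B (D u)]) (idx @^-1` [set k])).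
    by apply: bigcup_measurable.
  apply/seteqP; split => [u /= Bu|u /= [k [v vk Bv] uk]]; first by exists (idx u) => //; exists u.
  by have := pcan_inj pickleK (etrans vk (esym uk)); rewrite /D => <-.
have mGD : measurable_fun setT (fun w => G w (D (zeta w))).
  apply: (@measurable_fun_lip_comp _ _ _ G (fun w => D (zeta w)) L) => //.
  exact: measurableT_comp.
have mGz : measurable_fun setT (fun w => G w (zeta w)).
  exact: (@measurable_fun_lip_comp _ _ _ G zeta L).
have iGD : P.-integrable setT (EFin \o (fun w => G w (D (zeta w)))) by exact: bounded_integrable.
have iGz : P.-integrable setT (EFin \o (fun w => G w (zeta w))) by exact: bounded_integrable.
have iS f : P.-integrable setT f -> P.-integrable S f by apply: integrableS.
have z0 : \int[P]_(w in S) G w (D (zeta w)) = 0.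
  pose F k := S `&` (zeta @^-1` (idx @^-1` [set k])).
  have SE : S = \bigcup_k F k.
    apply/seteqP; split => [w Sw|w [k _ []]//].
    by exists (idx (zeta w)).
  rewrite /Rintegral {1}SE integral_bigcup /=.
  - rewrite eseries0 // => k _ _.
    have [[u uk]|nu] := pselect (exists u, idx u = k); last first.
      rewrite (_ : F k = set0) ?integral_set0 //.
      by apply/seteqP; split => // w [_ /= wk]; apply: nu; exists (zeta w).
    have := h0 (D u) _ (midx k).
    have -> : \int[P]_(w in S `&` zeta @^-1` (idx @^-1` [set k])) G w (D u) =
              \int[P]_(w in F k) G w (D (zeta w)).
      apply: eq_Rintegral => w; rewrite inE => -[_ /= wk]; congr G.
      by rewrite /D (pcan_inj pickleK (etrans uk (esym wk))).
    rewrite /Rintegral => /eqP; rewrite fine_eq0; first by move/eqP.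
    apply: integrable_fin_num; first by apply: measurableI => //; exact: mz'.
    apply: integrableS iGD => //; by apply: measurableI => //; exact: mz'.
  - by move=> i j _ _ [w [[_ /= <-] [_ /= <-]]].
  - by move=> k; apply: measurableI => //; exact: mz'.
  - by rewrite -SE; exact: iS.
rewrite -[X in `|X|]subr0 -[X in _ - X]z0 -RintegralB //; [|exact: iS..].
apply: le_trans (le_normr_Rintegral _ _) _ => //.
  apply: iS; apply: (@bounded_integrable _ _ _ _ _ (M + M)); first exact: measurable_funB.
  by move=> w; apply: le_trans (ler_normB _ _) _; rewrite lerD.
apply: (@le_trans _ _ (\int[P]_(w in S) (L / n.+1%:R))).
  apply: le_Rintegral => //.
  - apply: iS; apply: (@bounded_integrable _ _ _ _ _ (M + M)).
      by apply: measurableT_comp => //; exact: measurable_funB.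
    by move=> w; rewrite normr_id; apply: le_trans (ler_normB _ _) _; rewrite lerD.
  - by apply: iS; apply: (@bounded_integrable _ _ _ _ _ `|L / n.+1%:R|).
  by move=> w _; apply: le_trans (lG _ _ _) _; rewrite ler_wpM2l.
rewrite Rintegral_cst // ler_piMr ?divr_ge0 //.
rewrite -[leRHS]/(fine 1%E) fine_le ?fin_num_measure //.
exact: probability_le1.
Qed.

Context (V : zmodType) (K : finType) (e : K -> R -> V).
Hypothesis e_add : forall i s t, e i (s + t) = e i s + e i t.
Context d (T : measurableType d) (P : probability T R).
Variable Z : K -> T -> R.
Hypothesis mZ : forall i, measurable_fun setT (Z i).

(** Product rules for subfamilies are included, since any [B i] may be the whole line. *)
Definition rect_indep := forall B : K -> set R, (forall i, measurable (B i)) ->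
  P (\bigcap_(i in setT) (Z i @^-1` B i)) = (\prod_i P (Z i @^-1` B i))%E.

Definition shifted s (Phi : V -> R) x w := Phi (x + \sum_(i <- s) e i (Z i w)).

Lemma measurable_shifted M L Phi s x : bounded_lip e M L Phi ->
  measurable_fun setT (shifted s Phi x).
Proof.
move=> [b l]; rewrite /shifted; elim: s x => [|i s IH] x.
  by rewrite (_ : (fun w => _) = cst (Phi x)) //; apply/funext => w; rewrite big_nil addr0.
rewrite (_ : (fun w => _) = (fun w => Phi (x + e i (Z i w) + \sum_(j <- s) e j (Z j w)))); last first.
  by apply/funext => w; rewrite big_cons addrA.
apply: (@measurable_fun_lip_comp _ _ _ (fun w u => Phi (x + e i u + \sum_(j <- s) e j (Z j w))) _ L).
- exact: mZ.
- by move=> u; exact: IH.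
- by move=> w u v; rewrite ![x + e i _ + _]addrAC; apply: (lip_along2 e_add).
Qed.

Hypothesis indZ : rect_indep.

Let rect (B : K -> set R) := \bigcap_(i in setT) (Z i @^-1` B i).

Let mrect B : (forall i, measurable (B i)) -> measurable (rect B).
Proof.
move=> mB; apply: fin_bigcap_measurable => // j _.
by rewrite -[X in measurable X]setTI; exact: mZ.
Qed.

(* Integrating over a rectangle in the remaining coordinates makes the induction on s work. *)
Lemma convol_indep_rect M L Phi s x (B : K -> set R) : bounded_lip e M L Phi ->
  uniq s -> (forall i, measurable (B i)) -> (forall i, i \in s -> B i = setT) ->
  \int[P]_(w in rect B) shifted s Phi x w = convol e P Z s Phi x * fine (P (rect B)).
Proof.
move=> bP; elim: s x B => [|i s IH] x B us mB Bs.
  under eq_Rintegral do rewrite /shifted big_nil addr0.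
  by rewrite Rintegral_cst //; exact: mrect.
have mR := mrect mB.
have intR (f : T -> R) (M' : R) : measurable_fun setT f -> (forall w, `|f w| <= M') ->
    P.-integrable (rect B) (EFin \o f).
  move=> mf bf; apply: (integrableS measurableT) => //; exact: bounded_integrable bf.
move: us => /= /andP[nis us].
pose c u := convol e P Z s Phi (x + e i u).
have [bs ls] : bounded_lip e M L (convol e P Z s Phi) by exact: bounded_lip_convol.
pose G w u := shifted s Phi (x + e i u) w - c u.
have mc : measurable_fun setT (fun w => c (Z i w)).
  by rewrite /c; exact: (measurable_lip_comp e_add _ _ ls (mZ i)).
have shE w : shifted (i :: s) Phi x w = shifted s Phi (x + e i (Z i w)) w.
  by rewrite /shifted big_cons addrA.
have bsh (t : seq K) y w : `|shifted t Phi y w| <= M by case: bP => b _; exact: b.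
have split_int u B' : measurable B' ->
   \int[P]_(w in rect B `&` Z i @^-1` B') shifted s Phi (x + e i u) w =
   c u * fine (P (rect B `&` Z i @^-1` B')).
  move=> mB'; pose B1 j := if j == i then B' else B j.
  have E : rect B `&` Z i @^-1` B' = rect B1.
    apply/seteqP; split => w.
      move=> [rw /= Bw] j _; rewrite /= /B1; case: eqP => [->//|_]; exact: rw.
    move=> rw; split => [j _ /=|/=]; last by have := rw i I; rewrite /= /B1 eqxx.
    have [->|ji] := eqVneq j i; first by rewrite Bs ?mem_head.
    by have := rw j I; rewrite /= /B1 (negbTE ji).
  rewrite E IH //.
    by move=> j; rewrite /B1; case: ifP.
  move=> j js; rewrite /B1; case: eqP => [ji|_]; first by move: nis; rewrite -ji js.
  by apply: Bs; rewrite inE js orbT.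
(* With [u] frozen, the induction hypothesis on the rectangle cut by an event on [Z i] gives average
   zero; hence [u] may be replaced by [Z i]. *)
have Geq0 : \int[P]_(w in rect B) G w (Z i w) = 0.
  apply: (@Rintegral_comp_eq0 _ _ P G (Z i) (rect B) (M + M) (L + L)) => //.
  - by move=> u; apply: measurable_funB => //; exact: (measurable_shifted _ _ bP).
  - by move=> w u; apply: le_trans (ler_normB _ _) _; rewrite lerD // ?bsh ?bs.
  - move=> w u v.
    have -> : G w u - G w v = (shifted s Phi (x + e i u) w - shifted s Phi (x + e i v) w) - (c u - c v).
      by rewrite /G; ring.
    apply: le_trans (ler_normB _ _) _; rewrite [leRHS]mulrDl lerD //.
      rewrite /shifted ![x + e i _ + _]addrAC; apply: (lip_along2 e_add).
      by case: bP.
    exact: (lip_along2 e_add).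
  - move=> u B' mB'; rewrite /G.
    have mRB : measurable (rect B `&` Z i @^-1` B').
      by apply: measurableI => //; rewrite -[X in measurable X]setTI; exact: mZ.
    rewrite RintegralB //.
    + by rewrite split_int // Rintegral_cst // subrr.
    + apply: (integrableS measurableT) => //; apply: bounded_integrable (bsh s _).
      exact: (measurable_shifted _ _ bP).
    + by apply: (integrableS measurableT) => //; apply: (@bounded_integrable _ _ _ _ _ `|c u|).
have -> : \int[P]_(w in rect B) shifted (i :: s) Phi x w = \int[P]_(w in rect B) c (Z i w).
  apply/eqP; rewrite -subr_eq0 -RintegralB //; first last.
  - by apply: (intR _ M) => // w; exact: bs.
  - by apply: (intR _ M) => // ; exact: (measurable_shifted _ _ bP).
  by apply/eqP; rewrite -[RHS]Geq0; apply: eq_Rintegral => w _; rewrite shE.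
have Pfact B' : measurable B' ->
   fine (P (rect B `&` Z i @^-1` B')) = fine (P (Z i @^-1` B')) * fine (P (rect B)).
  move=> mB'; pose B1 j := if j == i then B' else B j.
  have E : rect B `&` Z i @^-1` B' = rect B1.
    apply/seteqP; split => w.
      move=> [rw /= Bw] j _; rewrite /= /B1; case: eqP => [->//|_]; exact: rw.
    move=> rw; split => [j _ /=|/=]; last by have := rw i I; rewrite /= /B1 eqxx.
    have [->|ji] := eqVneq j i; first by rewrite Bs ?mem_head.
    by have := rw j I; rewrite /= /B1 (negbTE ji).
  rewrite E /rect !indZ //; last by move=> j; rewrite /B1; case: ifP.
  rewrite (bigD1 i) //= [in RHS](bigD1 i) //= /B1 eqxx Bs ?mem_head // preimage_setT.
  rewrite [P setT]probability_setT mul1e -fineM ?fin_num_measure //; last 2 first.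
  - by rewrite -[X in measurable X]setTI; exact: mZ.
  - apply: prode_fin_num => j _; apply: fin_num_measure.
    by rewrite -[X in measurable X]setTI; exact: mZ.
  congr (fine (_ * _)%E); apply: eq_bigr => j ji; by rewrite (negbTE ji).
rewrite /= /convol1.
pose p := fine (P (rect B)).
have ic : P.-integrable setT (EFin \o (fun w => c (Z i w))) by apply: bounded_integrable => // w; exact: bs.
pose a := \int[P]_w c (Z i w).
rewrite -[X in X * _]/a.
(* Second use: [Z i] is independent of the rectangle, whose side at [i] is the whole line, so the
   indicator of [rect B] may be replaced by its probability [p]. *)
have := @Rintegral_comp_eq0 _ _ P (fun w u => c u * p - c u * \1_(rect B) w) (Z i) setT (M * p + M) (L * p + L).
have p0 : 0 <= p by rewrite /p fine_ge0.
have ind01 w : `|\1_(rect B) w : R| <= 1 by rewrite indicE; case: (_ \in _); rewrite ?normr1 ?normr0.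
have mind : measurable_fun setT (\1_(rect B) : T -> R) by exact: measurable_indic.
have lc u v : `|c u - c v| <= L * `|u - v| by exact: (lip_along2 e_add).
have iind f : P.-integrable setT (EFin \o f) -> \int[P]_w (f w * \1_(rect B) w) = \int[P]_(w in rect B) f w.
  move=> _; rewrite [RHS]Rintegral_mkcond; apply: eq_Rintegral => w _.
  by rewrite patchE indicE; case: (w \in rect B); rewrite ?mulr1 ?mulr0.
have mcm : measurable_fun setT (fun w => c (Z i w) * \1_(rect B) w) by exact: measurable_funM.
have bcm w u : `|c u * \1_(rect B) w| <= M.
  by rewrite normrM -[leRHS]mulr1 ler_pM // bs.
have Eint : \int[P]_w (c (Z i w) * p - c (Z i w) * \1_(rect B) w) = a * p - \int[P]_(w in rect B) c (Z i w).
  rewrite RintegralB //.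
  - by rewrite RintegralZr // iind.
  - by apply: (@bounded_integrable _ _ _ _ _ (M * p)); [exact: measurable_funM|move=> w; rewrite normrM ler_pM // ?bs ?ger0_norm].
  - by apply: (@bounded_integrable _ _ _ _ _ M).
rewrite Eint => h; apply/esym/eqP; rewrite -subr_eq0; apply/eqP; apply: h => //.
- by move=> u; apply: measurable_funB => //; exact: measurable_funM.
- move=> w u; apply: le_trans (ler_normB _ _) _; rewrite lerD //.
  by rewrite normrM [`|p|]ger0_norm // ler_wpM2r // bs.
- move=> w u v; rewrite (_ : _ - _ = (c u - c v) * p - (c u - c v) * \1_(rect B) w); last by ring.
  apply: le_trans (ler_normB _ _) _; rewrite [leRHS]mulrDl lerD //.
    by rewrite normrM [`|p|]ger0_norm // mulrAC ler_wpM2r.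
  rewrite normrM -[leRHS]mulr1 ler_pM //.
move=> u B' mB'; rewrite setTI.
have mRB : measurable (Z i @^-1` B') by rewrite -[X in measurable X]setTI; exact: mZ.
rewrite RintegralB //.
- rewrite Rintegral_cst // RintegralZl //; last first.
    by apply: (integrableS measurableT) => //; apply: (@bounded_integrable _ _ _ _ _ 1).
  have -> : \int[P]_(w in Z i @^-1` B') \1_(rect B) w = fine (P (rect B `&` Z i @^-1` B')).
    by rewrite /Rintegral integral_indic.
  rewrite Pfact // -/p; ring.
- by apply: (integrableS measurableT) => //; apply: (@bounded_integrable _ _ _ _ _ `|c u * p|).
- apply: (integrableS measurableT) => //; apply: (@bounded_integrable _ _ _ _ _ M) => //.
  exact: measurable_funM.
Qed.

Lemma convol_indep M L Phi s x : bounded_lip e M L Phi -> uniq s ->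
  \int[P]_w shifted s Phi x w = convol e P Z s Phi x.
Proof.
move=> bP us; have := @convol_indep_rect M L Phi s x (fun _ => setT) bP us.
have -> : rect (fun=> setT) = setT by apply/seteqP; split => // w _ i _.
by rewrite [P setT]probability_setT mulr1 => ->.
Qed.

End Independence.

(** * Moments of the normal law *)

Section GaussianLaw.
Context (R : realType).
Local Notation mu := (@lebesgue_measure R).
Local Notation RT := (measurableTypeR R).

Lemma normal_peakE (s : R) : 0 < s -> normal_peak s = (Num.sqrt (pi *+ 2) * s)^-1.
Proof.
move=> s0; rewrite /normal_peak -mulrnAr sqrtrM ?sqr_ge0 // sqrtr_sqr gtr0_norm //.
by rewrite mulrC.
Qed.

Lemma integral_normal_density_bounded (m s : R) (f : R -> R) (M : R) :
  measurable_fun setT f -> (forall x, `|f x| <= M) ->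
  (\int[normal_prob m s]_x (f x)%:E = \int[mu]_x (f x * normal_pdf m s x)%:E)%E.
Proof.
move=> mf bf.
have intf : (normal_prob m s).-integrable setT (EFin \o f).
  exact: (@bounded_integrable _ _ _ (normal_prob m s) f M).
rewrite -(Radon_Nikodym_change_of_variables (normal_prob_dominates m s)) //.
under [RHS]eq_integral do rewrite EFinM.
apply: ae_eq_integral => //.
- apply: emeasurable_funM; first exact/measurable_EFinP.
  apply: (measurable_int mu); apply: Radon_Nikodym_integrable.
  exact: normal_prob_dominates.
- apply: emeasurable_funM; apply/measurable_EFinP => //; exact: measurable_normal_pdf.
- apply: ae_eqe_mul2l => /=.
  rewrite Radon_NikodymE //=; first exact: normal_prob_dominates.
  move=> abmu; case: cid => /= h [h1 h2 h3].
  apply: integral_ae_eq => //=.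
  + by apply/measurable_EFinP; exact: measurable_normal_pdf.
  + by move=> E E01 mE; rewrite -h3.
Qed.

(** Truncation at level n makes the function integrable for the normal law, so that the bounded case
    applies; monotone convergence removes the truncation. *)
Lemma ge0_integral_normal_density (m s : R) (f : R -> R) :
  measurable_fun setT f -> (forall x, 0 <= f x) ->
  (\int[normal_prob m s]_x (f x)%:E = \int[mu]_x (f x * normal_pdf m s x)%:E)%E.
Proof.
move=> mf f0.
pose g n x := Num.min (f x) n%:R.
have g0 n x : 0 <= g n x by rewrite /g le_min f0 /=.
have mg n : measurable_fun setT (g n) by exact: measurable_minr.
have ndg x : {homo (fun n => g n x) : n p / (n <= p)%N >-> n <= p}.
  by move=> n p np; rewrite /g le_min !ge_min lexx /= ler_nat np orbT.
have limg x (c : R) : limn (fun n => (g n x * c)%:E) = (f x * c)%:E.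
  apply: lim_near_cst => //.
  exists (Num.bound (f x)) => // n /= hn; congr (_%:E); congr (_ * _).
  apply/min_idPl; apply: (le_trans (ltW (archi_boundP (f0 x)))).
  by rewrite ler_nat.
transitivity (limn (fun n => \int[normal_prob m s]_x (g n x * 1)%:E))%E.
  rewrite -monotone_convergence //.
  - by apply: eq_integral => x _; rewrite limg mulr1.
  - move=> n; apply/measurable_EFinP.
    by apply: (eq_measurable_fun (g n)) => // x _; rewrite /= mulr1.
  - by move=> n x _; rewrite lee_fin mulr1.
  - by move=> x _ n p np; rewrite lee_fin !mulr1; exact: ndg.
transitivity (limn (fun n => \int[mu]_x (g n x * normal_pdf m s x)%:E))%E; last first.
  rewrite -monotone_convergence //.
  - by apply: eq_integral => x _; rewrite limg.
  - move=> n; apply/measurable_EFinP; apply: measurable_funM; first exact: mg.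
    exact: measurable_normal_pdf.
  - by move=> n x _; rewrite lee_fin mulr_ge0 ?normal_pdf_ge0.
  - by move=> x _ n p np; rewrite lee_fin ler_wpM2r ?normal_pdf_ge0 //; exact: ndg.
apply: congr_lim; apply/funext => n.
under eq_integral do rewrite mulr1.
apply: (integral_normal_density_bounded _ _ (M := n%:R)) => // x.
by rewrite ger0_norm // /g ge_min lexx orbT.
Qed.

Lemma ge0_integral_affine (a b : R) (H : R -> R) : 0 < a -> continuous H ->
  (forall x, 0 <= H x) ->
  (\int[mu]_y (H y)%:E = \int[mu]_x (H (a * x + b) * a)%:E)%E.
Proof.
move=> a0 cH H0; pose F (x : R) := a * x + b.
have dF (x : R) : is_derive x (1 : R) F a.
  rewrite /F; apply: is_derive_eq; by rewrite !(scaler0, addr0, scaler1).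
have F'E : F^`()%classic = cst a.
  by apply/funext => x; rewrite derive1E; apply: derive_val.
rewrite (@increasing_ge0_integration_by_substitutionT _ F H) //.
- by apply: eq_integral => x _; rewrite F'E.
- by move=> x y xy; rewrite /F ltrD2r ltr_pM2l.
- by rewrite F'E => x; exact: cst_continuous.
- by rewrite F'E; exact: is_cvg_cst.
- by rewrite F'E; exact: is_cvg_cst.
- rewrite /F (_ : (fun x => _) = (fun x => b + a * x)); last by apply/funext => x; rewrite addrC.
  apply/cvgrNyPle => A; near=> x.
  rewrite -lerBrDl mulrC -ler_pdivlMr //; near: x; exact: nbhs_ninfty_le.
- apply/cvgryPge => A; near=> x.
  rewrite /F -lerBlDr mulrC -ler_pdivrMr //; near: x; exact: nbhs_pinfty_ge.
Unshelve. all: by end_near. Qed.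

Lemma ge0_integral_opp (H : R -> R) : measurable_fun setT H -> (forall x, 0 <= H x) ->
  (\int[mu]_x (H (- x))%:E = \int[mu]_x (H x)%:E)%E.
Proof.
move=> mH H0.
transitivity (\int[pushforward mu (-%R : R -> RT)]_y (H y)%:E)%E.
  by rewrite ge0_integral_pushforward //=; [apply/measurable_EFinP|move=> y _; rewrite lee_fin].
apply: eq_measure_integral => A mA _; exact: lebesgue_measureN.
Qed.

Context d (T : measurableType d) (P : probability T R).
Variables (Z : T -> R) (s : R).
Hypotheses (mZ : measurable_fun setT Z) (s0 : 0 < s).
Hypothesis ZE : forall B : set R, measurable B -> P (Z @^-1` B) = normal_prob 0 s B.

Lemma gaussian_law (f : R -> R) : measurable_fun setT f -> (forall x, 0 <= f x) ->
  (\int[P]_w (f (Z w))%:E = \int[mu]_x (f x * normal_pdf 0 s x)%:E)%E.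
Proof.
move=> mf f0; rewrite -ge0_integral_normal_density //.
transitivity (\int[pushforward P (Z : T -> RT)]_y (f y)%:E)%E.
  by rewrite ge0_integral_pushforward //=; [apply/measurable_EFinP|move=> y _; rewrite lee_fin].
apply: eq_measure_integral => A mA _; exact: ZE.
Qed.

Lemma gaussian_law_affine (f : R -> R) a b : 0 < a -> continuous f -> (forall x, 0 <= f x) ->
  (\int[P]_w (f (a * Z w + b))%:E = \int[mu]_x (f x * normal_pdf b (a * s) x)%:E)%E.
Proof.
move=> a0 cf f0.
have cab : continuous (fun x : R => a * x + b).
  by move=> x; apply: cvgD; [apply: cvgM; [exact: cvg_cst|exact: cvg_id]|exact: cvg_cst].
have cfab : continuous (fun x : R => f (a * x + b)).
  by move=> x; apply: (@continuous_comp _ _ _ (fun x => a * x + b) f); [exact: cab|exact: cf].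
have mfab : measurable_fun setT (fun x : R => f (a * x + b)).
  exact: continuous_measurable_fun.
rewrite (gaussian_law mfab (fun x => f0 _)).
have as0 : a * s != 0 by rewrite mulf_neq0 // gt_eqF.
rewrite (@ge0_integral_affine a b (fun y => f y * normal_pdf b (a * s) y)) //.
- apply: eq_integral => x _; congr (_%:E); rewrite -mulrA; congr (_ * _).
  rewrite !normal_pdfE ?gt_eqF ?mulr_gt0 // !normal_peakE ?mulr_gt0 // /normal_fun.
  rewrite addrK subr0 mulrAC; congr (_ * expR _).
    rewrite !invfM; field; rewrite !gt_eqF //= sqrtr_gt0 mulrn_wgt0 // pi_gt0 //.
  by field; rewrite !gt_eqF.
- move=> x; apply: cvgM; [exact: cf|exact: continuous_normal_pdf].
- by move=> x; rewrite mulr_ge0 ?normal_pdf_ge0.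
Qed.

(** The joint density of x and z = a x + b Z' factored the other way round: the law of z times the
    conditional law of x given z. *)
Lemma normal_pdf_mul (a b c x z : R) : 0 < a -> 0 < b -> 0 < c -> c ^+ 2 = a ^+ 2 + b ^+ 2 ->
  normal_pdf 0 s x * normal_pdf (a * x) (b * s) z =
  normal_pdf 0 (c * s) z * normal_pdf (a * z / c ^+ 2) (s * b / c) x.
Proof.
move=> a0 b0 c0 cE.
have n0 : Num.sqrt (pi *+ 2 : R) != 0 by rewrite gt_eqF // sqrtr_gt0 mulrn_wgt0 // pi_gt0.
rewrite !normal_pdfE ?gt_eqF ?mulr_gt0 ?invr_gt0 //.
rewrite !normal_peakE ?mulr_gt0 ?invr_gt0 // /normal_fun.
rewrite mulrACA [RHS]mulrACA -!expRD; congr (_ * expR _).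
  by field; rewrite n0 !gt_eqF.
rewrite !subr0.
have c2 : a ^+ 2 + b ^+ 2 != 0 by rewrite -cE expf_neq0 // gt_eqF.
have cc u : u / c = u * c / (a ^+ 2 + b ^+ 2) by rewrite -cE; field; rewrite gt_eqF.
have -> : (s * b / c) ^+ 2 = s ^+ 2 * b ^+ 2 / (a ^+ 2 + b ^+ 2).
  by rewrite -cE; field; rewrite gt_eqF.
have -> : (c * s) ^+ 2 = (a ^+ 2 + b ^+ 2) * s ^+ 2 by rewrite exprMn cE.
by rewrite cE; field; rewrite c2 !gt_eqF.
Qed.

Lemma gaussian_stable_ge0 (f : R -> R) a b c : 0 < a -> 0 < b -> 0 < c ->
  c ^+ 2 = a ^+ 2 + b ^+ 2 -> continuous f -> (forall x, 0 <= f x) ->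
  (\int[P]_w \int[P]_w' (f (a * Z w + b * Z w'))%:E = \int[P]_w (f (c * Z w))%:E)%E.
Proof.
move=> a0 b0 c0 cE cf f0.
have mf : measurable_fun setT f by exact: continuous_measurable_fun.
have bs0 : b * s != 0 by rewrite mulf_neq0 // gt_eqF.
pose g (z : T * RT) : \bar R := (f z.2 * normal_pdf (a * Z z.1) (b * s) z.2)%:E.
have mg : measurable_fun setT g.
  apply/measurable_EFinP; apply: measurable_funM.
    by apply: (@measurableT_comp _ _ _ _ _ _ f _ snd) => //; exact: measurable_snd.
  under eq_fun do rewrite normal_pdfE //.
  apply: measurable_funM => //; rewrite /normal_fun; apply: measurableT_comp => //.
  apply: measurable_funM => //; apply: measurableT_comp => //; apply: measurable_funX.
  apply: measurable_funB; first exact: measurable_snd.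
  apply: measurable_funM => //; apply: measurableT_comp => //; exact: measurable_fst.
have g0 z : (0 <= g z)%E by rewrite lee_fin mulr_ge0 ?normal_pdf_ge0.
transitivity (\int[P]_w \int[mu]_z g (w, z))%E.
  apply: eq_integral => w _; apply: etrans (gaussian_law_affine (a * Z w) b0 cf f0).
  by apply: eq_integral => w' _; rewrite addrC.
rewrite (@fubini_tonelli _ _ _ _ _ P mu g mg g0).
transitivity (\int[mu]_z (f z * normal_pdf 0 (c * s) z)%:E)%E; last first.
  apply: etrans (esym (gaussian_law_affine 0 c0 cf f0)) _.
  by apply: eq_integral => w _; rewrite addr0.
apply: eq_integral => z _; rewrite /fubini_G /g /=.
have mN : measurable_fun setT (fun x : R => f z * normal_pdf (a * x) (b * s) z).
  apply: measurable_funM => //.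
  under eq_fun do rewrite normal_pdfE //.
  apply: measurable_funM => //; rewrite /normal_fun; apply: measurableT_comp => //.
  apply: measurable_funM => //; apply: measurableT_comp => //; apply: measurable_funX.
  by apply: measurable_funB => //; exact: measurable_funM.
rewrite (gaussian_law mN); last by move=> x; rewrite mulr_ge0 ?normal_pdf_ge0.
under eq_integral => x _.
  rewrite -mulrA [normal_pdf _ _ z * _]mulrC (@normal_pdf_mul a b c) // mulrA EFinM; over.
rewrite ge0_integralZl //.
- by rewrite integral_normal_pdf mule1.
- by apply/measurable_EFinP; exact: measurable_normal_pdf.
- by move=> x _; rewrite lee_fin normal_pdf_ge0.
- by rewrite lee_fin mulr_ge0 ?normal_pdf_ge0.
Qed.

Lemma lip_continuous (f : R -> R) (L : R) : (forall x y, `|f x - f y| <= L * `|x - y|) ->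
  continuous f.
Proof.
move=> lf x; apply/cvgrPdist_le => /= e e0.
have L1 : 0 < `|L| + 1 by rewrite ltr_wpDl.
near=> y; apply: (le_trans (lf x y)).
apply: (@le_trans _ _ ((`|L| + 1) * `|x - y|)).
  by rewrite ler_wpM2r // (le_trans (ler_norm _)) // lerDl.
rewrite mulrC -ler_pdivlMr //; near: y.
apply: cvgr_dist_le; last by rewrite divr_gt0.
exact: cvg_id.
Unshelve. all: by end_near. Qed.

Lemma gaussian_stable (f : R -> R) (M L : R) a b c : 0 <= a -> 0 <= b -> 0 <= c ->
  c ^+ 2 = a ^+ 2 + b ^+ 2 -> (forall x, `|f x| <= M) ->
  (forall x y, `|f x - f y| <= L * `|x - y|) ->
  \int[P]_w \int[P]_w' f (a * Z w + b * Z w') = \int[P]_w f (c * Z w).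
Proof.
move=> a0 b0 c0 cE bf lf.
have cf : continuous f by exact: lip_continuous lf.
have mf : measurable_fun setT f by exact: continuous_measurable_fun.
have mfZ (u v : R) : measurable_fun setT (fun w => f (u + v * Z w)).
  apply: measurableT_comp => //; apply: measurable_funD => //; exact: measurable_funM.
(* The density argument needs positive [a] and [b]; a vanishing one makes the integral over its
   variable trivial. *)
have [a_eq0|a_neq0] := eqVneq a 0.
  have -> : c = b by apply/eqP; rewrite -(@eqrXn2 _ 2) // cE a_eq0 expr0n /= add0r.
  rewrite -[RHS](Rintegral_prob_cst P); apply: eq_Rintegral => w _.
  by apply: eq_Rintegral => w' _; rewrite a_eq0 mul0r add0r.
have [b_eq0|b_neq0] := eqVneq b 0.
  have -> : c = a by apply/eqP; rewrite -(@eqrXn2 _ 2) // cE b_eq0 expr0n /= addr0.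
  apply: eq_Rintegral => w _; rewrite -[RHS](Rintegral_prob_cst P).
  by apply: eq_Rintegral => w' _; rewrite b_eq0 mul0r addr0.
have {}a0 : 0 < a by rewrite lt0r a_neq0.
have {}b0 : 0 < b by rewrite lt0r b_neq0.
have {}c0 : 0 < c.
  rewrite lt0r c0 andbT; apply/eqP => c_eq0; move: cE; rewrite c_eq0 expr0n /=.
  by apply/eqP; rewrite eq_sym gt_eqF // addr_gt0 // exprn_gt0.
(* Adding [M] makes the integrand nonnegative, as Tonelli requires; both sides grow by [M]. *)
have cfM : continuous (fun x => f x + M).
  by move=> x; apply: cvgD; [exact: cf|exact: cvg_cst].
have fM0 x : 0 <= f x + M by have := bf x; rewrite ler_norml => /andP[]; lra.
have := gaussian_stable_ge0 a0 b0 c0 cE cfM fM0.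
have intb (g : T -> R) : measurable_fun setT g -> (forall w, `|g w| <= M) ->
    P.-integrable setT (EFin \o g) by exact: bounded_integrable.
have intc (k : R) : P.-integrable setT (EFin \o (fun _ : T => k)).
  by apply: (@bounded_integrable _ _ _ _ _ `|k|).
have E1 (g : T -> R) : measurable_fun setT g -> (forall w, `|g w| <= M) ->
    (\int[P]_w (g w + M)%:E = ((\int[P]_w g w) + M)%:E)%E.
  move=> mg bg; have <- : \int[P]_w (g w + M) = (\int[P]_w g w) + M.
    by rewrite RintegralD // ?Rintegral_prob_cst //; exact: intb.
  rewrite fineK //; apply: integrable_fin_num => //.
  apply: (@bounded_integrable _ _ _ _ _ (M + `|M|)); first exact: measurable_funD.
  by move=> w; apply: le_trans (ler_normD _ _) _; rewrite lerD.
have bI w : `|\int[P]_w' f (a * Z w + b * Z w')| <= M by exact: Rintegral_bounded.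
rewrite [X in _ = X]E1 //; last first.
  by under eq_fun do rewrite -[_ * _]add0r; exact: mfZ.
under eq_integral do rewrite E1 //.
rewrite E1 //; last first.
  have lI (u v : R) : `|\int[P]_w' f (u + b * Z w') - \int[P]_w' f (v + b * Z w')| <= L * `|u - v|.
    rewrite -RintegralB //; [|exact: intb..].
    apply: Rintegral_bounded; first exact: measurable_funB.
    move=> w; apply: le_trans (lf _ _) _.
    by rewrite opprD addrACA subrr addr0.
  have cI := lip_continuous lI.
  have mI := continuous_measurable_fun cI.
  have maZ : measurable_fun setT (fun w => a * Z w) by exact: measurable_funM.
  exact: (measurableT_comp mI maZ).
by move=> [] /addIr.
Qed.

Lemma integrable_ge0_lt (f : T -> R) (C : R) : measurable_fun setT f -> (forall w, 0 <= f w) ->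
  (\int[P]_w (f w)%:E <= C%:E)%E -> P.-integrable setT (EFin \o f).
Proof.
move=> mf f0 fC; apply/integrableP; split; first exact/measurable_EFinP.
under eq_integral do rewrite /= ger0_norm //.
exact: le_lt_trans fC (ltry _).
Qed.

(* The polynomial is absorbed by half of the Gaussian exponent. *)
Lemma gaussian_even_moment k : (\int[P]_w (Z w ^+ k.*2)%:E <=
  ((4 * s ^+ 2) ^+ k * k`!%:R * 2)%:E)%E.
Proof.
have p0 (x : R) : 0 <= x ^+ k.*2 by rewrite -mul2n exprM exprn_ge0 ?sqr_ge0.
rewrite (gaussian_law (f := fun x => x ^+ k.*2)) //.
set s2 := 2 * s; have s20 : 0 < s2 by rewrite mulr_gt0.
have key (x : R) : x ^+ k.*2 * normal_pdf 0 s x <=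
    (4 * s ^+ 2) ^+ k * k`!%:R * 2 * normal_pdf 0 s2 x.
  rewrite !normal_pdfE ?gt_eqF // !normal_peakE // /normal_fun !subr0 /s2.
  set q := Num.sqrt _; have q0 : 0 < q by rewrite sqrtr_gt0 mulrn_wgt0 // pi_gt0.
  pose u := x ^+ 2 / (4 * s ^+ 2); have u0 : 0 <= u by rewrite divr_ge0 ?sqr_ge0 // mulr_ge0 ?sqr_ge0.
  have -> : (q * (2 * s))^-1 = (q * s)^-1 / 2 by field; rewrite !gt_eqF.
  have -> : - x ^+ 2 / (s ^+ 2 *+ 2) = - x ^+ 2 / ((2 * s) ^+ 2 *+ 2) - 3 / 2 * u.
    by rewrite /u; field; rewrite gt_eqF.
  have -> : x ^+ k.*2 = (4 * s ^+ 2) ^+ k * u ^+ k.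
    by rewrite -exprMn /u -mul2n exprM; congr (_ ^+ _); field; rewrite gt_eqF.
  rewrite expRD; set e1 := expR (_ / _); have e10 : 0 <= e1 by exact: expR_ge0.
  set r := (q * s)^-1; have r0 : 0 <= r by rewrite invr_ge0 mulr_ge0 // ltW.
  have uk : u ^+ k * expR (- (3 / 2 * u)) <= k`!%:R.
    rewrite expRN ler_pdivrMr ?expR_gt0 //.
    apply: (@le_trans _ _ (k`!%:R * expR u)).
      case: k {p0} => [|k]; first by rewrite expr0 mul1r (le_trans _ (expR_ge1Dx _)) // lerDl.
      rewrite -ler_pdivrMl ?ltr0n ?fact_gt0 // mulrC.
      by apply: le_trans (expR_ge1Dxn k u0); rewrite lerDr.
    by rewrite ler_wpM2l // ler_expR; lra.
  have -> : (4 * s ^+ 2) ^+ k * u ^+ k * (r * (e1 * expR (- (3 / 2 * u)))) =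
    (4 * s ^+ 2) ^+ k * r * e1 * (u ^+ k * expR (- (3 / 2 * u))) by ring.
  have -> : (4 * s ^+ 2) ^+ k * k`!%:R * 2 * (r / 2 * e1) = (4 * s ^+ 2) ^+ k * r * e1 * k`!%:R.
    by field.
  by rewrite ler_wpM2l // !mulr_ge0 // exprn_ge0 // mulr_ge0 ?sqr_ge0.
apply: (@le_trans _ _ (\int[mu]_x (((4 * s ^+ 2) ^+ k * k`!%:R * 2)%:E * (normal_pdf 0 s2 x)%:E)))%E.
  apply: ge0_le_integral => //.
  - by move=> x _; rewrite lee_fin mulr_ge0 ?normal_pdf_ge0.
  - apply/measurable_EFinP; apply: measurable_funM; first exact: measurable_funX.
    exact: measurable_normal_pdf.
  - apply/measurable_EFinP; apply: measurable_funM => //; exact: measurable_normal_pdf.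
  - by move=> x _; rewrite -EFinM lee_fin.
rewrite ge0_integralZl //.
- by rewrite integral_normal_pdf mule1.
- by apply/measurable_EFinP; exact: measurable_normal_pdf.
- by move=> x _; rewrite lee_fin normal_pdf_ge0.
- by rewrite lee_fin !mulr_ge0 // exprn_ge0 // mulr_ge0 ?sqr_ge0.
Qed.

Lemma gaussian_integrable k : P.-integrable setT (EFin \o (fun w => Z w ^+ k)).
Proof.
have i2 : P.-integrable setT (EFin \o (fun w => Z w ^+ k.*2)).
  apply: integrable_ge0_lt (gaussian_even_moment k); first exact: measurable_funX.
  by move=> w; rewrite -mul2n exprM exprn_ge0 ?sqr_ge0.
apply: (integrableR_le (g := fun w => 1 + Z w ^+ k.*2)).
- exact: measurable_funX.
- move=> w; rewrite -muln2 exprM -(real_normK (num_real (_ ^+ k))).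
  by have := sqr_ge0 (`|Z w ^+ k| - 1); move: (`|_|) => x; nra.
- by apply: integrableRD => //; exact: integrableR_cst.
Qed.

Lemma gaussian_odd_mean0 (g : R -> R) : measurable_fun setT g -> (forall x, g (- x) = - g x) ->
  P.-integrable setT (EFin \o (g \o Z)) -> \int[P]_w g (Z w) = 0.
Proof.
move=> mg og ig.
have mp : measurable_fun setT (fun x : R => Num.max (g x) 0) by exact: measurable_maxr.
have mn : measurable_fun setT (fun x : R => Num.max (- g x) 0).
  by apply: measurable_maxr => //; exact: measurableT_comp.
have p0 (x : R) : 0 <= Num.max x 0 by rewrite le_max lexx orbT.
have law_p := gaussian_law mp (fun x => p0 (g x)).
have law_n := gaussian_law mn (fun x => p0 (- g x)).
have E : (\int[P]_w (Num.max (g (Z w)) 0)%:E = \int[P]_w (Num.max (- g (Z w)) 0)%:E)%E.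
  rewrite law_p law_n.
  rewrite -(@ge0_integral_opp (fun x => Num.max (g x) 0 * normal_pdf 0 s x)).
  - apply: eq_integral => x _; congr (_%:E); rewrite og; congr (_ * _).
    by rewrite !normal_pdfE ?gt_eqF // /normal_fun !subr0 sqrrN.
  - apply: measurable_funM => //; exact: measurable_normal_pdf.
  - by move=> x; rewrite mulr_ge0 ?normal_pdf_ge0.
have ZE2 w : g (Z w) = Num.max (g (Z w)) 0 - Num.max (- g (Z w)) 0.
  have [h|h] := leP 0 (g (Z w)).
    by rewrite (max_idPr _) ?subr0 // oppr_le0.
  by rewrite (max_idPl _) ?sub0r ?opprK // oppr_ge0 ltW.
have intp : P.-integrable setT (EFin \o (fun w => Num.max (g (Z w)) 0)).
  apply: (integrableR_le (g := fun w => `|g (Z w)|)); last exact: integrableR_norm.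
    exact: measurableT_comp mp mZ.
  by move=> w; rewrite ger0_norm // ge_max ler_norm normr_ge0.
have intn : P.-integrable setT (EFin \o (fun w => Num.max (- g (Z w)) 0)).
  apply: (integrableR_le (g := fun w => `|g (Z w)|)); last exact: integrableR_norm.
    exact: measurableT_comp mn mZ.
  by move=> w; rewrite ger0_norm // ge_max -normrN ler_norm normr_ge0.
under eq_Rintegral do rewrite ZE2.
rewrite RintegralB //; apply/eqP; rewrite subr_eq0; apply/eqP.
by rewrite /Rintegral E.
Qed.

Lemma gaussian_mean0 : \int[P]_w Z w = 0.
Proof.
apply: (gaussian_odd_mean0 (g := id)) => //; apply: eq_integrable (gaussian_integrable 1) => //.
Qed.

End GaussianLaw.

Local Open Scope complex_scope.
Local Open Scope sesquilinear_scope.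

(** * Second-order perturbation of linear eigenvalue statistics *)

Section HermitianAlgebra.
Context (R : realType).
Local Notation C := R[i].

Definition sqn (z : C) : R := complex.Re z ^+ 2 + complex.Im z ^+ 2.

Lemma sqn_ge0 z : 0 <= sqn z. Proof. by rewrite addr_ge0 ?sqr_ge0. Qed.
Lemma sqn0 : sqn 0 = 0. Proof. by rewrite /sqn /= expr0n addr0. Qed.
Lemma sqn1 : sqn 1 = 1. Proof. by rewrite /sqn /= expr1n expr0n addr0. Qed.
Lemma sqnM z z' : sqn (z * z') = sqn z * sqn z'.
Proof. by case: z z' => [a b] [c e]; rewrite /sqn /=; ring. Qed.
Lemma sqn_conj z : sqn z^* = sqn z.
Proof. by case: z => a b; rewrite /sqn /= sqrrN. Qed.
Lemma sqnE z : (sqn z)%:C = z * z^*.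
Proof. by case: z => a b; apply/eqP; rewrite eq_complex /sqn /=; apply/andP; split; apply/eqP; ring. Qed.
Lemma sqnE' z : (sqn z)%:C = z^* * z.
Proof. by rewrite sqnE mulrC. Qed.
Lemma sqn_real (x : R) : sqn x%:C = x ^+ 2.
Proof. by rewrite /sqn /= expr0n addr0. Qed.
Lemma sqnN z : sqn (- z) = sqn z.
Proof. by case: z => a b; rewrite /sqn /= !sqrrN. Qed.
Lemma sqnD_le z z' : sqn (z + z') <= 2 * (sqn z + sqn z').
Proof.
case: z z' => [a b] [c e]; rewrite -subr_ge0.
have -> : 2 * (sqn (a +i* b) + sqn (c +i* e)) - sqn ((a +i* b) + (c +i* e)) =
  (a - c) ^+ 2 + (b - e) ^+ 2 by rewrite /sqn /=; ring.
by rewrite addr_ge0 ?sqr_ge0.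
Qed.
Lemma sqn_eq0 z : (sqn z == 0) = (z == 0).
Proof.
by case: z => a b; rewrite /sqn /= paddr_eq0 ?sqr_ge0 // !sqrf_eq0 eq_complex.
Qed.

Lemma conj_conjM (x y : C) : (x^* * y)^* = x * y^*.
Proof.
by case: x y => [a b] [c e]; apply/eqP; rewrite eq_complex /=; apply/andP; split; apply/eqP; ring.
Qed.

(** The squared Hilbert-Schmidt norm, kept real; its unitary invariance is the only control on
    perturbations. *)
Definition hs m n (M : 'M[C]_(m, n)) : R := \sum_i \sum_j sqn (M i j).

Lemma hs_ge0 m n (M : 'M[C]_(m, n)) : 0 <= hs M.
Proof. by apply: sumr_ge0 => i _; apply: sumr_ge0 => j _; exact: sqn_ge0. Qed.

Lemma sum_rmorphC (I : Type) (r : seq I) (Q : pred I) (F : I -> R) :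
  (\sum_(i <- r | Q i) F i)%:C = \sum_(i <- r | Q i) (F i)%:C.
Proof. exact: (rmorph_sum (real_complex R)). Qed.

Lemma hs_trE m n (M : 'M[C]_(m, n)) : (hs M)%:C = \tr (M *m M ^t*).
Proof.
rewrite /hs sum_rmorphC /mxtrace; apply: eq_bigr => i _.
rewrite sum_rmorphC mxE; apply: eq_bigr => j _.
by rewrite sqnE !mxE.
Qed.

Lemma real_complexI : injective (real_complex R).
Proof. by move=> x y []. Qed.

Lemma hs_adj m n (M : 'M[C]_(m, n)) : hs (M ^t*) = hs M.
Proof.
rewrite /hs exchange_big; apply: eq_bigr => i _; apply: eq_bigr => j _.
by rewrite !mxE sqn_conj.
Qed.

Lemma hs_unitaryl m n (U : 'M[C]_m) (M : 'M[C]_(m, n)) : U \is unitarymx ->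
  hs (U *m M) = hs M.
Proof.
move=> Uu; apply: real_complexI; rewrite !hs_trE trmx_mul map_mxM.
rewrite mulmxA mxtrace_mulC !mulmxA -[U ^t* *m U]/(_).
have -> : U ^t* *m U = 1%:M by rewrite -invmx_unitary // mulVmx // unitarymx_unit.
by rewrite mul1mx.
Qed.

Lemma hs_unitaryr m n (U : 'M[C]_n) (M : 'M[C]_(m, n)) : U \is unitarymx ->
  hs (M *m U ^t*) = hs M.
Proof.
move=> Uu; rewrite -hs_adj trmx_mul map_mxM trmxCK hs_unitaryl //; exact: hs_adj.
Qed.

Definition lam n (H : 'M[C]_n) (i : 'I_n) : R := complex.Re (spectral_diag H 0 i).
Local Notation U H := (spectralmx H).

Lemma spectralE n (H : 'M[C]_n) : H \is hermsymmx ->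
  U H *m H = diag_mx (\row_i (lam H i)%:C) *m U H.
Proof.
move=> hH; have /orthomx_spectralP {2}-> := hermitian_normalmx hH.
rewrite -mulmxA (mulKVmx (spectral_unit H)); congr (diag_mx _ *m _).
apply/rowP => i; rewrite mxE /lam.
have := hermitian_spectral_diag_real hH => /mxOverP/(_ 0 i).
by case: (spectral_diag H 0 i) => a b; rewrite complex_real /= => /eqP ->.
Qed.

(** The unitary matrix between the two eigenbases. Its squared entries are doubly stochastic, which
    couples the two spectra without matching eigenvalues or following them along a path. *)
Definition overlap n (H H' : 'M[C]_n) := U H' *m (U H) ^t*.

Lemma overlap_unitary n (H H' : 'M[C]_n) : overlap H H' \is unitarymx.
Proof. by rewrite mul_unitarymx ?trmxC_unitary ?spectral_unitarymx. Qed.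

Lemma sum_sqn_row n (O : 'M[C]_n) k : O \is unitarymx -> \sum_i sqn (O k i) = 1.
Proof.
move=> /unitarymxP/matrixP/(_ k k); rewrite !mxE eqxx => h; apply: real_complexI.
rewrite sum_rmorphC /= -[RHS]h; apply: eq_bigr => i _.
by rewrite sqnE !mxE.
Qed.

Lemma sum_sqn_col n (O : 'M[C]_n) i : O \is unitarymx -> \sum_k sqn (O k i) = 1.
Proof.
move=> Ou; rewrite -(sum_sqn_row (O := O ^t*) i) ?trmxC_unitary //.
by apply: eq_bigr => k _; rewrite !mxE sqn_conj.
Qed.

Lemma adj_spectralK n (H : 'M[C]_n) : (U H) ^t* *m U H = 1%:M.
Proof. by rewrite -invmx_unitary ?spectral_unitarymx // mulVmx // spectral_unit. Qed.

(** Letting H' act on the left and H on the right turns the perturbation, entry by entry, into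
    eigenvalue differences. *)
Lemma overlap_commE n (H H' : 'M[C]_n) k i : H \is hermsymmx -> H' \is hermsymmx ->
  (U H' *m (H' - H) *m (U H) ^t*) k i = (lam H' k - lam H i)%:C * overlap H H' k i.
Proof.
move=> hH hH'; rewrite mulmxBr mulmxBl spectralE //.
have -> : U H' *m H *m (U H) ^t* = overlap H H' *m diag_mx (\row_i (lam H i)%:C).
  transitivity (overlap H H' *m (U H *m H) *m (U H) ^t*).
    by rewrite /overlap !mulmxA -[_ *m (U H) ^t* *m U H]mulmxA adj_spectralK mulmx1.
  rewrite spectralE // mulmxA -[_ *m U H *m _]mulmxA.
  by rewrite (unitarymxP (spectral_unitarymx H)) mulmx1.
rewrite -mulmxA mul_diag_mx mul_mx_diag !mxE.
by rewrite rmorphB /= mulrBl [X in _ - X]mulrC.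
Qed.

Definition trf n (f : R -> R) (H : 'M[C]_n) : R := \sum_i f (lam H i).

Definition fmx n (f : R -> R) (H : 'M[C]_n) : 'M[C]_n :=
  (U H) ^t* *m diag_mx (\row_i (f (lam H i))%:C) *m U H.

Lemma sum_overlap_row n (H H' : 'M[C]_n) (g : 'I_n -> R) :
  \sum_k \sum_i sqn (overlap H H' k i) * g k = \sum_k g k.
Proof.
apply: eq_bigr => k _; rewrite -mulr_suml sum_sqn_row ?mul1r //.
exact: overlap_unitary.
Qed.

Lemma sum_overlap_col n (H H' : 'M[C]_n) (g : 'I_n -> R) :
  \sum_k \sum_i sqn (overlap H H' k i) * g i = \sum_k g k.
Proof.
rewrite exchange_big; apply: eq_bigr => k _; rewrite -mulr_suml sum_sqn_col ?mul1r //.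
exact: overlap_unitary.
Qed.

Lemma trfB n f (H H' : 'M[C]_n) :
  trf f H' - trf f H = \sum_k \sum_i sqn (overlap H H' k i) * (f (lam H' k) - f (lam H i)).
Proof.
rewrite /trf -(sum_overlap_row H H' (fun k => f (lam H' k))).
rewrite -(sum_overlap_col H H' (fun i => f (lam H i))) -sumrB.
by apply: eq_bigr => k _; rewrite -sumrB; apply: eq_bigr => i _; rewrite mulrBr.
Qed.

Lemma hs_overlap n (H H' : 'M[C]_n) : H \is hermsymmx -> H' \is hermsymmx ->
  hs (H' - H) = \sum_k \sum_i sqn (overlap H H' k i) * (lam H' k - lam H i) ^+ 2.
Proof.
move=> hH hH'.
rewrite -(@hs_unitaryl _ _ (U H')) ?spectral_unitarymx //.
rewrite -(@hs_unitaryr _ _ (U H)) ?spectral_unitarymx // /hs.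
apply: eq_bigr => k _; apply: eq_bigr => i _.
by rewrite overlap_commE // sqnM sqn_real mulrC.
Qed.

Lemma trf_lip n f (H H' : 'M[C]_n) L B t : H \is hermsymmx -> H' \is hermsymmx ->
  (forall x y, `|f x - f y| <= L * `|x - y|) -> 0 <= L ->
  hs (H' - H) <= B * t ^+ 2 ->
  `|trf f H' - trf f H| <= L * (n%:R + B) * `|t|.
Proof.
move=> hH hH' lf L0 hB; rewrite trfB.
have o0 k i : 0 <= sqn (overlap H H' k i) by exact: sqn_ge0.
have [t0|t0] := eqVneq t 0.
  have : hs (H' - H) <= 0 by move: hB; rewrite t0 expr0n mulr0.
  rewrite hs_overlap // => h0.
  rewrite big1 ?normr0 ?t0 ?normr0 ?mulr0 // => k _; rewrite big1 // => i _.
  have : sqn (overlap H H' k i) * (lam H' k - lam H i) ^+ 2 <= 0.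
    apply: le_trans h0; rewrite (bigD1 k) //= (bigD1 i) //= -addrA lerDl.
    by rewrite addr_ge0 // !sumr_ge0 // => j _; rewrite ?sumr_ge0 // => *; rewrite mulr_ge0 ?sqr_ge0.
  rewrite le_eqVlt ltNge mulr_ge0 ?sqr_ge0 // orbF mulf_eq0 sqrf_eq0 subr_eq0.
  by case/orP => /eqP ->; rewrite ?mul0r // subrr mulr0.
have t1 : 0 < `|t| by rewrite normr_gt0.
(* A difference x satisfies |x| <= |t| + x^2/|t|; the first term is summed by double stochasticity,
   the second by [hs_overlap]. *)
apply: (@le_trans _ _ (\sum_k \sum_i sqn (overlap H H' k i) * (L * (`|t| + (lam H' k - lam H i) ^+ 2 / `|t|)))).
  apply: le_trans (ler_norm_sum _ _ _) _; apply: ler_sum => k _.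
  apply: le_trans (ler_norm_sum _ _ _) _; apply: ler_sum => i _.
  rewrite normrM ger0_norm // ler_wpM2l //; apply: le_trans (lf _ _) _; rewrite ler_wpM2l //.
  set x := _ - _; have [h|h] := leP `|x| `|t|.
    by rewrite ler_wpDr // divr_ge0 ?sqr_ge0.
  by rewrite ler_wpDl // ler_pdivlMr // -(real_normK (num_real x)) expr2 ler_pM2l ?ltW // (lt_trans t1).
have -> : \sum_k \sum_i sqn (overlap H H' k i) * (L * (`|t| + (lam H' k - lam H i) ^+ 2 / `|t|)) =
   L * (n%:R * `|t| + hs (H' - H) / `|t|).
  rewrite hs_overlap // mulrDr mulr_suml mulr_sumr.
  have -> : L * (n%:R * `|t|) = \sum_k \sum_i sqn (overlap H H' k i) * (L * `|t|).
    rewrite (sum_overlap_row H H' (fun _ => L * `|t|)) sumr_const card_ord -mulr_natl; ring.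
  rewrite -big_split /=; apply: eq_bigr => k _.
  by rewrite mulr_suml mulr_sumr -big_split /=; apply: eq_bigr => i _; ring.
rewrite -mulrA ler_wpM2l // mulrDl lerD2l ler_pdivrMr // -mulrA -expr2.
by rewrite real_normK ?num_real.
Qed.

Definition eigenframe n (H X : 'M[C]_n) := U H *m X *m (U H) ^t*.

Lemma hs_eigenframe n (H X : 'M[C]_n) : hs (eigenframe H X) = hs X.
Proof. by rewrite hs_unitaryr ?hs_unitaryl ?spectral_unitarymx. Qed.

Lemma overlap_eigenframe n (H H' X : 'M[C]_n) :
  overlap H H' *m eigenframe H X = U H' *m X *m (U H) ^t*.
Proof.
rewrite /overlap /eigenframe !mulmxA -[_ *m (U H) ^t* *m U H]mulmxA.
by rewrite adj_spectralK mulmx1.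
Qed.

Section SecondOrder.
Variables (n : nat) (H H' : 'M[C]_n).
Hypotheses (hH : H \is hermsymmx) (hH' : H' \is hermsymmx).
Let X := H' - H.
Let O := overlap H H'.
Let Y := eigenframe H X.

Let OY k i : (O *m Y) k i = (lam H' k - lam H i)%:C * O k i.
Proof. by rewrite /O /Y overlap_eigenframe overlap_commE. Qed.

Let adjOY : O ^t* *m (O *m Y) = Y.
Proof.
have /unitarymxP := overlap_unitary H H'; rewrite -/O => /mulmx1C h.
by rewrite mulmxA h mul1mx.
Qed.

Lemma sum_eigenframe_diag (g : 'I_n -> R) :
  \sum_i g i * complex.Re (Y i i) =
  \sum_k \sum_i sqn (O k i) * (g i * (lam H' k - lam H i)).
Proof.
rewrite exchange_big; apply: eq_bigr => i _; rewrite -{1}adjOY mxE raddf_sum mulr_sumr.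
apply: eq_bigr => k _ /=; rewrite OY !mxE mulrCA -sqnE' -rmorphM /=; ring.
Qed.

(** An exact formula: the factor (lam' - lam)^2 of the second-order remainder is absorbed into the
    squared entry of [O *m Y] by the commutation identity. *)
Lemma trf_taylor1 f f1 (h : R -> R -> R) :
  (forall x y, f y - f x - f1 x * (y - x) = (y - x) ^+ 2 * h x y) ->
  trf f H' - trf f H - \sum_i f1 (lam H i) * complex.Re (Y i i) =
  \sum_k \sum_i sqn ((O *m Y) k i) * h (lam H i) (lam H' k).
Proof.
move=> fh; rewrite trfB sum_eigenframe_diag -sumrB; apply: eq_bigr => k _.
rewrite -sumrB; apply: eq_bigr => i _.
by rewrite -mulrBr fh OY sqnM sqn_real; ring.
Qed.

Lemma trf_taylor1_le f f1 (h : R -> R -> R) B q :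
  (forall x y, f y - f x - f1 x * (y - x) = (y - x) ^+ 2 * h x y) ->
  (forall x y, `|h x y| <= B) -> hs X <= q ^+ 2 ->
  `|trf f H' - trf f H - \sum_i f1 (lam H i) * complex.Re (Y i i)| <= B * q ^+ 2.
Proof.
move=> fh hB hq; rewrite (trf_taylor1 fh).
have B0 : 0 <= B by exact: le_trans (hB 0 0).
apply: (@le_trans _ _ (B * hs (O *m Y))); last first.
  by rewrite hs_unitaryl ?hs_eigenframe ?ler_wpM2l // overlap_unitary.
rewrite /hs mulr_sumr; apply: le_trans (ler_norm_sum _ _ _) _; apply: ler_sum => k _.
rewrite mulr_sumr; apply: le_trans (ler_norm_sum _ _ _) _; apply: ler_sum => i _.
by rewrite normrM ger0_norm ?sqn_ge0 // mulrC ler_wpM2r ?sqn_ge0.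
Qed.

Let amgm (u v : C) (d th : R) : 0 < th ->
  complex.Re (u * v) * d <= th * sqn u + (sqn v * d ^+ 2) / th.
Proof.
case: u v => [a b] [c e] th0; rewrite -subr_ge0.
have -> : th * sqn (a +i* b) + sqn (c +i* e) * d ^+ 2 / th - complex.Re ((a +i* b) * (c +i* e)) * d =
  (th * (a - c * d / (2 * th)) ^+ 2 + th * (b + e * d / (2 * th)) ^+ 2)
  + 3 / 4 * ((c ^+ 2 + e ^+ 2) * d ^+ 2 / th).
  by rewrite /sqn /=; field; rewrite gt_eqF.
have th1 := ltW th0; apply: addr_ge0; first by rewrite addr_ge0 // mulr_ge0 ?sqr_ge0.
by rewrite mulr_ge0 // divr_ge0 // mulr_ge0 ?sqr_ge0 // addr_ge0 ?sqr_ge0.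
Qed.

(** The exact remainder still involves the spectrum of H'. Replacing it by that of H costs third
    order: every difference of [phi] between lam'_k and lam_j comes with the overlap entry (k, j),
    and the products of these entries with the eigenvalue differences have total square [hs X]. *)
Lemma quadratic_swap (phi : 'I_n -> R -> R) (L q : R) :
  (forall i x y, `|phi i x - phi i y| <= L * `|x - y|) -> 0 <= L -> 0 < q -> hs X <= q ^+ 2 ->
  `|\sum_k \sum_i sqn ((O *m Y) k i) * phi i (lam H' k)
   - \sum_k \sum_i sqn (Y k i) * phi i (lam H k)| <= L * (1 + n%:R) * q ^+ 3.
Proof.
move=> lphi L0 q0 hq.
pose D i k j := phi i (lam H' k) - phi i (lam H j).
(* Expanding one factor of each square through O puts both sums over the same pairs (k, j), with
   [phi] taken at lam'_k in the first and at lam_j in the second. *)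
have E i : \sum_k sqn ((O *m Y) k i) * phi i (lam H' k) - \sum_k sqn (Y k i) * phi i (lam H k)
   = \sum_k \sum_j complex.Re ((((O *m Y) k i)^* * Y j i) * O k j) * D i k j.
  have e1 : \sum_k sqn ((O *m Y) k i) * phi i (lam H' k) =
     \sum_k \sum_j complex.Re ((((O *m Y) k i)^* * Y j i) * O k j) * phi i (lam H' k).
    apply: eq_bigr => k _; rewrite -mulr_suml; congr (_ * _).
    rewrite -raddf_sum (_ : \sum_(j < n) _ = (sqn ((O *m Y) k i))%:C) //.
    by rewrite sqnE' [X in _ = _ * X]mxE mulr_sumr; apply: eq_bigr => j _; ring.
  have e2 : \sum_k sqn (Y k i) * phi i (lam H k) =
     \sum_k \sum_j complex.Re ((((O *m Y) k i)^* * Y j i) * O k j) * phi i (lam H j).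
    rewrite exchange_big; apply: eq_bigr => j _; rewrite -mulr_suml; congr (_ * _).
    rewrite -raddf_sum (_ : \sum_(k < n) _ = (sqn (Y j i))%:C) //.
    have YE : Y j i = \sum_k (O k j)^* * (O *m Y) k i.
      rewrite -[in LHS]adjOY mxE; apply: eq_bigr => k _.
      by congr (_ * _); rewrite !mxE.
    rewrite sqnE' {2}YE rmorph_sum /= mulr_suml; apply: eq_bigr => k _.
    transitivity (O k j * ((O *m Y) k i)^* * Y j i); first by ring.
    by rewrite -conj_conjM.
  rewrite e1 e2 -sumrB; apply: eq_bigr => k _; rewrite -sumrB; apply: eq_bigr => j _.
  by rewrite -mulrBr.
have -> : \sum_k \sum_i sqn ((O *m Y) k i) * phi i (lam H' k) - \sum_k \sum_i sqn (Y k i) * phi i (lam H k)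
  = \sum_i \sum_k \sum_j complex.Re ((((O *m Y) k i)^* * Y j i) * O k j) * D i k j.
  rewrite exchange_big [X in _ - X]exchange_big -sumrB; exact: eq_bigr.
pose a i k := sqn ((O *m Y) k i).
pose b i j := sqn (Y j i).
have hsY : \sum_i \sum_j b i j = hs X by rewrite -(hs_eigenframe H) /hs exchange_big.
have hsOY : \sum_i \sum_j a i j = hs X.
  rewrite -(hs_eigenframe H) -(@hs_unitaryl _ _ O) ?overlap_unitary // /hs exchange_big //.
(* Arithmetic-geometric mean with weight [q]: the first terms add up to at most q^4/q, the second to
   at most q times n q^2. *)
have bound i k j : `|complex.Re ((((O *m Y) k i)^* * Y j i) * O k j) * D i k j| <=
   L * (q^-1 * (a i k * b i j) + q * (sqn (O k j) * (lam H' k - lam H j) ^+ 2)).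
  have w0 : 0 <= q^-1 by rewrite invr_ge0 ltW.
  have S : (forall d : R, complex.Re ((((O *m Y) k i)^* * Y j i) * O k j) * d <=
     q^-1 * (a i k * b i j) + q * (sqn (O k j) * d ^+ 2)).
    move=> d; apply: le_trans (amgm _ _ d (th := q^-1) _) _; first by rewrite invr_gt0.
    by rewrite invrK sqnM sqn_conj [q * _]mulrC.
  set z := complex.Re _ in S *; set A := q^-1 * _ in S *.
  rewrite normrM; apply: (@le_trans _ _ (`|z| * (L * `|lam H' k - lam H j|))).
    by rewrite ler_wpM2l // lphi.
  rewrite mulrCA ler_wpM2l // -normrM.
  have := S (lam H' k - lam H j); have := S (- (lam H' k - lam H j)).
  by rewrite sqrrN mulrN ler_norml; move=> h1 h2; apply/andP; split => //; rewrite lerNl.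
apply: (@le_trans _ _ (\sum_i \sum_k \sum_j
   L * (q^-1 * (a i k * b i j) + q * (sqn (O k j) * (lam H' k - lam H j) ^+ 2)))).
  apply: le_trans (ler_norm_sum _ _ _) _; apply: ler_sum => i _.
  apply: le_trans (ler_norm_sum _ _ _) _; apply: ler_sum => k _.
  by apply: le_trans (ler_norm_sum _ _ _) _; apply: ler_sum => j _.
have -> : \sum_i \sum_k \sum_j
   L * (q^-1 * (a i k * b i j) + q * (sqn (O k j) * (lam H' k - lam H j) ^+ 2)) =
   L * (q^-1 * (\sum_i (\sum_k a i k) * (\sum_j b i j)) + q * (n%:R * hs X)).
  rewrite hs_overlap // -/O.
  under eq_bigr => i _.
    have -> : \sum_k \sum_j L * (q^-1 * (a i k * b i j) + q * (sqn (O k j) * (lam H' k - lam H j) ^+ 2))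
      = L * (q^-1 * ((\sum_k a i k) * (\sum_j b i j)) + q * (\sum_k \sum_j sqn (O k j) * (lam H' k - lam H j) ^+ 2)).
      rewrite mulr_suml !mulr_sumr -big_split mulr_sumr; apply: eq_bigr => k _ /=.
      by rewrite !mulr_sumr -big_split mulr_sumr; apply: eq_bigr => j _.
    over.
  rewrite -mulr_sumr big_split /= -mulr_sumr; congr (L * (_ + _)).
  by rewrite sumr_const card_ord -mulr_natl; ring.
have suma0 i : 0 <= \sum_k a i k by apply: sumr_ge0 => k _; exact: sqn_ge0.
have sumb0 i : 0 <= \sum_k b i k by apply: sumr_ge0 => k _; exact: sqn_ge0.
have sumab : \sum_i (\sum_k a i k) * (\sum_j b i j) <= q ^+ 2 * q ^+ 2.
  apply: (@le_trans _ _ (\sum_i (\sum_k a i k) * q ^+ 2)).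
    apply: ler_sum => i _; rewrite ler_wpM2l //; apply: le_trans hq; rewrite -hsY.
    by rewrite [leRHS](bigD1 i) //= lerDl sumr_ge0.
  by rewrite -mulr_suml hsOY ler_wpM2r ?sqr_ge0.
rewrite -mulrA ler_wpM2l // mulrDl mul1r lerD //.
  rewrite ler_pdivrMl // ; apply: le_trans sumab _; rewrite -exprS -exprD //.
have -> : n%:R * q ^+ 3 = q * (n%:R * q ^+ 2) by ring.
by apply: ler_wpM2l; [exact: ltW|exact: ler_wpM2l].
Qed.

End SecondOrder.
End HermitianAlgebra.

(** * Taylor estimates and divided differences in one variable *)

Section Taylor.
Context (R : realType).
Implicit Types f g : R -> R.

Lemma is_derive_continuous f f1 : (forall t : R, is_derive t (1 : R) f (f1 t)) -> continuous f.
Proof.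
move=> df x; apply: differentiable_continuous; apply/derivable1_diffP.
by case: (df x).
Qed.

Lemma mvt_between f f1 (y z : R) : (forall t : R, is_derive t (1 : R) f (f1 t)) ->
  exists c, Num.min y z <= c <= Num.max y z /\ f z - f y = f1 c * (z - y).
Proof.
move=> df; have cf := is_derive_continuous df.
have main a b : a < b -> exists2 c, a <= c <= b & f b - f a = f1 c * (b - a).
  move=> ab; have := @MVT _ f f1 a b ab (fun x _ => df x) (continuous_subspaceT cf).
  by case=> c; rewrite in_itv /= => /andP[/ltW ac /ltW cb] E; exists c => //; rewrite ac.
have [yz|zy|->] := ltgtP y z.
- by have [c h E] := main _ _ yz; exists c.
- have [c h E] := main _ _ zy; exists c; split => //.
  by rewrite -opprB E -mulrN opprB.
- by exists z; rewrite lexx !subrr mulr0.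
Qed.

Lemma derive_bound_lip f f1 A : (forall t : R, is_derive t (1 : R) f (f1 t)) ->
  (forall t, `|f1 t| <= A) -> forall x y, `|f x - f y| <= A * `|x - y|.
Proof.
move=> df hA x y; have [c [_ ->]] := mvt_between y x df.
by rewrite normrM ler_wpM2r.
Qed.

Lemma between_dist (x y c : R) : Num.min x y <= c <= Num.max x y -> `|c - x| <= `|y - x|.
Proof.
have [xy|yx] := leP x y => /andP[h1 h2].
  by rewrite !ger0_norm ?subr_ge0 // lerD2r.
by rewrite !ler0_norm; lra.
Qed.

(** Taylor remainders without factorials: order k for the derivative gives order k+1 for the
    function. Only the powers matter later. *)
Lemma mvt_pow_bound f f1 (A x y : R) k : (forall t : R, is_derive t (1 : R) f (f1 t)) ->
  f x = 0 -> (forall t, `|f1 t| <= A * `|t - x| ^+ k) -> `|f y| <= A * `|y - x| ^+ k.+1.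
Proof.
move=> df fx0 hA; have [c [cb]] := mvt_between x y df; rewrite fx0 subr0 => ->.
have A0 : 0 <= A by have := hA (x + 1); rewrite addrC addrK normr1 expr1n mulr1; exact: le_trans.
rewrite normrM exprS mulrCA [leRHS]mulrC ler_wpM2r //; apply: le_trans (hA c) _.
by rewrite ler_wpM2l // lerXn2r ?nnegrE ?normr_ge0 //; exact: between_dist.
Qed.

(* The divided difference f[x, x, y], extended by its limit on the diagonal. *)
Definition ddiff2 f f1 f2 (x y : R) : R :=
  if y == x then f2 x / 2 else (f y - f x - f1 x * (y - x)) / (y - x) ^+ 2.

Lemma ddiff2E f f1 f2 x y :
  f y - f x - f1 x * (y - x) = (y - x) ^+ 2 * ddiff2 f f1 f2 x y.
Proof.
rewrite /ddiff2; have [->|yx] := eqVneq y x; first by rewrite !subrr mulr0 expr0n mul0r subrr.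
by rewrite [RHS]mulrC divfK // expf_neq0 // subr_eq0.
Qed.

Section Bounds.
Variables (f f1 f2 f3 : R -> R).
Hypothesis df : forall t : R, is_derive t (1 : R) f (f1 t).
Hypothesis df1 : forall t : R, is_derive t (1 : R) f1 (f2 t).

Let taylor1 (M x y : R) : (forall t, `|f2 t| <= M) -> `|f y - f x - f1 x * (y - x)| <= M * (y - x) ^+ 2.
Proof.
move=> hM.
have D t : is_derive t (1 : R) (fun t => f t - f x - f1 x * (t - x)) (f1 t - f1 x).
  by apply: is_derive_eq; rewrite /GRing.scale /=; ring.
have := @mvt_pow_bound _ _ M x y 1 D _ _; rewrite real_normK ?num_real //; apply.
  by rewrite !subrr mulr0 subr0.
by move=> t; rewrite expr1; exact: derive_bound_lip.
Qed.

Lemma ddiff2_le (M x y : R) : (forall t, `|f2 t| <= M) -> `|ddiff2 f f1 f2 x y| <= M.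
Proof.
move=> hM; have M0 : 0 <= M by exact: le_trans (hM 0).
rewrite /ddiff2; have [yx|yx] := eqVneq y x.
  rewrite normrM [`|2^-1|]gtr0_norm // ler_pdivrMr //; apply: (le_trans (hM x)).
  by rewrite ler_peMr // ler1n.
have p : 0 < (y - x) ^+ 2 by rewrite exprn_even_gt0 //= subr_eq0.
by rewrite normrM normfV [X in _ / X]gtr0_norm // ler_pdivrMr //; exact: taylor1.
Qed.

Hypothesis df2 : forall t : R, is_derive t (1 : R) f2 (f3 t).

(** Differentiating the quotient would leave a singular denominator at the diagonal. When y and z
    lie on one side of x, the mean value theorem is applied to the numerator instead; on opposite
    sides the comparison passes through the diagonal value [f2 x / 2]. *)
Lemma ddiff2_lip (M : R) : (forall t, `|f3 t| <= M) ->
  forall x y z, `|ddiff2 f f1 f2 x y - ddiff2 f f1 f2 x z| <= 3 * M * `|y - z|.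
Proof.
move=> hM; have M0 : 0 <= M by exact: le_trans (hM 0).
have l2 x y : `|f2 y - f2 x| <= M * `|y - x| by exact: derive_bound_lip.
have t1 x y : `|f1 y - f1 x - f2 x * (y - x)| <= M * `|y - x| ^+ 2.
  have D t : is_derive t (1 : R) (fun t => f1 t - f1 x - f2 x * (t - x)) (f2 t - f2 x).
    by apply: is_derive_eq; rewrite /GRing.scale /=; ring.
  apply: (@mvt_pow_bound _ _ M x y 1 D); first by rewrite !subrr mulr0 subr0.
  by move=> t; rewrite expr1.
have t0 x y : `|f y - f x - f1 x * (y - x) - f2 x / 2 * (y - x) ^+ 2| <= M * `|y - x| ^+ 3.
  have D t : is_derive t (1 : R) (fun t => f t - f x - f1 x * (t - x) - f2 x / 2 * (t - x) ^+ 2)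
     (f1 t - f1 x - f2 x * (t - x)).
    by apply: is_derive_eq; rewrite /GRing.scale /=; field.
  by apply: (@mvt_pow_bound _ _ M x y 2 D) => //; rewrite !subrr expr0n !mulr0 !subr0.
pose h := ddiff2 f f1 f2.
have hx x y : `|h x y - f2 x / 2| <= M * `|y - x|.
  rewrite /h /ddiff2; have [->|yx] := eqVneq y x; first by rewrite !subrr normr0 mulr0.
  have yx0 : y - x != 0 by rewrite subr_eq0.
  have p : 0 < `|y - x| ^+ 2 by rewrite exprn_gt0 // normr_gt0.
  rewrite -(ler_pM2r p) -[M * _ * _]mulrA -exprS.
  rewrite -[X in _ * X <= _]normrX -normrM mulrBl divfK ?expf_neq0 //; exact: t0.
have same x y z : y != x -> z != x -> 0 < (y - x) * (z - x) -> `|y - x| <= `|z - x| ->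
    `|h x y - h x z| <= 3 * M * `|y - z|.
  move=> yx zx yz le_yz.
  set H := h x y.
  (* This function vanishes at y and equals (h x z - H) (z - x)^2 at z. Taking z as the farther
     point lets |z - x|^2 dominate its derivative in between. *)
  have D t : is_derive t (1 : R) (fun t => f t - f x - f1 x * (t - x) - H * (t - x) ^+ 2)
     (f1 t - f1 x - 2 * H * (t - x)).
    by apply: is_derive_eq; rewrite /GRing.scale /=; ring.
  have [c [cb E]] := mvt_between y z D.
  have cx : `|c - x| <= `|z - x|.
    move: cb yz le_yz; have [yz|zy] := leP y z => /andP[c1 c2] p.
      have [xy|xy] := leP x y.
        by move=> _; rewrite !ger0_norm; lra.
      have zx0 : z < x by rewrite -subr_lt0; nra.
      by rewrite !ler0_norm; lra.
    have [xy|xy] := leP x y.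
      have zx0 : x < z by rewrite -subr_gt0; nra.
      by rewrite !ger0_norm; lra.
    by rewrite !ler0_norm; lra.
  have Ey : f y - f x - f1 x * (y - x) - H * (y - x) ^+ 2 = 0.
    by rewrite (ddiff2E f f1 f2) /H /h mulrC subrr.
  have Ez : f z - f x - f1 x * (z - x) - H * (z - x) ^+ 2 = (h x z - H) * (z - x) ^+ 2.
    by rewrite (ddiff2E f f1 f2) -/(h x z); ring.
  rewrite Ey Ez subr0 in E.
  have zx0 : z - x != 0 by rewrite subr_eq0.
  have p : 0 < `|z - x| ^+ 2 by rewrite exprn_gt0 // normr_gt0.
  rewrite distrC -(ler_pM2r p) -[X in _ * X <= _]normrX -normrM E normrM.
  rewrite [`|z - y|]distrC [leRHS]mulrAC; apply: ler_wpM2r => //.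
  have -> : f1 c - f1 x - 2 * H * (c - x) = (f1 c - f1 x - f2 x * (c - x)) - 2 * (H - f2 x / 2) * (c - x).
    by field.
  apply: le_trans (ler_normB _ _) _.
  have -> : 3 * M * `|z - x| ^+ 2 = M * `|z - x| ^+ 2 + 2 * (M * `|z - x|) * `|z - x| by ring.
  rewrite lerD //.
    apply: (le_trans (t1 x c)); rewrite ler_wpM2l // lerXn2r ?nnegrE //.
  rewrite !normrM [`|2|]gtr0_norm // ler_pM ?mulr_ge0 // ler_wpM2l //.
  by apply: (le_trans (hx x y)); rewrite ler_wpM2l.
move=> x y z; rewrite -/h.
have opp : (y - x) * (z - x) <= 0 -> `|h x y - h x z| <= 3 * M * `|y - z|.
  move=> yz.
  have -> : h x y - h x z = (h x y - f2 x / 2) - (h x z - f2 x / 2) by ring.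
  apply: le_trans (ler_normB _ _) _; apply: (le_trans (lerD (hx _ _) (hx _ _))).
  have E : `|y - z| = `|y - x| + `|z - x|.
    have [xy|xy] := leP x y; have [xz|xz] := leP x z.
    - have [->|] := eqVneq y x; first by rewrite subrr normr0 add0r distrC.
      move=> ne; have xy' : x < y by rewrite lt_neqAle eq_sym ne.
      have -> : z = x by nra.
      by rewrite subrr normr0 addr0.
    - by rewrite (ger0_norm (_ : 0 <= y - z)) ?(ger0_norm (_ : 0 <= y - x)) ?(ler0_norm (_ : z - x <= 0)); lra.
    - by rewrite (ler0_norm (_ : y - z <= 0)) ?(ler0_norm (_ : y - x <= 0)) ?(ger0_norm (_ : 0 <= z - x)); lra.
    - exfalso; nra.
  rewrite -mulrDr -E -mulrA; have := mulr_ge0 M0 (normr_ge0 (y - z)); lra.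
have [/opp//|yz] := leP ((y - x) * (z - x)) 0.
have yx : y != x by apply/eqP => e; rewrite e subrr mul0r ltxx in yz.
have zx : z != x by apply/eqP => e; rewrite e subrr mulr0 ltxx in yz.
have [le_yz|/ltW le_zy] := leP `|y - x| `|z - x|; first exact: same.
by rewrite distrC [`|y - z|]distrC; apply: same => //; rewrite mulrC.
Qed.

End Bounds.

(* Away from the diagonal the quadratic denominator beats the linear growth of the numerator. *)
Lemma ddiff2_kernel_le (f f1 f2 : R -> R) (M r : R) :
  (forall t : R, is_derive t (1 : R) f (f1 t)) -> (forall t : R, is_derive t (1 : R) f1 (f2 t)) ->
  (forall t, `|f t| <= M) -> (forall t, `|f1 t| <= M) -> (forall t, `|f2 t| <= M) ->
  (forall t, r < `|t| -> f t = 0 /\ f1 t = 0 /\ f2 t = 0) -> 0 <= r ->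
  forall x y, `|ddiff2 f f1 f2 x y| <=
    6 * M * (1 + r) * ((`|x| <= r)%R%:R / (1 + `|y|) + (`|y| <= r)%R%:R / (1 + `|x|)).
Proof.
move=> df df1 b0 b1 b2 out r0 x y.
have M0 : 0 <= M by exact: le_trans (b0 0).
have k1 : `|ddiff2 f f1 f2 x y| * (1 + `|y - x|) <= 6 * M.
  have [h|h] := leP `|y - x| 1.
    apply: (@le_trans _ _ (M * 2)); last by lra.
    by rewrite ler_pM // ?addr_ge0 // ?(ddiff2_le df df1) //; lra.
  rewrite /ddiff2; have [yx|yx] := eqVneq y x; first by move: h; rewrite yx subrr normr0; lra.
  set dd := `|y - x|.
  have d0 : 0 < dd by rewrite (lt_trans _ h).
  rewrite normrM normfV normrX -/dd mulrAC ler_pdivrMr ?exprn_gt0 //.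
  apply: (@le_trans _ _ (3 * M * dd * (2 * dd))); last by rewrite expr2; nra.
  have h' : 1 + dd <= 2 * dd by rewrite /dd; move: h; lra.
  rewrite ler_pM ?addr_ge0 // ?(ltW d0) //.
  apply: le_trans (ler_normB _ _) _; rewrite normrM -/dd.
  have := ler_normB (f y) (f x); have := b0 y; have := b0 x.
  have := ler_wpM2r (ltW d0) (b1 x); nra.
have xy0 : 0 < 1 + `|y - x| by rewrite ltr_pwDl.
have x0 : 0 < 1 + `|x| by rewrite ltr_pwDl.
have y0 : 0 < 1 + `|y| by rewrite ltr_pwDl.
have near (u v : R) : `|u| <= r -> 1 + `|v| <= (1 + r) * (1 + `|v - u|).
  move=> ur; have := ler_normD (v - u) u; rewrite subrK => h.
  have := normr_ge0 (v - u); nra.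
have hmain (u v : R) : `|ddiff2 f f1 f2 x y| * (1 + `|v - u|) <= 6 * M -> `|u| <= r ->
   `|ddiff2 f f1 f2 x y| <= 6 * M * (1 + r) * (1 / (1 + `|v|)).
  move=> k ur; have v0 : 0 < 1 + `|v| by rewrite ltr_pwDl.
  rewrite mulrA ler_pdivlMr // mulr1.
  apply: (@le_trans _ _ (`|ddiff2 f f1 f2 x y| * ((1 + r) * (1 + `|v - u|)))).
    by rewrite ler_wpM2l // near.
  by rewrite mulrCA mulrC ler_wpM2r // addr_ge0.
have c0 : 0 <= 6 * M * (1 + r) by rewrite !mulr_ge0 // addr_ge0.
have [xr|xr] := leP `|x| r.
  apply: (le_trans (hmain x y k1 xr)); rewrite ler_wpM2l // lerDl.
  by rewrite divr_ge0 // ltW.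
have [yr|yr] := leP `|y| r.
  rewrite /= mul0r add0r; apply: hmain yr; by rewrite distrC.
rewrite !mul0r addr0 mulr0 /ddiff2.
have [fx [f1x f2x]] := out _ xr; have [fy _] := out _ yr.
by rewrite f2x fx fy f1x !mul0r !subrr mul0r if_same normr0.
Qed.

End Taylor.

(** * Smooth test functions of two variables *)

Section TestFunction.
Context (R : realType).

Definition row2 (u v : R) : 'rV[R]_2 := \row_(k < 2) (if k == 0 then u else v).

(* D i j is the j-th partial derivative in the second variable of the i-th one in the first. *)
Record test_fun (F : R -> R -> R) (M r : R) (D : nat -> nat -> R -> R -> R) : Prop := TestFun {
  tf0 : D 0%N 0%N = F;
  tf1 : forall i u v, is_derive u (1 : R) (fun u => D i 0%N u v) (D i.+1 0%N u v);
  tf2 : forall i j u v, is_derive v (1 : R) (fun v => D i j u v) (D i j.+1 u v);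
  tf_bound : forall i j u v, (i <= 3)%N -> (j <= 3)%N -> `|D i j u v| <= M;
  tf_out1 : forall i j u v, r < `|u| -> D i j u v = 0;
  tf_out2 : forall i j u v, r < `|v| -> D i j u v = 0;
  tf_r : 0 <= r
}.

Lemma Cinfty_c_test_fun (F : 'rV[R]_2 -> R) : Cinfty_c F ->
  exists M r D, test_fun (fun u v => F (row2 u v)) M r D.
Proof.
move=> [FC cK]; set K := closure _ in cK.
have clK : closed K by exact: closed_closure.
pose P (G : 'rV[R]_2 -> R) := (forall k, Ck k G) /\ (forall x, ~ K x -> G x = 0).
have PF : P F.
  split => // x nKx; apply/eqP; apply/negPn/negP => Fx; apply: nKx.
  exact: subset_closure.
pose dd (i : 'I_2) (G : 'rV[R]_2 -> R) := fun x => 'D_(delta_mx 0 i) G x.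
have Pd i G : P G -> P (dd i G).
  move=> [GC Gout]; split; first by move=> k; have [_ _] := GC k.+1; apply.
  move=> x nKx; rewrite /dd (@near_eq_derive _ _ _ G (cst 0)) ?derive_cst //.
  have : nbhs x (~` K) by apply: open_nbhs_nbhs; split => //; exact: closed_openC.
  by apply: filterS => y /= nKy; exact: Gout.
(* Derivatives in the second variable are taken last: the recursion in j holds for every i, and that
   in i is needed at j = 0 only, so the symmetry of mixed derivatives is never invoked. *)
pose G i j := iter j (dd 1) (iter i (dd 0) F).
have PG i j : P (G i j).
  by rewrite /G; elim: j => [|j]; [elim: i => //= i; exact: Pd|exact: Pd].
have Gcont i j : continuous (G i j) by have [h _] := PG i j; exact: (h 0).
have derv i j e x : derivable (G i j) x (delta_mx 0 e).
  by have [h _] := PG i j; have [_ + _] := h 1%N; apply.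
have [r [rr hr]] : exists r : R, 0 <= r /\ forall x, K x -> forall k, `|x 0 k| <= r.
  have [B [_ hB]] := compact_bounded cK.
  exists (`|B| + 1); split; first by rewrite addr_ge0.
  move=> x Kx k; apply: le_trans (hB (`|B| + 1) _ x Kx); last first.
    by rewrite (le_lt_trans (ler_norm _)) // ltrDl.
  rewrite -[`|x|]/(mx_norm x) mx_normrE.
  exact: (le_bigmax _ (fun i : 'I_1 * 'I_2 => `|x i.1 i.2|) (0, k)).
have Gb (ij : nat * nat) : exists M : R, forall x, `|G ij.1 ij.2 x| <= M.
  have cG : compact (G ij.1 ij.2 @` K).
    by apply: continuous_compact => //; apply: continuous_subspaceT; exact: Gcont.
  have [B [_ hB]] := compact_bounded cG.
  exists (`|B| + 1) => x; have [Kx|nKx] := pselect (K x).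
    apply: (hB (`|B| + 1)); first by rewrite (le_lt_trans (ler_norm _)) // ltrDl.
    by exists x.
  by have [_ ->//] := PG ij.1 ij.2; rewrite normr0 addr_ge0.
have [Mb hMb] := choice Gb.
have Mb0 ij : 0 <= Mb ij by exact: le_trans (hMb ij 0).
have row2E0 h u v : row2 (h + u) v = h *: delta_mx 0 0 + row2 u v.
  by apply/rowP => k; rewrite !mxE eqxx /=; case: eqP => _; rewrite ?mulr1 ?mulr0 ?add0r.
have row2E1 h u v : row2 u (h + v) = h *: delta_mx 0 1 + row2 u v.
  apply/rowP => k; rewrite !mxE eqxx /=.
  have [->|k0] := eqVneq k 0; first by rewrite mulr0 add0r.
  have -> : (k == 1) by move: k0; case: k => -[|[|//]] // p _; apply/eqP/val_inj.
  by rewrite mulr1.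
exists (\sum_(i < 4) \sum_(j < 4) Mb (i : nat, j : nat)), r.
exists (fun i j u v => G i j (row2 u v)); split => //.
- move=> i u v.
  have E : (fun h => h^-1 *: ((G i 0%N \o shift (row2 u v)) (h *: delta_mx 0 0) - G i 0%N (row2 u v))) =
      (fun h => h^-1 *: (((fun u => G i 0%N (row2 u v)) \o shift u) (h *: 1) - G i 0%N (row2 u v))).
    by apply/funext => h; rewrite /= -row2E0 [h *: 1]mulr1.
  apply: DeriveDef; first by have := derv i 0%N 0 (row2 u v); rewrite /derivable E.
  by rewrite -[RHS]/('D_(delta_mx 0 0) (G i 0%N) (row2 u v)) /derive E.
- move=> i j u v.
  have E : (fun h => h^-1 *: ((G i j \o shift (row2 u v)) (h *: delta_mx 0 1) - G i j (row2 u v))) =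
      (fun h => h^-1 *: (((fun v => G i j (row2 u v)) \o shift v) (h *: 1) - G i j (row2 u v))).
    by apply/funext => h; rewrite /= -row2E1 [h *: 1]mulr1.
  apply: DeriveDef; first by have := derv i j 1 (row2 u v); rewrite /derivable E.
  by rewrite -[RHS]/('D_(delta_mx 0 1) (G i j) (row2 u v)) /derive E.
- move=> i j u v i3 j3; apply: (le_trans (hMb (i, j) (row2 u v))).
  have i4 : (i < 4)%N by []. have j4 : (j < 4)%N by [].
  rewrite (bigD1 (Ordinal i4)) //= (bigD1 (Ordinal j4)) //= -addrA lerDl.
  by rewrite addr_ge0 // sumr_ge0 // => k _; rewrite sumr_ge0.
- move=> i j u v ru; have [_ ->//] := PG i j => Kx.
  by have := hr _ Kx 0; rewrite !mxE /= leNgt ru.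
- move=> i j u v rv; have [_ ->//] := PG i j => Kx.
  by have := hr _ Kx 1; rewrite !mxE /= leNgt rv.
Qed.

End TestFunction.

(** * Small-ball estimates *)

Section Trig.
Context (R : realType).

Lemma sin_abs_le (x : R) : `|sin x| <= `|x|.
Proof.
have := @mvt_pow_bound R sin cos 1 0 x 0 (fun t => is_derive_sin t) (sin0 R).
by rewrite expr1 mul1r subr0; apply => t; rewrite expr0 mulr1 ler_norml cos_geN1 cos_le1.
Qed.

Let dcos1 (t : R) : is_derive t (1 : R) (fun t => 1 - cos t) (sin t).
Proof.
have h : is_derive t (1 : R) (fun t => 1 - cos t) (0 - - sin t) by apply: is_deriveB.
by apply: is_derive_eq h _; rewrite opprK add0r.
Qed.

Lemma onem_cos_abs_le (x : R) : `|1 - cos x| <= `|x|.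
Proof.
have := @mvt_pow_bound R _ sin 1 0 x 0 dcos1.
rewrite cos0 subrr expr1 mul1r subr0; apply => // t.
by rewrite expr0 mulr1 ler_norml sin_geN1 sin_le1.
Qed.

Lemma onem_cos_sqr_le (x : R) : `|1 - cos x| <= x ^+ 2.
Proof.
have := @mvt_pow_bound R _ sin 1 0 x 1 dcos1.
rewrite cos0 subrr mul1r subr0 real_normK ?num_real //; apply => // t.
by rewrite expr1 mul1r subr0 sin_abs_le.
Qed.

Let dsin1 (t : R) : is_derive t (1 : R) (fun t => t - sin t) (1 - cos t).
Proof. by apply: is_derive_eq. Qed.

Lemma subr_sin_sqr_le (x : R) : `|x - sin x| <= x ^+ 2.
Proof.
have := @mvt_pow_bound R _ _ 1 0 x 1 dsin1.
rewrite sin0 subrr mul1r subr0 real_normK ?num_real //; apply => // t.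
by rewrite expr1 mul1r subr0 onem_cos_abs_le.
Qed.

Lemma cos_taylor4 (x : R) : `|cos x - 1 + x ^+ 2 / 2| <= x ^+ 4.
Proof.
have d3 (t : R) : `|t - sin t| <= 1 * `|t - 0| ^+ 3.
  have := @mvt_pow_bound R _ _ 1 0 t 2 dsin1; rewrite sin0 subrr; apply => // u.
  by rewrite mul1r subr0 real_normK ?num_real // onem_cos_sqr_le.
have D (t : R) : is_derive t (1 : R) (fun t => cos t - 1 + t ^+ 2 / 2) (t - sin t).
  by apply: is_derive_eq; rewrite /GRing.scale /=; field.
have := @mvt_pow_bound R _ _ 1 0 x 3 D; rewrite cos0 subrr expr0n mul0r addr0 mul1r subr0.
have -> : x ^+ 4 = `|x| ^+ 4.
  by rewrite -[4%N]/(2 * 2)%N !exprM real_normK ?num_real.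
by apply.
Qed.

(** A crude form of cosh y <= exp(y^2/2), enough for the exponential moments of random signs on a
    bounded range. *)
Lemma expR_sumpm_le (y : R) : `|y| <= 2^-1 -> expR y + expR (- y) <= 2 * expR (2 * y ^+ 2).
Proof.
rewrite ler_norml => /andP[y1 y2].
have p1 : 0 < 1 - y by lra.
have p2 : 0 < 1 + y by lra.
have a1 : expR y <= (1 - y)^-1.
  by rewrite -[y in expR y]opprK expRN lef_pV2 ?posrE ?expR_gt0 //; exact: expR_ge1Dx.
have a2 : expR (- y) <= (1 + y)^-1.
  by rewrite expRN lef_pV2 ?posrE ?expR_gt0 //; exact: expR_ge1Dx.
apply: (le_trans (lerD a1 a2)).
have -> : (1 - y)^-1 + (1 + y)^-1 = 2 / (1 - y ^+ 2).
  field; rewrite !gt_eqF //; nra.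
rewrite ler_wpM2l //; apply: (@le_trans _ _ (1 + 2 * y ^+ 2)); last exact: expR_ge1Dx.
have p : 0 < 1 - y ^+ 2 by nra.
rewrite -[leLHS]mul1r ler_pdivrMr //.
have y4 : 0 <= y ^+ 2 by exact: sqr_ge0.
have yh : y ^+ 2 <= 1 / 4 by nra.
nra.
Qed.

Lemma half_expR_le (b : R) : 0 <= b <= 4^-1 -> (1 + expR (- (4 * b))) / 2 <= expR (- b).
Proof.
move=> /andP[b0 b1].
have h : expR (- (4 * b)) <= 1 - 2 * b.
  rewrite expRN -[leRHS]invrK lef_pV2 ?posrE ?expR_gt0 ?invr_gt0 //; last by lra.
  apply: (@le_trans _ _ (1 + 4 * b)); last exact: expR_ge1Dx.
  rewrite -[leLHS]mul1r ler_pdivrMr; [nra|lra].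
rewrite ler_pdivrMr //; have := expR_ge1Dx (- b); lra.
Qed.

Definition expi (a : R) : R[i] := cos a +i* sin a.

Lemma expiD a b : expi (a + b) = expi a * expi b.
Proof.
by rewrite /expi cosD sinD; apply/eqP; rewrite eq_complex /=; apply/andP; split; apply/eqP; ring.
Qed.

Lemma expi_sum (I : Type) (r : seq I) (Q : pred I) (f : I -> R) :
  expi (\sum_(i <- r | Q i) f i) = \prod_(i <- r | Q i) expi (f i).
Proof.
elim/big_rec2: _ => [|i y1 y2 _ <-]; last exact: expiD.
by rewrite /expi cos0 sin0.
Qed.

(* Two independent fair signs: their sum takes the values 2, 0, 0, -2. *)
Definition two_signs (k : 'I_4) : R := if k == 0 :> nat then 2 else if k == 3 :> nat then -2 else 0.

Lemma sum_two_signs (f : R -> R) : \sum_k f (two_signs k) = f 2 + f 0 + f 0 + f (-2).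
Proof. by rewrite !big_ord_recr big_ord0 /= add0r. Qed.

(** cos^2 is the characteristic function of a sum of two fair signs. The product is thus a
    nonnegative test for the smallness of all [a j] at once and also a finite average of cosines of
    linear combinations, which characteristic functions can handle. *)
Lemma prod_cos2E (J : finType) (a : J -> R) :
  \prod_j cos (a j) ^+ 2 =
  \sum_(g : {ffun J -> 'I_4}) (4^-1) ^+ #|J| * cos (\sum_j two_signs (g j) * a j).
Proof.
have key j : (cos (a j) ^+ 2)%:C = \sum_k (4^-1)%:C * expi (two_signs k * a j).
  rewrite -mulr_sumr !big_ord_recr big_ord0 /= /two_signs /= add0r mul0r.
  rewrite /expi mulNr cosN sinN cos0 sin0 mulr_natl cos_mulr2n sin_mulr2n.
  by apply/eqP; rewrite eq_complex /=; apply/andP; split; apply/eqP; field.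
apply: real_complexI; rewrite rmorph_prod /=.
rewrite (eq_bigr _ (fun j _ => key j)) bigA_distr_bigA /=.
have E (g : {ffun J -> 'I_4}) : \prod_i ((4^-1)%:C * expi (two_signs (g i) * a i)) =
   ((4^-1) ^+ #|J|)%:C * expi (\sum_j two_signs (g j) * a j).
  rewrite big_split /= prodr_const -expi_sum rmorphXn /= //.
rewrite (eq_bigr _ (fun g _ => E g)).
set S := \sum_g _.
have Sreal : S = (\prod_j cos (a j) ^+ 2)%:C.
  rewrite /S -(eq_bigr _ (fun g _ => E g)).
  rewrite -(bigA_distr_bigA (fun j k => (4^-1)%:C * expi (two_signs k * a j))) rmorph_prod /=.
  by apply: eq_bigr => j _; rewrite -key.
have ReS : complex.Re S = \sum_(g : {ffun J -> 'I_4}) (4^-1) ^+ #|J| * cos (\sum_j two_signs (g j) * a j).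
  by rewrite /S raddf_sum; apply: eq_bigr => g _; rewrite /= mul0r subr0.
by rewrite -ReS Sreal.
Qed.

End Trig.

Section CharacteristicFunction.
Context d (T : measurableType d) (R : realType) (P : probability T R).

(** The squared modulus of the characteristic function of [Z]. *)
Definition char_sqr (Z : T -> R) (t : R) : R :=
  (\int[P]_w cos (t * Z w)) ^+ 2 + (\int[P]_w sin (t * Z w)) ^+ 2.

Variable Z : T -> R.
Hypothesis mZ : measurable_fun setT Z.

Let mcos t : measurable_fun setT (fun w => cos (t * Z w)).
Proof.
apply: measurableT_comp; last exact: measurable_funM.
by apply: continuous_measurable_fun; exact: continuous_cos.
Qed.

Let msin t : measurable_fun setT (fun w => sin (t * Z w)).
Proof.
apply: measurableT_comp; last exact: measurable_funM.
by apply: continuous_measurable_fun; exact: continuous_sin.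
Qed.

Let bcos (x : R) : `|cos x| <= 1. Proof. by rewrite ler_norml cos_geN1 cos_le1. Qed.
Let bsin (x : R) : `|sin x| <= 1. Proof. by rewrite ler_norml sin_geN1 sin_le1. Qed.

Let icos t : P.-integrable setT (EFin \o (fun w => cos (t * Z w))).
Proof. exact: (bounded_integrable P (mcos t)). Qed.
Let isin t : P.-integrable setT (EFin \o (fun w => sin (t * Z w))).
Proof. exact: (bounded_integrable P (msin t)). Qed.

Lemma Rintegral_phase (a b th t : R) :
  \int[P]_w (a * cos (th + t * Z w) - b * sin (th + t * Z w)) =
  (a * (\int[P]_w cos (t * Z w)) - b * (\int[P]_w sin (t * Z w))) * cos th
  - (a * (\int[P]_w sin (t * Z w)) + b * (\int[P]_w cos (t * Z w))) * sin th.
Proof.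
under eq_Rintegral => w _.
  have -> : a * cos (th + t * Z w) - b * sin (th + t * Z w) =
    (a * cos th - b * sin th) * cos (t * Z w) - (a * sin th + b * cos th) * sin (t * Z w).
    by rewrite cosD sinD; ring.
  over.
rewrite RintegralB //.
- rewrite !RintegralZl //; ring.
- by apply: (bounded_integrable P (M := `|a * cos th - b * sin th|)); [exact: measurable_funM|move=> w; rewrite normrM ler_piMr].
- by apply: (bounded_integrable P (M := `|a * sin th + b * cos th|)); [exact: measurable_funM|move=> w; rewrite normrM ler_piMr].
Qed.

Lemma char_sqr_ge0 t : 0 <= char_sqr Z t.
Proof. by rewrite addr_ge0 ?sqr_ge0. Qed.

(* A C + B S is the integral of a single cosine, hence at most one when A^2 + B^2 <= 1. *)
Lemma char_sqr_le1 t : char_sqr Z t <= 1.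
Proof.
rewrite /char_sqr; set A := \int[P]_w _; set B := \int[P]_w _.
have : \int[P]_w (A * cos (0 + t * Z w) - (- B) * sin (0 + t * Z w)) <= \int[P]_w ((A ^+ 2 + B ^+ 2 + 1) / 2).
  apply: le_Rintegral => //.
  - apply: (bounded_integrable P (M := `|A| + `|B|)).
      apply: measurable_funB; apply: measurable_funM => //; under eq_fun do rewrite add0r; [exact: mcos|exact: msin].
    move=> w; apply: le_trans (ler_normB _ _) _; rewrite !normrM normrN lerD // ler_piMr //.
  - by apply: (bounded_integrable P (M := `|(A ^+ 2 + B ^+ 2 + 1) / 2|)).
  - move=> w _; rewrite add0r; set c := cos _; set s := sin _.
    have : c ^+ 2 + s ^+ 2 = 1 by rewrite cos2Dsin2.
    have := sqr_ge0 (A - c); have := sqr_ge0 (B - s); nra.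
rewrite Rintegral_phase Rintegral_prob_cst cos0 sin0 mulr1 mulr0 subr0 -/A -/B mulNr opprK -!expr2.
lra.
Qed.

(** Zero mean makes the sine integral quadratic in t, so the decay comes from the cosine integral;
    the condition on t lets half of its variance term absorb all quartic terms. *)
Lemma char_sqr_decay (v m4 t : R) :
  P.-integrable setT (EFin \o Z) -> P.-integrable setT (EFin \o (fun w => Z w ^+ 2)) ->
  P.-integrable setT (EFin \o (fun w => Z w ^+ 4)) ->
  \int[P]_w Z w = 0 -> v <= \int[P]_w (Z w ^+ 2) -> \int[P]_w (Z w ^+ 4) <= m4 ->
  0 <= v -> 8 * t ^+ 2 * m4 <= v -> char_sqr Z t <= expR (- (t ^+ 2 * v / 4)).
Proof.
move=> i1 i2 i4 mean0 v_le m4_le v0 tm.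
set s2 := \int[P]_w (Z w ^+ 2) in v_le.
set s4 := \int[P]_w (Z w ^+ 4) in m4_le.
have s20 : 0 <= s2 by exact: le_trans v_le.
have iZ k c (f : T -> R) : f = (fun w => Z w ^+ k) -> P.-integrable setT (EFin \o f) ->
    P.-integrable setT (EFin \o (fun w => c * f w)).
  by move=> _ h; exact: integrableRZ.
have jensen : s2 ^+ 2 <= s4.
  have : 0 <= \int[P]_w ((Z w ^+ 2 - s2) ^+ 2) by apply: Rintegral_ge0 => w _; exact: sqr_ge0.
  have -> : \int[P]_w ((Z w ^+ 2 - s2) ^+ 2) = s4 - (2 * s2) * s2 + s2 ^+ 2.
    under eq_Rintegral => w _.
      have -> : (Z w ^+ 2 - s2) ^+ 2 = (Z w ^+ 4 - (2 * s2) * Z w ^+ 2) + s2 ^+ 2 by ring.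
      over.
    have ic : P.-integrable setT (EFin \o (fun _ : T => s2 ^+ 2)).
      by apply: (bounded_integrable P (M := `|s2 ^+ 2|)).
    have i22 : P.-integrable setT (EFin \o (fun w => (2 * s2) * Z w ^+ 2)) by exact: (iZ 2).
    rewrite RintegralD // ?Rintegral_prob_cst.
      by rewrite RintegralB // RintegralZl.
    exact: integrableRB.
  nra.
have t0 : 0 <= t ^+ 2 by exact: sqr_ge0.
have m40 : 0 <= m4 by apply: le_trans m4_le; apply: le_trans jensen; exact: sqr_ge0.
(* Jensen and the condition on t give t^2 s2 <= 1/8, which makes the cosine integral nonnegative, so
   that its square is at most itself. *)
have small : t ^+ 2 * s2 <= 1 / 8 \/ s2 = 0.
  have [->|s2n] := eqVneq s2 0; first by right.
  left; have s2p : 0 < s2 by rewrite lt0r s2n.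
  have : 8 * t ^+ 2 * s2 ^+ 2 <= s2.
    apply: (@le_trans _ _ (8 * t ^+ 2 * m4)); last exact: le_trans tm v_le.
    by apply: ler_wpM2l; [exact: mulr_ge0|exact: le_trans jensen m4_le].
  rewrite [s2 ^+ 2]expr2 mulrA -[leRHS]mul1r (ler_pM2r s2p) => h; lra.
set a := \int[P]_w cos (t * Z w); set b := \int[P]_w sin (t * Z w).
have a_ge : 1 - t ^+ 2 * s2 <= a.
  have -> : 1 - t ^+ 2 * s2 = \int[P]_w (1 - t ^+ 2 * Z w ^+ 2).
    rewrite RintegralB //; last exact: (iZ 2).
      by rewrite Rintegral_prob_cst RintegralZl.
    by apply: (bounded_integrable P (M := 1)) => // w; rewrite normr1.
  apply: le_Rintegral => //.
    by apply: integrableRB; [exact: integrableR_cst|exact: (iZ 2)].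
  move=> w _; have := onem_cos_sqr_le (t * Z w); rewrite ler_norml exprMn => /andP[_]; lra.
have a_le : a <= 1 - t ^+ 2 * s2 / 2 + t ^+ 4 * m4.
  apply: (@le_trans _ _ (1 - t ^+ 2 / 2 * s2 + t ^+ 4 * s4)); last first.
    by rewrite lerD ?ler_wpM2l ?exprn_even_ge0 // mulrAC.
  have -> : 1 - t ^+ 2 / 2 * s2 + t ^+ 4 * s4 = \int[P]_w (1 - t ^+ 2 / 2 * Z w ^+ 2 + t ^+ 4 * Z w ^+ 4).
    have ione : P.-integrable setT (EFin \o (fun _ : T => 1 : R)).
      by apply: (bounded_integrable P (M := 1)) => // w; rewrite normr1.
    have iq : P.-integrable setT (EFin \o (fun w => 1 - t ^+ 2 / 2 * Z w ^+ 2)).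
      by apply: integrableRB => //; exact: (iZ 2).
    rewrite RintegralD //; last exact: (iZ 4).
    by rewrite RintegralB // ?Rintegral_prob_cst ?RintegralZl //; exact: (iZ 2).
  apply: le_Rintegral => //.
    apply: integrableRD; last exact: (iZ 4).
    by apply: integrableRB; [exact: integrableR_cst|exact: (iZ 2)].
  move=> w _; have := cos_taylor4 (t * Z w); rewrite ler_norml !exprMn => /andP[_]; lra.
have b_le : `|b| <= t ^+ 2 * s2.
  have bE : b = - \int[P]_w (t * Z w - sin (t * Z w)).
    rewrite RintegralB //; last exact: (iZ 1).
    by rewrite RintegralZl // mean0 mulr0 sub0r opprK.
  have idiff : P.-integrable setT (EFin \o (fun w => t * Z w - sin (t * Z w))).
    by apply: integrableRB => //; exact: (iZ 1).
  rewrite bE normrN; apply: le_trans (le_normr_Rintegral _ _) _ => //.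
  rewrite -RintegralZl //; apply: le_Rintegral => //.
  - exact: integrableR_norm.
  - exact: (iZ 2).
  - by move=> w _; rewrite -exprMn; exact: subr_sin_sqr_le.
have tv : t ^+ 2 * v / 4 <= t ^+ 2 * s2 / 4 by rewrite ler_wpM2r // ler_wpM2l.
apply: (@le_trans _ _ (1 - t ^+ 2 * v / 4)); last exact: expR_ge1Dx.
rewrite /char_sqr -/a -/b.
have b2 : b ^+ 2 <= (t ^+ 2 * s2) ^+ 2.
  by rewrite -(real_normK (num_real b)) lerXn2r ?nnegrE // mulr_ge0.
have tm2 : t ^+ 2 * (8 * t ^+ 2 * m4) <= t ^+ 2 * v by rewrite ler_wpM2l.
have ts : (t ^+ 2 * s2) ^+ 2 <= t ^+ 4 * m4.
  rewrite exprMn -exprM; rewrite ler_wpM2l ?exprn_even_ge0 //; exact: le_trans jensen m4_le.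
have t4 : t ^+ 2 * (8 * t ^+ 2 * m4) = 8 * (t ^+ 4 * m4) by ring.
have ts0 : 0 <= t ^+ 2 * s2 by exact: mulr_ge0.
have a1 : a <= 1.
  rewrite -(Rintegral_prob_cst P 1); apply: le_Rintegral => //; exact: integrableR_cst.
have a0 : 0 <= a by case: small a_ge => [|->]; lra.
have aa : a ^+ 2 <= a by rewrite expr2 ler_piMr.
move: aa a_le b2 ts tm2 tv; rewrite t4; move: (t ^+ 4 * m4) (a ^+ 2) (b ^+ 2) => y p q.
move: ((t ^+ 2 * s2) ^+ 2) => z; clear; move: a (t ^+ 2 * s2) (t ^+ 2 * v) => a x u; lra.
Qed.

End CharacteristicFunction.

Section SmallBall.
Context d (T : measurableType d) (R : realType) (P : probability T R).
Context (V : zmodType) (K : eqType) (J : finType) (e : K -> R -> V).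
Hypothesis e_add : forall i s t, e i (s + t) = e i s + e i t.
Variable Z : K -> T -> R.
Hypothesis mZ : forall i, measurable_fun setT (Z i).

Lemma bounded_lip_cos (ell : V -> R) (t : K -> R) (al B : R) :
  (forall x i u, ell (x + e i u) = ell x + t i * u) -> (forall i, `|t i| <= B) ->
  bounded_lip e 1 B (fun x => cos (al + ell x)).
Proof.
move=> hell tB; split => [x|i x u]; first by rewrite ler_norml cos_geN1 cos_le1.
rewrite hell.
have dc (z : R) : is_derive z (1 : R) cos (- sin z) by exact: is_derive_cos.
apply: le_trans (derive_bound_lip dc (A := 1) _ _ _) _.
  by move=> z; rewrite normrN ler_norml sin_geN1 sin_le1.
rewrite mul1r addrA [al + _ + _]addrC addrK normrM ler_wpM2r //.
Qed.

(** Each coordinate rotates and contracts the pair (A, B) by its characteristic function. *)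
Lemma convol_cos (ell : V -> R) (t : K -> R) s :
  (forall x i u, ell (x + e i u) = ell x + t i * u) ->
  exists A B, (forall al x, convol e P Z s (fun x => cos (al + ell x)) x =
                A * cos (al + ell x) - B * sin (al + ell x)) /\
    A ^+ 2 + B ^+ 2 = \prod_(i <- s) char_sqr P (Z i) (t i).
Proof.
move=> hell; elim: s => [|i s [A [B [hAB hp]]]].
  exists 1, 0; split => [al x|]; last by rewrite big_nil expr1n expr0n addr0.
  by rewrite /= mul1r mul0r subr0.
set C := \int[P]_w cos (t i * Z i w); set S := \int[P]_w sin (t i * Z i w).
exists (A * C - B * S), (A * S + B * C); split => [al x|]; last first.
  by rewrite big_cons -hp /char_sqr -/C -/S; ring.
rewrite /= /convol1.
under eq_Rintegral => w _ do rewrite hAB hell addrA.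
by rewrite Rintegral_phase.
Qed.

Lemma convol_cos_le (ell : V -> R) (t : K -> R) s al x :
  (forall x i u, ell (x + e i u) = ell x + t i * u) ->
  convol e P Z s (fun x => cos (al + ell x)) x <=
  Num.sqrt (\prod_(i <- s) char_sqr P (Z i) (t i)).
Proof.
move=> hell; have [A [B [-> <-]]] := convol_cos s hell.
set th := al + ell x.
apply: (le_trans (ler_norm _)).
rewrite -[leLHS]sqrtr_sqr ler_sqrt ?addr_ge0 ?sqr_ge0 //.
have := cos2Dsin2 th; have := sqr_ge0 (A * sin th + B * cos th).
set c := cos th; set sn := sin th => h1 h2.
have -> : A ^+ 2 + B ^+ 2 = (A * c - B * sn) ^+ 2 + (A * sn + B * c) ^+ 2.
  have -> : (A * c - B * sn) ^+ 2 + (A * sn + B * c) ^+ 2 = (A ^+ 2 + B ^+ 2) * (c ^+ 2 + sn ^+ 2) by ring.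
  by rewrite h2 mulr1.
by rewrite lerDl.
Qed.

Variables (t : J -> K -> R) (ell : J -> V -> R) (s : seq K) (Q : pred J).
Hypothesis hell : forall j x i u, ell j (x + e i u) = ell j x + t j i * u.
Variables (tau L v m4 : R).
Hypotheses (tau0 : 0 <= tau) (L0 : 0 <= L) (v0 : 0 <= v).

Let lin (g : {ffun J -> 'I_4}) i := \sum_j two_signs R (g j) * t j i.

Hypothesis i1 : forall i, i \in s -> P.-integrable setT (EFin \o Z i).
Hypothesis i2 : forall i, i \in s -> P.-integrable setT (EFin \o (fun w => Z i w ^+ 2)).
Hypothesis i4 : forall i, i \in s -> P.-integrable setT (EFin \o (fun w => Z i w ^+ 4)).
Hypothesis mean0 : forall i, i \in s -> \int[P]_w Z i w = 0.
Hypothesis var_ge : forall i, i \in s -> v <= \int[P]_w (Z i w ^+ 2).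
Hypothesis m4_ge : forall i, i \in s -> \int[P]_w (Z i w ^+ 4) <= m4.
Hypothesis m40 : 0 <= m4.
Hypothesis tauL : 8 * (tau * L) ^+ 2 * m4 <= v.
Hypothesis tb : forall j i, `|t j i| <= tau.
Hypothesis beta_le : v * tau ^+ 2 / 8 <= 4^-1.
Hypothesis t_row : forall f : J -> R,
  \sum_(j | Q j) (f j) ^+ 2 * tau ^+ 2 <= \sum_(i <- s) (\sum_j f j * t j i) ^+ 2.
Hypothesis t_col : forall i, i \in s -> \sum_j t j i ^+ 2 <= tau ^+ 2.

Let beta := v * tau ^+ 2 / 8.

Let tail (g : {ffun J -> 'I_4}) i (sg : R) := expR (4^-1 * (sg * lin g i / tau) - 4^-1 * L).

Let pointwise g : Num.sqrt (\prod_(i <- s) char_sqr P (Z i) (lin g i)) <=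
  expR (- beta * \sum_(j | Q j) two_signs R (g j) ^+ 2) +
  \sum_(i <- s) (tail g i 1 + tail g i (-1)).
Proof.
have [all_le|] := boolP (all (fun i => `|lin g i| <= tau * L) s).
  apply: ler_wpDr; first by apply: sumr_ge0 => i _; rewrite addr_ge0 ?expR_ge0.
  apply: (@le_trans _ _ (Num.sqrt (\prod_(i <- s) expR (- (lin g i ^+ 2 * v / 4))))).
    apply: ler_wsqrtr; rewrite !big_seq; apply: ler_prod => i is_; rewrite char_sqr_ge0 /=.
    apply: char_sqr_decay (m4_ge is_) _ _ => //; try by [exact: i1|exact: i2|exact: i4|exact: mean0|exact: var_ge].
    apply: le_trans tauL; rewrite ler_wpM2r // ler_wpM2l //.
    rewrite -(real_normK (num_real (lin g i))) lerXn2r ?nnegrE ?mulr_ge0 //.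
    exact: (allP all_le).
  rewrite -expR_sum.
  have -> : \sum_(i <- s) - (lin g i ^+ 2 * v / 4) = (- (v / 8) * \sum_(i <- s) lin g i ^+ 2) * 2.
    by rewrite mulr_sumr mulr_suml; apply: eq_bigr => i _; field.
  rewrite expRM_natr sqrtr_sqr ger0_norm ?expR_ge0 // ler_expR /beta.
  rewrite !mulNr lerN2; apply: le_trans (ler_wpM2l _ (t_row _)); last by rewrite divr_ge0.
  rewrite -mulr_suml le_eqVlt; apply/orP; left; apply/eqP; ring.
move/allPn => [i is_]; rewrite -ltNge => hi.
(* For exceptional signs the characteristic functions are bounded by 1, a value that one of the two
   tails at i already reaches. *)
apply: (@le_trans _ _ 1).
  rewrite -[leRHS]sqrtr1; apply: ler_wsqrtr; apply: prodr_ile1 => k _.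
  by rewrite char_sqr_ge0 char_sqr_le1.
apply: ler_wpDl; first exact: expR_ge0.
have tau_gt0 : 0 < tau.
  rewrite lt0r tau0 andbT; apply/eqP => tau_eq0.
  have := t_col is_; rewrite tau_eq0 expr0n /= => h.
  move: hi; rewrite tau_eq0 mul0r normr_gt0 => /eqP; apply.
  rewrite /lin big1 // => j _; have : t j i ^+ 2 <= 0.
    by apply: le_trans h; rewrite (bigD1 j) //= lerDl sumr_ge0 // => *; exact: sqr_ge0.
  by rewrite le_eqVlt ltNge sqr_ge0 orbF sqrf_eq0 => /eqP ->; rewrite mulr0.
rewrite (big_rem i) //=; apply: ler_wpDr.
  by apply: sumr_ge0 => k _; rewrite addr_ge0 ?expR_ge0.
have hi' : L <= `|lin g i / tau|.
  by rewrite normrM normfV (gtr0_norm tau_gt0) ler_pdivlMr // mulrC ltW.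
have ge1 x : 0 <= x -> 1 <= expR x by move=> x0; rewrite -[1]expR0 ler_expR.
have [p|p] := leP 0 (lin g i / tau).
  apply: ler_wpDr; first exact: expR_ge0.
  apply: ge1; rewrite mul1r -mulrBr mulr_ge0 // subr_ge0.
  by rewrite ger0_norm in hi'.
apply: ler_wpDl; first exact: expR_ge0.
apply: ge1; rewrite -mulrBr mulr_ge0 // subr_ge0 mulN1r mulNr.
by rewrite ltr0_norm in hi'.
Qed.

Let avg (f : {ffun J -> 'I_4} -> R) := \sum_g (4^-1) ^+ #|J| * f g.

Let avg_prod (f : J -> R -> R) : avg (fun g => \prod_j f j (two_signs R (g j))) =
  \prod_j (4^-1 * (f j 2 + f j 0 + f j 0 + f j (-2))).
Proof.
rewrite /avg (eq_bigr (fun g : {ffun J -> 'I_4} => \prod_j (4^-1 * f j (two_signs R (g j))))); last first.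
  by move=> g _; rewrite big_split /= prodr_const.
rewrite -(bigA_distr_bigA (fun j k => 4^-1 * f j (two_signs R k))).
by apply: eq_bigr => j _; rewrite -mulr_sumr sum_two_signs.
Qed.

Let avg_tail i sg : i \in s -> sg ^+ 2 = 1 -> avg (fun g => tail g i sg) <= expR (2^-1 - 4^-1 * L).
Proof.
move=> is_ sg1.
have [tau_eq0|tau_neq0] := eqVneq tau 0.
  rewrite /avg (eq_bigr (fun _ => (4^-1) ^+ #|J| * expR (- (4^-1 * L)))); last first.
    by move=> g _; rewrite /tail tau_eq0 invr0 !mulr0 sub0r.
  rewrite sumr_const card_ffun card_ord -[_ *+ _]mulr_natl mulrA natrX -exprMn divff // expr1n mul1r.
  by rewrite ler_expR lerDr.
have -> : avg (fun g => tail g i sg) =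
   avg (fun g => \prod_j expR (two_signs R (g j) * (4^-1 * sg * t j i / tau))) * expR (- (4^-1 * L)).
  rewrite /avg mulr_suml; apply: eq_bigr => g _; rewrite -mulrA; congr (_ * _).
  rewrite /tail expRD -expR_sum; congr (expR _ * _).
  by rewrite /lin !(mulr_suml, mulr_sumr); apply: eq_bigr => j _; field.
rewrite (avg_prod (fun j y => expR (y * (4^-1 * sg * t j i / tau)))) expRD ler_wpM2r ?expR_ge0 //.
(* The weight 1/4 in [tail] keeps each exponent in the range of [expR_sumpm_le]; by the column bound
   the product is at most exp(1/2). *)
apply: (@le_trans _ _ (\prod_j expR (t j i ^+ 2 / (2 * tau ^+ 2)))).
  apply: ler_prod => j _; rewrite mulr_ge0 ?invr_ge0 ?addr_ge0 ?expR_ge0 //=.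
  rewrite mul0r expR0; set x := 4^-1 * sg * t j i / tau.
  have x2 : 8 * x ^+ 2 = t j i ^+ 2 / (2 * tau ^+ 2).
    rewrite /x; have -> : 8 * (4^-1 * sg * t j i / tau) ^+ 2 = 8 / 16 * sg ^+ 2 * t j i ^+ 2 / tau ^+ 2 by field.
    by rewrite sg1; field.
  rewrite -x2.
  have xle : `|2 * x| <= 2^-1.
    rewrite -(@ler_pXn2r _ 2) ?nnegrE // real_normK ?num_real //.
    have tt : t j i ^+ 2 <= tau ^+ 2.
      by rewrite -(real_normK (num_real (t j i))) lerXn2r ?nnegrE.
    have : 8 * x ^+ 2 <= 2^-1.
      have tau2 : 0 < tau ^+ 2 by rewrite exprn_even_gt0.
      have tau3 : 0 < 2 * tau ^+ 2 by exact: mulr_gt0.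
      rewrite x2 (ler_pdivrMr _ _ tau3); lra.
    rewrite !exprMn; move: (x ^+ 2) => y hy; lra.
  have := expR_sumpm_le xle; rewrite exprMn -mulNr.
  have : 1 <= expR (2 * (2 ^+ 2 * x ^+ 2)) by rewrite -[leLHS]expR0 ler_expR pmulr_rge0 // pmulr_rge0 ?sqr_ge0 // exprn_gt0.
  have -> : 2 * (2 ^+ 2 * x ^+ 2) = 8 * x ^+ 2 by ring.
  lra.
rewrite -expR_sum ler_expR -mulr_suml ler_pdivrMr; last by rewrite mulr_gt0 // exprn_even_gt0.
rewrite mulrA mulVf // mul1r; exact: t_col.
Qed.

(** For each index the sum of two signs vanishes with probability 1/2 and has square 4 otherwise, so
    the average is (1 + exp(-4 beta))/2. *)
Let avg_main : avg (fun g => expR (- beta * \sum_(j | Q j) two_signs R (g j) ^+ 2)) <=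
  expR (- (beta * #|[pred j | Q j]|%:R)).
Proof.
have beta0 : 0 <= beta by rewrite /beta divr_ge0 // mulr_ge0 ?sqr_ge0.
have -> : avg (fun g => expR (- beta * \sum_(j | Q j) two_signs R (g j) ^+ 2)) =
   avg (fun g => \prod_j (if Q j then expR (- beta * two_signs R (g j) ^+ 2) else 1)).
  rewrite /avg; apply: eq_bigr => g _; congr (_ * _).
  by rewrite mulr_sumr expR_sum big_mkcond.
rewrite (avg_prod (fun j y => if Q j then expR (- beta * y ^+ 2) else 1)).
apply: (@le_trans _ _ (\prod_j (if Q j then expR (- beta) else 1))); last first.
  by rewrite -big_mkcond /= prodr_const -expRM_natl mulrC mulNr.
apply: ler_prod => j _; case: (Q j).
  rewrite mulr_ge0 ?invr_ge0 ?addr_ge0 ?expR_ge0 //= sqrrN expr0n mulr0 expR0.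
  have -> : - beta * 2 ^+ 2 = - (4 * beta) by ring.
  have := @half_expR_le R beta; rewrite beta0 beta_le => /(_ isT); lra.
by rewrite mulr_ge0 ?invr_ge0 ?addr_ge0 //=; lra.
Qed.

(** The signs are averaged last: for typical signs all coefficients [lin g i] stay where the
    characteristic functions decay, and [t_row] bounds their square sum from below by one
    contribution per form in [Q]. The 1/8 in [beta] is the 1/4 of [char_sqr_decay] halved by the
    square root. *)
Lemma convol_prod_cos2_le x :
  convol e P Z s (fun y => \prod_j cos (ell j y) ^+ 2) x <=
  expR (- (beta * #|[pred j | Q j]|%:R)) + (size s)%:R * (2 * expR (2^-1 - 4^-1 * L)).
Proof.
have hlin (g : {ffun J -> 'I_4}) y i u : \sum_j two_signs R (g j) * ell j (y + e i u) =
   \sum_j two_signs R (g j) * ell j y + lin g i * u.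
  by rewrite /lin mulr_suml -big_split /=; apply: eq_bigr => j _; rewrite hell; ring.
have blg (g : {ffun J -> 'I_4}) : bounded_lip e ((4^-1) ^+ #|J| * 1) ((4^-1) ^+ #|J| * (2 * tau *+ #|J|))
   (fun y => (4^-1) ^+ #|J| * cos (0 + \sum_j two_signs R (g j) * ell j y)).
  have := @bounded_lip_cos (fun y => \sum_j two_signs R (g j) * ell j y) (lin g) 0 (2 * tau *+ #|J|) (hlin g).
  have hb i : `|lin g i| <= 2 * tau *+ #|J|.
    apply: le_trans (ler_norm_sum _ _ _) _; rewrite -sumr_const; apply: ler_sum => j _.
    rewrite normrM ler_pM // /two_signs; case: (g j) => -[|[|[|[|//]]]] /= _; rewrite ?normrN ?normr0 ?gtr0_norm //.
  move=> /(_ hb) /(bounded_lipZ ((4^-1) ^+ #|J|)).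
  by rewrite ger0_norm ?exprn_ge0.
rewrite (eq_convol e P Z s (Psi := fun y => \sum_(g : {ffun J -> 'I_4}) (4^-1) ^+ #|J| * cos (0 + \sum_j two_signs R (g j) * ell j y))); last first.
  by move=> y; rewrite prod_cos2E; apply: eq_bigr => g _; rewrite add0r.
rewrite (convol_sum e_add P mZ _ _ _ _ blg).
apply: (@le_trans _ _ (avg (fun g => expR (- beta * \sum_(j | Q j) two_signs R (g j) ^+ 2) +
  \sum_(i <- s) (tail g i 1 + tail g i (-1))))).
  apply: ler_sum => g _.
  have [hb1 hb2] : bounded_lip e 1 (2 * tau *+ #|J|) (fun y => cos (0 + \sum_j two_signs R (g j) * ell j y)).
    apply: (@bounded_lip_cos (fun y => \sum_j two_signs R (g j) * ell j y) (lin g) 0 _ (hlin g)).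
    move=> i; apply: le_trans (ler_norm_sum _ _ _) _; rewrite -sumr_const; apply: ler_sum => j _.
    rewrite normrM ler_pM // /two_signs; case: (g j) => -[|[|[|[|//]]]] /= _; rewrite ?normrN ?normr0 ?gtr0_norm //.
  rewrite (convolZ e_add P mZ _ _ _ (conj hb1 hb2)) ler_wpM2l ?exprn_ge0 //.
  exact: le_trans (@convol_cos_le _ (lin g) s 0 x (hlin g)) (pointwise g).
have avgD f1 f2 : avg (fun g => f1 g + f2 g) = avg f1 + avg f2.
  by rewrite /avg -big_split; apply: eq_bigr => g _; rewrite mulrDr.
have avg_sum (F : K -> {ffun J -> 'I_4} -> R) : avg (fun g => \sum_(i <- s) F i g) = \sum_(i <- s) avg (F i).
  by rewrite /avg exchange_big; apply: eq_bigr => g _; rewrite mulr_sumr.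
rewrite avgD lerD //.
rewrite (avg_sum (fun i g => tail g i 1 + tail g i (-1))).
apply: (@le_trans _ _ (\sum_(i <- s) 2 * expR (2^-1 - 4^-1 * L))).
  rewrite !big_seq; apply: ler_sum => i is_; rewrite avgD mulr_natl mulr2n.
  by rewrite lerD // avg_tail // ?expr1n // sqrrN expr1n.
by rewrite big_const_seq count_predT iter_addr_0 [leRHS]mulr_natl.
Qed.

End SmallBall.

(** * Real coordinates of Hermitian matrices *)

Section Coordinates.
Context (R : realType) (N : nat).
Local Notation C := R[i].
Implicit Types (X : 'M[C]_N) (a b : 'I_N).

Lemma hermP X : reflect (X ^t* = X) (X \is hermsymmx).
Proof.
rewrite is_hermitianmxE expr0 scale1r; apply: (iffP eqP) => h.
  by rewrite -h.
by rewrite h.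
Qed.

Lemma adjmxD X Y : (X + Y) ^t* = X ^t* + Y ^t*.
Proof. by rewrite linearD /= map_mxD. Qed.

Lemma adjmxZ c X : (c *: X) ^t* = c^* *: X ^t*.
Proof. by apply/matrixP => i j; rewrite !mxE rmorphM. Qed.

Lemma conjC_real (r : R) : Num.conj (r%:C : C) = r%:C.
Proof. exact: conjc_real. Qed.

Lemma adj_delta a b : (delta_mx a b : 'M[C]_N) ^t* = delta_mx b a.
Proof. by apply/matrixP => i j; rewrite !mxE andbC; case: (_ && _); rewrite ?rmorph1 ?rmorph0. Qed.

Definition coord_idx : finType := ('I_N * 'I_N * bool)%type.

(* The indices (a, b, c) with b < a are dummies: both the basis element and the coordinate vanish. *)
Definition hbasis (k : coord_idx) : 'M[C]_N :=
  let: (a, b, c) := k in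
  if a == b then (if c then delta_mx a a else 0)
  else if (a < b)%N then
    (if c then delta_mx a b + delta_mx b a else 'i *: (delta_mx a b - delta_mx b a))
  else 0.

Definition hstep (k : coord_idx) (t : R) : 'M[C]_N := t%:C *: hbasis k.

Definition hcoord (k : coord_idx) X : R :=
  let: (a, b, c) := k in if (a <= b)%N then part c (X a b) else 0.

Lemma hstepD k s t : hstep k (s + t) = hstep k s + hstep k t.
Proof. by rewrite /hstep rmorphD scalerDl. Qed.

Lemma hstepM k s t : hstep k (s * t) = s%:C *: hstep k t.
Proof. by rewrite /hstep rmorphM scalerA. Qed.

Lemma hbasis_adj k : (hbasis k) ^t* = hbasis k.
Proof.
case: k => [[a b] c] /=; have z : (0 : 'M[C]_N) ^t* = 0 by rewrite trmx0 map_mx0.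
case: eqP => _; case: c => //; first exact: adj_delta.
  by case: ifP => // _; rewrite adjmxD !adj_delta addrC.
case: ifP => // _; rewrite adjmxZ -scaleN1r adjmxD adjmxZ !adj_delta.
rewrite rmorphN1 !scaleN1r -[RHS]opprK -scalerN opprB -scaleNr; congr (_ *: _).
by apply/eqP; rewrite eq_complex /= oppr0 !eqxx.
Qed.

Lemma hstep_herm k t : hstep k t \is hermsymmx.
Proof. by apply/hermP; rewrite /hstep adjmxZ hbasis_adj conjC_real. Qed.

Lemma hermD X Y : X \is hermsymmx -> Y \is hermsymmx -> X + Y \is hermsymmx.
Proof. by move=> /hermP hX /hermP hY; apply/hermP; rewrite adjmxD hX hY. Qed.

Lemma hermZ (r : R) X : X \is hermsymmx -> r%:C *: X \is hermsymmx.
Proof. by move=> /hermP hX; apply/hermP; rewrite adjmxZ hX conjC_real. Qed.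

(** Observables must be defined on all matrices, the group in which displacements live. Composing
    with this projection makes the spectral theorem available and leaves the displacements
    unchanged. *)
Definition hermpart X : 'M[C]_N := (2^-1)%:C *: (X + X ^t*).

Lemma hermpart_herm X : hermpart X \is hermsymmx.
Proof. by apply: hermZ; apply/hermP; rewrite adjmxD trmxCK addrC. Qed.

Lemma hermpart_id X : X \is hermsymmx -> hermpart X = X.
Proof.
move=> /hermP hX; rewrite /hermpart hX -mulr2n -[X *+ 2](scaler_nat 2) scalerA.
by rewrite -(rmorph_nat (real_complex R)) -rmorphM /= mulVf ?pnatr_eq0 // scale1r.
Qed.

Lemma hermpartD X Y : hermpart (X + Y) = hermpart X + hermpart Y.
Proof. by rewrite /hermpart adjmxD addrACA scalerDr. Qed.

Lemma hermpart_step X k t : hermpart (X + hstep k t) = hermpart X + hstep k t.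
Proof. by rewrite hermpartD (hermpart_id (hstep_herm k t)). Qed.

Lemma hs_delta a b : hs (delta_mx a b : 'M[C]_N) = 1.
Proof.
rewrite /hs (bigD1 a) //= (bigD1 b) //= !mxE !eqxx sqn1 big1 ?addr0 => [|j /negbTE jb]; last first.
  by rewrite !mxE jb andbF sqn0.
by rewrite big1 ?addr0 // => i /negbTE ia; apply: big1 => j _; rewrite !mxE ia sqn0.
Qed.

Lemma hsZ c X : hs (c *: X) = sqn c * hs X.
Proof.
rewrite /hs mulr_sumr; apply: eq_bigr => i _; rewrite mulr_sumr; apply: eq_bigr => j _.
by rewrite !mxE sqnM.
Qed.

Lemma hsD_le X Y : hs (X + Y) <= 2 * (hs X + hs Y).
Proof.
rewrite /hs -big_split mulr_sumr; apply: ler_sum => i _ /=; rewrite -big_split mulr_sumr.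
by apply: ler_sum => j _ /=; rewrite !mxE; exact: sqnD_le.
Qed.

Lemma sqn_i : sqn ('i : C) = 1. Proof. by rewrite /sqn /= expr0n expr1n add0r. Qed.

Lemma hs_basis k : hs (hbasis k) <= 4.
Proof.
case: k => [[a b] c] /=.
have h0 : hs (0 : 'M[C]_N) <= 4.
  by rewrite /hs big1 // => i _; apply: big1 => j _; rewrite mxE sqn0.
case: eqP => _; case: c => //; first by rewrite hs_delta; lra.
  case: ifP => // _; apply: le_trans (hsD_le _ _) _; rewrite !hs_delta; lra.
case: ifP => // _; rewrite hsZ sqn_i mul1r; apply: le_trans (hsD_le _ _) _.
rewrite -scaleN1r hsZ !hs_delta sqnN sqn1; lra.
Qed.

Lemma hs_step k t : hs (hstep k t) <= 4 * t ^+ 2.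
Proof. by rewrite hsZ sqn_real mulrC ler_wpM2r ?sqr_ge0 // hs_basis. Qed.

Lemma sum_hstep X : X \is hermsymmx -> \sum_k hstep k (hcoord k X) = X.
Proof.
move=> /hermP hX.
have cj a b : X b a = (X a b)^* by rewrite -{1}hX !mxE.
have E a b : \sum_c hstep (a, b, c) (hcoord (a, b, c) X) =
   (if (a <= b)%N then X a b *: delta_mx a b else 0) + (if (a < b)%N then X b a *: delta_mx b a else 0).
  rewrite big_bool /hstep /=; case: (ltngtP a b) => [ab|ba|/val_inj <-].
  - rewrite (_ : (a == b) = false); last by apply/eqP => E; rewrite E ltnn in ab.
    rewrite (cj a b); case: (X a b) => x y.
    rewrite scalerA scalerBr scalerDr addrACA -scalerDl -scaleNr -scalerDl.
    by congr (_ *: _ + _ *: _); apply/eqP; rewrite eq_complex /=; apply/andP; split; apply/eqP; ring.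
  - rewrite (_ : (a == b) = false) ?scaler0 ?addr0 //; last by apply/eqP => E; rewrite E ltnn in ba.
  - rewrite eqxx scaler0 !addr0; congr (_ *: _).
    by move: (cj a a); case: (X a a) => x y [] h; apply/eqP; rewrite eq_complex /= eqxx /=; apply/eqP; lra.
transitivity (\sum_a \sum_b \sum_c hstep (a, b, c) (hcoord (a, b, c) X)).
  rewrite pair_bigA pair_bigA /=; apply: eq_bigr; by case => [[a b] c].
under eq_bigr do under eq_bigr do rewrite E.
under eq_bigr do rewrite big_split.
rewrite big_split /= [X in _ + X]exchange_big -big_split /= [RHS]matrix_sum_delta.
apply: eq_bigr => a _; rewrite -big_split; apply: eq_bigr => b _ /=.
by case: (ltngtP a b); rewrite ?addr0 ?add0r.
Qed.

(** Small balls use only the real parts in row a: in both symmetry types they carry at least half of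
    the variance, and for fixed a they are distinct coordinates. *)
Definition row_idx a b : coord_idx := if (a <= b)%N then (a, b, true) else (b, a, true).

Lemma row_idx_inj a : injective (row_idx a).
Proof.
move=> b b'; rewrite /row_idx; case: leqP => h; case: leqP => h' [] //.
- by move=> e1 e2; rewrite e2 e1.
- by move=> e1 e2; rewrite e1 e2.
Qed.

Lemma hstep_row a b t i j :
  hstep (row_idx a b) t i j = if ((i == a) && (j == b)) || ((i == b) && (j == a)) then t%:C else 0.
Proof.
rewrite /hstep /row_idx; case: (ltngtP a b) => [ab|ba|/val_inj <-].
- have n : (a == b) = false by apply/eqP => E; rewrite E ltnn in ab.
  rewrite /= n ab !mxE; case: (eqVneq i a) => [->|ia]; case: (eqVneq j b) => [->|jb] /=;
  rewrite ?eqxx ?n ?(eq_sym b a) ?n /= ?andbF ?andbT ?addr0 ?add0r ?mulr1 ?mulr0 //.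
  by case: (_ && _); rewrite ?mulr1 ?mulr0.
- have n : (b == a) = false by apply/eqP => E; rewrite E ltnn in ba.
  rewrite /= n ba !mxE; case: (eqVneq i a) => [->|ia]; case: (eqVneq j b) => [->|jb] /=;
  rewrite ?eqxx ?n ?(eq_sym a b) ?n /= ?andbF ?andbT ?addr0 ?add0r ?mulr1 ?mulr0 //.
  by case: (_ && _); rewrite ?mulr1 ?mulr0.
- by rewrite /= eqxx !mxE; case: (_ && _); rewrite /= ?mulr1 ?mulr0.
Qed.

Lemma enum_row_split a : exists s, perm_eq (enum coord_idx) (s ++ map (row_idx a) (enum 'I_N)).
Proof.
pose p : pred coord_idx := fun k => k \in map (row_idx a) (enum 'I_N).
exists (seq.filter (predC p) (enum coord_idx)).
rewrite perm_sym perm_catC; apply: (@perm_trans _ (seq.filter p (enum coord_idx) ++ seq.filter (predC p) (enum coord_idx))).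
  rewrite perm_cat2r; apply: uniq_perm.
  - by rewrite map_inj_uniq ?enum_uniq //; exact: row_idx_inj.
  - by rewrite filter_uniq ?enum_uniq.
  - by move=> k; rewrite mem_filter mem_enum andbT.
by apply/permPl; exact: perm_filterC.
Qed.

End Coordinates.

(** * Local eigenvalue counts *)

Section EigenvalueCount.
Context (R : realType) (N : nat).
Local Notation C := R[i].
Local Notation U H := (spectralmx H).
Implicit Types (H : 'M[C]_N) (a : 'I_N) (y : 'cV[C]_N).

(** The diagonal entry of f(H) at a, that is, the spectral weight of the coordinate a. *)
Definition diagf (f : R -> R) H a : R := \sum_i f (lam H i) * sqn (U H i a).

Lemma sum_diagf f H : \sum_a diagf f H a = trf f H.
Proof.
rewrite exchange_big; apply: eq_bigr => i _ /=; rewrite -mulr_sumr.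
by rewrite sum_sqn_row ?mulr1 ?spectral_unitarymx.
Qed.

Lemma fmxE f H a : fmx f H a a = (diagf f H a)%:C.
Proof.
rewrite /fmx /diagf mul_mx_diag mxE sum_rmorphC; apply: eq_bigr => i _.
by rewrite rmorphM /= sqnE' !mxE; ring.
Qed.

(** Between the two eigenbases, f(H') - f(H) has the entries f(lam'_k) - f(lam_i) times the overlap,
    so a scalar Lipschitz bound passes entrywise to the Hilbert-Schmidt norm. *)
Lemma hs_fmx_lip f H H' L : (forall x z, `|f x - f z| <= L * `|x - z|) -> 0 <= L ->
  H \is hermsymmx -> H' \is hermsymmx -> hs (fmx f H' - fmx f H) <= L ^+ 2 * hs (H' - H).
Proof.
move=> lf L0 hH hH'; rewrite (hs_overlap hH hH').
rewrite -(@hs_unitaryl _ _ _ (U H')) ?spectral_unitarymx //.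
rewrite -(@hs_unitaryr _ _ _ (U H)) ?spectral_unitarymx // /hs mulr_sumr.
have E : U H' *m (fmx f H' - fmx f H) *m (U H) ^t* =
   diag_mx (\row_i (f (lam H' i))%:C) *m overlap H H' - overlap H H' *m diag_mx (\row_i (f (lam H i))%:C).
  have -> : diag_mx (\row_i (f (lam H' i))%:C) *m overlap H H' = U H' *m fmx f H' *m (U H) ^t*.
    by rewrite /overlap /fmx !mulmxA (unitarymxP (spectral_unitarymx H')) mul1mx.
  have -> : overlap H H' *m diag_mx (\row_i (f (lam H i))%:C) = U H' *m fmx f H *m (U H) ^t*.
    by rewrite /fmx -!mulmxA (unitarymxP (spectral_unitarymx H)) mulmx1 /overlap !mulmxA.
  by rewrite mulmxBr mulmxBl.
rewrite E; apply: ler_sum => k _; rewrite mulr_sumr; apply: ler_sum => i _.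
rewrite mul_diag_mx mul_mx_diag !mxE mulrC -mulrBr sqnM mulrCA ler_wpM2l ?sqn_ge0 //.
rewrite -rmorphB sqn_real -exprMn -(real_normK (num_real (_ - _))) -[leRHS]real_normK ?num_real //.
rewrite lerXn2r ?nnegrE ?normr_ge0 // normrM (ger0_norm L0); exact: lf.
Qed.

Lemma diagf_lip f H H' L a : (forall x z, `|f x - f z| <= L * `|x - z|) -> 0 <= L ->
  H \is hermsymmx -> H' \is hermsymmx ->
  (diagf f H' a - diagf f H a) ^+ 2 <= L ^+ 2 * hs (H' - H).
Proof.
move=> lf L0 hH hH'; apply: le_trans (hs_fmx_lip lf L0 hH hH').
rewrite /hs (bigD1 a) //= (bigD1 a) //= -addrA -sqn_real rmorphB /= -!fmxE.
have -> : (fmx f H' - fmx f H) a a = fmx f H' a a - fmx f H a a by rewrite mxE [in X in _ + X]mxE.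
rewrite lerDl addr_ge0 // sumr_ge0 // => i _; first exact: sqn_ge0.
by apply: sumr_ge0 => j _; exact: sqn_ge0.
Qed.

Lemma spectral_shiftE H E y i j : H \is hermsymmx ->
  (U H *m ((H - E%:C%:M) *m y)) i j = (lam H i - E)%:C * (U H *m y) i j.
Proof.
move=> hH; rewrite mulmxBl mulmxBr mulmxA spectralE // -mulmxA mul_scalar_mx -scalemxAr.
by rewrite mul_diag_mx !mxE rmorphB mulrBl.
Qed.

Lemma hs_spectral H y : hs (U H *m y) = hs y.
Proof. by rewrite hs_unitaryl ?spectral_unitarymx. Qed.

Lemma hs_col y : hs y = \sum_i sqn (y i 0).
Proof. by apply: eq_bigr => i _; rewrite big_ord1. Qed.

Definition window H (E r : R) : {pred 'I_N} := [pred i | `|lam H i - E| <= r].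

Lemma residual_le H E r y : H \is hermsymmx ->
  (forall i, i \notin window H E r -> (U H *m y) i 0 = 0) ->
  hs ((H - E%:C%:M) *m y) <= r ^+ 2 * hs y.
Proof.
move=> hH out; rewrite -(hs_spectral H) -[hs y](hs_spectral H) !hs_col mulr_sumr.
apply: ler_sum => i _; rewrite spectral_shiftE // sqnM sqn_real.
have [iw|/out ->] := boolP (i \in window H E r); last by rewrite sqn0 !mulr0.
rewrite ler_wpM2r ?sqn_ge0 // -(real_normK (num_real (_ - _))).
move: iw; rewrite inE => h; rewrite lerXn2r ?nnegrE ?normr_ge0 //.
exact: le_trans (normr_ge0 _) h.
Qed.

(** The minor keeps its size: row and column a are decoupled, with [be] as their only eigenvalue,
    which is later put outside the window. *)
Definition minor H a (be : R) : 'M[C]_N :=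
  \matrix_(i, j) if (i == a) || (j == a) then (if (i == a) && (j == a) then be%:C else 0) else H i j.

Lemma minor_herm H a be : H \is hermsymmx -> minor H a be \is hermsymmx.
Proof.
move=> /hermP hH; apply/hermP/matrixP => i j; rewrite !mxE orbC andbC.
case: ifP => _; last by rewrite -[in RHS]hH !mxE.
by case: ifP; rewrite ?rmorph0 // conjC_real.
Qed.

Lemma minor_spectral0 H a be l : H \is hermsymmx -> lam (minor H a be) l != be ->
  U (minor H a be) l a = 0.
Proof.
move=> hH hl; have /matrixP/(_ l a) := spectralE (minor_herm a be hH).
rewrite mul_diag_mx !mxE (bigD1 a) //= big1 ?addr0 => [|j ja]; last first.
  by rewrite !mxE (negbTE ja) eqxx /= mulr0.
rewrite !mxE eqxx /= mulrC => /eqP; rewrite -subr_eq0 -mulrBl -rmorphB mulf_eq0 => /orP[]; last by move/eqP.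
by rewrite eq_complex /= eqxx andbT subr_eq0 eq_sym (negbTE hl).
Qed.

Section Interlacing.
Variables (H : 'M[C]_N) (a : 'I_N) (be E r : R).
Hypothesis hH : H \is hermsymmx.
Hypothesis r_ge0 : 0 <= r.
Hypothesis be_out : r < `|be - E|.
Let Ha := minor H a be.
Let V := U Ha.
Let hHa : Ha \is hermsymmx. Proof. exact: minor_herm. Qed.
Let S := window H E r.
Let Q := window Ha E r.

Lemma window_minor0 l : l \in Q -> V l a = 0.
Proof.
rewrite inE => hl; apply: minor_spectral0 => //; apply: contraTneq hl => ->.
by rewrite -ltNge.
Qed.

(** Since y vanishes at a, passing to the minor only drops the a-th entry of (H - E) y. The residual
    thus stays at most r |y|, whereas orthogonality to the window of the minor pushes it above
    unless y = 0. *)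
Lemma no_vector y : (forall i, i \notin S -> (U H *m y) i 0 = 0) ->
  (forall l, l \in Q -> (V *m y) l 0 = 0) -> y a 0 = 0 -> y = 0.
Proof.
move=> hS hQ ya.
have e1 : hs ((Ha - E%:C%:M) *m y) <= hs ((H - E%:C%:M) *m y).
  rewrite !hs_col; apply: ler_sum => b _; have [->|ba] := eqVneq b a.
    apply: (@le_trans _ _ 0); last exact: sqn_ge0.
    rewrite mxE big1 ?sqn0 // => j _; rewrite !mxE eqxx /=.
    have [->|ja] := eqVneq j a; first by rewrite ya mulr0.
    by rewrite mulr0n subr0 mul0r.
  rewrite !mxE le_eqVlt; apply/orP; left; apply/eqP; congr sqn; apply: eq_bigr => j _.
  have [->|ja] := eqVneq j a; first by rewrite ya !mulr0.
  by rewrite !mxE (negbTE ba) (negbTE ja).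
have e2 := le_trans e1 (residual_le hH hS).
have {e2} : \sum_l ((lam Ha l - E) ^+ 2 - r ^+ 2) * sqn ((V *m y) l 0) <= 0.
  have -> : \sum_l ((lam Ha l - E) ^+ 2 - r ^+ 2) * sqn ((V *m y) l 0) =
     hs ((Ha - E%:C%:M) *m y) - r ^+ 2 * hs y.
    rewrite -(hs_spectral Ha) -[hs y](hs_spectral Ha) !hs_col mulr_sumr -sumrB.
    by apply: eq_bigr => l _; rewrite spectral_shiftE // sqnM sqn_real mulrBl.
  by rewrite subr_le0.
have t0 l : 0 <= ((lam Ha l - E) ^+ 2 - r ^+ 2) * sqn ((V *m y) l 0) ?= iff ((V *m y) l 0 == 0).
  apply/leifP; have [lQ|lQ] := boolP (l \in Q); first by rewrite hQ // eqxx sqn0 mulr0.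
  have h : 0 < (lam Ha l - E) ^+ 2 - r ^+ 2.
    rewrite subr_gt0 -[ltRHS](real_normK (num_real _)) ltrXn2r ?nnegrE //.
    by move: lQ; rewrite inE -ltNge.
  by case: eqP => [->|/eqP nz]; [rewrite sqn0 mulr0|rewrite mulr_gt0 // lt0r sqn_ge0 sqn_eq0 nz].
move=> sum_le0.
have {}sum_le0 : \sum_l ((lam Ha l - E) ^+ 2 - r ^+ 2) * sqn ((V *m y) l 0) = 0.
  by apply/le_anti; rewrite sum_le0 sumr_ge0 // => l _; case: (t0 l).
have Vy0 : V *m y = 0.
  apply/matrixP => l j; rewrite ord1 [RHS]mxE; apply/eqP.
  have [_ <-] := t0 l; rewrite eq_sym; apply/eqP.
  by apply: (psumr_eq0P _ sum_le0) => // i _; case: (t0 i).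
by rewrite -[y](mulKmx (spectral_unit Ha)) -/V Vy0 mulmx0.
Qed.

Let pdiag (p : {pred 'I_N}) : 'M[C]_N := diag_mx (\row_i (i \in p)%:R).

Let rank_pdiag (p : {pred 'I_N}) : (\rank (pdiag p) <= #|p|)%N.
Proof.
have -> : pdiag p = \sum_(i in p) delta_mx i i.
  apply/matrixP => i j; rewrite /pdiag mxE summxE.
  rewrite (eq_bigr (fun k => if k == i then ((i == j)%:R : C) else 0)); last first.
    move=> k _; rewrite mxE eq_sym; case: eqP => [->|//]; by rewrite eq_sym.
  rewrite -big_mkcondr /= mxE; case: (boolP (i \in p)) => ip.
    by rewrite (big_pred1 i) // => k /=; case: eqP => [->|]; rewrite ?ip ?andbF.
  rewrite big1 ?mul0rn // => k /andP[kp /eqP ki]; by rewrite -ki kp in ip.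
rewrite -sum1_card; elim/big_ind2: _ => [|m A n B hA hB|i _]; first by rewrite mxrank0.
  exact: leq_trans (mxrank_add _ _) (leq_add hA hB).
by rewrite mxrank_delta.
Qed.

(** Half of Cauchy interlacing by a dimension count: otherwise the window space of H would contain a
    nonzero vector meeting the 1 + #|Q| linear conditions of [no_vector]. *)
Lemma card_window_minor : (#|S| <= #|Q| + 1)%N.
Proof.
rewrite leqNgt; apply/negP => lt.
(* The row space of [G] consists of the transposed vectors of the window space of H, and the columns
   of [B] are the linear conditions. *)
pose G := pdiag S *m invmx (U H)^T.
have uUT : (U H)^T \in unitmx by rewrite unitmx_tr spectral_unit.
pose B : 'M[C]_(N, 1 + N) := row_mx (delta_mx a 0) (V^T *m pdiag Q).
have rB : (\rank B <= 1 + #|Q|)%N.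
  have -> : B = delta_mx a 0 *m row_mx 1%:M 0 + (V^T *m pdiag Q) *m row_mx 0 1%:M.
    by rewrite !mul_mx_row !mulmx1 !mulmx0 add_row_mx addr0 add0r.
  apply: leq_trans (mxrank_add _ _) _; apply: leq_add.
    by apply: leq_trans (mxrankM_maxl _ _) _; rewrite mxrank_delta.
  apply: leq_trans (mxrankM_maxl _ _) _; apply: leq_trans (mxrankM_maxr _ _) _.
  exact: rank_pdiag.
have rG : (#|S| <= \rank G)%N.
  rewrite /G mxrankMfree; last by rewrite row_free_unit unitmx_inv.
  have : (\rank (1%:M : 'M[C]_N) <= \rank (pdiag S) + \rank (pdiag [predC S]))%N.
    have -> : 1%:M = pdiag S + pdiag [predC S].
      by apply/matrixP => i j; rewrite !mxE !inE; case: (_ <= r); rewrite /= ?mul0rn ?addr0 ?add0r.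
    exact: mxrank_add.
  rewrite mxrank1 => h; have := leq_trans h (leq_add (leqnn _) (rank_pdiag [predC S])).
  by rewrite -[X in (X <= _)%N -> _](card_ord N) -(cardC S) leq_add2r.
have : (0 < \rank (G :&: kermx B))%N.
  rewrite -(ltn_add2l (\rank (G *m B))) addn0 mxrank_mul_ker.
  apply: leq_trans _ rG; apply: leq_ltn_trans (mxrankM_maxr _ _) _.
  by apply: leq_ltn_trans rB _; rewrite addnC.
rewrite lt0n mxrank_eq0 => /rowV0Pn[g]; rewrite sub_capmx => /andP[/submxP[D gE] /sub_kermxP gB] g0.
have : g^T = 0.
  apply: no_vector.
  - move=> i iS; have -> : U H *m g^T = (D *m pdiag S)^T.
      by rewrite -[LHS]trmxK trmx_mul trmxK gE /G mulmxA mulmxKV.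
    by rewrite mul_mx_diag !mxE (negbTE iS) mulr0.
  - move=> l lQ; move: gB; rewrite mul_mx_row => /(congr1 rsubmx).
    rewrite row_mxKr linear0 mulmxA => /matrixP/(_ 0 l).
    rewrite mul_mx_diag !mxE lQ mulr1 => h; rewrite -[RHS]h; apply: eq_bigr => j _.
    by rewrite !mxE mulrC.
  - move: gB; rewrite mul_mx_row => /(congr1 lsubmx).
    rewrite row_mxKl linear0 => /matrixP/(_ 0 0).
    rewrite !mxE (bigD1 a) //= big1 => [|j ja]; last by rewrite mxE (negbTE ja) mulr0.
    by rewrite mxE !eqxx mulr1 addr0.
by move=> /(congr1 trmx); rewrite trmxK trmx0 => g00; rewrite g00 eqxx in g0.
Qed.

(** Test with y, the projection of e_a to the window of H: its a-th entry and its squared norm both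
    equal m. Window eigenvectors of the minor vanish at a, so against (H - Ha) y they return m times
    their product with the column; and both (H - E) y and (Ha - E) y are small in these
    directions. *)
Lemma sum_window_col m : m = \sum_(i in S) sqn (U H i a) -> 0 < m ->
  (\sum_(l in Q) sqn ((V *m col a H) l 0)) * m <= 4 * r ^+ 2.
Proof.
move=> mE m0.
pose y := (U H)^t* *m (pdiag S *m col a (U H)).
have Uy : U H *m y = pdiag S *m col a (U H).
  by rewrite /y mulmxA (unitarymxP (spectral_unitarymx H)) mul1mx.
have hy : hs y = m.
  rewrite -(hs_spectral H) Uy hs_col mE [RHS]big_mkcond /=; apply: eq_bigr => i _.
  by rewrite mul_diag_mx !mxE; case: (i \in S); rewrite ?mul1r // mul0r sqn0.
have ya : y a 0 = m%:C.
  rewrite mE sum_rmorphC [RHS]big_mkcond mxE; apply: eq_bigr => i _ /=.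
  by rewrite mul_diag_mx !mxE; case: (i \in S); rewrite ?mul1r ?mul0r ?mulr0 // sqnE'.
have r1 : hs ((H - E%:C%:M) *m y) <= r ^+ 2 * m.
  rewrite -hy; apply: residual_le => // i iS.
  by rewrite Uy mul_diag_mx !mxE (negbTE iS) mul0r.
clearbody y.
have key l : l \in Q -> (V *m col a H) l 0 * m%:C =
    (V *m ((H - E%:C%:M) *m y)) l 0 - (V *m ((Ha - E%:C%:M) *m y)) l 0.
  move=> lQ; have Vla := window_minor0 lQ.
  have -> : (V *m ((H - E%:C%:M) *m y)) l 0 - (V *m ((Ha - E%:C%:M) *m y)) l 0 =
     (V *m ((H - Ha) *m y)) l 0.
    have -> : (H - Ha) *m y = (H - E%:C%:M) *m y - (Ha - E%:C%:M) *m y.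
      by rewrite -mulmxBl opprB addrA subrK.
    rewrite mulmxBr; move: (V *m ((H - _) *m _)) (V *m ((Ha - _) *m _)) => A A'; by rewrite !mxE.
  rewrite -ya; clearbody V; rewrite [in LHS]mxE [in RHS]mxE mulr_suml; apply: eq_bigr => b _.
  have [->|ba] := eqVneq b a; first by rewrite Vla !mul0r.
  rewrite -mulrA [col a H b 0]mxE; congr (_ * _).
  rewrite [RHS]mxE (bigD1 a) //= big1 ?addr0 => [|j ja]; last first.
    by rewrite !mxE (negbTE ba) (negbTE ja) /= subrr mul0r.
  by rewrite !mxE (negbTE ba) eqxx /= subr0.
have r2 : \sum_(l in Q) sqn ((V *m ((Ha - E%:C%:M) *m y)) l 0) <= r ^+ 2 * m.
  rewrite -hy -(hs_spectral Ha) hs_col mulr_sumr [leRHS](bigID (mem Q)) /=; apply: ler_wpDr.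
    by apply: sumr_ge0 => l _; rewrite mulr_ge0 ?sqr_ge0 ?sqn_ge0.
  apply: ler_sum => l lQ; rewrite (spectral_shiftE E y l 0 hHa) sqnM sqn_real ler_wpM2r ?sqn_ge0 //.
  rewrite -(real_normK (num_real (_ - _))).
  by move: lQ; rewrite inE => h; rewrite lerXn2r ?nnegrE ?normr_ge0.
have r3 : \sum_(l in Q) sqn ((V *m ((H - E%:C%:M) *m y)) l 0) <= r ^+ 2 * m.
  apply: le_trans r1; rewrite -(hs_spectral Ha) hs_col [leRHS](bigID (mem Q)) /=; apply: ler_wpDr => //.
  by apply: sumr_ge0 => l _; exact: sqn_ge0.
rewrite -(ler_pM2r m0) -mulrA -expr2 -(sqn_real m) mulr_suml.
apply: (@le_trans _ _ (\sum_(l in Q) 2 * (sqn ((V *m ((H - E%:C%:M) *m y)) l 0) +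
   sqn ((V *m ((Ha - E%:C%:M) *m y)) l 0)))).
  apply: ler_sum => l lQ; rewrite -sqnM key //.
  by apply: le_trans (sqnD_le _ _) _; rewrite sqnN.
rewrite -mulr_sumr big_split /=.
have -> : 4 * r ^+ 2 * m = 2 * (r ^+ 2 * m + r ^+ 2 * m) by ring.
by apply: ler_wpM2l; [exact: ler0n | exact: lerD r3 r2].
Qed.

(* The spectral weight of a in the window of H forces the a-th column to be almost
   orthogonal to the window of the minor. *)
Lemma minor_event (th : R -> R) (k d : R) : (forall u, 0 <= th u <= 1) ->
  (forall u, r < `|u - E| -> th u = 0) -> 0 < d -> k < trf th H -> d < diagf th H a ->
  k <= #|Q|%:R + 1 /\ \sum_(l in Q) sqn ((V *m col a H) l 0) <= 4 * r ^+ 2 / d.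
Proof.
move=> th01 th0 d0 hk hd; have th_S i : th (lam H i) <= (i \in S)%:R.
  case: (boolP (i \in S)) => [_|]; first by have /andP[] := th01 (lam H i).
  by rewrite inE -ltNge => /th0 ->.
split.
  apply: (@le_trans _ _ (#|S|%:R)).
    apply: (le_trans (ltW hk)); rewrite -sum1_card natr_sum big_mkcond /=.
    by apply: ler_sum => i _; apply: le_trans (th_S i) _; case: (i \in S).
  by rewrite -[1 in leRHS]/(1%:R) -natrD ler_nat card_window_minor.
pose m := \sum_(i in S) sqn (U H i a).
have dm : d <= m.
  apply: (le_trans (ltW hd)); rewrite /m big_mkcond /=; apply: ler_sum => i _.
  apply: (@le_trans _ _ ((i \in S)%:R * sqn (U H i a))); first by rewrite ler_wpM2r ?sqn_ge0.
  by case: (i \in S); rewrite ?mul1r ?mul0r.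
have h := sum_window_col (erefl m) (lt_le_trans d0 dm).
rewrite ler_pdivlMr //; apply: le_trans h; rewrite ler_wpM2l //.
by apply: sumr_ge0 => l _; exact: sqn_ge0.
Qed.

End Interlacing.
End EigenvalueCount.

(** * Squares of expectations through two independent copies *)

Section Doubling.
Context (R : realType) (V : zmodType) (K : Type) (e : K -> R -> V).
Hypothesis e_add : forall i s t, e i (s + t) = e i s + e i t.
Context d (T : measurableType d) (P : probability T R).
Variable Z : K -> T -> R.
Hypothesis mZ : forall i, measurable_fun setT (Z i).

Definition pair_step (i : K * bool) (t : R) : (V * V)%type :=
  if i.2 then (e i.1 t, 0) else (0, e i.1 t).

Lemma pair_stepD i s t : pair_step i (s + t) = pair_step i s + pair_step i t.
Proof. by case: i => k [] /=; rewrite /pair_step /= e_add -[RHS]/(_ + _, _ + _) addr0. Qed.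

Lemma convol_pair1 M L (Phi Psi : V -> R) s x : bounded_lip e M L Psi ->
  convol pair_step P (Z \o fst) [seq (i, false) | i <- s] (fun y => Phi y.1 * Psi y.2) x =
  Phi x.1 * convol e P Z s Psi x.2.
Proof.
move=> bP; elim: s x => //= i s IH x; rewrite /convol1.
under eq_Rintegral do rewrite IH /= addr0.
rewrite RintegralZl //; apply: (integrable_lip_comp e_add) => //.
exact: bounded_lip_convol bP.
Qed.

Lemma convol_pair2 M L (Phi Psi : V -> R) s x : bounded_lip e M L Phi ->
  convol pair_step P (Z \o fst) [seq (i, true) | i <- s] (fun y => Phi y.1 * Psi y.2) x =
  convol e P Z s Phi x.1 * Psi x.2.
Proof.
move=> bP; elim: s x => //= i s IH x; rewrite /convol1.
under eq_Rintegral do rewrite IH /= addr0.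
rewrite RintegralZr //; apply: (integrable_lip_comp e_add) => //.
exact: bounded_lip_convol bP.
Qed.

Lemma convol_sqr M L (Phi : V -> R) s x : bounded_lip e M L Phi ->
  convol e P Z s Phi x ^+ 2 =
  convol pair_step P (Z \o fst) ([seq (i, true) | i <- s] ++ [seq (i, false) | i <- s])
    (fun y => Phi y.1 * Phi y.2) (x, x).
Proof.
move=> bP; rewrite convol_cat expr2.
rewrite (eq_convol _ _ _ _ (Psi := fun y => Phi y.1 * convol e P Z s Phi y.2)).
  by rewrite (convol_pair2 _ _ _ bP).
by move=> y; rewrite (convol_pair1 _ _ _ bP).
Qed.

Lemma bounded_lip_pair M L (Phi : V -> R) : bounded_lip e M L Phi ->
  bounded_lip pair_step (M * M) (M * L + L * M) (fun y => Phi y.1 * Phi y.2).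
Proof.
move=> [b l]; have L0 : K -> 0 <= L.
  by move=> i; have := l i 0 1; rewrite normr1 mulr1; exact: le_trans.
apply: bounded_lipM.
  split => [x|[i []] x t] /=; rewrite ?addr0 ?b ?l //.
  by rewrite subrr normr0 mulr_ge0 ?L0.
split => [x|[i []] x t] /=; rewrite ?addr0 ?b ?l //.
by rewrite subrr normr0 mulr_ge0 ?L0.
Qed.

End Doubling.

Lemma bounded_lip_prod (R : realType) (V : zmodType) (K : Type) (e : K -> R -> V)
    (J : Type) (s : seq J) (F : J -> V -> R) :
  (forall j, exists M L, bounded_lip e M L (F j)) ->
  exists M L, bounded_lip e M L (fun y => \prod_(j <- s) F j y).
Proof.
move=> bF; elim: s => [|j s [M [L IH]]].
  exists `|1|, 0; under eq_fun do rewrite big_nil; exact: bounded_lip_cst.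
have [M' [L' bj]] := bF j; exists (M' * M), (M' * L + L' * M).
under eq_fun do rewrite big_cons.
exact: bounded_lipM.
Qed.

Lemma prod_cos2_ge (R : realType) (J : Type) (s : seq J) (a : J -> R) :
  1 - \sum_(j <- s) a j ^+ 2 <= \prod_(j <- s) cos (a j) ^+ 2 <= 1.
Proof.
elim: s => [|j s /andP[IH1 IH2]]; first by rewrite !big_nil subr0 lexx.
rewrite !big_cons.
have h1 : 1 - a j ^+ 2 <= cos (a j) ^+ 2.
  have := cos2Dsin2 (a j); have := sin_abs_le (a j); set c := cos _; set sn := sin _ => h1 h2.
  have : sn ^+ 2 <= a j ^+ 2.
    by rewrite -(real_normK (num_real sn)) -(real_normK (num_real (a j))) lerXn2r ?nnegrE.
  by move: h2; move: (sn ^+ 2) (c ^+ 2) (a j ^+ 2) => p q r; lra.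
have h2 : cos (a j) ^+ 2 <= 1.
  by have := cos2Dsin2 (a j); have := sqr_ge0 (sin (a j)); move: (sin _ ^+ 2) (cos _ ^+ 2) => p q; lra.
have p0 : 0 <= \prod_(j <- s) cos (a j) ^+ 2 by apply: prodr_ge0 => i _; exact: sqr_ge0.
have s0 : 0 <= \sum_(j <- s) a j ^+ 2 by apply: sumr_ge0 => i _; exact: sqr_ge0.
have c0 := sqr_ge0 (cos (a j)); have a0 := sqr_ge0 (a j).
move: h1 h2 p0 s0 c0 a0 IH1 IH2; move: (\prod_(j <- s) _) (\sum_(j <- s) _) (cos _ ^+ 2) (a j ^+ 2).
move=> p q c x h1 h2 p0 s0 c0 a0 IH1 IH2; apply/andP; split; nra.
Qed.

Lemma le1_double (R : realType) (p q : R) : 1 - p <= q -> p <= 2^-1 -> 1 <= 2 * q.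
Proof. lra. Qed.

Section RowSmallBall.
Context (R : realType) (N : nat).
Local Notation C := R[i].
Local Notation U H := (spectralmx H).
Context d (T : measurableType d) (P : probability T R).
Variables (a : 'I_N) (Z : 'I_N -> T -> R).
Hypothesis mZ : forall i, measurable_fun setT (Z i).

Definition row_step b t : 'M[C]_N := hstep (row_idx a b) t.

Lemma row_stepD b s t : row_step b (s + t) = row_step b s + row_step b t.
Proof. exact: hstepD. Qed.

Lemma col_row_step b t : col a (row_step b t) = t%:C *: delta_mx b 0.
Proof.
apply/matrixP => i j; rewrite ord1 mxE hstep_row !mxE eqxx !andbT.
have [->|ib] := eqVneq i b; first by rewrite orbT mulr1.
by rewrite orbF mulr0; case: eqP => //= ia; rewrite -ia (negbTE ib).
Qed.

Lemma minor_row_step x b t be : minor (hermpart (x + row_step b t)) a be = minor (hermpart x) a be.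
Proof.
rewrite hermpart_step; apply/matrixP => i j.
have -> : minor (hermpart x + hstep (row_idx a b) t) a be i j = if (i == a) || (j == a)
    then (if (i == a) && (j == a) then be%:C else 0) else hermpart x i j + hstep (row_idx a b) t i j.
  by rewrite mxE [X in if _ then _ else X]mxE.
rewrite hstep_row [RHS]mxE; case: ifP => // /negbT; rewrite negb_or => /andP[/negbTE -> /negbTE ->].
by rewrite andbF addr0.
Qed.

Lemma minor_reachable s x y be : reachable (pair_step row_step) s x y ->
  minor (hermpart y.1) a be = minor (hermpart x.1) a be /\
  minor (hermpart y.2) a be = minor (hermpart x.2) a be.
Proof.
elim: s x => [|[b c] s IH] x /=; first by move=> ->.
by case=> u /IH; case: c => /=; rewrite addr0 minor_row_step.
Qed.

Section Frame.
Variables (W : 'M[C]_N) (Q : {pred 'I_N}) (tau : R).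
Hypothesis hW : W \is unitarymx.
Hypothesis tau0 : 0 <= tau.

Definition phase (c : bool) : C := if c then 1 else 'i.
(** Two real rows form one complex column. With its 2N real coordinates, the real and imaginary
    parts of the projections on orthonormal vectors are orthonormal forms; a single real row need
    not give this when the eigenvectors are complex. *)
Definition pair_col (y : 'M[C]_N * 'M[C]_N) : 'cV[C]_N := col a (hermpart y.1) + 'i *: col a (hermpart y.2).
Definition frame_coord (j : 'I_N * bool) (c : 'cV[C]_N) : R :=
  if j.1 \in Q then tau * part j.2 ((W *m c) j.1 0) else 0.
Definition frame_form (j : 'I_N * bool) y : R := frame_coord j (pair_col y).
Definition frame_coef (j : 'I_N * bool) (i : 'I_N * bool) : R :=
  if j.1 \in Q then tau * part j.2 (phase i.2 * W j.1 i.1) else 0.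

Lemma partD c (z z' : C) : part c (z + z') = part c z + part c z'.
Proof. by case: c; case: z z' => [? ?] [? ?]. Qed.

Lemma partZ c (u : R) (z : C) : part c (u%:C * z) = u * part c z.
Proof. by case: c; case: z => [p q]; rewrite /part /=; ring. Qed.

Lemma pair_col_step y i u :
  pair_col (y + pair_step row_step i u) = pair_col y + u%:C *: (phase i.2 *: delta_mx i.1 0).
Proof.
case: y i => y1 y2 [b []]; rewrite /pair_step /=.
  rewrite -[(y1, y2) + _]/(y1 + row_step b u, y2 + 0) addr0 /pair_col /= hermpart_step linearD /= col_row_step.
  by rewrite scale1r [LHS]addrAC.
rewrite -[(y1, y2) + _]/(y1 + 0, y2 + row_step b u) addr0 /pair_col /= hermpart_step linearD /= col_row_step.
by rewrite scalerDr [LHS]addrA !scalerA ['i * _]mulrC.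
Qed.

Lemma frame_coord_step j c i u :
  frame_coord j (c + u%:C *: (phase i.2 *: delta_mx i.1 0)) = frame_coord j c + frame_coef j i * u.
Proof.
rewrite /frame_coord /frame_coef; case: ifP => _; last by rewrite mul0r addr0.
rewrite mulmxDr mxE partD mulrDr; congr (_ + _).
by rewrite -scalemxAr mxE partZ -scalemxAr mxE -colE mxE mulrCA mulrC.
Qed.

Lemma frame_form_step j y i u :
  frame_form j (y + pair_step row_step i u) = frame_form j y + frame_coef j i * u.
Proof.
have E1 := congr1 (frame_coord j) (pair_col_step y i u).
have E2 := etrans E1 (frame_coord_step j (pair_col y) i u).
exact: E2.
Qed.

Lemma sum_pair_bool (F : 'I_N * bool -> R) : \sum_j F j = \sum_l (F (l, true) + F (l, false)).
Proof.
transitivity (\sum_l \sum_c F (l, c)); last by apply: eq_bigr => l _; rewrite big_bool.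
by rewrite pair_bigA; apply: eq_bigr => -[].
Qed.

Lemma sum_frame_coef i : \sum_j frame_coef j i ^+ 2 <= tau ^+ 2.
Proof.
rewrite sum_pair_bool.
apply: (@le_trans _ _ (\sum_l tau ^+ 2 * sqn (W l i.1))).
  apply: ler_sum => l _; rewrite /frame_coef /=; case: ifP => _; last first.
    by rewrite expr0n addr0 mulr_ge0 ?sqr_ge0 ?sqn_ge0.
  rewrite !exprMn -mulrDr -[part true _ ^+ 2 + _]/(sqn _) sqnM.
  by case: (i.2); rewrite /phase ?sqn1 ?sqn_i mul1r.
by rewrite -mulr_sumr sum_sqn_col ?mulr1.
Qed.

Lemma frame_coef_le j i : `|frame_coef j i| <= tau.
Proof.
rewrite -(@ler_pXn2r _ 2) ?nnegrE // real_normK ?num_real //.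
apply: le_trans (sum_frame_coef i); rewrite (bigD1 j) //= lerDl.
by apply: sumr_ge0 => *; exact: sqr_ge0.
Qed.

Lemma frame_coef_row (f : 'I_N * bool -> R) :
  \sum_(j | j.1 \in Q) f j ^+ 2 * tau ^+ 2 <=
  \sum_(i <- [seq (i, true) | i <- enum 'I_N] ++ [seq (i, false) | i <- enum 'I_N])
    (\sum_j f j * frame_coef j i) ^+ 2.
Proof.
(* The combination of forms with coefficients f has as coefficients the real parts of c W and of i c
   W. The minus sign makes the imaginary part appear, as Re (- i (x + i y)) = y. Unitarity of W then
   gives the norm of c. *)
pose c : 'rV[C]_N := \row_l (if l \in Q then f (l, true) +i* - f (l, false) else 0).
have E1 b p : \sum_j f j * frame_coef j (b, p) = tau * complex.Re (phase p * (c *m W) 0 b).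
  rewrite sum_pair_bool mxE mulr_sumr raddf_sum mulr_sumr; apply: eq_bigr => l _ /=.
  rewrite mxE /frame_coef /=; case: ifP => _; last by rewrite !mulr0 mul0r mulr0 /= mulr0 addr0.
  by case: p; rewrite /phase; case: (W l b) => p q; rewrite /part /=; ring.
rewrite big_cat [X in _ <= X + _]big_map [X in _ <= _ + X]big_map !big_enum /=.
have -> : \sum_b (\sum_j f j * frame_coef j (b, true)) ^+ 2 +
  \sum_b (\sum_j f j * frame_coef j (b, false)) ^+ 2 = tau ^+ 2 * hs (c *m W).
  rewrite -big_split /hs big_ord1 mulr_sumr; apply: eq_bigr => b _ /=; rewrite !E1.
  by case: ((c *m W) 0 b) => p q; rewrite /phase /sqn /=; ring.
rewrite -[W]trmxCK hs_unitaryr ?trmxC_unitary //.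
rewrite /hs big_ord1 big_mkcond sum_pair_bool /= mulr_sumr; apply: ler_sum => l _; rewrite mxE.
case: ifP => _; last by rewrite addr0 mulr_ge0 ?sqr_ge0 ?sqn_ge0.
by rewrite /sqn /= sqrrN -mulrDl mulrC.
Qed.

Lemma sum_frame_form y :
  \sum_j frame_form j y ^+ 2 = tau ^+ 2 * \sum_(l in Q) sqn ((W *m pair_col y) l 0).
Proof.
rewrite sum_pair_bool mulr_sumr [RHS]big_mkcond; apply: eq_bigr => l _ /=; rewrite /frame_form /frame_coord /=.
by case: ifP => _; rewrite ?expr0n ?addr0 // !exprMn -mulrDr.
Qed.

Lemma sqn_pair_col_le y l : sqn ((W *m pair_col y) l 0) <=
  2 * (sqn ((W *m col a (hermpart y.1)) l 0) + sqn ((W *m col a (hermpart y.2)) l 0)).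
Proof.
rewrite /pair_col mulmxDr -scalemxAr mxE [X in _ + X]mxE.
by apply: le_trans (sqnD_le _ _) _; rewrite sqnM sqn_i mul1r.
Qed.

End Frame.

Variables (x : 'M[C]_N) (th : R -> R) (E r k dd : R) (Phi : 'M[C]_N -> R) (M L0 : R).
Hypothesis bP : bounded_lip row_step M L0 Phi.
Hypothesis Phi01 : forall y, 0 <= Phi y <= 1.
Hypothesis PhiE : forall y, Phi y != 0 ->
  k < trf th (hermpart y) /\ dd < diagf th (hermpart y) a.
Hypothesis th01 : forall u, 0 <= th u <= 1.
Hypothesis th0 : forall u, r < `|u - E| -> th u = 0.
Hypothesis dd0 : 0 < dd.
Hypothesis r0 : 0 <= r.

Variables (tau L v m4 : R).
Hypotheses (tau0 : 0 <= tau) (Lge0 : 0 <= L) (v0 : 0 <= v).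
Hypothesis i1 : forall i, P.-integrable setT (EFin \o Z i).
Hypothesis i2 : forall i, P.-integrable setT (EFin \o (fun w => Z i w ^+ 2)).
Hypothesis i4 : forall i, P.-integrable setT (EFin \o (fun w => Z i w ^+ 4)).
Hypothesis mean0 : forall i, \int[P]_w Z i w = 0.
Hypothesis var_ge : forall i, v <= \int[P]_w (Z i w ^+ 2).
Hypothesis m4_ge : forall i, \int[P]_w (Z i w ^+ 4) <= m4.
Hypothesis m40 : 0 <= m4.
Hypothesis tauL : 8 * (tau * L) ^+ 2 * m4 <= v.
Hypothesis beta_le : v * tau ^+ 2 / 8 <= 4^-1.
Hypothesis tau_small : tau ^+ 2 * (16 * r ^+ 2 / dd) <= 2^-1.

Let be := E + r + 1.
Let Ha := minor (hermpart x) a be.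
Let W := U Ha.
Let Q := window Ha E r.
Let be_out : r < `|be - E|.
Proof. have -> : be - E = r + 1 by rewrite /be; ring.
by rewrite ger0_norm ?addr_ge0 // ltrDl. Qed.

Let hW : W \is unitarymx. Proof. exact: spectral_unitarymx. Qed.
Let ell := frame_form W Q tau.
Let s2 := [seq (i, true) | i <- enum 'I_N] ++ [seq (i, false) | i <- enum 'I_N].

Let event_le y : minor (hermpart y) a be = Ha -> Phi y != 0 ->
  k <= #|Q|%:R + 1 /\ \sum_(l in Q) sqn ((W *m col a (hermpart y)) l 0) <= 4 * r ^+ 2 / dd.
Proof.
move=> hm /PhiE[h1 h2].
have := minor_event (hermpart_herm y) r0 be_out th01 th0 dd0 h1 h2.
by rewrite hm.
Qed.

(** When both copies lie in the event, the forms have square sum at most 1/2, and there the product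
    of squared cosines is at least 1/2. *)
Let pair_le y : reachable (pair_step row_step) s2 (x, x) y ->
  Phi y.1 * Phi y.2 <= 2 * \prod_j cos (ell j y) ^+ 2.
Proof.
move=> /(minor_reachable be) [/= m1 m2].
have p0 : 0 <= \prod_j cos (ell j y) ^+ 2 by apply: prodr_ge0 => j _; exact: sqr_ge0.
have [->|n1] := eqVneq (Phi y.1) 0; first by rewrite mul0r mulr_ge0.
have [->|n2] := eqVneq (Phi y.2) 0; first by rewrite mulr0 mulr_ge0.
have [_ h1] := event_le m1 n1; have [_ h2] := event_le m2 n2.
apply: (@le_trans _ _ 1).
  have /andP[? ?] := Phi01 y.1; have /andP[? ?] := Phi01 y.2.
  by rewrite -[leRHS]mulr1 ler_pM.
have /andP[h3 _] := prod_cos2_ge (index_enum ('I_N * bool)%type) (ell^~ y).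
have : \sum_j ell j y ^+ 2 <= 2^-1.
  rewrite sum_frame_form; apply: le_trans tau_small; rewrite ler_wpM2l ?sqr_ge0 //.
  apply: (@le_trans _ _ (\sum_(l in Q) 2 * (sqn ((W *m col a (hermpart y.1)) l 0) +
     sqn ((W *m col a (hermpart y.2)) l 0)))).
    by apply: ler_sum => l _; exact: sqn_pair_col_le.
  rewrite -mulr_sumr big_split /=.
  have -> : 16 * r ^+ 2 / dd = 2 * (4 * r ^+ 2 / dd + 4 * r ^+ 2 / dd) by field; rewrite gt_eqF.
  by rewrite ler_wpM2l //; exact: lerD h1 h2.
exact: le1_double h3.
Qed.

(** Given the other rows, the minor is fixed. Either its window is too small for the event to occur,
    or the event in both copies makes at least 2 (k - 1) orthonormal forms small: two for each
    window eigenvector. *)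
Lemma row_small_ball : convol row_step P Z (enum 'I_N) Phi x ^+ 2 <=
  2 * (expR (- (v * tau ^+ 2 / 8 * (2 * (k - 1)))) + (2 * N%:R) * (2 * expR (2^-1 - 4^-1 * L))).
Proof.
rewrite (convol_sqr row_stepD P mZ _ _ bP) -/s2.
have mZ2 (i : 'I_N * bool) : measurable_fun setT ((Z \o fst) i) by exact: mZ.
have b2 := bounded_lip_pair bP.
have pD := pair_stepD row_stepD.
have rhs0 : 0 <= 2 * (expR (- (v * tau ^+ 2 / 8 * (2 * (k - 1)))) + (2 * N%:R) * (2 * expR (2^-1 - 4^-1 * L))).
  by rewrite mulr_ge0 // addr_ge0 ?expR_ge0 // !mulr_ge0 ?expR_ge0.
have [hk|hk] := leP k (#|Q|%:R + 1); last first.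
  apply: le_trans rhs0; rewrite -[leRHS](convol_cst (pair_step row_step) P (Z \o fst) 0 s2 (x, x)).
  have b0 := bounded_lip_cst (pair_step row_step) (0 : R).
  apply: (convol_le_at pD P mZ2 b2 b0) => y /(minor_reachable be) [/= m1 _].
  have [->|n1] := eqVneq (Phi y.1) 0; first by rewrite mul0r.
  by have [] := event_le m1 n1; rewrite leNgt hk.
have [M' [L' bcos]] : exists M' L', bounded_lip (pair_step row_step) M' L'
   (fun y => \prod_j cos (ell j y) ^+ 2).
  apply: bounded_lip_prod => j; exists (1 * 1), (1 * tau + tau * 1).
  under eq_fun do rewrite expr2.
  have bc : bounded_lip (pair_step row_step) 1 tau (fun y => cos (ell j y)).
    have := bounded_lip_cos 0 (frame_form_step W Q tau j) (frame_coef_le Q hW tau0 j).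
    by under eq_fun do rewrite add0r.
  exact: bounded_lipM.
apply: le_trans (convol_le_at pD P mZ2 b2 (bounded_lipZ 2 bcos) pair_le) _.
rewrite (convolZ pD P mZ2 _ _ _ bcos) ler_wpM2l //.
have main := @convol_prod_cos2_le _ _ _ P _ _ _ _ pD _ mZ2 (frame_coef W Q tau) ell s2 (fun j => j.1 \in Q)
  (frame_form_step W Q tau) tau L v m4 tau0 Lge0 v0 (fun i _ => i1 i.1) (fun i _ => i2 i.1)
  (fun i _ => i4 i.1) (fun i _ => mean0 i.1) (fun i _ => var_ge i.1) (fun i _ => m4_ge i.1)
  m40 tauL (frame_coef_le Q hW tau0) beta_le (frame_coef_row Q tau hW)
  (fun i _ => sum_frame_coef Q tau hW i) (x, x).
apply: le_trans main _.
have b0 : 0 <= v * tau ^+ 2 / 8 by rewrite divr_ge0 // mulr_ge0 ?sqr_ge0.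
rewrite lerD //.
  rewrite ler_expR lerN2 ler_wpM2l //.
  have -> : #|[pred j : 'I_N * bool | j.1 \in Q]| = (2 * #|Q|)%N.
    rewrite -sum1_card (eq_bigl (fun j => (j.1 \in Q) && true)) => [|j]; last by rewrite andbT.
    rewrite -(pair_big (fun l => l \in Q) (fun _ => true) (fun _ _ => 1%N)) /=.
    rewrite (eq_bigr (fun _ => 2%N)) => [|l _]; last by rewrite big_bool.
    by rewrite sum_nat_const mulnC.
  rewrite natrM ler_wpM2l //; lra.
rewrite ler_wpM2r ?mulr_ge0 ?expR_ge0 //.
have -> : size s2 = (N + N)%N.
  by rewrite /s2 size_cat; congr (_ + _)%N; exact: etrans (size_map _ _) (size_enum_ord N).
by rewrite natrD mulr_natl mulr2n.
Qed.

End RowSmallBall.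

(** * Lipschitz cutoffs and smoothed counts *)

Section Bumps.
Context (R : realType).
Implicit Types (x y u E eta k : R).

Definition clamp01 x : R := Num.min 1 (Num.max 0 x).

Lemma clamp01_itv x : 0 <= clamp01 x <= 1.
Proof. by rewrite /clamp01 le_min ler01 le_max lexx ge_min lexx. Qed.

Lemma clamp01_eq1 x : 1 <= x -> clamp01 x = 1.
Proof. by move=> h; rewrite /clamp01 max_r ?(le_trans ler01) // min_l. Qed.

Lemma clamp01_eq0 x : x <= 0 -> clamp01 x = 0.
Proof. by move=> h; rewrite /clamp01 max_l // min_r. Qed.

Lemma clamp01_lip x y : `|clamp01 x - clamp01 y| <= `|x - y|.
Proof.
wlog xy : x y / x <= y.
  by move=> h; have [/h//|/ltW/h] := leP x y; rewrite distrC [in leRHS]distrC.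
rewrite /clamp01 distrC [leRHS]distrC (ger0_norm (_ : 0 <= y - x)) ?subr_ge0 //.
case: (leP 0 x) => x0; case: (leP 0 y) => y0; rewrite /Num.min /Num.max; do ?case: ifP => ?; rewrite ler_norml; apply/andP; split; lra.
Qed.

(** A threshold rising from 0 at k to 1 at 2 k; an indicator would not be Lipschitz. *)
Definition kap k x : R := clamp01 (x / k - 1).

Lemma kap_lip k x y : 0 < k -> `|kap k x - kap k y| <= k^-1 * `|x - y|.
Proof.
move=> k0; apply: le_trans (clamp01_lip _ _) _.
rewrite opprB addrA subrK -mulrBl normrM [X in _ * X]gtr0_norm ?invr_gt0 //.
by rewrite mulrC.
Qed.

Lemma kap_neq0 k x : 0 < k -> kap k x != 0 -> k < x.
Proof.
move=> k0; apply: contraR; rewrite -leNgt => xk; apply/eqP/clamp01_eq0.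
by rewrite subr_le0 ler_pdivrMr ?mul1r.
Qed.

Lemma kap_eq1 k x : 0 < k -> 2 * k <= x -> kap k x = 1.
Proof. by move=> k0 h; apply: clamp01_eq1; rewrite lerBrDr ler_pdivlMr. Qed.

(** Equal to 1 within eta of E and 0 beyond 2 eta: it lies between the indicators of the two
    windows. *)
Definition hat E eta u : R := clamp01 (2 - `|u - E| / eta).

Lemma hat_itv E eta u : 0 <= hat E eta u <= 1. Proof. exact: clamp01_itv. Qed.

Lemma hat_norm E eta u : `|hat E eta u| <= 1.
Proof. by have /andP[h1 h2] := hat_itv E eta u; rewrite ger0_norm. Qed.

Lemma hat_eq1 E eta u : 0 < eta -> `|u - E| <= eta -> hat E eta u = 1.
Proof.
move=> e0 h; apply: clamp01_eq1; rewrite lerBrDr addrC -lerBrDr.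
by rewrite ler_pdivrMr // (_ : 2 - 1 = 1) ?mul1r //; ring.
Qed.

Lemma hat_eq0 E eta u : 0 < eta -> 2 * eta < `|u - E| -> hat E eta u = 0.
Proof. by move=> e0 h; apply: clamp01_eq0; rewrite subr_le0 ler_pdivlMr // ltW. Qed.

Lemma hat_lip E eta u u' : 0 < eta -> `|hat E eta u - hat E eta u'| <= eta^-1 * `|u - u'|.
Proof.
move=> e0; apply: le_trans (clamp01_lip _ _) _.
have -> : 2 - `|u - E| / eta - (2 - `|u' - E| / eta) = (`|u' - E| - `|u - E|) * eta^-1 by ring.
rewrite normrM [X in _ * X]gtr0_norm ?invr_gt0 // mulrC ler_pM2l ?invr_gt0 //.
apply: le_trans (ler_dist_dist _ _) _.
have -> : u' - E - (u - E) = u' - u by ring.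
by rewrite distrC.
Qed.

End Bumps.

Section SpectralStatistics.
Context (R : realType) (N : nat).
Local Notation C := R[i].

Lemma trf_bounded_lip (f : R -> R) (M L : R) : (forall u, `|f u| <= M) -> 0 <= L ->
  (forall u u', `|f u - f u'| <= L * `|u - u'|) ->
  bounded_lip (@hstep R N) (N%:R * M) (L * (N%:R + 4)) (fun x => trf f (hermpart x)).
Proof.
move=> bf L0 lf; split => [x|k x t].
  apply: le_trans (ler_norm_sum _ _ _) _; apply: le_trans (ler_sum _ (fun i _ => bf _)) _.
  by rewrite sumr_const card_ord mulr_natl.
rewrite hermpart_step; apply: trf_lip => //; first exact: hermpart_herm.
  by apply: hermD; [exact: hermpart_herm|exact: hstep_herm].
by rewrite addrC addKr; exact: hs_step.
Qed.

Lemma diagf_bounded_lip (f : R -> R) (M L : R) a : (forall u, `|f u| <= M) -> 0 <= L ->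
  (forall u u', `|f u - f u'| <= L * `|u - u'|) ->
  bounded_lip (@hstep R N) M (L * 2) (fun x => diagf f (hermpart x) a).
Proof.
move=> bf L0 lf; split => [x|k x t].
  apply: le_trans (ler_norm_sum _ _ _) _.
  apply: (@le_trans _ _ (\sum_i M * sqn (spectralmx (hermpart x) i a))).
    by apply: ler_sum => i _; rewrite normrM (ger0_norm (sqn_ge0 _)) ler_wpM2r ?sqn_ge0.
  by rewrite -mulr_sumr sum_sqn_col ?mulr1 ?spectral_unitarymx.
rewrite hermpart_step -(@ler_pXn2r _ 2) ?nnegrE ?mulr_ge0 // real_normK ?num_real //.
have hX := hermpart_herm x; have hY := hermD hX (hstep_herm k t).
apply: le_trans (diagf_lip a lf L0 hX hY) _.
rewrite [X in hs X]addrC addKr !exprMn -mulrA ler_wpM2l ?sqr_ge0 //.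
apply: le_trans (hs_step k t) _; rewrite real_normK ?num_real //.
by rewrite ler_wpM2r ?sqr_ge0 //; lra.
Qed.

Definition cnt (E eta : R) (x : 'M[C]_N) : R := trf (hat E eta) (hermpart x).

Lemma cnt_itv E eta x : 0 <= cnt E eta x <= N%:R.
Proof.
apply/andP; split; first by apply: sumr_ge0 => i _; case/andP: (hat_itv E eta (lam (hermpart x) i)).
apply: (@le_trans _ _ (\sum_(i < N) 1)); last by rewrite sumr_const card_ord.
by apply: ler_sum => i _; case/andP: (hat_itv E eta (lam (hermpart x) i)).
Qed.

Lemma cnt_bounded_lip E eta : 0 < eta ->
  bounded_lip (@hstep R N) (N%:R * 1) (eta^-1 * (N%:R + 4)) (cnt E eta).
Proof.
move=> e0; apply: trf_bounded_lip => [u||u u']; first exact: hat_norm.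
  by rewrite invr_ge0 ltW.
exact: hat_lip.
Qed.

Definition row_event (E eta k : R) a (x : 'M[C]_N) : R :=
  kap k (cnt E eta x) * kap (k / N%:R) (diagf (hat E eta) (hermpart x) a).

Lemma row_event_bounded_lip E eta k a : 0 < eta -> 0 < k -> (0 < N)%N ->
  exists M L, bounded_lip (@hstep R N) M L (row_event E eta k a).
Proof.
move=> e0 k0 N0.
have kN0 : 0 < k / N%:R by rewrite divr_gt0 // ltr0n.
have kb (k' x : R) : `|kap k' x| <= 1.
  by have /andP[h1 h2] := clamp01_itv (x / k' - 1); rewrite ger0_norm.
have e1 : 0 <= eta^-1 by rewrite invr_ge0 ltW.
do 2 eexists; apply: bounded_lipM.
  apply: (bounded_lip_comp (cnt_bounded_lip E e0) (kb k)) => [x y|]; first exact: kap_lip.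
  by rewrite invr_ge0 ltW.
apply: (bounded_lip_comp (diagf_bounded_lip a (hat_norm E eta) e1 (fun u u' => hat_lip E u u' e0)) (kb (k / N%:R))).
  by move=> x y; exact: kap_lip.
by rewrite invr_ge0 ltW.
Qed.

Lemma row_event_itv E eta k a x : 0 <= row_event E eta k a x <= 1.
Proof.
have /andP[h1 h2] := clamp01_itv (cnt E eta x / k - 1).
have /andP[h3 h4] := clamp01_itv (diagf (hat E eta) (hermpart x) a / (k / N%:R) - 1).
by rewrite /row_event mulr_ge0 //= -[leRHS]mulr1 ler_pM.
Qed.

(** The diagonal weights add up to the count, so a count above 2 k gives some a a weight of at least
    2 k/N; the trivial bound N^3 is then charged to the event of that a. *)
Lemma cnt_cube_le E eta k x : 0 < k -> (0 < N)%N ->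
  cnt E eta x ^+ 3 <= (2 * k) ^+ 3 + N%:R ^+ 3 * \sum_a row_event E eta k a x.
Proof.
move=> k0 N0; have /andP[c0 cN] := cnt_itv E eta x.
have s0 a : 0 <= row_event E eta k a x by case/andP: (row_event_itv E eta k a x).
have N1 : 0 < N%:R :> R by rewrite ltr0n.
have [h|h] := leP (cnt E eta x) (2 * k).
  apply: ler_wpDr; first by rewrite mulr_ge0 ?exprn_ge0 ?sumr_ge0.
  by rewrite lerXn2r // nnegrE // mulr_ge0 // ltW.
apply: ler_wpDl; first by rewrite exprn_ge0 // mulr_ge0 // ltW.
apply: (@le_trans _ _ (N%:R ^+ 3)); first by rewrite lerXn2r // nnegrE.
rewrite ler_peMr ?exprn_ge0 //.
have [a ha] : exists a, 2 * (k / N%:R) <= diagf (hat E eta) (hermpart x) a.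
  apply/existsP; rewrite -[X in is_true X]negbK negb_exists; apply/negP => /forallP hall.
  move: h; rewrite /cnt -sum_diagf ltNge => /negP; apply.
  apply: (@le_trans _ _ (\sum_(a < N) 2 * (k / N%:R))).
    by apply: ler_sum => a _; have := hall a; rewrite -ltNge => /ltW.
  by rewrite sumr_const card_ord -[_ *+ _]mulr_natl mulrCA [_%:R * (k / _)]mulrC divfK ?gt_eqF.
rewrite (bigD1 a) //= ler_wpDr ?sumr_ge0 //.
by rewrite /row_event kap_eq1 ?(ltW h) // kap_eq1 ?mulr1 // divr_gt0.
Qed.

End SpectralStatistics.

(** Moments are prescribed for the real parts of entries only; the other coordinates will act as
    deterministic shifts. *)
Record row_family (R : realType) N d (T : measurableType d) (P : probability T R)
    (Z : coord_idx N -> T -> R) (v m4 : R) : Prop := RowFamily {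
  rf_meas : forall k, measurable_fun setT (Z k);
  rf_int1 : forall a b, P.-integrable setT (EFin \o Z (row_idx a b));
  rf_int2 : forall a b, P.-integrable setT (EFin \o (fun w => Z (row_idx a b) w ^+ 2));
  rf_int4 : forall a b, P.-integrable setT (EFin \o (fun w => Z (row_idx a b) w ^+ 4));
  rf_mean : forall a b, \int[P]_w Z (row_idx a b) w = 0;
  rf_var : forall a b, v <= \int[P]_w (Z (row_idx a b) w ^+ 2);
  rf_m4 : forall a b, \int[P]_w (Z (row_idx a b) w ^+ 4) <= m4
}.

Section CountBound.
Context (R : realType) (N : nat) d (T : measurableType d) (P : probability T R).
Variables (Z : coord_idx N -> T -> R) (v m4 : R).
Hypothesis rf : row_family P Z v m4.
Hypothesis N0 : (0 < N)%N.
Variables (E eta k tau L : R).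
Hypotheses (eta0 : 0 < eta) (k0 : 0 < k) (tau0 : 0 <= tau) (L0 : 0 <= L) (v0 : 0 <= v).
Hypothesis m40 : 0 <= m4.
Hypothesis tauL : 8 * (tau * L) ^+ 2 * m4 <= v.
Hypothesis beta_le : v * tau ^+ 2 / 8 <= 4^-1.
Hypothesis tau_small : tau ^+ 2 * (16 * (2 * eta) ^+ 2 / (k / N%:R)) <= 2^-1.

Let B := 2 * (expR (- (v * tau ^+ 2 / 8 * (2 * (k - 1)))) + (2 * N%:R) * (2 * expR (2^-1 - 4^-1 * L))).

(** The row is integrated innermost; the bound is uniform in the other coordinates and so survives
    their integration. *)
Lemma convol_row_event_le a x :
  convol (@hstep R N) P Z (enum (coord_idx N)) (row_event E eta k a) x <= Num.sqrt B.
Proof.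
have [M [L' bl]] := row_event_bounded_lip E a eta0 k0 N0.
have [s ps] := enum_row_split a.
have hD := @hstepD R N.
rewrite -[enum (coord_idx N)]map_id (convol_perm hD P id x bl (rf_meas rf) ps) map_id convol_cat.
apply: (convol_leM hD P (rf_meas rf) s x (bounded_lip_convol hD P (rf_meas rf) _ bl)) => y.
rewrite -[row_event E eta k a]/(row_event E eta k a \o id) (convol_map (e' := row_step a) (p := id)) //.
set q := convol _ _ _ _ _ _.
have q0 : 0 <= q.
  apply: (convol_ge0 (row_stepD a) P _ _ _ (_ : bounded_lip (row_step a) M L' _)).
  - by move=> i; exact: (rf_meas rf).
  - by case: bl => b l; split => // i z t; exact: l.
  - by move=> z; case/andP: (row_event_itv E eta k a z).
rewrite -[q]ger0_norm // -sqrtr_sqr ler_wsqrtr //.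
apply: (@row_small_ball R N d T P a (Z \o row_idx a) _ y (hat E eta) E (2 * eta) k (k / N%:R)
  (row_event E eta k a) M L' _ _ _ _ _ _ _ tau L v m4) => //.
- by move=> i; exact: (rf_meas rf).
- by case: bl => b l; split => // i z t; exact: l.
- exact: row_event_itv.
- move=> z; rewrite /row_event mulf_eq0 negb_or => /andP[h1 h2]; split; first exact: kap_neq0 h1.
  by apply: kap_neq0 h2; rewrite divr_gt0 // ltr0n.
- exact: hat_itv.
- by move=> u; exact: hat_eq0.
- by rewrite divr_gt0 // ltr0n.
- by rewrite mulr_ge0 // ltW.
- by move=> i; exact: (rf_int1 rf).
- by move=> i; exact: (rf_int2 rf).
- by move=> i; exact: (rf_int4 rf).
- by move=> i; exact: (rf_mean rf).
- by move=> i; exact: (rf_var rf).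
- by move=> i; exact: (rf_m4 rf).
Qed.

Lemma cnt_cube_bounded_lip : exists M L, bounded_lip (@hstep R N) M L (fun x => cnt E eta x ^+ 3).
Proof.
have b1 := @cnt_bounded_lip R N E eta eta0.
do 2 eexists; under eq_fun do rewrite exprS expr2.
exact: bounded_lipM b1 (bounded_lipM b1 b1).
Qed.

Lemma convol_cnt_cube_le x :
  convol (@hstep R N) P Z (enum (coord_idx N)) (fun x => cnt E eta x ^+ 3) x <=
  (2 * k) ^+ 3 + N%:R ^+ 4 * Num.sqrt B.
Proof.
have hD := @hstepD R N; have mZ := rf_meas rf.
have [M1 [L1 b1]] := cnt_cube_bounded_lip.
have [F bF] := choice (fun a => row_event_bounded_lip E a eta0 k0 N0).
have [F' {}bF] := choice bF.
pose MM := \sum_a `|F a|; pose LL := \sum_a `|F' a|.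
have bl a : bounded_lip (@hstep R N) MM LL (row_event E eta k a).
  have [b l] := bF a; split => [y|i y t].
    apply: le_trans (b y) _; apply: le_trans (ler_norm _) _.
    by rewrite /MM (bigD1 a) //= lerDl sumr_ge0.
  apply: le_trans (l i y t) _; rewrite ler_wpM2r //; apply: le_trans (ler_norm _) _.
  by rewrite /LL (bigD1 a) //= lerDl sumr_ge0.
have bs := bounded_lip_sum (index_enum 'I_N) xpredT bl.
have bsZ := bounded_lipZ (N%:R ^+ 3) bs.
have bc := bounded_lip_cst (@hstep R N) ((2 * k) ^+ 3).
have bD := bounded_lipD bc bsZ.
apply: (@le_trans _ _ (convol (@hstep R N) P Z (enum (coord_idx N))
   (fun x => (2 * k) ^+ 3 + N%:R ^+ 3 * \sum_a row_event E eta k a x) x)).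
  by apply: (convol_le hD P mZ _ _ b1 bD) => y; exact: cnt_cube_le.
rewrite (convolD hD P mZ _ _ bc bsZ) convol_cst lerD2l.
rewrite (convolZ hD P mZ _ _ _ bs) [leRHS](_ : _ = N%:R ^+ 3 * (N%:R * Num.sqrt B)); last by ring.
rewrite ler_wpM2l ?exprn_ge0 //.
rewrite (convol_sum hD P mZ _ _ _ _ bl).
apply: le_trans (ler_sum _ (fun a _ => convol_row_event_le a x)) _.
by rewrite sumr_const card_ord mulr_natl.
Qed.

End CountBound.

Section Powers.
Context (R : realType).

Lemma powR_ge1 (x a : R) : 1 <= x -> 0 <= a -> 1 <= x `^ a.
Proof. by move=> x1 a0; rewrite -(powRr0 x); exact: ler_powR. Qed.

Lemma expRN_le (x : R) m : 0 < x -> (0 < m)%N -> expR (- x) <= m`!%:R / x ^+ m.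
Proof.
case: m => // m x0 _; have fp : 0 < (m.+1)`!%:R :> R by rewrite ltr0n fact_gt0.
have xp : 0 < x ^+ m.+1 by rewrite exprn_gt0.
have h : x ^+ m.+1 / (m.+1)`!%:R <= expR x.
  by apply: le_trans (expR_ge1Dxn m (ltW x0)); rewrite lerDr.
rewrite expRN -[leRHS]invf_div lef_pV2 ?posrE ?expR_gt0 // divr_gt0 //.
Qed.

End Powers.

(** With L = N^(delta/4), the scale of the forms satisfies tau^2 = t N/L^2 and the threshold is k =
    L^4. Then tau L is of order sqrt N, as far as the characteristic functions are known to decay,
    while beta k grows like L^2; both error terms beat every power of N. *)
Lemma count_bound (R : realType) (delta cv Cm wd : R) : 0 < delta -> 0 < cv -> 0 < Cm -> 0 < wd ->
  exists C1 : R, 0 < C1 /\ forall N, (0 < N)%N ->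
  forall d (T : measurableType d) (P : probability T R) (Z : coord_idx N -> T -> R),
    row_family P Z (cv / N%:R) (Cm / N%:R ^+ 2) ->
  forall E x, convol (@hstep R N) P Z (enum (coord_idx N)) (fun x => cnt E (wd / N%:R) x ^+ 3) x <=
    C1 * (N%:R `^ delta) ^+ 3.
Proof.
move=> delta0 cv0 Cm0 wd0.
(* t = 1/D is small enough for the three conditions [t1], [t2] and [t3] at once. *)
pose D := 1 + 8 * Cm / cv + cv + 128 * wd ^+ 2.
have p1 : 0 < 8 * Cm / cv by rewrite divr_gt0 // mulr_gt0.
have p2 : 0 < 128 * wd ^+ 2 by rewrite mulr_gt0 // exprn_gt0.
have D1 : 0 < D by rewrite /D; lra.
pose t := D^-1; have t0 : 0 < t by rewrite invr_gt0.
have le_t x : x <= D -> x * t <= 1 by move=> h; rewrite /t ler_pdivrMr // mul1r.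
have t1 : 8 * Cm * t <= cv.
  rewrite -(ler_pM2r (_ : 0 < cv^-1)) ?invr_gt0 // divff ?gt_eqF // mulrAC; apply: le_t; rewrite /D; lra.
have t2 : cv * t <= 1 by apply: le_t; rewrite /D; lra.
have t3 : 128 * wd ^+ 2 * t <= 1 by apply: le_t; rewrite /D; lra.
clearbody t; pose b := cv * t / 4; have b0 : 0 < b by rewrite divr_gt0 // mulr_gt0.
have d4 : 0 < delta / 4 by rewrite divr_gt0.
(* L^m must beat N^9: N^8 from moving the prefactor N^4 under the square root, and one more N from
   the number of coordinates in the tail term. *)
have [m m9 m0] : exists2 m : nat, 9 <= delta / 4 * m%:R & (0 < m)%N.
  exists (Num.bound (9 / (delta / 4))).+1 => //.
  rewrite mulrC -ler_pdivrMr //; apply/ltW/(lt_trans (archi_boundP _)); first by rewrite divr_ge0 // ltW.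
  by rewrite ltr_nat.
pose K := 2 * (expR b * (m`!%:R / b ^+ m) + 4 * expR 2^-1 * (m`!%:R * 4 ^+ m)).
have f0 : 0 < m`!%:R :> R by rewrite ltr0n fact_gt0.
have K0 : 0 <= K.
  rewrite /K mulr_ge0 // addr_ge0 ?mulr_ge0 ?expR_ge0 ?exprn_ge0 ?(ltW f0) ?invr_ge0 ?exprn_ge0 ?(ltW b0) //.
exists (8 + Num.sqrt K); split; first by rewrite ltr_wpDr // sqrtr_ge0.
move=> N N0 d T P Z rf E x.
have N1 : 1 <= N%:R :> R by rewrite ler1n.
have Np : 0 < N%:R :> R by rewrite ltr0n.
pose L : R := N%:R `^ (delta / 4).
have L1 : 1 <= L by apply: powR_ge1 => //; exact: ltW.
have L0 : 0 < L by exact: lt_le_trans L1.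
have kE : N%:R `^ delta = L ^+ 4.
  rewrite /L -powR_mulrn ?powR_ge0 // -powRrM; congr (_ `^ _); by field.
have Lm : N%:R ^+ 9 <= L ^+ m.
  by rewrite -!powR_mulrn ?powR_ge0 ?ler0n // /L -powRrM; exact: ler_powR.
pose k := L ^+ 4; have k0 : 0 < k by rewrite exprn_gt0.
pose tau := Num.sqrt (t * N%:R) / L.
have tau2 : tau ^+ 2 = t * N%:R / L ^+ 2.
  by rewrite /tau expr_div_n sqr_sqrtr // mulr_ge0 // ltW.
have Lne : L != 0 by rewrite gt_eqF.
have Nne : N%:R != 0 :> R by rewrite gt_eqF.
have L21 : 1 <= L ^+ 2 by exact: exprn_ege1.
have iL2 : (L ^+ 2)^-1 <= 1 by rewrite invf_le1 // exprn_gt0.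
have vt : cv / N%:R * tau ^+ 2 / 8 = cv * t / 8 * (L ^+ 2)^-1 by rewrite tau2; field; rewrite Lne.
have vt0 : 0 <= cv * t / 8 by rewrite divr_ge0 // mulr_ge0 // ltW.
pose B := 2 * (expR (- (cv / N%:R * tau ^+ 2 / 8 * (2 * (k - 1)))) +
  2 * N%:R * (2 * expR (2^-1 - 4^-1 * L))).
apply: (@le_trans _ _ ((2 * k) ^+ 3 + N%:R ^+ 4 * Num.sqrt B)).
apply: (@convol_cnt_cube_le R N d T P Z (cv / N%:R) (Cm / N%:R ^+ 2) rf N0 E (wd / N%:R) k tau L).
- by rewrite divr_gt0.
- by [].
- by rewrite /tau divr_ge0 // ?sqrtr_ge0 // ltW.
- exact: ltW.
- by rewrite divr_ge0 // ltW.
- by rewrite divr_ge0 // ?exprn_ge0 // ltW.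
- rewrite exprMn tau2 [leLHS](_ : _ = 8 * Cm * t / N%:R); last by field; rewrite ?Lne ?Nne.
  by rewrite ler_pM2r // invr_gt0.
- rewrite vt; apply: (@le_trans _ _ (cv * t / 8)); first by rewrite ler_piMr.
  lra.
- rewrite tau2 /k [leLHS](_ : _ = 64 * wd ^+ 2 * t * ((L ^+ 2)^-1) ^+ 3); last by field; rewrite ?Lne ?Nne.
  have q0 : 0 <= 64 * wd ^+ 2 * t by rewrite !mulr_ge0 ?exprn_ge0 // ltW.
  apply: (@le_trans _ _ (64 * wd ^+ 2 * t)); last lra.
  rewrite ler_piMr // exprn_ile1 // invr_ge0 ltW // exprn_gt0 //.
rewrite kE -/k.
have kge1 : 1 <= k ^+ 3 by rewrite !exprn_ege1.
have sB : N%:R ^+ 4 * Num.sqrt B <= Num.sqrt K.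
  have N40 : 0 <= N%:R ^+ 4 :> R by exact: exprn_ge0.
  rewrite -[X in X * _](ger0_norm N40) -sqrtr_sqr -sqrtrM ?sqr_ge0 //.
  apply: ler_wsqrtr; rewrite -exprM.
  have e1 : expR (- (cv / N%:R * tau ^+ 2 / 8 * (2 * (k - 1)))) <= expR b * (m`!%:R / b ^+ m) / L ^+ m.
    apply: (@le_trans _ _ (expR b * expR (- (b * L)))).
      rewrite -expRD ler_expR vt.
      have -> : cv * t / 8 / L ^+ 2 * (2 * (k - 1)) = b * (L ^+ 2 - (L ^+ 2)^-1).
        by rewrite /k /b; field; rewrite Lne.
      have LL : L <= L ^+ 2 by rewrite expr2 ler_peMl // ltW.
      have -> : b - b * L = b * (1 - L) by ring.
      rewrite -mulrN ler_pM2l //.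
      by move: LL iL2; move: (L ^+ 2)^-1 (L ^+ 2) => p q; lra.
    rewrite -mulrA ler_wpM2l ?expR_ge0 //.
    apply: le_trans (expRN_le (m := m) _ _) _ => //; first exact: mulr_gt0.
    by rewrite exprMn invfM mulrA.
  have e2 : expR (2^-1 - 4^-1 * L) <= expR 2^-1 * (m`!%:R * 4 ^+ m) / L ^+ m.
    rewrite expRD -mulrA ler_wpM2l ?expR_ge0 //.
    apply: le_trans (expRN_le (m := m) _ _) _ => //; first exact: mulr_gt0.
    by rewrite exprMn invfM exprVn invrK mulrA.
  apply: (@le_trans _ _ (N%:R ^+ 8 * (N%:R * (K / L ^+ m)))).
    rewrite ler_wpM2l ?exprn_ge0 //.
    have -> : N%:R * (K / L ^+ m) = 2 * (N%:R * (expR b * (m`!%:R / b ^+ m) / L ^+ m) +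
      (2 * N%:R) * (2 * (expR 2^-1 * (m`!%:R * 4 ^+ m) / L ^+ m))) by rewrite /K; ring.
    rewrite /B ler_wpM2l // lerD //.
      apply: (le_trans e1); rewrite ler_peMl //.
      exact: le_trans (expR_ge0 _) e1.
    by rewrite ler_wpM2l ?mulr_ge0 // ler_wpM2l.
  rewrite mulrA -exprSr mulrC mulrAC -mulrA ler_piMr // ler_pdivrMr ?exprn_gt0 // mul1r //.
rewrite exprMn mulrDl; apply: lerD; first by rewrite (_ : 2 ^+ 3 = 8 :> R) //; ring.
apply: (le_trans sB); rewrite ler_peMr // sqrtr_ge0.
Qed.

(** * Expansion of pair statistics along the Gaussian flow *)

Section Expansion.
Context (R : realType) (N : nat).
Local Notation C := R[i].
Implicit Types (H X : 'M[C]_N).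

Definition pair_stat (f : R -> R -> R) H H' : R := \sum_i \sum_j f (lam H i) (lam H' j).

Definition diag_part H X (i : 'I_N) : R := complex.Re (eigenframe H X i i).

Lemma diag_part_le H X q i : hs X <= q ^+ 2 -> 0 <= q -> `|diag_part H X i| <= q.
Proof.
move=> hX q0; rewrite -(@ler_pXn2r _ 2) ?nnegrE // real_normK ?num_real //.
apply: le_trans hX; rewrite -(hs_eigenframe H) /hs (bigD1 i) //= (bigD1 i) //= -addrA.
rewrite /diag_part; apply: (@le_trans _ _ (sqn (eigenframe H X i i))).
  by rewrite /sqn lerDl sqr_ge0.
rewrite lerDl addr_ge0 // sumr_ge0 // => k _; first exact: sqn_ge0.
by apply: sumr_ge0 => l _; exact: sqn_ge0.
Qed.

(** The remainder of [trf_taylor1] becomes an expression in the spectrum of H alone by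
    [quadratic_swap], at third-order cost. *)
Lemma trf_taylor2 (g g1 g2 g3 : R -> R) M H X q :
  (forall t : R, is_derive t (1 : R) g (g1 t)) -> (forall t : R, is_derive t (1 : R) g1 (g2 t)) ->
  (forall t : R, is_derive t (1 : R) g2 (g3 t)) -> (forall t, `|g3 t| <= M) ->
  H \is hermsymmx -> X \is hermsymmx -> 0 < q -> hs X <= q ^+ 2 ->
  `|trf g (H + X) - trf g H - \sum_i g1 (lam H i) * diag_part H X i
    - \sum_k \sum_i sqn (eigenframe H X k i) * ddiff2 g g1 g2 (lam H i) (lam H k)|
  <= 3 * M * (1 + N%:R) * q ^+ 3.
Proof.
move=> d1 d2 d3 b3 hH hX q0 hq.
have hY := hermD hH hX.
have XE : H + X - H = X by rewrite addrC addKr.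
have M0 : 0 <= M by exact: le_trans (b3 0).
have T := @trf_taylor1 R N H (H + X) hH hY g g1 (ddiff2 g g1 g2) (ddiff2E g g1 g2).
rewrite XE in T; rewrite T.
have Q := @quadratic_swap R N H (H + X) hH hY (fun i => ddiff2 g g1 g2 (lam H i)) (3 * M) q.
rewrite XE in Q; apply: Q => //; last by rewrite mulr_ge0.
by move=> i x y; exact: (ddiff2_lip d1 d2 d3 b3).
Qed.

Lemma is_derive_sum (I : Type) (s : seq I) (F dF : I -> R -> R) (x : R) :
  (forall i, is_derive x (1 : R) (F i) (dF i x)) ->
  is_derive x (1 : R) (fun u => \sum_(i <- s) F i u) (\sum_(i <- s) dF i x).
Proof.
move=> dF'; elim: s => [|i s IH].
  rewrite big_nil (_ : (fun u => _) = fun _ => 0); first exact: is_derive_cst.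
  by apply/funext => u; rewrite big_nil.
rewrite big_cons (_ : (fun u => _) = F i \+ (fun u => \sum_(j <- s) F j u)).
  exact: is_deriveD.
by apply/funext => u; rewrite big_cons.
Qed.

Lemma sum_norm_le (I : finType) (F : I -> R) M : (forall i, `|F i| <= M) ->
  `|\sum_i F i| <= #|I|%:R * M.
Proof.
move=> h; apply: le_trans (ler_norm_sum _ _ _) _; apply: le_trans (ler_sum _ (fun i _ => h i)) _.
by rewrite sumr_const mulr_natl.
Qed.

Variables (f : R -> R -> R) (M r : R) (D : nat -> nat -> R -> R -> R).
Hypothesis tf : test_fun f M r D.

Let f0 u v : D 0 0 u v = f u v. Proof. by rewrite (tf0 tf). Qed.
Let M0 : 0 <= M. Proof. exact: le_trans (normr_ge0 _) (@tf_bound _ _ _ _ _ tf 0 0 0 0 isT isT). Qed.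

Section Mixed.
Variables (H H' X X' : 'M[C]_N) (q : R).
Hypotheses (hH : H \is hermsymmx) (hX : X \is hermsymmx).
Hypotheses (hH' : H' \is hermsymmx) (hX' : X' \is hermsymmx).
Hypotheses (q0 : 0 < q) (hq : hs X <= q ^+ 2) (hq' : hs X' <= q ^+ 2).

Let n v : R := trf (f^~ v) (H + X) - trf (f^~ v) H.
Let n0 v : R := \sum_i D 1 0 (lam H i) v * diag_part H X i.
Let XE : H + X - H = X. Proof. by rewrite addrC addKr. Qed.
Let XE' : H' + X' - H' = X'. Proof. by rewrite addrC addKr. Qed.
Let hY := hermD hH hX.
Let hY' := hermD hH' hX'.

(* The remainder of the first-order expansion in H is itself of size q^2 times a Lipschitz
   function of v, since it is linear in f. *)
Let rem_lip v v' : `|(n v - n0 v) - (n v' - n0 v')| <= M * q ^+ 2 * `|v - v'|.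
Proof.
pose g u := D 0 0 u v - D 0 0 u v'; pose g1 u := D 1 0 u v - D 1 0 u v'.
pose g2 u := D 2 0 u v - D 2 0 u v'.
have dg t : is_derive t (1 : R) g (g1 t) by apply: is_deriveB; exact: (tf1 tf).
have dg1 t : is_derive t (1 : R) g1 (g2 t) by apply: is_deriveB; exact: (tf1 tf).
have bg2 t : `|g2 t| <= M * `|v - v'|.
  apply: (@derive_bound_lip _ (fun v => D 2 0 t v) (fun v => D 2 1 t v)) => u.
    exact: (tf2 tf).
  exact: (tf_bound tf).
have T := @trf_taylor1_le R N H (H + X) hH hY g g1 (ddiff2 g g1 g2) (M * `|v - v'|) q (ddiff2E g g1 g2).
rewrite XE in T; have {}T := T (fun x y => ddiff2_le dg dg1 x y bg2) hq.
rewrite mulrAC; apply: le_trans T; rewrite le_eqVlt; apply/orP; left; apply/eqP; congr (`|_|).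
have E G : trf g G = trf (f^~ v) G - trf (f^~ v') G.
  by rewrite /trf -sumrB; apply: eq_bigr => i _; rewrite /g !f0.
have E1 : \sum_i g1 (lam H i) * complex.Re (eigenframe H X i i) = n0 v - n0 v'.
  by rewrite /n0 -sumrB; apply: eq_bigr => i _; rewrite /g1 mulrBl.
rewrite !E E1 /n.
move: (trf _ _) (trf _ _) (trf _ _) (trf _ _) (n0 v) (n0 v') => a b c d e k; clear; ring.
Qed.

(** The mixed increment is the increment in H' of [n], itself an increment in H. Its linear part
    [n0] is expanded to first order in H'; the rest is Lipschitz with a constant of order q^2, so
    its increment is cubic. *)
Let mixed_le : `|trf n (H' + X') - trf n H' -
    \sum_i \sum_j D 1 1 (lam H i) (lam H' j) * diag_part H X i * diag_part H' X' j| <=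
  M * (N%:R + 1 + N%:R) * q ^+ 3.
Proof.
pose n1 v : R := \sum_i D 1 1 (lam H i) v * diag_part H X i.
pose n2 v : R := \sum_i D 1 2 (lam H i) v * diag_part H X i.
have dk k t : is_derive t (1 : R) (fun v => \sum_i D 1 k (lam H i) v * diag_part H X i)
    (\sum_i D 1 k.+1 (lam H i) t * diag_part H X i).
  apply: (is_derive_sum _ (dF := fun i v => D 1 k.+1 (lam H i) v * diag_part H X i)) => i.
  have := tf2 tf 1 k (lam H i) t => d; apply: is_derive_eq.
  by rewrite /GRing.scale /= mulr0 add0r mulrC.
have b2 t : `|n2 t| <= N%:R * (M * q).
  rewrite -[X in X%:R](card_ord N); apply: sum_norm_le => i.
  by rewrite normrM ler_pM // ?(tf_bound tf) // diag_part_le // ltW.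
have T := @trf_taylor1_le R N H' (H' + X') hH' hY' n0 n1 (ddiff2 n0 n1 n2) (N%:R * (M * q)) q (ddiff2E n0 n1 n2).
rewrite XE' in T; have {}T := T (fun x y => ddiff2_le (dk 0%N) (dk 1%N) x y b2) hq'.
have rl := trf_lip (f := fun v => n v - n0 v) (t := q) (B := 1) hH' hY' rem_lip _ _.
rewrite XE' mul1r (gtr0_norm q0) in rl.
have {}rl := rl (mulr_ge0 M0 (sqr_ge0 q)) hq'.
have E G : trf (fun v => n v - n0 v) G = trf n G - trf n0 G by rewrite /trf -sumrB.
have E1 : \sum_j n1 (lam H' j) * complex.Re (eigenframe H' X' j j) =
  \sum_i \sum_j D 1 1 (lam H i) (lam H' j) * diag_part H X i * diag_part H' X' j.
  by rewrite exchange_big; apply: eq_bigr => j _; rewrite /n1 mulr_suml.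
rewrite E1 in T; rewrite !E in rl.
have -> : M * (N%:R + 1 + N%:R) * q ^+ 3 = M * q ^+ 2 * (N%:R + 1) * q + N%:R * (M * q) * q ^+ 2 by ring.
apply: le_trans (lerD rl T); apply: le_trans (ler_normD _ _).
rewrite le_eqVlt; apply/orP; left; apply/eqP; congr (`|_|).
move: (trf _ _) (trf _ _) (trf _ _) (trf _ _) (\sum_i _) => a b c d e; clear; ring.
Qed.

Let G0 (i : nat) u : R := \sum_j D i 0 u (lam H' j).
Let F0 (j : nat) v : R := \sum_i D 0 j (lam H i) v.

(** Inclusion-exclusion: the change of both slots is the mixed increment plus the two single
    ones. *)
Let pair_statE : pair_stat f (H + X) (H' + X') - pair_stat f H H' =
  (trf n (H' + X') - trf n H') + (trf (G0 0) (H + X) - trf (G0 0) H) +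
  (trf (F0 0) (H' + X') - trf (F0 0) H').
Proof.
have E1 G : trf (G0 0) G = pair_stat f G H'.
  by apply: eq_bigr => i _; apply: eq_bigr => j _; rewrite f0.
have E2 G : trf (F0 0) G = pair_stat f H G.
  by rewrite /pair_stat exchange_big; apply: eq_bigr => i _; apply: eq_bigr => j _; rewrite f0.
have E3 G : trf n G = pair_stat f (H + X) G - pair_stat f H G.
  by rewrite {1}/trf /n sumrB /pair_stat; congr (_ - _); rewrite exchange_big.
rewrite !E1 !E2 !E3.
move: (pair_stat _ _ _) (pair_stat _ _ _) (pair_stat _ _ _) (pair_stat _ _ _) => a b c d; clear; ring.
Qed.

Definition linear_part : R :=
  \sum_i (\sum_j D 1 0 (lam H i) (lam H' j)) * diag_part H X i +
  \sum_j (\sum_i D 0 1 (lam H i) (lam H' j)) * diag_part H' X' j.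

Definition quadratic_part : R :=
  \sum_k \sum_i sqn (eigenframe H X k i) *
     ddiff2 (fun u => \sum_j D 0 0 u (lam H' j)) (fun u => \sum_j D 1 0 u (lam H' j))
       (fun u => \sum_j D 2 0 u (lam H' j)) (lam H i) (lam H k) +
  \sum_k \sum_j sqn (eigenframe H' X' k j) *
     ddiff2 (fun v => \sum_i D 0 0 (lam H i) v) (fun v => \sum_i D 0 1 (lam H i) v)
       (fun v => \sum_i D 0 2 (lam H i) v) (lam H' j) (lam H' k) +
  \sum_i \sum_j D 1 1 (lam H i) (lam H' j) * diag_part H X i * diag_part H' X' j.

Let assemble (a b c d e l1 l2 k1 k2 k3 x y z : R) :
  `|a - k3| <= x -> `|b - l1 - k1| <= y -> `|c - l2 - k2| <= z -> x + y + z <= d -> e = a + b + c ->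
  `|e - (l1 + l2) - (k1 + k2 + k3)| <= d.
Proof.
move=> h1 h2 h3 h4 ->; apply: le_trans h4; apply: le_trans (lerD (lerD h1 h2) h3).
apply: le_trans _ (lerD (ler_normD _ _) (lexx _)); apply: le_trans _ (ler_normD _ _).
by rewrite le_eqVlt; apply/orP; left; apply/eqP; congr (`|_|); clear; ring.
Qed.

(** The factor N^2 is harmless, as this error enters only through a time step that tends to zero. *)
Lemma pair_stat_expansion :
  `|pair_stat f (H + X) (H' + X') - pair_stat f H H' - linear_part - quadratic_part| <=
  10 * M * (1 + N%:R) ^+ 2 * q ^+ 3.
Proof.
have dG k t : is_derive t (1 : R) (G0 k) (G0 k.+1 t).
  by apply: (is_derive_sum _ (dF := fun j u => D k.+1 0 u (lam H' j))) => j; exact: (tf1 tf).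
have dF k t : is_derive t (1 : R) (F0 k) (F0 k.+1 t).
  by apply: (is_derive_sum _ (dF := fun i v => D 0 k.+1 (lam H i) v)) => i; exact: (tf2 tf).
have bG t : `|G0 3 t| <= N%:R * M.
  by rewrite -[X in X%:R](card_ord N); apply: sum_norm_le => j; exact: (tf_bound tf).
have bF t : `|F0 3 t| <= N%:R * M.
  by rewrite -[X in X%:R](card_ord N); apply: sum_norm_le => j; exact: (tf_bound tf).
have T1 := trf_taylor2 (dG 0%N) (dG 1%N) (dG 2%N) bG hH hX q0 hq.
have T2 := trf_taylor2 (dF 0%N) (dF 1%N) (dF 2%N) bF hH' hX' q0 hq'.
have T3 := mixed_le.
have q3 : 0 <= q ^+ 3 by rewrite exprn_ge0 // ltW.
have N0 : 0 <= N%:R :> R by [].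
rewrite /linear_part /quadratic_part; apply: (assemble T3 T1 T2) pair_statE.
rewrite -!mulrDl ler_wpM2r //.
have M1 := M0; have h1 : 0 <= M * N%:R by exact: mulr_ge0.
have h2 : 0 <= M * N%:R ^+ 2 by rewrite mulr_ge0 ?sqr_ge0.
rewrite -subr_ge0.
have -> : 10 * M * (1 + N%:R) ^+ 2 - (M * (N%:R + 1 + N%:R) + 3 * (N%:R * M) * (1 + N%:R)
   + 3 * (N%:R * M) * (1 + N%:R)) = 9 * M + 12 * (M * N%:R) + 4 * (M * N%:R ^+ 2) by ring.
by rewrite !addr_ge0 // mulr_ge0.
Qed.

End Mixed.

End Expansion.

(** * The quadratic part on the scale of the eigenvalue spacing *)

Section ScaledTestFunction.
Context (R : realType).
Variables (F : R -> R -> R) (M r : R) (D : nat -> nat -> R -> R -> R).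
Hypothesis tf : test_fun F M r D.
Variables (s E : R).
Hypothesis s0 : 0 < s.

Definition rescale (G : R -> R -> R) u v : R := G (s * (u - E)) (s * (v - E)).

Definition rescale_der i j u v : R := s ^+ (i + j) * rescale (D i j) u v.

Lemma is_derive_affine (g g1 : R -> R) c u : (forall t, is_derive t (1 : R) g (g1 t)) ->
  is_derive u (1 : R) (fun u => c * g (s * (u - E))) (c * s * g1 (s * (u - E))).
Proof.
move=> dg; have da : is_derive u (1 : R) (fun u => s * (u - E)) s.
  by apply: is_derive_eq; rewrite /GRing.scale /=; ring.
have dc : is_derive u (1 : R) (g \o (fun u => s * (u - E))) (s * g1 (s * (u - E))).
  have := @is_derive1_comp _ g (fun u => s * (u - E)) u _ _ (dg _) da.
  by rewrite mulrC.
have := @is_deriveZ _ _ _ _ c _ _ _ dc => d.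
by apply: is_derive_eq; rewrite /GRing.scale /= mulrA.
Qed.

(** Only the existence of these constants is used, so their dependence on s stays crude; the
    quantitative estimates return to [D] itself. *)
Lemma rescale_test_fun : exists M' r', test_fun (rescale F) M' r' rescale_der.
Proof.
pose S := Num.max 1 s; have S1 : 1 <= S by rewrite le_max lexx.
have sS : s <= S by rewrite le_max lexx orbT.
have M0 : 0 <= M by exact: le_trans (normr_ge0 _) (@tf_bound _ _ _ _ _ tf 0 0 0 0 isT isT).
have out u : `|E| + r / s < `|u| -> r < `|s * (u - E)|.
  move=> h; rewrite normrM gtr0_norm // mulrC -ltr_pdivrMr //.
  have : `|u| <= `|u - E| + `|E| by rewrite -{1}(subrK E u) ler_normD.
  by lra.
exists (S ^+ 6 * M), (`|E| + r / s); split.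
- by apply/funext => u; apply/funext => v; rewrite /rescale_der mul1r /rescale (tf0 tf).
- move=> i u v; rewrite /rescale_der /rescale !addn0 exprSr.
  apply: (@is_derive_affine (fun u => D i 0 u (s * (v - E))) (fun u => D i.+1 0 u (s * (v - E)))).
  by move=> t; exact: (tf1 tf).
- move=> i j u v; rewrite /rescale_der /rescale addnS exprSr.
  apply: (@is_derive_affine (fun v => D i j (s * (u - E)) v) (fun v => D i j.+1 (s * (u - E)) v)).
  by move=> t; exact: (tf2 tf).
- move=> i j u v i3 j3; rewrite normrM ler_pM ?normr_ge0 //; last exact: (tf_bound tf).
  rewrite normrX gtr0_norm //; apply: (@le_trans _ _ (S ^+ (i + j))).
    by rewrite lerXn2r // ?nnegrE ?(ltW s0) // (le_trans ler01).
  by apply: ler_weXn2l => //; exact: (leq_add i3 j3).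
- by move=> i j u v /out h; rewrite /rescale_der /rescale (tf_out1 tf) ?mulr0.
- by move=> i j u v /out h; rewrite /rescale_der /rescale (tf_out2 tf) ?mulr0.
- by rewrite addr_ge0 // divr_ge0 ?(tf_r tf) // ltW.
Qed.

Lemma ddiff2_rescale (g g1 g2 : R -> R) x y :
  ddiff2 (fun u => g (s * (u - E))) (fun u => s * g1 (s * (u - E)))
    (fun u => s ^+ 2 * g2 (s * (u - E))) x y =
  s ^+ 2 * ddiff2 g g1 g2 (s * (x - E)) (s * (y - E)).
Proof.
rewrite /ddiff2; have sn : s != 0 by rewrite gt_eqF.
have -> : (s * (y - E) == s * (x - E)) = (y == x).
  by rewrite (inj_eq (mulfI sn)) (inj_eq (addIr _)).
case: eqVneq => [_|yx]; first by rewrite mulrA.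
have yx0 : y - x != 0 by rewrite subr_eq0.
have -> : s * (y - E) - s * (x - E) = s * (y - x) by ring.
by field; rewrite sn yx0.
Qed.

Lemma ddiff2_sum (I : finType) (g g1 g2 : I -> R -> R) x y :
  ddiff2 (fun u => \sum_j g j u) (fun u => \sum_j g1 j u) (fun u => \sum_j g2 j u) x y =
  \sum_j ddiff2 (g j) (g1 j) (g2 j) x y.
Proof.
rewrite /ddiff2; case: eqP => _; first by rewrite mulr_suml.
by rewrite -mulr_suml; congr (_ * _); rewrite mulr_suml -!sumrB.
Qed.

End ScaledTestFunction.

Section KernelSums.
Context (R : realType) (N : nat).
Local Notation C := R[i].
Variables (F : R -> R -> R) (M r : R) (D : nat -> nat -> R -> R -> R).
Hypothesis tf : test_fun F M r D.
Variables (s E : R).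
Hypothesis s0 : 0 < s.
Implicit Types (H : 'M[C]_N).

Definition near_count H : R := \sum_i (`|s * (lam H i - E)| <= r)%R%:R.
Definition decay_sum H : R := \sum_i (1 + `|s * (lam H i - E)|)^-1.

Lemma near_count_ge0 H : 0 <= near_count H.
Proof. by apply: sumr_ge0 => i _; exact: ler0n. Qed.

Lemma decay_sum_ge0 H : 0 <= decay_sum H.
Proof. by apply: sumr_ge0 => i _; rewrite invr_ge0 addr_ge0. Qed.

Let M0 : 0 <= M. Proof. exact: le_trans (normr_ge0 _) (@tf_bound _ _ _ _ _ tf 0 0 0 0 isT isT). Qed.
Let r0 := tf_r tf.

(** The kernel bound factorises: one eigenvalue is near E and the other is weighted by its inverse
    distance, so the double sum becomes a product. *)
Lemma ddiff2_sum_le H (g g1 g2 : R -> R) (c : R) :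
  (forall t : R, is_derive t (1 : R) g (g1 t)) -> (forall t : R, is_derive t (1 : R) g1 (g2 t)) ->
  (forall t, `|g t| <= c) -> (forall t, `|g1 t| <= c) -> (forall t, `|g2 t| <= c) ->
  (forall t, r < `|t| -> g t = 0 /\ g1 t = 0 /\ g2 t = 0) ->
  \sum_k \sum_i `|ddiff2 (fun u => g (s * (u - E))) (fun u => s * g1 (s * (u - E)))
    (fun u => s ^+ 2 * g2 (s * (u - E))) (lam H i) (lam H k)| <=
  s ^+ 2 * (12 * c * (1 + r)) * (near_count H * decay_sum H).
Proof.
move=> d1 d2 b0 b1 b2 out.
pose a i : R := (`|s * (lam H i - E)| <= r)%R%:R; pose w i := (1 + `|s * (lam H i - E)|)^-1.
apply: (@le_trans _ _ (\sum_k \sum_i s ^+ 2 * (6 * c * (1 + r)) * (a i * w k + a k * w i))).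
  apply: ler_sum => k _; apply: ler_sum => i _.
  rewrite (ddiff2_rescale _ s0) normrM (ger0_norm (sqr_ge0 s)) -mulrA ler_wpM2l ?sqr_ge0 //.
  exact: ddiff2_kernel_le.
have E1 : \sum_k \sum_i a i * w k = near_count H * decay_sum H.
  rewrite /near_count /decay_sum mulr_sumr; apply: eq_bigr => k _; rewrite mulr_suml //.
have E2 : \sum_k \sum_i a k * w i = near_count H * decay_sum H.
  by rewrite exchange_big E1.
under eq_bigr do rewrite -mulr_sumr big_split.
rewrite -mulr_sumr big_split /= E1 E2 le_eqVlt; apply/orP; left; apply/eqP; ring.
Qed.

Let f := rescale s E F.
Let Df := rescale_der D s E.

Lemma quad_kernel1_le H H' :
  \sum_k \sum_i `|ddiff2 (fun u => \sum_j Df 0 0 u (lam H' j)) (fun u => \sum_j Df 1 0 u (lam H' j))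
       (fun u => \sum_j Df 2 0 u (lam H' j)) (lam H i) (lam H k)| <=
  s ^+ 2 * (12 * M * (1 + r)) * (near_count H * near_count H' * decay_sum H).
Proof.
pose T j := \sum_k \sum_i `|ddiff2 (fun u => Df 0 0 u (lam H' j)) (fun u => Df 1 0 u (lam H' j))
       (fun u => Df 2 0 u (lam H' j)) (lam H i) (lam H k)|.
apply: (@le_trans _ _ (\sum_j T j)).
  rewrite /T [leRHS]exchange_big; apply: ler_sum => k _ /=.
  rewrite [leRHS]exchange_big; apply: ler_sum => i _ /=.
  by rewrite ddiff2_sum ler_norm_sum.
have -> : s ^+ 2 * (12 * M * (1 + r)) * (near_count H * near_count H' * decay_sum H) =
  \sum_j s ^+ 2 * (12 * (M * (`|s * (lam H' j - E)| <= r)%R%:R) * (1 + r)) * (near_count H * decay_sum H).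
  rewrite /near_count -mulr_suml; move: (\sum_i _) (decay_sum H) => x y.
  rewrite -mulr_sumr -!mulr_suml -!mulr_sumr; ring.
apply: ler_sum => j _; set v := s * (lam H' j - E).
have E0 t : Df 0 0 t (lam H' j) = D 0 0 (s * (t - E)) v by rewrite /Df /rescale_der mul1r.
have E1 t : Df 1 0 t (lam H' j) = s * D 1 0 (s * (t - E)) v by rewrite /Df /rescale_der expr1.
have E2 t : Df 2 0 t (lam H' j) = s ^+ 2 * D 2 0 (s * (t - E)) v by [].
have bnd k t : (k <= 3)%N -> `|D k 0 t v| <= M * (`|v| <= r)%R%:R.
  move=> k3; have [_|h] := leP `|v| r; first by rewrite mulr1 (tf_bound tf).
  by rewrite (tf_out2 tf) // normr0 mulr0.
rewrite /T (_ : (fun u => Df 0 0 u (lam H' j)) = fun u => D 0 0 (s * (u - E)) v); last exact/funext.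
rewrite (_ : (fun u => Df 1 0 u (lam H' j)) = fun u => s * D 1 0 (s * (u - E)) v); last exact/funext.
rewrite (_ : (fun u => Df 2 0 u (lam H' j)) = fun u => s ^+ 2 * D 2 0 (s * (u - E)) v); last exact/funext.
apply: (@ddiff2_sum_le H (fun t => D 0 0 t v) (fun t => D 1 0 t v) (fun t => D 2 0 t v)).
- by move=> t; exact: (tf1 tf).
- by move=> t; exact: (tf1 tf).
- by move=> t; exact: bnd.
- by move=> t; exact: bnd.
- by move=> t; exact: bnd.
- by move=> t ht; rewrite !(tf_out1 tf).
Qed.

Lemma quad_kernel2_le H H' :
  \sum_k \sum_j `|ddiff2 (fun v => \sum_i Df 0 0 (lam H i) v) (fun v => \sum_i Df 0 1 (lam H i) v)
       (fun v => \sum_i Df 0 2 (lam H i) v) (lam H' j) (lam H' k)| <=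
  s ^+ 2 * (12 * M * (1 + r)) * (near_count H * near_count H' * decay_sum H').
Proof.
pose T j := \sum_k \sum_i `|ddiff2 (fun u => Df 0 0 (lam H j) u) (fun u => Df 0 1 (lam H j) u)
       (fun u => Df 0 2 (lam H j) u) (lam H' i) (lam H' k)|.
apply: (@le_trans _ _ (\sum_j T j)).
  rewrite /T [leRHS]exchange_big; apply: ler_sum => k _ /=.
  rewrite [leRHS]exchange_big; apply: ler_sum => i _ /=.
  by rewrite ddiff2_sum ler_norm_sum.
have -> : s ^+ 2 * (12 * M * (1 + r)) * (near_count H * near_count H' * decay_sum H') =
  \sum_j s ^+ 2 * (12 * (M * (`|s * (lam H j - E)| <= r)%R%:R) * (1 + r)) * (near_count H' * decay_sum H').
  rewrite [near_count H]/near_count -mulr_suml; move: (near_count H') (decay_sum H') => x y.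
  rewrite -mulr_sumr -!mulr_suml -!mulr_sumr; ring.
apply: ler_sum => j _; set v := s * (lam H j - E).
have E0 t : Df 0 0 (lam H j) t = D 0 0 v (s * (t - E)) by rewrite /Df /rescale_der mul1r.
have E1 t : Df 0 1 (lam H j) t = s * D 0 1 v (s * (t - E)) by rewrite /Df /rescale_der expr1.
have bnd k t : (k <= 3)%N -> `|D 0 k v t| <= M * (`|v| <= r)%R%:R.
  move=> k3; have [_|h] := leP `|v| r; first by rewrite mulr1 (tf_bound tf).
  by rewrite (tf_out1 tf) // normr0 mulr0.
rewrite /T (_ : (fun u => Df 0 0 (lam H j) u) = fun u => D 0 0 v (s * (u - E))); last exact/funext.
rewrite (_ : (fun u => Df 0 1 (lam H j) u) = fun u => s * D 0 1 v (s * (u - E))); last exact/funext.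
rewrite (_ : (fun u => Df 0 2 (lam H j) u) = fun u => s ^+ 2 * D 0 2 v (s * (u - E))); last exact/funext.
apply: (@ddiff2_sum_le H' (fun t => D 0 0 v t) (fun t => D 0 1 v t) (fun t => D 0 2 v t)).
- by move=> t; exact: (tf2 tf).
- by move=> t; exact: (tf2 tf).
- by move=> t; exact: bnd.
- by move=> t; exact: bnd.
- by move=> t; exact: bnd.
- by move=> t ht; rewrite !(tf_out2 tf).
Qed.

Lemma mixed_kernel_le H H' :
  \sum_i \sum_j `|Df 1 1 (lam H i) (lam H' j)| <= s ^+ 2 * M * (near_count H * near_count H').
Proof.
rewrite /near_count mulr_suml mulr_sumr; apply: ler_sum => i _.
rewrite mulr_sumr mulr_sumr; apply: ler_sum => j _.
rewrite normrM (ger0_norm (sqr_ge0 s)) -mulrA ler_wpM2l ?sqr_ge0 // /rescale.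
have [h|h] := leP `|s * (lam H i - E)| r; last by rewrite (tf_out1 tf) // normr0 mul0r mulr0.
have [h'|h'] := leP `|s * (lam H' j - E)| r; last by rewrite (tf_out2 tf) // normr0 !mulr0.
by rewrite !mulr1 (tf_bound tf).
Qed.

Variable eta : R.
Hypotheses (eta0 : 0 < eta) (eta_r : r <= s * eta) (eta_1 : 1 <= s * eta).

(** Windows at distance j eta on both sides of E, weighted with the decay of the kernel there; the
    harmonic weights cost only a logarithm. *)
Definition ladder (x : 'M[C]_N) : R :=
  \sum_(j < N.+1) (1 + j%:R)^-1 * (cnt (E + j%:R * eta) eta x + cnt (E - j%:R * eta) eta x).

Lemma near_count_le (x : 'M[C]_N) : near_count (hermpart x) <= cnt E eta x.
Proof.
apply: ler_sum => i _; set u := lam _ i.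
have [h|_] := leP `|s * (u - E)| r; last by case/andP: (hat_itv E eta u).
rewrite hat_eq1 // -(ler_pM2l s0); apply: le_trans eta_r.
by rewrite -[X in X * _](gtr0_norm s0) -normrM.
Qed.

(** The rung covering u is the integer part of |u - E|/eta. A point beyond the last rung contributes
    at most 1/N, hence all of them at most 1 in [decay_sum_le]. *)
Lemma decay_le_ladder u : (0 < N)%N -> (1 + `|s * (u - E)|)^-1 <=
  N%:R^-1 + \sum_(j < N.+1) (1 + j%:R)^-1 * (hat (E + j%:R * eta) eta u + hat (E - j%:R * eta) eta u).
Proof.
move=> N0; have N1 : 0 < N%:R :> R by rewrite ltr0n.
have bp E' : 0 <= hat E' eta u by case/andP: (hat_itv E' eta u).
have ip (j : nat) : 0 <= (1 + j%:R)^-1 :> R by rewrite invr_ge0 addr_ge0.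
have sum0 : 0 <= \sum_(j < N.+1) (1 + j%:R)^-1 * (hat (E + j%:R * eta) eta u + hat (E - j%:R * eta) eta u).
  by apply: sumr_ge0 => j _; rewrite mulr_ge0 ?addr_ge0.
pose z := `|u - E| / eta; have z0 : 0 <= z by rewrite divr_ge0 // ltW.
pose m := Num.truncn z; have /andP[m1 m2] := truncn_itv z0.
rewrite -/m in m1 m2.
have hm : m%:R <= `|s * (u - E)|.
  apply: (le_trans m1); rewrite /z ler_pdivrMr // normrM (gtr0_norm s0) mulrAC.
  by rewrite ler_peMl.
have mN : (1 + `|s * (u - E)|)^-1 <= (1 + m%:R)^-1.
  by rewrite lef_pV2 ?posrE ?lerD2l // ltr_pwDl.
have [le_mN|lt_Nm] := leqP m N; last first.
  have q : N%:R <= 1 + m%:R :> R by apply: ler_wpDl => //; rewrite ler_nat ltnW.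
  by apply: ler_wpDr => //; apply: (le_trans mN); rewrite lef_pV2 // posrE (lt_le_trans N1 q).
apply: ler_wpDl; first by rewrite invr_ge0 ltW.
apply: (le_trans mN); rewrite -ltnS in le_mN.
rewrite (bigD1 (Ordinal le_mN)) //=; apply: ler_wpDr.
  by apply: sumr_ge0 => j _; rewrite mulr_ge0 ?addr_ge0.
rewrite ler_peMr //.
have m1' : m%:R * eta <= `|u - E| by rewrite -ler_pdivlMr.
have m2' : `|u - E| <= m%:R * eta + eta.
  have -> : m%:R * eta + eta = m.+1%:R * eta by rewrite -natr1 mulrDl mul1r.
  by rewrite -ler_pdivrMr // ltW.
have [uE|uE] := leP 0 (u - E).
  rewrite (ger0_norm uE) in m1' m2'.
  by rewrite hat_eq1 ?lerDl //  ler_norml; apply/andP; split; lra.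
rewrite (ltr0_norm uE) in m1' m2'.
by rewrite [X in _ + X]hat_eq1 ?lerDr // ler_norml; apply/andP; split; lra.
Qed.

Lemma decay_sum_le (x : 'M[C]_N) : (0 < N)%N -> decay_sum (hermpart x) <= 1 + ladder x.
Proof.
move=> N0; apply: le_trans (ler_sum _ (fun i _ => decay_le_ladder _ N0)) _.
rewrite big_split sumr_const card_ord /= -[_ *+ N]mulr_natl divff ?pnatr_eq0 -?lt0n // lerD2l.
rewrite exchange_big /ladder /cnt /trf le_eqVlt; apply/orP; left; apply/eqP.
by apply: eq_bigr => j _; rewrite -mulr_sumr big_split.
Qed.

Definition drift_bound (x : 'M[C]_N * 'M[C]_N) : R :=
  cnt E eta x.1 * cnt E eta x.2 * (3 + ladder x.1 + ladder x.2).

Lemma kernel_total_le (x : 'M[C]_N * 'M[C]_N) : (0 < N)%N ->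
  forall H H', H = hermpart x.1 -> H' = hermpart x.2 ->
  \sum_k \sum_i `|ddiff2 (fun u => \sum_j Df 0 0 u (lam H' j)) (fun u => \sum_j Df 1 0 u (lam H' j))
       (fun u => \sum_j Df 2 0 u (lam H' j)) (lam H i) (lam H k)| +
  \sum_k \sum_j `|ddiff2 (fun v => \sum_i Df 0 0 (lam H i) v) (fun v => \sum_i Df 0 1 (lam H i) v)
       (fun v => \sum_i Df 0 2 (lam H i) v) (lam H' j) (lam H' k)| +
  \sum_i \sum_j `|Df 1 1 (lam H i) (lam H' j)| <=
  s ^+ 2 * (12 * M * (1 + r)) * drift_bound x.
Proof.
move=> N0 H H' HE HE'.
apply: le_trans (lerD (lerD (quad_kernel1_le H H') (quad_kernel2_le H H')) (mixed_kernel_le H H')) _.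
have c0 := near_count_ge0 H; have c0' := near_count_ge0 H'.
have cM : s ^+ 2 * M <= s ^+ 2 * (12 * M * (1 + r)).
  rewrite ler_wpM2l ?sqr_ge0 //; have := mulr_ge0 M0 r0; have := M0; lra.
have cM0 : 0 <= s ^+ 2 * (12 * M * (1 + r)) by apply: le_trans cM; rewrite mulr_ge0 ?sqr_ge0.
apply: (@le_trans _ _ (s ^+ 2 * (12 * M * (1 + r)) * (near_count H * near_count H' *
   (1 + decay_sum H + decay_sum H')))).
  rewrite !mulrDr mulr1; move: (ler_wpM2r (mulr_ge0 c0 c0') cM).
  by move: (_ * (_ * _ * decay_sum H)) (_ * (_ * _ * decay_sum H')) => p q; lra.
rewrite ler_wpM2l // /drift_bound ler_pM ?mulr_ge0 ?addr_ge0 ?decay_sum_ge0 //.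
  by rewrite HE HE' ler_pM // ?near_count_le ?near_count_ge0.
have -> : 3 + ladder x.1 + ladder x.2 = 1 + (1 + ladder x.1) + (1 + ladder x.2).
  by move: (ladder _) (ladder _) => a b; ring.
by rewrite HE HE'; apply: lerD (lerD (lexx _) (decay_sum_le x.1 N0)) (decay_sum_le x.2 N0).
Qed.

End KernelSums.

(** * Orthogonality of unbounded independent coordinates *)

Section Truncation.
Context (R : realType).
Implicit Types (n x y : R).

(** [convol_indep] needs bounded Lipschitz functions; truncation supplies them, and fourth moments
    control the error. *)
Definition trunc n x : R := Num.max (- n) (Num.min n x).

Lemma trunc_norm n x : 0 <= n -> `|trunc n x| <= n.
Proof.
move=> n0; rewrite ler_norml /trunc le_max lexx /= ge_max ge_min lexx /= andbT.
by rewrite (le_trans _ n0) // oppr_le0.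
Qed.

Lemma trunc0 n : 0 < n -> trunc n 0 = 0.
Proof. by move=> n0; rewrite /trunc min_r ?ltW // max_r // oppr_le0 ltW. Qed.

Lemma trunc_lip n x y : `|trunc n x - trunc n y| <= 1 * `|x - y|.
Proof.
rewrite mul1r; wlog xy : x y / x <= y.
  by move=> h; have [/h//|/ltW/h] := leP x y; rewrite distrC [in leRHS]distrC.
rewrite distrC [leRHS]distrC (ger0_norm (_ : 0 <= y - x)) ?subr_ge0 // /trunc /Num.max /Num.min.
by do ?case: ifP => /=; do ?[move=> /negbT; rewrite -leNgt]; move=> *; rewrite ler_norml; apply/andP; split; lra.
Qed.

Lemma trunc_dist n x : 0 < n -> `|x - trunc n x| <= x ^+ 2 / n.
Proof.
move=> n0; rewrite ler_pdivlMr //.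
have [h|h] := leP `|x| n.
  rewrite /trunc; have := h; rewrite ler_norml => /andP[h1 h2].
  by rewrite min_r // max_r // subrr normr0 mul0r sqr_ge0.
have h1 : `|x - trunc n x| <= `|x|.
  rewrite /trunc; have := h; rewrite ltr_normr => /orP[p|p].
    rewrite min_l ?(ltW p) // max_r; last by lra.
    by rewrite !ger0_norm; lra.
  rewrite min_r; last by lra.
  rewrite max_l; last by lra.
  by rewrite !ler0_norm; lra.
by rewrite -(real_normK (num_real x)) expr2 ler_pM // ltW.
Qed.

Lemma measurable_trunc n : measurable_fun setT (trunc n).
Proof. by apply: continuous_measurable_fun; apply: lip_continuous => x y; exact: trunc_lip. Qed.

End Truncation.

Lemma rect_indep_comp (R : realType) (K : finType) d (T : measurableType d) (P : probability T R)
    (Z : K -> T -> R) (phi : K -> R -> R) :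
  rect_indep P Z -> (forall i, measurable_fun setT (phi i)) ->
  rect_indep P (fun i w => phi i (Z i w)).
Proof.
move=> iZ mphi B mB; apply: (iZ (fun i => phi i @^-1` B i)) => i.
by rewrite -[X in measurable X]setTI; exact: mphi.
Qed.

Section Orthogonality.
Context (R : realType) (K : finType) d (T : measurableType d) (P : probability T R).
Variable Z : K -> T -> R.
Hypothesis mZ : forall i, measurable_fun setT (Z i).
Hypothesis iZ : rect_indep P Z.

Lemma integrable_mul4 (X Y : T -> R) : measurable_fun setT X -> measurable_fun setT Y ->
  P.-integrable setT (EFin \o (fun w => X w ^+ 4)) ->
  P.-integrable setT (EFin \o (fun w => Y w ^+ 4)) ->
  P.-integrable setT (EFin \o (fun w => X w * Y w)).
Proof.
move=> mX mY iX iY.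
apply: (integrableR_le (g := fun w => 1 + (X w ^+ 4 + Y w ^+ 4))).
- exact: measurable_funM.
- move=> w; move: (X w) (Y w) => x y; clear; rewrite ler_norml.
  have := sqr_ge0 (x - y); have := sqr_ge0 (x + y); have := sqr_ge0 (x ^+ 2 - 1); have := sqr_ge0 (y ^+ 2 - 1).
  have -> : x ^+ 4 = (x ^+ 2) ^+ 2 by ring.
  have -> : y ^+ 4 = (y ^+ 2) ^+ 2 by ring.
  move=> *; apply/andP; split; nra.
- by apply: integrableRD; [exact: integrableR_cst|exact: integrableRD].
Qed.

Lemma indep_trunc_mul i j n : i != j -> 0 < n ->
  \int[P]_w (trunc n (Z i w) * trunc n (Z j w)) = \int[P]_w trunc n (Z i w) * \int[P]_w trunc n (Z j w).
Proof.
move=> ij n0.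
(* Placing [Z i] and [Z j] on the two axes of the plane turns the product into one bounded Lipschitz
   observable. *)
pose e (k : K) (t : R) : (R * R)%type := if k == i then (t, 0) else if k == j then (0, t) else (0, 0).
have eD k s t : e k (s + t) = e k s + e k t.
  rewrite /e; case: ifP => _; first by rewrite -[RHS]/(_ + _, _ + _) addr0.
  by case: ifP => _; rewrite -[RHS]/(_ + _, _ + _) addr0.
pose Phi (x : (R * R)%type) := trunc n x.1 * trunc n x.2.
have b1 : bounded_lip e n 1 (fun x => trunc n x.1).
  split => [x|k x t]; first exact/trunc_norm/ltW.
  apply: le_trans (trunc_lip _ _ _) _; rewrite !mul1r /e; case: ifP => _; first by rewrite /= addrC addKr.
  by case: ifP => _; rewrite /= addr0 subrr normr0.
have b2 : bounded_lip e n 1 (fun x => trunc n x.2).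
  split => [x|k x t]; first exact/trunc_norm/ltW.
  apply: le_trans (trunc_lip _ _ _) _; rewrite !mul1r /e; case: ifP => _; first by rewrite /= addr0 subrr normr0.
  by case: ifP => _; rewrite /= ?addr0 ?subrr ?normr0 // addrC addKr.
have bP : bounded_lip e (n * n) (n * 1 + 1 * n) Phi by exact: bounded_lipM.
have us : uniq [:: i; j] by rewrite /= inE ij.
have := convol_indep eD mZ iZ 0 bP us.
have ji : (j == i) = false by rewrite eq_sym (negbTE ij).
have shE w : shifted e Z [:: i; j] Phi 0 w = trunc n (Z i w) * trunc n (Z j w).
  rewrite /shifted big_cons big_cons big_nil /Phi /e eqxx ji eqxx addr0 add0r.
  by rewrite /= add0r addr0.
under eq_Rintegral do rewrite shE.
have it l : P.-integrable setT (EFin \o (fun w => trunc n (Z l w))).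
  apply: (bounded_integrable P (M := n)) => [|w']; last exact/trunc_norm/ltW.
  by apply: measurableT_comp (mZ l); exact: measurable_trunc.
move=> ->; rewrite /= /convol1.
under eq_Rintegral => w _.
  under eq_Rintegral => w' _ do rewrite /Phi /e ji !eqxx /= !add0r !addr0.
  rewrite (RintegralZl _ _ (it j)) // mulrC.
  over.
by rewrite RintegralZl // mulrC.
Qed.

Lemma trunc_mean_le (X : T -> R) n : measurable_fun setT X ->
  P.-integrable setT (EFin \o (fun w => X w ^+ 4)) -> 0 < n ->
  `|\int[P]_w trunc n (X w)| <= \int[P]_w (1 + X w ^+ 4) /\
  (\int[P]_w X w = 0 -> `|\int[P]_w trunc n (X w)| <= \int[P]_w (1 + X w ^+ 4) / n).
Proof.
move=> mX i4 n0.
have mt : measurable_fun setT (fun w => trunc n (X w)).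
  by apply: measurableT_comp mX; exact: measurable_trunc.
have it : P.-integrable setT (EFin \o (fun w => trunc n (X w))).
  by apply: (bounded_integrable P (M := n)) => // w; exact/trunc_norm/ltW.
have i14 : P.-integrable setT (EFin \o (fun w => 1 + X w ^+ 4)).
  by apply: integrableRD => //; exact: integrableR_cst.
have x1 (x : R) : `|x| <= 1 + x ^+ 4 /\ x ^+ 2 <= 1 + x ^+ 4.
  have -> : x ^+ 4 = (x ^+ 2) ^+ 2 by ring.
  have := sqr_ge0 (x - 1); have := sqr_ge0 (x + 1); have := sqr_ge0 (x ^+ 2 - 1); have := sqr_ge0 x.
  by split; [rewrite ler_norml; apply/andP; split|]; nra.
have iX : P.-integrable setT (EFin \o X) by apply: integrableR_le i14 => // w; case: (x1 (X w)).
split=> [|X0].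
  apply: le_trans (le_normr_Rintegral _ _) _ => //; apply: le_Rintegral => //; first exact: integrableR_norm.
  move=> w _; apply: le_trans (proj1 (x1 (X w))); have := trunc_lip n (X w) 0.
  by rewrite trunc0 // !subr0 mul1r.
rewrite -[X in `|X|]subr0 -[X in _ - X]X0 -RintegralB // mulrC -RintegralZl //.
apply: le_trans (le_normr_Rintegral _ _) _ => //; first exact: integrableRB.
apply: le_Rintegral => //; first by apply: integrableR_norm; exact: integrableRB.
  exact: integrableRZ.
move=> w _; rewrite distrC; apply: le_trans (trunc_dist _ n0) _.
rewrite [leRHS]mulrC; apply: ler_wpM2r; first by rewrite invr_ge0 ltW.
by case: (x1 (X w)).
Qed.

(* The truncations absorb the unboundedness: the error is O(1/n). *)
Lemma indep_mul_eq0 i j : i != j -> \int[P]_w Z j w = 0 ->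
  P.-integrable setT (EFin \o (fun w => Z i w ^+ 4)) ->
  P.-integrable setT (EFin \o (fun w => Z j w ^+ 4)) ->
  \int[P]_w (Z i w * Z j w) = 0.
Proof.
move=> ij cj i4 j4.
apply: (@le_inv_nat_eq0 _ _ (\int[P]_w (2 * (1 + (Z i w ^+ 4 + Z j w ^+ 4))) +
  \int[P]_w (1 + Z i w ^+ 4) * \int[P]_w (1 + Z j w ^+ 4))) => k.
have n0 : 0 < k.+1%:R :> R by [].
have mt l : measurable_fun setT (fun w => trunc k.+1%:R (Z l w)).
  by apply: measurableT_comp (mZ l); exact: measurable_trunc.
have it : P.-integrable setT (EFin \o (fun w => trunc k.+1%:R (Z i w) * trunc k.+1%:R (Z j w))).
  apply: (bounded_integrable P (M := k.+1%:R * k.+1%:R)); first exact: measurable_funM.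
  by move=> w; rewrite normrM ler_pM // trunc_norm // ltW.
have iij : P.-integrable setT (EFin \o (fun w => Z i w * Z j w)) by exact: integrable_mul4.
have ig : P.-integrable setT (EFin \o (fun w => 2 * (1 + (Z i w ^+ 4 + Z j w ^+ 4)))).
  by apply: integrableRZ; apply: integrableRD; [exact: integrableR_cst|exact: integrableRD].
have -> : \int[P]_w (Z i w * Z j w) = \int[P]_w (Z i w * Z j w - trunc k.+1%:R (Z i w) * trunc k.+1%:R (Z j w)) +
    \int[P]_w trunc k.+1%:R (Z i w) * \int[P]_w trunc k.+1%:R (Z j w).
  by rewrite -(indep_trunc_mul ij n0) RintegralB // subrK.
rewrite mulrDl; apply: le_trans (ler_normD _ _) _; apply: lerD; last first.
  have [h1 _] := trunc_mean_le (mZ i) i4 n0; have [_ h2] := trunc_mean_le (mZ j) j4 n0.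
  by rewrite normrM -mulrA ler_pM // h2.
apply: le_trans (le_normr_Rintegral _ _) _ => //; first exact: integrableRB.
rewrite mulrC -RintegralZl //; apply: le_Rintegral => //.
- by apply: integrableR_norm; exact: integrableRB.
- exact: integrableRZ.
move=> w _; move: (Z i w) (Z j w) => x y; rewrite [leRHS]mulrC.
have hx := trunc_dist x n0; have hy := trunc_dist y n0.
set c := trunc _ x in hx *; set e := trunc _ y in hy *.
have he : `|e| <= `|y|.
  by have := trunc_lip k.+1%:R y 0; rewrite trunc0 // !subr0 mul1r.
have -> : x * y - c * e = x * (y - e) + (x - c) * e by ring.
apply: le_trans (ler_normD _ _) _; rewrite !normrM.
apply: (@le_trans _ _ (`|x| * (y ^+ 2 / k.+1%:R) + x ^+ 2 / k.+1%:R * `|y|)).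
  by rewrite lerD // ler_pM.
rewrite ler_pdivlMr // mulrDl.
have -> : `|x| * (y ^+ 2 / k.+1%:R) * k.+1%:R = `|x| * y ^+ 2 by field; rewrite gt_eqF.
have -> : x ^+ 2 / k.+1%:R * `|y| * k.+1%:R = x ^+ 2 * `|y| by field; rewrite gt_eqF.
have x2 : x ^+ 2 = `|x| ^+ 2 by rewrite real_normK ?num_real.
have y2 : y ^+ 2 = `|y| ^+ 2 by rewrite real_normK ?num_real.
have -> : x ^+ 4 = (`|x| ^+ 2) ^+ 2 by rewrite -x2; ring.
have -> : y ^+ 4 = (`|y| ^+ 2) ^+ 2 by rewrite -y2; ring.
rewrite x2 y2; move: (normr_ge0 x) (normr_ge0 y); move: (`|x|) (`|y|) => p q p0 q0.
have h1 : p * q ^+ 2 <= 1 + (p ^+ 2) ^+ 2 + (q ^+ 2) ^+ 2.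
  by have := sqr_ge0 (p - q ^+ 2); have := sqr_ge0 (p ^+ 2 - 1); have := sqr_ge0 (q ^+ 2); have := sqr_ge0 (p ^+ 2); nra.
have h2 : p ^+ 2 * q <= 1 + (p ^+ 2) ^+ 2 + (q ^+ 2) ^+ 2.
  by have := sqr_ge0 (q - p ^+ 2); have := sqr_ge0 (q ^+ 2 - 1); have := sqr_ge0 (q ^+ 2); have := sqr_ge0 (p ^+ 2); nra.
lra.
Qed.

Lemma sum_second_moment (s : seq K) (a : K -> R) v : uniq s ->
  (forall i, \int[P]_w Z i w = 0) ->
  (forall i, P.-integrable setT (EFin \o (fun w => Z i w ^+ 4))) ->
  (forall i, \int[P]_w (Z i w * Z i w) <= v) ->
  \int[P]_w ((\sum_(i <- s) a i * Z i w) ^+ 2) <= v * \sum_(i <- s) a i ^+ 2.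
Proof.
move=> us cZ i4 vZ.
have iij i j : P.-integrable setT (EFin \o (fun w => a i * a j * (Z i w * Z j w))).
  by apply: integrableRZ; exact: integrable_mul4.
have -> : \int[P]_w ((\sum_(i <- s) a i * Z i w) ^+ 2) =
  \sum_(i <- s) \sum_(j <- s) \int[P]_w (a i * a j * (Z i w * Z j w)).
  under [RHS]eq_bigr => i _ do rewrite -Rintegral_sum //.
  rewrite -Rintegral_sum; last by move=> i; exact: integrableR_sum.
  apply: eq_Rintegral => w _; rewrite expr2 mulr_suml; apply: eq_bigr => i _.
  by rewrite mulr_sumr; apply: eq_bigr => j _; ring.
rewrite mulr_sumr !big_seq; apply: ler_sum => i is_.
rewrite (bigD1_seq i) //= big1 ?addr0 => [|j ji]; last first.
  by rewrite RintegralZl ?indep_mul_eq0 ?mulr0 // 1?eq_sym //; exact: integrable_mul4.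
rewrite RintegralZl //; last exact: integrable_mul4.
by rewrite -expr2 mulrC ler_wpM2r ?sqr_ge0.
Qed.

End Orthogonality.

Section GaussianCoordinates.
Context (R : realType) d (T : measurableType d) (P : probability T R).

(** The degenerate alternative covers dummy coordinates and vanishing imaginary parts; a common
    upper bound on the variances suffices for the moment estimates. *)
Record gauss_coord (v : R) (Z : T -> R) : Prop := GaussCoord {
  gc_meas : measurable_fun setT Z;
  gc_law : (forall w, Z w = 0) \/
    exists sd : R, [/\ 0 < sd, sd ^+ 2 <= v &
      forall B, measurable B -> P (Z @^-1` B) = normal_prob 0 sd B]
}.

Variables (v : R) (Z : T -> R).
Hypotheses (v0 : 0 <= v) (gc : gauss_coord v Z).

Lemma gc_integrable k : (0 < k)%N -> P.-integrable setT (EFin \o (fun w => Z w ^+ k)).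
Proof.
move=> k0; case: (gc_law gc) => [Z0|[sd [sd0 _ law]]]; last exact: gaussian_integrable (gc_meas gc) sd0 law k.
rewrite (_ : (fun w => Z w ^+ k) = fun _ => 0); first exact: integrableR_cst.
by apply/funext => w; rewrite Z0 expr0n gtn_eqF.
Qed.

Lemma gc_integrable1 : P.-integrable setT (EFin \o Z).
Proof. by apply: eq_integrable (gc_integrable (ltn0Sn 0)). Qed.

Lemma gc_mean0 : \int[P]_w Z w = 0.
Proof.
case: (gc_law gc) => [Z0|[sd [sd0 _ law]]]; last exact: gaussian_mean0 (gc_meas gc) sd0 law.
by under eq_Rintegral do rewrite Z0; exact: Rintegral_prob_cst.
Qed.

Lemma gc_sqr_le : \int[P]_w (Z w * Z w) <= 8 * v.
Proof.
case: (gc_law gc) => [Z0|[sd [sd0 sdv law]]].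
  under eq_Rintegral do rewrite Z0 mulr0; by rewrite Rintegral_prob_cst mulr_ge0.
have h := gaussian_even_moment (gc_meas gc) sd0 law 1.
apply: (@le_trans _ _ ((4 * sd ^+ 2) ^+ 1 * 1`!%:R * 2)).
  rewrite /Rintegral -lee_fin fineK; first exact: h.
  apply: integrable_fin_num => //.
  by apply: eq_integrable (gc_integrable (ltn0Sn 1)) => // w _; rewrite /= expr2.
rewrite expr1 factE /= mulr1; lra.
Qed.

Lemma gc_stable (f : R -> R) (M L a b c : R) : 0 <= a -> 0 <= b -> 0 <= c ->
  c ^+ 2 = a ^+ 2 + b ^+ 2 -> (forall x, `|f x| <= M) ->
  (forall x y, `|f x - f y| <= L * `|x - y|) ->
  \int[P]_w \int[P]_w' f (a * Z w + b * Z w') = \int[P]_w f (c * Z w).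
Proof.
move=> a0 b0 c0 cE bf lf; case: (gc_law gc) => [Z0|[sd [sd0 _ law]]].
  under eq_Rintegral => w _.
    under eq_Rintegral => w' _ do rewrite !Z0 !mulr0 addr0.
    over.
  under [RHS]eq_Rintegral => w _ do rewrite Z0 mulr0.
  by rewrite !Rintegral_prob_cst.
have st := gaussian_stable (gc_meas gc) sd0 law a0 b0 c0 cE.
exact: st _ _ _ bf lf.
Qed.

End GaussianCoordinates.

Section FrameCoefficients.
Context (R : realType) (N : nat).
Local Notation C := R[i].
Local Notation U H := (spectralmx H).
Implicit Types (H X : 'M[C]_N) (p q : 'I_N).

Lemma eigenframeD H X Y : eigenframe H (X + Y) = eigenframe H X + eigenframe H Y.
Proof. by rewrite /eigenframe mulmxDr mulmxDl. Qed.

Lemma eigenframeZ H c X : eigenframe H (c *: X) = c *: eigenframe H X.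
Proof. by rewrite /eigenframe -scalemxAr -scalemxAl. Qed.

Lemma eigenframe_entryD H X Y p q :
  eigenframe H (X + Y) p q = eigenframe H X p q + eigenframe H Y p q.
Proof. by rewrite eigenframeD; move: (eigenframe H X) (eigenframe H Y) => A B; rewrite mxE. Qed.

Lemma eigenframe_entryZ H c X p q : eigenframe H (c *: X) p q = c * eigenframe H X p q.
Proof. by rewrite eigenframeZ; move: (eigenframe H X) => A; rewrite mxE. Qed.

Lemma eigenframe0 H : eigenframe H 0 = 0.
Proof. by rewrite /eigenframe mulmx0 mul0mx. Qed.

Lemma eigenframe_sum H (s : seq (coord_idx N)) (t : coord_idx N -> R) p q :
  eigenframe H (\sum_(k <- s) hstep k (t k)) p q =
  \sum_(k <- s) (t k)%:C * eigenframe H (hbasis R k) p q.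
Proof.
elim: s => [|k s IH]; first by rewrite !big_nil eigenframe0 mxE.
by rewrite !big_cons eigenframe_entryD IH /hstep eigenframe_entryZ.
Qed.

Lemma eigenframe_delta H a b p q :
  eigenframe H (delta_mx a b) p q = U H p a * (U H q b)^*.
Proof.
rewrite /eigenframe -(mul_delta_mx (0 : 'I_1) a b) mulmxA -mulmxA -colE -rowE.
by rewrite mxE big_ord1 !mxE.
Qed.

Let w H p q a b := sqn (U H p a) * sqn (U H q b).

Lemma sqn_frame_basis_le H p q a b c :
  sqn (eigenframe H (hbasis R (a, b, c)) p q) <= 2 * (w H p q a b + w H p q b a).
Proof.
have w0 x y : 0 <= w H p q x y by rewrite mulr_ge0 ?sqn_ge0.
have z : sqn (eigenframe H 0 p q) <= 2 * (w H p q a b + w H p q b a).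
  by rewrite eigenframe0 mxE sqn0 mulr_ge0 // addr_ge0.
have wE x y : sqn (U H p x * (U H q y)^*) = w H p q x y by rewrite sqnM sqn_conj.
rewrite /hbasis; case: eqP => [E|_].
  rewrite -E in z *.
  case: c; last exact: z.
  have waa := w0 a a; rewrite eigenframe_delta wE.
  by move: waa; move: (w _ _ _ _ _) => x; lra.
case: ifP => _; last exact: z.
case: c.
  rewrite eigenframe_entryD !eigenframe_delta; apply: le_trans (sqnD_le _ _) _.
  by rewrite !wE.
rewrite eigenframe_entryZ sqnM sqn_i mul1r -scaleN1r eigenframe_entryD eigenframe_entryZ.
rewrite !eigenframe_delta; apply: le_trans (sqnD_le _ _) _.
by rewrite sqnM sqnN sqn1 mul1r !wE.
Qed.

(** The bound is uniform in N by the normalisation of the two eigenvectors; hence every entry in an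
    eigenframe has a variance of the order of a single coordinate. *)
Lemma sum_sqn_frame_basis H p q : \sum_k sqn (eigenframe H (hbasis R k) p q) <= 8.
Proof.
have one x : \sum_a sqn (U H x a) = 1 by rewrite sum_sqn_row ?spectral_unitarymx.
have E1 : \sum_a \sum_b w H p q a b = 1.
  rewrite /w -[RHS]mulr1 -{1}(one p) -(one q) mulr_suml; apply: eq_bigr => a _.
  by rewrite mulr_sumr.
have E2 : \sum_a \sum_b w H p q b a = 1 by rewrite exchange_big.
apply: (@le_trans _ _ (\sum_a \sum_b \sum_(c : bool) 2 * (w H p q a b + w H p q b a))).
  rewrite pair_bigA pair_bigA /=; apply: ler_sum => -[[a b] c] _ /=.
  exact: sqn_frame_basis_le.
have -> : \sum_a \sum_b \sum_(c : bool) 2 * (w H p q a b + w H p q b a) =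
   4 * (\sum_a \sum_b w H p q a b + \sum_a \sum_b w H p q b a).
  rewrite -big_split mulr_sumr; apply: eq_bigr => a _ /=; rewrite -big_split mulr_sumr.
  by apply: eq_bigr => b _ /=; rewrite big_bool /=; ring.
by rewrite E1 E2; lra.
Qed.

End FrameCoefficients.

Section FrameMoments.
Context (R : realType) (N : nat) d (T : measurableType d) (P : probability T R).
Local Notation C := R[i].
Variables (I : finType) (Z : I * coord_idx N -> T -> R) (v : R).
Hypothesis v0 : 0 <= v.
Hypothesis iZ : rect_indep P Z.
Hypothesis gZ : forall i, gauss_coord P v (Z i).

Definition coord_mx (j : I) (w : T) : 'M[C]_N := \sum_k hstep k (Z (j, k) w).

Lemma coord_mx_herm j w : coord_mx j w \is hermsymmx.
Proof.
apply: (big_ind (fun X => X \is hermsymmx)) => [|X Y hX hY|k _].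
- by apply/hermP; rewrite trmx0 map_mx0.
- exact: hermD.
- exact: hstep_herm.
Qed.

Lemma sum_idx (j : I) (a : coord_idx N -> R) w :
  \sum_k a k * Z (j, k) w = \sum_(i <- [seq (j, k) | k <- enum (coord_idx N)]) a i.2 * Z i w.
Proof. by rewrite big_map big_enum. Qed.

Let mZ i := gc_meas (gZ i).
Let iZ4 i := gc_integrable (gZ i) (ltn0Sn 3).

Lemma linear_form_integrable j (a : coord_idx N -> R) :
  P.-integrable setT (EFin \o (fun w => \sum_k a k * Z (j, k) w)).
Proof. by apply: integrableR_sum => k; apply: integrableRZ; exact: gc_integrable1 (gZ _). Qed.

Lemma linear_form_mean0 j (a : coord_idx N -> R) : \int[P]_w (\sum_k a k * Z (j, k) w) = 0.
Proof.
rewrite Rintegral_sum; last by move=> k; apply: integrableRZ; exact: gc_integrable1 (gZ _).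
rewrite big1 // => k _; rewrite RintegralZl //; last exact: gc_integrable1 (gZ _).
by rewrite (gc_mean0 (gZ _)) mulr0.
Qed.

Lemma linear_form_sqr_integrable j (a : coord_idx N -> R) :
  P.-integrable setT (EFin \o (fun w => (\sum_k a k * Z (j, k) w) ^+ 2)).
Proof.
rewrite (_ : (fun w => _) = fun w => \sum_k \sum_l a k * a l * (Z (j, k) w * Z (j, l) w)); last first.
  apply/funext => w; rewrite expr2 mulr_suml; apply: eq_bigr => k _.
  by rewrite mulr_sumr; apply: eq_bigr => l _; ring.
apply: integrableR_sum => k; apply: integrableR_sum => l; apply: integrableRZ.
exact: integrable_mul4.
Qed.

Lemma linear_form_sqr_le j (a : coord_idx N -> R) :
  \int[P]_w ((\sum_k a k * Z (j, k) w) ^+ 2) <= 8 * v * \sum_k a k ^+ 2.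
Proof.
under eq_Rintegral do rewrite sum_idx.
have -> : \sum_k a k ^+ 2 = \sum_(i <- [seq (j, k) | k <- enum (coord_idx N)]) a i.2 ^+ 2.
  by rewrite big_map big_enum.
apply: (sum_second_moment mZ iZ).
- by rewrite map_inj_uniq ?enum_uniq // => k l [].
- by move=> i; exact: gc_mean0 (gZ i).
- exact: iZ4.
- by move=> i; exact: gc_sqr_le v0 (gZ i).
Qed.

Lemma part_frame b H j w p q : part b (eigenframe H (coord_mx j w) p q) =
  \sum_k part b (eigenframe H (hbasis R k) p q) * Z (j, k) w.
Proof.
rewrite /coord_mx -big_enum eigenframe_sum big_enum /=.
have partS (F : coord_idx N -> C) : part b (\sum_k F k) = \sum_k part b (F k).
  by case: b; rewrite /part raddf_sum.
by rewrite partS; apply: eq_bigr => k _; rewrite partZ mulrC.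
Qed.

Lemma frame_part_integrable b H j p q :
  P.-integrable setT (EFin \o (fun w => part b (eigenframe H (coord_mx j w) p q))).
Proof. by under eq_fun do rewrite part_frame; exact: linear_form_integrable. Qed.

Lemma frame_part_mean0 b H j p q : \int[P]_w part b (eigenframe H (coord_mx j w) p q) = 0.
Proof. by under eq_Rintegral do rewrite part_frame; exact: linear_form_mean0. Qed.

Lemma frame_sqn_integrable H j p q :
  P.-integrable setT (EFin \o (fun w => sqn (eigenframe H (coord_mx j w) p q))).
Proof.
apply: (integrableRD (f := fun w => part true (eigenframe H (coord_mx j w) p q) ^+ 2)
  (g := fun w => part false (eigenframe H (coord_mx j w) p q) ^+ 2)).
- by under eq_fun do rewrite part_frame; exact: linear_form_sqr_integrable.
- by under eq_fun do rewrite part_frame; exact: linear_form_sqr_integrable.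
Qed.

Lemma frame_sqn_le H j p q : \int[P]_w sqn (eigenframe H (coord_mx j w) p q) <= 64 * v.
Proof.
have i2 b : P.-integrable setT (EFin \o (fun w => part b (eigenframe H (coord_mx j w) p q) ^+ 2)).
  by under eq_fun do rewrite part_frame; exact: linear_form_sqr_integrable.
have -> : \int[P]_w sqn (eigenframe H (coord_mx j w) p q) =
  \int[P]_w (part true (eigenframe H (coord_mx j w) p q) ^+ 2) +
  \int[P]_w (part false (eigenframe H (coord_mx j w) p q) ^+ 2) by rewrite -RintegralD.
have le b : \int[P]_w (part b (eigenframe H (coord_mx j w) p q) ^+ 2) <=
   8 * v * \sum_k part b (eigenframe H (hbasis R k) p q) ^+ 2.
  by under eq_Rintegral do rewrite part_frame; exact: linear_form_sqr_le.
apply: le_trans (lerD (le true) (le false)) _; rewrite -mulrDr -big_split /=.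
have -> : 64 * v = 8 * v * 8 by ring.
by rewrite ler_wpM2l ?mulr_ge0 // sum_sqn_frame_basis.
Qed.

End FrameMoments.

Lemma sum_ord_norm_le (R : realType) n (F : 'I_n -> R) M : (forall i, `|F i| <= M) ->
  `|\sum_i F i| <= n%:R * M.
Proof. by move=> h; have := sum_norm_le h; rewrite card_ord. Qed.

Lemma norm3_le (R : realType) (a b c A B C : R) : `|a| <= A -> `|b| <= B -> `|c| <= C ->
  `|a + b + c| <= A + B + C.
Proof.
move=> h1 h2 h3; apply: le_trans (ler_normD _ _) _; apply: lerD => //.
by apply: le_trans (ler_normD _ _) _; apply: lerD.
Qed.

Section PairStatLipschitz.
Context (R : realType) (N : nat).
Local Notation C := R[i].
Variables (f : R -> R -> R) (M r : R) (D : nat -> nat -> R -> R -> R).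
Hypothesis tf : test_fun f M r D.

Let M0 : 0 <= M. Proof. exact: le_trans (normr_ge0 _) (@tf_bound _ _ _ _ _ tf 0 0 0 0 isT isT). Qed.

Lemma pair_stat_bound (H H' : 'M[C]_N) : `|pair_stat f H H'| <= N%:R * (N%:R * M).
Proof.
apply: sum_ord_norm_le => i; apply: sum_ord_norm_le => j.
by have := @tf_bound _ _ _ _ _ tf 0 0 (lam H i) (lam H' j) isT isT; rewrite (tf0 tf).
Qed.

Lemma pair_stat_lip (A B A' B' : 'M[C]_N) t : A \is hermsymmx -> A' \is hermsymmx ->
  B \is hermsymmx -> B' \is hermsymmx -> hs (A' - A) <= 4 * t ^+ 2 -> hs (B' - B) <= 4 * t ^+ 2 ->
  `|pair_stat f A' B' - pair_stat f A B| <= N%:R * (2 * (M * (N%:R + 4))) * `|t|.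
Proof.
move=> hA hA' hB hB' hAA hBB.
have lu v x y : `|f x v - f y v| <= M * `|x - y|.
  rewrite -(tf0 tf); apply: (@derive_bound_lip _ (fun u => D 0 0 u v) (fun u => D 1 0 u v)) => u.
    exact: (tf1 tf).
  exact: (tf_bound tf).
have lv u x y : `|f u x - f u y| <= M * `|x - y|.
  rewrite -(tf0 tf); apply: (@derive_bound_lip _ (fun v => D 0 0 u v) (fun v => D 0 1 u v)) => v.
    exact: (tf2 tf).
  exact: (tf_bound tf).
have -> : pair_stat f A' B' - pair_stat f A B =
   \sum_j (trf (f^~ (lam B' j)) A' - trf (f^~ (lam B' j)) A) +
   \sum_i (trf (f (lam A i)) B' - trf (f (lam A i)) B).
  rewrite !sumrB /trf /pair_stat [X in X - _ + _]exchange_big [X in _ - X + _]exchange_big.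
  by rewrite addrA subrK.
apply: le_trans (ler_normD _ _) _.
have -> : N%:R * (2 * (M * (N%:R + 4))) * `|t| = N%:R * (M * (N%:R + 4) * `|t|) + N%:R * (M * (N%:R + 4) * `|t|) by ring.
by apply: lerD; apply: sum_ord_norm_le => j; apply: trf_lip.
Qed.

End PairStatLipschitz.

Section OneStep.
Context (R : realType) (N : nat) d (T : measurableType d) (P : probability T R).
Local Notation C := R[i].
Local Notation GK := ((bool * coord_idx N)%type : finType).
Variables (f : R -> R -> R) (M r : R) (D : nat -> nat -> R -> R -> R).
Hypothesis tf : test_fun f M r D.
Variable b : bool.

(* For b = true both slots are moved by the first family, for b = false by independent ones. *)
Definition gstep (i : GK) (t : R) : ('M[C]_N * 'M[C]_N)%type :=
  (if i.1 then hstep i.2 t else 0, if i.1 == b then hstep i.2 t else 0).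

Lemma gstepD i s t : gstep i (s + t) = gstep i s + gstep i t.
Proof.
rewrite /gstep -[RHS]/(_ + _, _ + _) hstepD.
by congr (_, _); case: ifP => // _; rewrite addr0.
Qed.

Definition pair_obs (x : 'M[C]_N * 'M[C]_N) : R := pair_stat f (hermpart x.1) (hermpart x.2).

Lemma pair_obs_bounded_lip : bounded_lip gstep (N%:R * (N%:R * M)) (N%:R * (2 * (M * (N%:R + 4)))) pair_obs.
Proof.
split => [x|[c k] [x1 x2] t]; first exact: (pair_stat_bound tf).
have e (c' : bool) y : hs (hermpart (y + (if c' then hstep k t else 0)) - hermpart y) <= 4 * t ^+ 2.
  rewrite hermpartD addrC addKr; case: c'; first by rewrite (hermpart_id (hstep_herm k t)) hs_step.
  have -> : hermpart (0 : 'M[C]_N) = 0 by apply/hermpart_id/hermP; rewrite trmx0 map_mx0.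
  have -> : hs (0 : 'M[C]_N) = 0 by rewrite /hs big1 // => i _; rewrite big1 // => j _; rewrite mxE sqn0.
  by apply: mulr_ge0 => //; exact: sqr_ge0.
by apply: (pair_stat_lip tf); try exact: hermpart_herm; exact: e.
Qed.

Variables (g : GK -> T -> R) (v : R).
Hypothesis v0 : 0 <= v.
Hypothesis ig : rect_indep P g.
Hypothesis gg : forall i, gauss_coord P v (g i).

Let mg i := gc_meas (gg i).
Let M0 : 0 <= M. Proof. exact: le_trans (normr_ge0 _) (@tf_bound _ _ _ _ _ tf 0 0 0 0 isT isT). Qed.

Lemma hs_sum_le (s : seq (coord_idx N)) (F : coord_idx N -> 'M[C]_N) :
  hs (\sum_(k <- s) F k) <= 2 ^+ size s * \sum_(k <- s) hs (F k).
Proof.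
elim: s => [|k s IH].
  by rewrite !big_nil mulr0 /hs big1 // => i _; rewrite big1 // => j _; rewrite mxE sqn0.
rewrite !big_cons /= exprS -mulrA; apply: le_trans (hsD_le _ _) _; rewrite ler_wpM2l // mulrDr.
by rewrite lerD // ler_peMl ?hs_ge0 // exprn_ege1 // ler1n.
Qed.

(** A crude random bound on the perturbation, exponentially large in the number of coordinates; only
    the finiteness of its third moment is used. *)
Definition size_bound w : R := 1 + 2 ^+ size (enum (coord_idx N)) * (4 * \sum_i g i w ^+ 2).

Lemma size_bound_ge1 w : 1 <= size_bound w.
Proof.
rewrite lerDl mulr_ge0 ?exprn_ge0 // mulr_ge0 //.
by apply: sumr_ge0 => i _; exact: sqr_ge0.
Qed.

Lemma hs_coord_mx_le c w : hs (coord_mx g c w) <= size_bound w ^+ 2.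
Proof.
have s1 := size_bound_ge1 w.
apply: (@le_trans _ _ (size_bound w)); last by rewrite expr2 ler_peMl // (le_trans ler01).
rewrite /coord_mx -big_enum; apply: le_trans (hs_sum_le _ _) _.
rewrite /size_bound; apply: ler_wpDl => //; rewrite ler_wpM2l ?exprn_ge0 //.
apply: (@le_trans _ _ (\sum_(k : coord_idx N) 4 * g (c, k) w ^+ 2)).
  by rewrite big_enum; apply: ler_sum => k _; exact: hs_step.
rewrite -mulr_sumr ler_wpM2l //.
have -> : \sum_i g i w ^+ 2 = \sum_c \sum_k g (c, k) w ^+ 2 by rewrite pair_bigA; apply: eq_bigr => -[].
rewrite big_bool /=; case: (c); rewrite ?lerDl ?lerDr; apply: sumr_ge0 => i _; exact: sqr_ge0.
Qed.

Lemma sum_cube_le (I : Type) (s : seq I) (y : I -> R) : (forall i, 0 <= y i) ->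
  (\sum_(i <- s) y i) ^+ 3 <= 4 ^+ size s * \sum_(i <- s) y i ^+ 3.
Proof.
move=> y0; elim: s => [|i s IH]; first by rewrite !big_nil mulr0 expr0n.
have -> : 4 ^+ size (i :: s) = 4 * 4 ^+ size s :> R by rewrite -exprS.
rewrite !big_cons -mulrA; set S := \sum_(j <- s) y j in IH *.
have S0 : 0 <= S by apply: sumr_ge0.
set S3 := \sum_(j <- s) y j ^+ 3 in IH *.
have h : (y i + S) ^+ 3 <= 4 * (y i ^+ 3 + S ^+ 3).
  rewrite -subr_ge0.
  have -> : 4 * (y i ^+ 3 + S ^+ 3) - (y i + S) ^+ 3 = 3 * ((y i + S) * (y i - S) ^+ 2) by ring.
  by rewrite mulr_ge0 // mulr_ge0 ?addr_ge0 ?sqr_ge0.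
apply: (le_trans h); rewrite ler_wpM2l // mulrDr lerD //.
by rewrite ler_peMl ?exprn_ge0 // exprn_ege1 // ler1n.
Qed.

Lemma size_bound_cube_integrable : P.-integrable setT (EFin \o (fun w => size_bound w ^+ 3)).
Proof.
pose c : R := 2 ^+ size (enum (coord_idx N)) * 4.
have c0 : 0 <= c by rewrite mulr_ge0 ?exprn_ge0.
pose s := index_enum GK.
apply: (integrableR_le (g := fun w => 4 * (1 + c ^+ 3 * (4 ^+ size s * \sum_(i <- s) g i w ^+ 6)))).
- apply: measurable_funX; apply: measurable_funD => //; apply: measurable_funM => //.
  apply: measurable_funM => //; apply: measurable_sum => i; exact: measurable_funX.
- move=> w; have s1 := size_bound_ge1 w.
  rewrite ger0_norm ?exprn_ge0 ?(le_trans ler01) //.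
  have S0 : 0 <= \sum_(i <- s) g i w ^+ 2 by apply: sumr_ge0 => i _; exact: sqr_ge0.
  have h := sum_cube_le s (fun i => sqr_ge0 (g i w)).
  have e6 : \sum_(i <- s) (g i w ^+ 2) ^+ 3 = \sum_(i <- s) g i w ^+ 6.
    by apply: eq_bigr => i _; rewrite -exprM.
  rewrite e6 in h; rewrite /size_bound mulrA -/c.
  set S := \sum_(i <- s) g i w ^+ 2 in S0 h *.
  have cS : 0 <= c * S by exact: mulr_ge0.
  apply: (@le_trans _ _ (4 * (1 + (c * S) ^+ 3))).
    move: cS; move: (c * S) => y y0; rewrite -subr_ge0.
    have -> : 4 * (1 + y ^+ 3) - (1 + y) ^+ 3 = 3 * ((1 + y) * (1 - y) ^+ 2) by ring.
    by rewrite mulr_ge0 // mulr_ge0 ?addr_ge0 ?sqr_ge0.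
  by rewrite ler_wpM2l // lerD2l exprMn ler_wpM2l ?exprn_ge0.
- apply: integrableRZ; apply: integrableRD; first exact: integrableR_cst.
  apply: integrableRZ; apply: integrableRZ.
  by apply: integrableR_sum => i; exact: (gc_integrable (gg i) (ltn0Sn 5)).
Qed.

Variable x : ('M[C]_N * 'M[C]_N)%type.
Let H := hermpart x.1.
Let H' := hermpart x.2.

Definition kernel_sum : R :=
  \sum_k \sum_i `|ddiff2 (fun u => \sum_j D 0 0 u (lam H' j)) (fun u => \sum_j D 1 0 u (lam H' j))
       (fun u => \sum_j D 2 0 u (lam H' j)) (lam H i) (lam H k)| +
  \sum_k \sum_j `|ddiff2 (fun v => \sum_i D 0 0 (lam H i) v) (fun v => \sum_i D 0 1 (lam H i) v)
       (fun v => \sum_i D 0 2 (lam H i) v) (lam H' j) (lam H' k)| +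
  \sum_i \sum_j `|D 1 1 (lam H i) (lam H' j)|.

Variable sg : R.
Hypothesis sg0 : 0 < sg.

Let X w := sg%:C *: coord_mx g true w.
Let X' w := sg%:C *: coord_mx g b w.

Let diag_partE c (G : 'M[C]_N) w i :
  diag_part G (sg%:C *: coord_mx g c w) i = sg * part true (eigenframe G (coord_mx g c w) i i).
Proof. by rewrite /diag_part eigenframe_entryZ -[complex.Re _]/(part true _) partZ. Qed.

Let frameE c (G : 'M[C]_N) w k i :
  sqn (eigenframe G (sg%:C *: coord_mx g c w) k i) = sg ^+ 2 * sqn (eigenframe G (coord_mx g c w) k i).
Proof. by rewrite eigenframe_entryZ sqnM sqn_real. Qed.

Let lin w := linear_part D H H' (X w) (X' w).
Let quad w := quadratic_part D H H' (X w) (X' w).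

Let lin_half c (G : 'M[C]_N) (a : 'I_N -> R) :
  P.-integrable setT (EFin \o (fun w => \sum_i a i * diag_part G (sg%:C *: coord_mx g c w) i)) /\
  \int[P]_w (\sum_i a i * diag_part G (sg%:C *: coord_mx g c w) i) = 0.
Proof.
have ii i : P.-integrable setT (EFin \o (fun w => a i * diag_part G (sg%:C *: coord_mx g c w) i)).
  under eq_fun do rewrite diag_partE.
  by do 2 apply: integrableRZ; exact: frame_part_integrable.
split; first exact: integrableR_sum.
rewrite Rintegral_sum // big1 // => i _.
under eq_Rintegral do rewrite diag_partE mulrA.
rewrite RintegralZl //; last exact: (frame_part_integrable gg true).
by rewrite (frame_part_mean0 gg true) mulr0.
Qed.

Let lin_int : P.-integrable setT (EFin \o lin).
Proof.
have [h1 _] := lin_half true H (fun i => \sum_j D 1 0 (lam H i) (lam H' j)).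
have [h2 _] := lin_half b H' (fun j => \sum_i D 0 1 (lam H i) (lam H' j)).
exact: integrableRD h1 h2.
Qed.

Let lin_mean : \int[P]_w lin w = 0.
Proof.
have [h1 e1] := lin_half true H (fun i => \sum_j D 1 0 (lam H i) (lam H' j)).
have [h2 e2] := lin_half b H' (fun j => \sum_i D 0 1 (lam H i) (lam H' j)).
rewrite /lin /linear_part (RintegralD measurableT h1 h2).
by apply: etrans (congr2 +%R e1 e2) _; rewrite addr0.
Qed.

Let quad_half c (G : 'M[C]_N) (h : 'I_N -> 'I_N -> R) :
  P.-integrable setT (EFin \o (fun w => \sum_k \sum_i sqn (eigenframe G (sg%:C *: coord_mx g c w) k i) * h k i)) /\
  `|\int[P]_w (\sum_k \sum_i sqn (eigenframe G (sg%:C *: coord_mx g c w) k i) * h k i)| <=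
   sg ^+ 2 * (64 * v) * \sum_k \sum_i `|h k i|.
Proof.
have ii k i : P.-integrable setT (EFin \o (fun w => sqn (eigenframe G (sg%:C *: coord_mx g c w) k i) * h k i)).
  under eq_fun do rewrite frameE mulrC.
  by do 2 apply: integrableRZ; exact: frame_sqn_integrable.
split; first by apply: integrableR_sum => k; exact: integrableR_sum.
rewrite Rintegral_sum; last by move=> k; exact: integrableR_sum.
rewrite mulr_sumr; apply: le_trans (ler_norm_sum _ _ _) _; apply: ler_sum => k _.
rewrite Rintegral_sum // mulr_sumr; apply: le_trans (ler_norm_sum _ _ _) _; apply: ler_sum => i _.
under eq_Rintegral do rewrite frameE mulrC mulrA.
rewrite RintegralZl //; last exact: frame_sqn_integrable.
have p0 : 0 <= \int[P]_w sqn (eigenframe G (coord_mx g c w) k i).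
  by apply: Rintegral_ge0 => w _; exact: sqn_ge0.
rewrite normrM normrM (ger0_norm (sqr_ge0 sg)) (ger0_norm p0).
have -> : sg ^+ 2 * (64 * v) * `|h k i| = `|h k i| * sg ^+ 2 * (64 * v) by ring.
apply: ler_wpM2l; last exact: frame_sqn_le.
by apply: mulr_ge0; [exact: normr_ge0|exact: sqr_ge0].
Qed.

(** The product of two diagonal entries is bounded by the mean of their squares, so the same
    argument covers independent and identical perturbations. *)
Let mixed_half (h : 'I_N -> 'I_N -> R) :
  P.-integrable setT (EFin \o (fun w => \sum_i \sum_j h i j * diag_part H (X w) i * diag_part H' (X' w) j)) /\
  `|\int[P]_w (\sum_i \sum_j h i j * diag_part H (X w) i * diag_part H' (X' w) j)| <=
   sg ^+ 2 * (64 * v) * \sum_i \sum_j `|h i j|.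
Proof.
pose u i w := part true (eigenframe H (coord_mx g true w) i i).
pose u' j w := part true (eigenframe H' (coord_mx g b w) j j).
have E i j w : h i j * diag_part H (X w) i * diag_part H' (X' w) j = (h i j * sg ^+ 2) * (u i w * u' j w).
  by rewrite !diag_partE -/(u i w) -/(u' j w); ring.
pose q i j w := sqn (eigenframe H (coord_mx g true w) i i) + sqn (eigenframe H' (coord_mx g b w) j j).
have iq i j : P.-integrable setT (EFin \o (fun w => 2^-1 * q i j w)).
  by apply: integrableRZ; apply: integrableRD; exact: frame_sqn_integrable.
have uq i j w : `|u i w * u' j w| <= 2^-1 * q i j w.
  rewrite /q /sqn -/(u i w) -/(u' j w).
  have := sqr_ge0 (complex.Im (eigenframe H (coord_mx g true w) i i)).
  have := sqr_ge0 (complex.Im (eigenframe H' (coord_mx g b w) j j)).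
  rewrite -[complex.Re (eigenframe H _ _ _)]/(u i w) -[complex.Re (eigenframe H' _ _ _)]/(u' j w).
  move: (u i w) (u' j w) (_ ^+ 2) (_ ^+ 2) => y z p1 p2 hp1 hp2.
  by have := sqr_ge0 (y - z); have := sqr_ge0 (y + z); rewrite ler_norml => *; apply/andP; split; nra.
have mu i : measurable_fun setT (u i).
  by have /integrableP[/measurable_EFinP] := frame_part_integrable gg true H true i i.
have mu' j : measurable_fun setT (u' j).
  by have /integrableP[/measurable_EFinP] := frame_part_integrable gg true H' b j j.
have iu i j : P.-integrable setT (EFin \o (fun w => u i w * u' j w)).
  by apply: (integrableR_le (measurable_funM (mu i) (mu' j)) _ (iq i j)) => w; exact: uq.
have ii i j : P.-integrable setT (EFin \o (fun w => h i j * diag_part H (X w) i * diag_part H' (X' w) j)).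
  by under eq_fun do rewrite E; exact: integrableRZ.
split; first by apply: integrableR_sum => k; exact: integrableR_sum.
rewrite Rintegral_sum; last by move=> k; exact: integrableR_sum.
rewrite mulr_sumr; apply: le_trans (ler_norm_sum _ _ _) _; apply: ler_sum => i _.
rewrite Rintegral_sum // mulr_sumr; apply: le_trans (ler_norm_sum _ _ _) _; apply: ler_sum => j _.
under eq_Rintegral do rewrite E.
rewrite RintegralZl // normrM normrM (ger0_norm (sqr_ge0 sg)).
have -> : sg ^+ 2 * (64 * v) * `|h i j| = `|h i j| * sg ^+ 2 * (64 * v) by ring.
apply: ler_wpM2l; first by apply: mulr_ge0; [exact: normr_ge0|exact: sqr_ge0].
apply: le_trans (le_normr_Rintegral _ _) _ => //.
apply: (@le_trans _ _ (\int[P]_w (2^-1 * q i j w))).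
  by apply: le_Rintegral => //; exact: integrableR_norm.
rewrite RintegralZl //; last by apply: integrableRD; exact: frame_sqn_integrable.
rewrite RintegralD //; try exact: frame_sqn_integrable.
have h1 := frame_sqn_le v0 ig gg H true i i; have h2 := frame_sqn_le v0 ig gg H' b j j.
by move: h1 h2; move: (\int[P]_w _) (\int[P]_w _) => y z; lra.
Qed.

Let quad_int : P.-integrable setT (EFin \o quad).
Proof.
apply: integrableRD; [apply: integrableRD|].
- by case: (quad_half true H (fun k i => ddiff2 (fun u => \sum_j D 0 0 u (lam H' j)) (fun u => \sum_j D 1 0 u (lam H' j))
       (fun u => \sum_j D 2 0 u (lam H' j)) (lam H i) (lam H k))).
- by case: (quad_half b H' (fun k j => ddiff2 (fun v => \sum_i D 0 0 (lam H i) v) (fun v => \sum_i D 0 1 (lam H i) v)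
       (fun v => \sum_i D 0 2 (lam H i) v) (lam H' j) (lam H' k))).
- by case: (mixed_half (fun i j => D 1 1 (lam H i) (lam H' j))).
Qed.

Let quad_mean : `|\int[P]_w quad w| <= sg ^+ 2 * (64 * v) * kernel_sum.
Proof.
have [i1 m1] := quad_half true H (fun k i => ddiff2 (fun u => \sum_j D 0 0 u (lam H' j)) (fun u => \sum_j D 1 0 u (lam H' j))
       (fun u => \sum_j D 2 0 u (lam H' j)) (lam H i) (lam H k)).
have [i2 m2] := quad_half b H' (fun k j => ddiff2 (fun v => \sum_i D 0 0 (lam H i) v) (fun v => \sum_i D 0 1 (lam H i) v)
       (fun v => \sum_i D 0 2 (lam H i) v) (lam H' j) (lam H' k)).
have [i3 m3] := mixed_half (fun i j => D 1 1 (lam H i) (lam H' j)).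
rewrite /quad /quadratic_part (RintegralD measurableT (integrableRD i1 i2) i3) (RintegralD measurableT i1 i2).
by rewrite /kernel_sum !mulrDr; exact: norm3_le m1 m2 m3.
Qed.

Let shiftE w : x + \sum_(i <- enum GK) gstep i (sg * g i w) = (x.1 + X w, x.2 + X' w).
Proof.
rewrite {1}[x]surjective_pairing -[RHS]/((x.1, x.2) + (X w, X' w)); congr (_ + _).
have half c : \sum_(i <- enum GK) (if i.1 == c then hstep i.2 (sg * g i w) else 0) = sg%:C *: coord_mx g c w.
  rewrite big_enum /= /coord_mx scaler_sumr.
  have -> : \sum_(i : GK) (if i.1 == c then hstep i.2 (sg * g i w) else 0) =
    \sum_(c' : bool) \sum_k (if c' == c then hstep k (sg * g (c', k) w) else 0).
    by rewrite pair_bigA; apply: eq_bigr => -[].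
  rewrite (bigD1 c) //= [X in _ + X]big1 ?addr0 => [|c' /negbTE ->]; last by rewrite big1.
  by apply: eq_bigr => k _; rewrite eqxx hstepM.
rewrite /X /X' -!half; elim: (enum GK) => [|i s IH]; first by rewrite !big_nil.
rewrite !big_cons IH /gstep; case: i => c k /=.
by rewrite eqb_id.
Qed.

(** The linear part averages to zero, the quadratic part has a mean of order sg^2 v times the
    kernel, and the expansion error is cubic in sg with a finite constant. *)
Lemma one_step :
  `|convol gstep P (fun i w => sg * g i w) (enum GK) pair_obs x - pair_obs x| <=
  sg ^+ 2 * (64 * v) * kernel_sum +
  10 * M * (1 + N%:R) ^+ 2 * sg ^+ 3 * \int[P]_w (size_bound w ^+ 3).
Proof.
have bl := pair_obs_bounded_lip.
have ms i : measurable_fun setT (fun w => sg * g i w) by exact: measurable_funM.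
have is_ : rect_indep P (fun i w => sg * g i w).
  by apply: (rect_indep_comp (phi := fun _ t => sg * t)) => // i; exact: measurable_funM.
have mS := measurable_shifted gstepD ms (enum GK) x bl.
rewrite -(convol_indep gstepD ms is_ x bl (enum_uniq _)).
pose K := 10 * M * (1 + N%:R) ^+ 2 * sg ^+ 3.
pose Sh w := shifted gstep (fun i w => sg * g i w) (enum GK) pair_obs x w.
have iS : P.-integrable setT (EFin \o Sh) by apply: bounded_integrable => // w; case: bl => h _; exact: h.
have iQ : P.-integrable setT (EFin \o (fun w => K * size_bound w ^+ 3)).
  by apply: integrableRZ; exact: size_bound_cube_integrable.
have i0 : P.-integrable setT (EFin \o (fun _ : T => pair_obs x)) by exact: integrableR_cst.
have i1 : P.-integrable setT (EFin \o (fun w => Sh w - pair_obs x)) by exact: integrableRB.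
have i2 : P.-integrable setT (EFin \o (fun w => Sh w - pair_obs x - lin w)) by exact: integrableRB.
pose rem w := Sh w - pair_obs x - lin w - quad w.
have irem : P.-integrable setT (EFin \o rem) by exact: integrableRB.
have rem_le w : `|rem w| <= K * size_bound w ^+ 3.
  have s1 := size_bound_ge1 w; have s0 : 0 < size_bound w by exact: lt_le_trans s1.
  have hq c : hs (sg%:C *: coord_mx g c w) <= (sg * size_bound w) ^+ 2.
    by rewrite hsZ sqn_real exprMn ler_wpM2l ?sqr_ge0 // hs_coord_mx_le.
  have hX c : sg%:C *: coord_mx g c w \is hermsymmx by apply: hermZ; exact: coord_mx_herm.
  have := pair_stat_expansion tf (hermpart_herm x.1) (hX true) (hermpart_herm x.2) (hX b)
    (mulr_gt0 sg0 s0) (hq true) (hq b).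
  have -> : K * size_bound w ^+ 3 = 10 * M * (1 + N%:R) ^+ 2 * (sg * size_bound w) ^+ 3.
    by rewrite /K; move: (size_bound w) (10 * M * _) => y z; ring.
  apply: le_trans; rewrite le_eqVlt; apply/orP; left; apply/eqP.
  congr (`|_ - _ - _ - _|); rewrite /Sh /shifted shiftE /pair_obs /= !hermpartD.
  by rewrite (hermpart_id (hX true)) (hermpart_id (hX b)).
have -> : \int[P]_w Sh w - pair_obs x = \int[P]_w rem w + \int[P]_w quad w.
  rewrite /rem RintegralB // subrK RintegralB // lin_mean subr0 RintegralB //.
  by rewrite Rintegral_prob_cst.
rewrite addrC; apply: le_trans (ler_normD _ _) _; apply: lerD; first exact: quad_mean.
apply: le_trans (le_normr_Rintegral _ _) _ => //.
rewrite -/K -RintegralZl //; last exact: size_bound_cube_integrable.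
by apply: le_Rintegral => //; exact: integrableR_norm.
Qed.

End OneStep.

Lemma le_inv_nat (R : realType) (a b C : R) : (forall n : nat, a <= b + C / n.+1%:R) -> a <= b.
Proof.
move=> h; rewrite -subr_le0 leNgt; apply/negP => p.
suff e : a - b = 0 by rewrite e ltxx in p.
by apply: (@le_inv_nat_eq0 _ _ C) => n; rewrite (gtr0_norm p) lerBlDl.
Qed.

(** * The heat flow *)

Section GaussianSemigroup.
Context (R : realType) (V : zmodType) (K : finType) (e : K -> R -> V).
Hypothesis eD : forall i s t, e i (s + t) = e i s + e i t.
Context d (T : measurableType d) (P : probability T R) (g : K -> T -> R).
Hypothesis mg : forall i, measurable_fun setT (g i).
Variables (v : R) (s : seq K).
Hypothesis gg : forall i, i \in s -> gauss_coord P v (g i).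

(** [c] is a scale of standard deviations, so c^2 plays the role of time and is what adds up in
    [heatD]. *)
Definition heat (c : R) (Phi : V -> R) : V -> R := convol e P (fun i w => c * g i w) s Phi.

Let mcg c i : measurable_fun setT (fun w => c * g i w).
Proof. exact: measurable_funM. Qed.

Lemma heat_bounded_lip M L c Phi : bounded_lip e M L Phi -> bounded_lip e M L (heat c Phi).
Proof. exact: (bounded_lip_convol eD P (mcg c) s). Qed.

(** Stability of the normal law coordinate by coordinate; Fubini first brings the two integrations
    over one coordinate next to each other. *)
Lemma heatD M L a b c Phi x : bounded_lip e M L Phi -> 0 <= a -> 0 <= b -> 0 <= c ->
  c ^+ 2 = a ^+ 2 + b ^+ 2 -> heat a (heat b Phi) x = heat c Phi x.
Proof.
move=> bP a0 b0 c0 cE; rewrite /heat; elim: s gg x => //= i s' IH gg' x.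
have gi : gauss_coord P v (g i) by apply: gg'; rewrite mem_head.
have bl := bounded_lip_convol eD P (mcg c) s' bP.
rewrite {1}/convol1; under eq_Rintegral => w _.
  have -> : convol e P (fun i w => a * g i w) s' (convol1 e P (fun w => b * g i w) i
     (convol e P (fun i w => b * g i w) s' Phi)) = convol1 e P (fun w => b * g i w) i (convol e P (fun i w => c * g i w) s' Phi).
    apply/funext => y; rewrite -(convol1_convol eD P (mcg a) i s' y (bounded_lip_convol eD P (mcg b) s' bP) (mcg b i)).
    congr (convol1 _ _ _ _ _ _); apply/funext => z.
    by apply: IH => j js; apply: gg'; rewrite inE js orbT.
  over.
rewrite /convol1 /=.
under eq_Rintegral => w _.
  under eq_Rintegral => w' _ do rewrite -addrA -eD.
  over.
apply: (gc_stable gi (f := fun t => convol e P (fun i w => c * g i w) s' Phi (x + e i t)) a0 b0 c0 cE).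
  by move=> t; case: bl => h _; exact: h.
by move=> t t'; case: bl => _ l; exact: lip_along2.
Qed.

Variables (Y : K -> T -> R) (s' : seq K).
Hypothesis mY : forall i, measurable_fun setT (Y i).
Variables (M L : R) (Phi : V -> R) (M' L' : R) (B : V -> R) (B0 kappa : R).
Hypotheses (bP : bounded_lip e M L Phi) (bB : bounded_lip e M' L' B).
Hypothesis kappa0 : 0 <= kappa.
Hypothesis step : forall c x, 0 < c -> `|heat c Phi x - Phi x| <= c ^+ 2 * B x + kappa * c ^+ 3.
Hypothesis hB : forall x, convol e P Y s' B x <= B0.

(* Telescoping over n small times; the cubic errors sum to O(n^(-1/2)). *)
Lemma heat_evolution a x : 0 < a ->
  `|convol e P Y s' (heat a Phi) x - convol e P Y s' Phi x| <= a ^+ 2 * B0.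
Proof.
move=> a0; apply: (@le_inv_nat _ _ _ (kappa * a ^+ 3)) => n.
(* The time a^2 is split into (n+1)^2 equal steps, each of scale q = a/(n+1), which keeps roots out
   of the step size. *)
pose t m : R := a * Num.sqrt (m%:R / (n.+1%:R ^+ 2)).
have n0 : 0 < n.+1%:R :> R by [].
have t0 m : 0 <= t m by rewrite mulr_ge0 ?sqrtr_ge0 // ltW.
have tE m : t m ^+ 2 = a ^+ 2 * (m%:R / n.+1%:R ^+ 2).
  by rewrite exprMn sqr_sqrtr // divr_ge0 // exprn_ge0.
pose q := a / n.+1%:R; have q0 : 0 < q by rewrite divr_gt0.
have qE m : t m.+1 ^+ 2 = t m ^+ 2 + q ^+ 2.
  by rewrite !tE /q -[m.+1%:R]natr1 expr_div_n; move: n0; move: (n.+1%:R : R) => y y0; field; rewrite gt_eqF.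
pose D m := convol e P Y s' (heat (t m) Phi) x.
have blH c Psi m l : bounded_lip e m l Psi -> bounded_lip e m l (heat c Psi) by exact: heat_bounded_lip.
have Dstep m : `|D m.+1 - D m| <= q ^+ 2 * B0 + kappa * q ^+ 3.
  have E : heat (t m.+1) Phi = heat (t m) (heat q Phi).
    by apply/funext => y; rewrite (heatD y bP (t0 m) (ltW q0) (t0 m.+1) (qE m)).
  rewrite /D E; have bq := blH q _ _ _ bP.
  have bN := bounded_lipZ (-1) bP.
  have bd := bounded_lipD bq bN.
  have -> : convol e P Y s' (heat (t m) (heat q Phi)) x - convol e P Y s' (heat (t m) Phi) x =
     convol e P Y s' (heat (t m) (fun y => heat q Phi y + -1 * Phi y)) x.
    have -> : heat (t m) (fun y => heat q Phi y + -1 * Phi y) =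
      (fun y => heat (t m) (heat q Phi) y + -1 * heat (t m) Phi y).
      apply/funext => y; rewrite /heat (convolD eD P (mcg _) _ _ bq bN).
      by rewrite (convolZ eD P (mcg _) _ _ _ bP).
    rewrite (convolD eD P mY _ _ (blH _ _ _ _ bq) (bounded_lipZ (-1) (blH _ _ _ _ bP))).
    by rewrite (convolZ eD P mY _ _ _ (blH _ _ _ _ bP)) mulN1r.
  have bR := bounded_lipD (bounded_lipZ (q ^+ 2) bB) (bounded_lip_cst e (kappa * q ^+ 3)).
  (* The flow up to time t m is moved outside: [hB] holds from every starting point, so this part
     acts only as a shift. *)
  rewrite /heat (convol_swap eD P _ _ _ bd mY (mcg _)).
  apply: le_trans (convol_norm_le eD P (mcg _) _ _ (bounded_lip_convol eD P mY s' bd)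
    (bounded_lip_convol eD P mY s' bR) _) _.
    move=> y; apply: (convol_norm_le eD P mY _ _ bd bR) => z.
    by rewrite mulN1r; exact: step.
  apply: (convol_leM eD P (mcg _) _ _ (bounded_lip_convol eD P mY s' bR)) => y.
  rewrite (convolD eD P mY _ _ (bounded_lipZ (q ^+ 2) bB) (bounded_lip_cst e (kappa * q ^+ 3))).
  by rewrite (convolZ eD P mY _ _ _ bB) convol_cst lerD2r ler_wpM2l ?sqr_ge0.
have Dn : `|D (n.+1 ^ 2)%N - D 0%N| <= (n.+1 ^ 2)%:R * (q ^+ 2 * B0 + kappa * q ^+ 3).
  elim: (n.+1 ^ 2)%N => [|m IH]; first by rewrite subrr normr0 mul0r.
  rewrite -natr1 mulrDl mul1r [leRHS]addrC.
  have -> : D m.+1 - D 0%N = (D m.+1 - D m) + (D m - D 0%N) by rewrite addrA subrK.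
  by apply: le_trans (ler_normD _ _) _; exact: lerD.
have e1 : t (n.+1 ^ 2)%N = a.
  by rewrite /t natrX divff ?sqrtr1 ?mulr1 // expf_neq0 // pnatr_eq0.
have h0 : heat (t 0%N) Phi = Phi.
  apply/funext => y; rewrite /heat /t mul0r sqrtr0 mulr0; elim: s y => //= i u IH y.
  rewrite /convol1; under eq_Rintegral do rewrite IH mul0r -[e i 0](addrK (e i 0)) -eD addr0 subrr addr0.
  exact: Rintegral_prob_cst.
rewrite /D e1 h0 in Dn; apply: (le_trans Dn).
rewrite le_eqVlt; apply/orP; left; apply/eqP.
rewrite natrX /q; move: n0; move: (n.+1%:R : R) => y y0; rewrite !expr_div_n.
by field; rewrite gt_eqF.
Qed.

End GaussianSemigroup.

Section ConvolutionBounds.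
Context (R : realType) (V : zmodType) (K : Type) (e : K -> R -> V).
Hypothesis eD : forall i s t, e i (s + t) = e i s + e i t.
Context d (T : measurableType d) (P : probability T R) (Z : K -> T -> R) (s : seq K).
Hypothesis mZ : forall i, measurable_fun setT (Z i).

Definition convol_bound (Phi : V -> R) (B : R) :=
  (exists M L, bounded_lip e M L Phi) /\ forall x, convol e P Z s Phi x <= B.

Lemma convol_bound_cst c : convol_bound (fun _ => c) c.
Proof. by split=> [|x]; [exists `|c|, 0; exact: bounded_lip_cst|rewrite convol_cst]. Qed.

Lemma convol_boundD Phi Psi A B : convol_bound Phi A -> convol_bound Psi B ->
  convol_bound (fun x => Phi x + Psi x) (A + B).
Proof.
move=> [[M [L b1]] h1] [[M' [L' b2]] h2]; split.
  by do 2 eexists; exact: bounded_lipD b1 b2.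
by move=> x; rewrite (convolD eD P mZ _ _ b1 b2); exact: lerD.
Qed.

Lemma convol_boundZ Phi A c : 0 <= c -> convol_bound Phi A -> convol_bound (fun x => c * Phi x) (c * A).
Proof.
move=> c0 [[M [L b1]] h1]; split; first by do 2 eexists; exact: bounded_lipZ b1.
by move=> x; rewrite (convolZ eD P mZ _ _ _ b1) ler_wpM2l.
Qed.

Lemma convol_bound_sum n (F : 'I_n -> V -> R) (B : 'I_n -> R) :
  (forall j, convol_bound (F j) (B j)) -> convol_bound (fun x => \sum_j F j x) (\sum_j B j).
Proof.
elim: n F B => [|n IH] F B h.
  rewrite big_ord0 (_ : (fun x => _) = fun _ => 0); first exact: convol_bound_cst.
  by apply/funext => x; rewrite big_ord0.
rewrite big_ord_recl (_ : (fun x => _) = fun x => F ord0 x + \sum_(j < n) F (lift ord0 j) x).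
  by apply: convol_boundD => //; apply: IH.
by apply/funext => x; rewrite big_ord_recl.
Qed.

Lemma convol_bound_le Phi Psi B M L : bounded_lip e M L Phi -> (forall x, Phi x <= Psi x) ->
  convol_bound Psi B -> convol_bound Phi B.
Proof.
move=> bP h [[M' [L' bQ]] hQ]; split; first by exists M, L.
by move=> x; apply: le_trans (hQ x); exact: (convol_le eD P mZ _ _ bP bQ).
Qed.

End ConvolutionBounds.

Lemma mul3_le_cubes (R : realType) (a b c : R) : 0 <= a -> 0 <= b -> 0 <= c ->
  a * b * c <= 3^-1 * (a ^+ 3 + b ^+ 3 + c ^+ 3).
Proof.
move=> a0 b0 c0; rewrite ler_pdivlMl // -subr_ge0.
have -> : a ^+ 3 + b ^+ 3 + c ^+ 3 - 3 * (a * b * c) =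
  2^-1 * ((a + b + c) * ((a - b) ^+ 2 + (b - c) ^+ 2 + (a - c) ^+ 2)) by field.
by apply: mulr_ge0 => //; apply: mulr_ge0; rewrite !addr_ge0 ?sqr_ge0.
Qed.

(** * Pairs of matrices with common and separate randomness *)

Section MatrixPairs.
Context (R : realType) (N : nat).
Local Notation C := R[i].
Local Notation JK := (('I_3 * coord_idx N)%type : finType).
Local Notation GK := ((bool * coord_idx N)%type : finType).

(* Index 0 moves both slots; the Gaussian indices 1 and 2 move the first and the second slot,
   except that for b = true index 1 moves both. *)
Definition mstep (b : bool) (i : JK) (t : R) : ('M[C]_N * 'M[C]_N)%type :=
  (if (i.1 : nat) == 2%N then 0 else hstep i.2 t,
   if ((i.1 : nat) == 0%N) || ((i.1 : nat) == if b then 1%N else 2%N) then hstep i.2 t else 0).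

Lemma mstepD b i s t : mstep b i (s + t) = mstep b i s + mstep b i t.
Proof.
rewrite /mstep -[RHS]/(_ + _, _ + _) hstepD.
by congr (_, _); case: ifP => // _; rewrite addr0.
Qed.

Definition gslot (c : bool) : 'I_3 := if c then inord 1 else inord 2.

Lemma mstep_gslot b (c : bool) k t : mstep b (gslot c, k) t = gstep b (c, k) t.
Proof. by rewrite /mstep /gstep /gslot; case: c; case: b; rewrite /= inordK. Qed.

Definition wseq : seq JK := [seq (ord0, k) | k <- enum (coord_idx N)].
Definition gseq : seq JK := [seq (gslot i.1, i.2) | i <- enum GK].

Lemma gslot_inj : injective gslot.
Proof. by move=> [] [] // /(congr1 val); rewrite /= !inordK. Qed.

Lemma perm_wseq_gseq : perm_eq (enum JK) (wseq ++ gseq).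
Proof.
apply: uniq_perm; first exact: enum_uniq.
  rewrite cat_uniq; apply/and3P; split.
  - by rewrite map_inj_uniq ?enum_uniq // => k k' [].
  - apply/hasPn => _ /mapP[[c k] _ ->]; apply/mapP => -[k' _ []].
    by move=> /(congr1 val) /=; case: c; rewrite /gslot /= inordK.
  - by rewrite map_inj_uniq ?enum_uniq // => -[c k] [c' k'] [/gslot_inj -> ->].
move=> [j k]; rewrite mem_enum mem_cat; symmetry; apply/orP.
case: j => -[|[|[|//]]] lt3; [left|right|right].
- by apply/mapP; exists k; rewrite ?mem_enum //; congr (_, _); exact: val_inj.
- by apply/mapP; exists (true, k); rewrite ?mem_enum //; congr (_, _); apply: val_inj; rewrite /= inordK.
- by apply/mapP; exists (false, k); rewrite ?mem_enum //; congr (_, _); apply: val_inj; rewrite /= inordK.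
Qed.

Lemma sum_mstep b (t : JK -> R) : \sum_(i <- enum JK) mstep b i (t i) =
  (\sum_k hstep k (t (ord0, k)) + \sum_k hstep k (t (inord 1, k)),
   \sum_k hstep k (t (ord0, k)) + \sum_k hstep k (t (if b then inord 1 else inord 2, k))).
Proof.
have -> : \sum_(i <- enum JK) mstep b i (t i) =
    (\sum_(i <- enum JK) (mstep b i (t i)).1, \sum_(i <- enum JK) (mstep b i (t i)).2).
  by elim: (enum JK) => [|i r IH]; rewrite ?big_nil // !big_cons IH.
have E (F : bool * coord_idx N -> 'M[C]_N) : \sum_i F i = \sum_k F (true, k) + \sum_k F (false, k).
  by rewrite -[RHS](big_bool _ (fun c => \sum_k F (c, k))) pair_bigA; apply: eq_bigr => -[].
have S (F : JK -> 'M[C]_N) : \sum_(i <- enum JK) F i =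
    \sum_k F (ord0, k) + (\sum_k F (gslot true, k) + \sum_k F (gslot false, k)).
  rewrite (perm_big _ perm_wseq_gseq); transitivity (\sum_(i <- wseq) F i + \sum_(i <- gseq) F i).
    exact: big_cat.
  rewrite /wseq /gseq big_map [X in _ + X]big_map [X in X + _]big_enum [X in _ + X]big_enum.
  by congr (_ + _); exact: E.
rewrite !S /gslot /mstep /= !inordK //=.
congr (_ + _, _ + _); first by rewrite [X in _ + X]big1 ?addr0.
by case: b => /=; [rewrite [X in _ + X]big1 ?addr0|rewrite [X in X + _]big1 ?add0r].
Qed.

End MatrixPairs.

Lemma eq_in_convol (R : realType) (V : zmodType) (K : eqType) (e : K -> R -> V)
    d (T : measurableType d) (P : probability T R) (Z Z' : K -> T -> R) s (Phi : V -> R) :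
  {in s, Z =1 Z'} -> convol e P Z s Phi = convol e P Z' s Phi.
Proof.
elim: s => //= i s IH h; rewrite (h i) ?mem_head // IH // => j js.
by apply: h; rewrite inE js orbT.
Qed.

Lemma rect_indep_inj (R : realType) (K K' : finType) d (T : measurableType d) (P : probability T R)
    (Z : K -> T -> R) (h : K' -> K) :
  injective h -> rect_indep P Z -> rect_indep P (fun i => Z (h i)).
Proof.
move=> ih iZ B mB.
pose B' k := if [pick i | h i == k] is Some i then B i else setT.
have B'h i : B' (h i) = B i.
  by rewrite /B'; case: pickP => [j /eqP /ih ->|/(_ i)] //; rewrite eqxx.
have B'out k : k \notin codom h -> B' k = setT.
  by move=> hk; rewrite /B'; case: pickP => // i /eqP hi; rewrite -hi codom_f in hk.
have mB' k : measurable (B' k) by rewrite /B'; case: pickP.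
have -> : \bigcap_(i in setT) (Z (h i) @^-1` B i) = \bigcap_(k in setT) (Z k @^-1` B' k).
  apply/seteqP; split => w hw k _ /=; last by have := hw (h k) I; rewrite /= B'h.
  by have [/codomP[i ->]|/B'out ->//] := boolP (k \in codom h); rewrite B'h; exact: hw.
rewrite iZ // (bigID (mem (codom h))) /= [X in (_ * X)%E]big1 ?mule1; last first.
  by move=> k /B'out ->; rewrite preimage_setT; exact: probability_setT.
rewrite -big_uniq; last by rewrite map_inj_uniq ?enum_uniq.
rewrite /codom /image_mem big_map big_enum /=.
by apply: eq_bigr => i _; rewrite B'h.
Qed.

Lemma slot_bounded_lip (R : realType) (N : nat) (b c : bool) M L (phi : 'M[R[i]]_N -> R) : 0 <= L ->
  bounded_lip (@hstep R N) M L phi ->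
  bounded_lip (@mstep R N b) M L (fun x => phi (if c then x.1 else x.2)).
Proof.
move=> L0 [bn bl]; split => [x|i x t]; first exact: bn.
have z (y : 'M[R[i]]_N) : `|phi (y + 0) - phi y| <= L * `|t|.
  by rewrite addr0 subrr normr0 mulr_ge0.
by case: c; rewrite /mstep /=; case: ifP => _; [exact: z|exact: bl|exact: bl|exact: z].
Qed.

Section PairFlow.
Context (R : realType) (N : nat) d (T : measurableType d) (P : probability T R).
Local Notation C := R[i].
Local Notation JK := (('I_3 * coord_idx N)%type : finType).
Local Notation GK := ((bool * coord_idx N)%type : finType).
Variables (Z : JK -> T -> R) (v : R).
Hypotheses (N0 : (0 < N)%N) (v0 : 0 <= v) (mZ : forall i, measurable_fun setT (Z i)).
Hypothesis iZ : rect_indep P Z.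
Hypothesis gZ : forall c k, gauss_coord P v (Z (gslot c, k)).
Variables (F : R -> R -> R) (M r : R) (D : nat -> nat -> R -> R -> R).
Hypothesis tf : test_fun F M r D.
Variables (s E eta B1 : R).
Hypotheses (s0 : 0 < s) (eta0 : 0 < eta) (eta_r : r <= s * eta) (eta_1 : 1 <= s * eta).
Hypothesis hB : forall E' x,
  convol (@hstep R N) P (fun k => Z (ord0, k)) (enum (coord_idx N)) (fun x => cnt E' eta x ^+ 3) x <= B1.

Definition cube (c : bool) E' (x : 'M[C]_N * 'M[C]_N) := cnt E' eta (if c then x.1 else x.2) ^+ 3.

Let cnt_slot (c : bool) E' (x : 'M[C]_N * 'M[C]_N) := cnt E' eta (if c then x.1 else x.2).

Let cnt_slot_lip b c E' : bounded_lip (@mstep R N b) (N%:R * 1) (eta^-1 * (N%:R + 4)) (cnt_slot c E').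
Proof.
apply: slot_bounded_lip; last exact: cnt_bounded_lip.
by rewrite mulr_ge0 ?addr_ge0 // invr_ge0 ltW.
Qed.

Lemma cube_bound b c E' : convol_bound (@mstep R N b) P Z (wseq N) (cube c E') B1.
Proof.
split.
  have h := cnt_slot_lip b c E'; do 2 eexists.
  rewrite (_ : cube c E' = fun x => cnt_slot c E' x * (cnt_slot c E' x * cnt_slot c E' x)); last first.
    by apply/funext => x; rewrite /cube exprS expr2.
  exact: bounded_lipM h (bounded_lipM h h).
move=> x; have := hB E' (if c then x.1 else x.2); apply: le_trans.
rewrite le_eqVlt; apply/orP; left; apply/eqP.
apply: (convol_map (e' := @hstep R N) (p := fun x : 'M[C]_N * 'M[C]_N => if c then x.1 else x.2)) => k y t.
by case: (c).
Qed.

Definition drift_const : R := 1 + B1 + B1 + \sum_(j < N.+1) (1 + j%:R)^-1 * (B1 + B1 + B1 + B1).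

Let tri c E' x := 3^-1 * (cube true E x + cube false E x + cube c E' x).

Let tri_bound b c E' : convol_bound (@mstep R N b) P Z (wseq N) (tri c E') B1.
Proof.
have -> : B1 = 3^-1 * (B1 + B1 + B1) by field.
apply: (convol_boundZ (@mstepD R N b) mZ); first by rewrite invr_ge0.
apply: (convol_boundD (@mstepD R N b) mZ); last exact: cube_bound.
by apply: (convol_boundD (@mstepD R N b) mZ); exact: cube_bound.
Qed.

Let drift_lip b : exists M' L', bounded_lip (@mstep R N b) M' L' (drift_bound E eta).
Proof.
have hD := @mstepD R N b.
have lip c : exists M' L', bounded_lip (@mstep R N b) M' L' (fun x => ladder E eta (if c then x.1 else x.2)).
  have cb E' : convol_bound (@mstep R N b) P Z (wseq N) (cnt_slot c E') (N%:R * 1).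
    split; first by do 2 eexists; exact: cnt_slot_lip.
    move=> x; apply: (convol_leM hD P mZ _ _ (cnt_slot_lip b c E')) => y.
    by case: (cnt_slot_lip b c E') => h _; apply: le_trans (ler_norm _) (h y).
  have w (j : 'I_N.+1) : 0 <= (1 + j%:R)^-1 :> R by rewrite invr_ge0 addr_ge0.
  by have [] := convol_bound_sum hD mZ (fun j : 'I_N.+1 =>
    convol_boundZ hD mZ (w j) (convol_boundD hD mZ (cb (E + j%:R * eta)) (cb (E - j%:R * eta)))).
have [M1 [L1 b1]] := lip true; have [M2 [L2 b2]] := lip false.
do 2 eexists; apply: bounded_lipM; last first.
  by apply: bounded_lipD b2; apply: bounded_lipD b1; exact: bounded_lip_cst.
exact: bounded_lipM (cnt_slot_lip b true E) (cnt_slot_lip b false E).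
Qed.

(** A product of three counts is dominated by cubes, each involving a single slot. Hence third
    moments suffice, and nothing is needed about the joint law of the slots. *)
Lemma drift_convol b : convol_bound (@mstep R N b) P Z (wseq N) (drift_bound E eta) drift_const.
Proof.
have [M' [L' bd]] := drift_lip b.
have hD := @mstepD R N b.
pose G x := 1 + cube true E x + cube false E x + \sum_(j < N.+1) (1 + j%:R)^-1 *
  (tri true (E + j%:R * eta) x + tri true (E - j%:R * eta) x + tri false (E + j%:R * eta) x + tri false (E - j%:R * eta) x).
apply: (convol_bound_le hD mZ (Psi := G) bd); last first.
  apply: (convol_boundD hD mZ).
    apply: (convol_boundD hD mZ); last exact: cube_bound.
    apply: (convol_boundD hD mZ); [exact: convol_bound_cst|exact: cube_bound].
  apply: (convol_bound_sum hD mZ) => j; apply: (convol_boundZ hD mZ); first by rewrite invr_ge0 addr_ge0.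
  by apply: (convol_boundD hD mZ); [apply: (convol_boundD hD mZ); [apply: (convol_boundD hD mZ)|]|]; exact: tri_bound.
move=> x; rewrite /drift_bound /G -addrA mulrDr.
have c0 E' (y : 'M[C]_N) : 0 <= cnt E' eta y by case/andP: (cnt_itv E' eta y).
apply: lerD.
  have h := mul3_le_cubes (c0 E x.1) (c0 E x.2) ler01; rewrite mulr1 expr1n in h.
  by rewrite /cube; move: h; move: (_ * cnt E eta x.2) (_ ^+ 3) (_ ^+ 3) => p q u; lra.
rewrite /ladder -big_split mulr_sumr; apply: ler_sum => j _ /=.
rewrite -mulrDr mulrCA ler_wpM2l ?invr_ge0 ?addr_ge0 //.
have t1 c E' : cnt E eta x.1 * cnt E eta x.2 * cnt E' eta (if c then x.1 else x.2) <= tri c E' x.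
  exact: mul3_le_cubes.
by rewrite addrA !mulrDr; apply: lerD (t1 false _); apply: lerD (t1 false _); apply: lerD; exact: (t1 true).
Qed.

Let Phi := pair_obs (N := N) (rescale s E F).

Let M0 : 0 <= M. Proof. exact: le_trans (normr_ge0 _) (@tf_bound _ _ _ _ _ tf 0 0 0 0 isT isT). Qed.

Definition flow_rate : R := 64 * v * (s ^+ 2 * (12 * M * (1 + r))).

Let rate0 : 0 <= flow_rate.
Proof.
have r0 := tf_r tf; apply: mulr_ge0; first exact: mulr_ge0.
apply: mulr_ge0; first exact: sqr_ge0.
by apply: mulr_ge0; [exact: mulr_ge0|exact: addr_ge0].
Qed.

Let gfam (i : bool * coord_idx N) := Z (gslot i.1, i.2).

Let gfam_indep : rect_indep P gfam.
Proof.
apply: (rect_indep_inj (h := fun i : bool * coord_idx N => (gslot i.1, i.2))) => //.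
by move=> [c k] [c' k'] [/gslot_inj -> ->].
Qed.

Lemma pair_obs_lip b : exists M' L', bounded_lip (@mstep R N b) M' L' Phi.
Proof.
have [M' [r' tf']] := rescale_test_fun tf E s0.
exists (N%:R * (N%:R * M')), (N%:R * (2 * (M' * (N%:R + 4)))).
have lip := pair_obs_bounded_lip N tf'.
split => [x|[j k] x t]; first by case: (lip b) => h _; exact: h.
case: j => -[|[|[|//]]] lt3.
- by have [_ l] := lip true; have := l (true, k) x t.
- have -> : Ordinal lt3 = gslot true by apply: val_inj; rewrite /= inordK.
  by have [_ l] := lip b; rewrite mstep_gslot; exact: l.
- have -> : Ordinal lt3 = gslot false by apply: val_inj; rewrite /= inordK.
  by have [_ l] := lip b; rewrite mstep_gslot; exact: l.
Qed.

Lemma pair_flow b a x : 0 < a ->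
  `|convol (@mstep R N b) P Z (wseq N) (heat (@mstep R N b) P Z (gseq N) a Phi) x -
    convol (@mstep R N b) P Z (wseq N) Phi x| <= a ^+ 2 * (flow_rate * drift_const).
Proof.
move=> a0; have hD := @mstepD R N b.
have [M' [L' bP]] := pair_obs_lip b.
have [[MB [LB bB]] hdrift] := convol_boundZ hD mZ rate0 (drift_convol b).
have gg i : i \in gseq N -> gauss_coord P v (Z i) by move=> /mapP[[c k] _ ->]; exact: gZ.
have gf i : gauss_coord P v (gfam i) by exact: gZ.
have [MF [r' tf']] := rescale_test_fun tf E s0.
have MF0 : 0 <= MF by exact: le_trans (normr_ge0 _) (@tf_bound _ _ _ _ _ tf' 0 0 0 0 isT isT).
pose kap := 10 * MF * (1 + N%:R) ^+ 2 * \int[P]_w (size_bound gfam w ^+ 3).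
apply: (heat_evolution hD mZ gg mZ bP bB (kappa := kap)) => //.
move=> c y c0.
have -> : heat (@mstep R N b) P Z (gseq N) c Phi y =
   convol (@gstep R N b) P (fun i w => c * gfam i w) (enum GK) Phi y.
  apply: (convol_map (e' := @gstep R N b) (p := id)) => -[c' k] z t.
  by rewrite /= mstep_gslot.
apply: le_trans (one_step tf' b v0 gfam_indep gf y c0) _.
apply: lerD; last by rewrite /kap le_eqVlt; apply/orP; left; apply/eqP; ring.
rewrite -mulrA ler_wpM2l ?sqr_ge0 // /flow_rate -[leRHS]mulrA.
by apply: ler_wpM2l; [exact: mulr_ge0|exact: (kernel_total_le tf E s0 eta0 eta_r eta_1 N0 erefl erefl)].
Qed.

Let Y := coord_mx (N := N) Z.

Definition perturbed (b : bool) (a : R) (x : 'M[C]_N * 'M[C]_N) w : 'M[C]_N * 'M[C]_N :=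
  (x.1 + (Y ord0 w + a%:C *: Y (inord 1) w),
   x.2 + (Y ord0 w + a%:C *: Y (if b then inord 1 else inord 2) w)).

Section Perturbed.
Variables (b : bool) (a : R) (x : 'M[C]_N * 'M[C]_N).
Let Zs (i : JK) w := (if i.1 == ord0 then 1 else a) * Z i w.

Let mZs i : measurable_fun setT (Zs i). Proof. exact: measurable_funM. Qed.

Let shifted_perturbed (Psi : 'M[C]_N * 'M[C]_N -> R) w :
  shifted (@mstep R N b) Zs (enum JK) Psi x w = Psi (perturbed b a x w).
Proof.
rewrite /shifted sum_mstep; congr (Psi _).
rewrite [in LHS](surjective_pairing x) -[LHS]/(_ + _, _ + _) /perturbed.
have EY j : j != ord0 -> \sum_k hstep k (Zs (j, k) w) = a%:C *: Y j w.
  move=> /negbTE ne; rewrite /Zs /Y /coord_mx scaler_sumr; apply: eq_bigr => k _.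
  by rewrite /= ne hstepM.
have n1 : inord 1 != ord0 :> 'I_3 by rewrite -val_eqE /= inordK.
have n2 : inord 2 != ord0 :> 'I_3 by rewrite -val_eqE /= inordK.
have n3 : (if b then inord 1 else inord 2) != ord0 :> 'I_3 by case: (b).
rewrite /= (EY _ n1) (EY _ n3).
by congr (_ + (_ + _), _ + (_ + _)); apply: eq_bigr => k _; rewrite /Zs /= mul1r.
Qed.

Lemma perturbed_measurable M' L' (Psi : 'M[C]_N * 'M[C]_N -> R) :
  bounded_lip (@mstep R N b) M' L' Psi -> measurable_fun setT (fun w => Psi (perturbed b a x w)).
Proof.
move=> bP; have h := measurable_shifted (@mstepD R N b) mZs (enum JK) x bP.
by apply: eq_measurable_fun h => w _; exact: shifted_perturbed.
Qed.

Lemma perturbed_expectation M' L' (Psi : 'M[C]_N * 'M[C]_N -> R) :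
  bounded_lip (@mstep R N b) M' L' Psi ->
  \int[P]_w Psi (perturbed b a x w) =
  convol (@mstep R N b) P Z (wseq N) (heat (@mstep R N b) P Z (gseq N) a Psi) x.
Proof.
move=> bP; have hD := @mstepD R N b.
have iZs : rect_indep P Zs.
  by apply: (rect_indep_comp (phi := fun (i : JK) t => (if i.1 == ord0 then 1 else a) * t)) => // i; exact: measurable_funM.
transitivity (convol (@mstep R N b) P Zs (enum JK) Psi x).
  rewrite -(convol_indep hD mZs iZs x bP (enum_uniq _)).
  by apply: eq_Rintegral => w _; rewrite shifted_perturbed.
rewrite -[enum JK]map_id (convol_perm hD P id _ bP mZs (perm_wseq_gseq N)) map_id convol_cat.
rewrite (eq_in_convol _ _ (Z' := Z)); last first.
  by move=> _ /mapP[k _ ->]; apply/funext => w; rewrite /Zs /= mul1r.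
congr (convol _ _ _ _ _ _); apply: eq_in_convol => _ /mapP[[c k] _ ->].
apply/funext => w; rewrite /Zs /gslot /=; case: ifP => // /eqP /(congr1 val).
by case: (c); rewrite /= inordK.
Qed.

(** With the Gaussian component integrated outermost, it is a deterministic shift for [hB]. *)
Lemma cube_expectation c : \int[P]_w cube c E (perturbed b a x w) <= B1.
Proof.
have [[M' [L' bl]] hc] := cube_bound b c E.
have mg i : measurable_fun setT (fun w => a * Z i w) by exact: measurable_funM.
rewrite (perturbed_expectation bl) /heat (convol_swap (@mstepD R N b) P _ _ _ bl mZ mg).
apply: (convol_leM (@mstepD R N b) P mg _ _ (bounded_lip_convol (@mstepD R N b) P mZ _ bl)).
exact: hc.
Qed.

End Perturbed.

(** At time zero the cases b = true and b = false coincide, because the common matrix moves both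
    slots alike; each flow stays close to this shared value. *)
Lemma pair_coupling a x : 0 < a ->
  `|\int[P]_w Phi (perturbed false a x w) - \int[P]_w Phi (perturbed true a x w)| <=
  2 * (a ^+ 2 * (flow_rate * drift_const)).
Proof.
move=> a0; have [M1 [L1 b1]] := pair_obs_lip false; have [M2 [L2 b2]] := pair_obs_lip true.
pose c b := convol (@mstep R N b) P Z (wseq N) (heat (@mstep R N b) P Z (gseq N) a Phi) x.
apply: (@le_trans _ _ `|c false - c true|).
  rewrite le_eqVlt; apply/orP; left; apply/eqP.
  exact: (congr2 (fun p q : R => `|p - q|) (perturbed_expectation a x b1) (perturbed_expectation a x b2)).
have e : convol (@mstep R N false) P Z (wseq N) Phi x = convol (@mstep R N true) P Z (wseq N) Phi x.
  transitivity (convol (fun k => @mstep R N true (ord0, k)) P (fun k => Z (ord0, k)) (enum (coord_idx N)) Phi x).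
    exact: (convol_map (e' := fun k => @mstep R N true (ord0, k)) (p := id)).
  by symmetry; exact: (convol_map (e' := fun k => @mstep R N true (ord0, k)) (p := id)).
have h1 := pair_flow true x a0; have := pair_flow false x a0; rewrite e => h2.
move: h1 h2; rewrite -!/(c _); move: (c false) (c true) (convol _ _ _ _ _ _) (a ^+ 2 * _) => p q u B h1 h2.
have -> : p - q = (p - u) - (q - u) by ring.
by rewrite mulr_natl mulr2n; apply: le_trans (ler_normB _ _) _; exact: lerD.
Qed.

End PairFlow.

(** * Coordinates of the random matrices *)

Section GeneratedSigmaAlgebra.
Context (R : realType) d (T : measurableType d) (I : Type) (X : I -> T -> R).

Lemma sigma_gen_preimage i (B : set R) : measurable B -> sigma_gen X (X i @^-1` B).
Proof.
move=> mB; apply: sub_sigma_algebra; exists i => //; exists B => //.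
by rewrite setTI.
Qed.

Lemma sigma_gen_cst (c : R) (B : set R) : sigma_gen X ((fun _ => c) @^-1` B).
Proof.
have -> : ((fun _ : T => c) @^-1` B) = (if c \in B then setT else set0) by exact: preimage_cst.
by case: ifP => _; [exact: (@measurableT _ (g_sigma_algebraType _))|exact: (@measurable0 _ (g_sigma_algebraType _))].
Qed.

Lemma sigma_gen_bigcap (K : finType) (E : K -> set T) : (forall k, sigma_gen X (E k)) ->
  sigma_gen X (\bigcap_(k in setT) E k).
Proof.
by move=> h; apply: (@fin_bigcap_measurable _ (g_sigma_algebraType _)) => // k _; exact: h.
Qed.

End GeneratedSigmaAlgebra.

Section ConstantEvents.
Context (R : realType) d (T : measurableType d) (P : probability T R).

Lemma prob_cap_cst (X : T -> R) c (A : set T) B : (forall w, X w = c) -> measurable A ->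
  P (A `&` X @^-1` B) = (P A * P (X @^-1` B))%E.
Proof.
move=> Xc mA; have -> : X = (fun _ => c) by apply/funext.
have -> : ((fun _ : T => c) @^-1` B) = (if c \in B then setT else set0) by exact: preimage_cst.
case: ifP => _; first by rewrite setIT probability_setT mule1.
by rewrite setI0 measure0 mule0.
Qed.

(* A product rule on a subset of indices extends to all indices when the other events are trivial. *)
Lemma prob_bigcap_trivial (I : finType) (A : {pred I}) (E : I -> set T) :
  (forall i, i \notin A -> E i = setT \/ E i = set0) ->
  P (\bigcap_(x in [set: {i | i \in A}]) E (val x)) = (\prod_(x : {i | i \in A}) P (E (val x)))%E ->
  P (\bigcap_(i in setT) E i) = (\prod_i P (E i))%E.
Proof.
move=> triv prodA.
have [[i iA Ei]|h] := pselect (exists2 i, i \notin A & E i = set0).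
  rewrite (bigD1 i) //= Ei measure0 mul0e.
  by rewrite (_ : \bigcap_(_ in _) _ = set0) ?measure0 // -subset0 => w /(_ i Logic.I); rewrite Ei.
have ET i : i \notin A -> E i = setT.
  by move=> iA; case: (triv i iA) => // Ei; exfalso; apply: h; exists i.
have -> : \bigcap_(i in setT) E i = \bigcap_(x in [set: {i | i \in A}]) E (val x).
  apply/seteqP; split => w hw; first by move=> x _; exact: hw.
  move=> i _; have [iA|/ET -> //] := boolP (i \in A).
  exact: (hw (exist _ i iA) Logic.I).
rewrite prodA -(big_sub A (fun i => P (E i))) [RHS](bigID (mem A)) /= [X in (_ * X)%E]big1 ?mule1 //.
by move=> i /ET ->; exact: probability_setT.
Qed.

Lemma mutually_independentT (I : finType) (S : I -> set_system T) (E : I -> set T) :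
  mutually_independent P S -> (forall i, S i (E i)) ->
  P (\bigcap_(i in setT) E i) = (\prod_i P (E i))%E.
Proof.
move=> ind h; have := ind [set: I]%SET E (fun i _ => h i).
rewrite (_ : [set` [set: I]%SET] = setT); last by apply/seteqP; split => // i _; rewrite /= inE.
by move=> ->; apply: eq_bigl => i; rewrite inE.
Qed.

End ConstantEvents.

Section CoordinateIndependence.
Context (R : realType) (N : nat) d (T : measurableType d) (P : probability T R).
Local Notation C := R[i].
Variable Y : T -> 'M[C]_N.
Hypothesis hY : forall w, Y w \is hermsymmx.
Hypothesis mY : random_matrix Y.
Hypothesis iY : independent_entries P Y.
Hypothesis iE : forall a b : 'I_N, (a < b)%N ->
  indep_Re_Im P (fun w => Y w a b) \/ forall w, complex.Im (Y w a b) = 0.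

Let Z k w := hcoord k (Y w).

Lemma measurable_hcoord k : measurable_fun setT (Z k).
Proof. by case: k => -[a b] c; rewrite /Z /hcoord; case: (a <= b)%N; [exact: mY|exact: measurable_cst]. Qed.

Lemma herm_diag_Im w a : complex.Im (Y w a a) = 0.
Proof.
have /hermP := hY w; move: (Y w) => X /matrixP /(_ a a); rewrite !mxE.
by case: (X a a) => x y [] /= e; lra.
Qed.

Let rect2 (B : coord_idx N -> set R) a b : (forall k, measurable (B k)) ->
  P (\bigcap_(c in setT) (Z (a, b, c) @^-1` B (a, b, c))) = (\prod_c P (Z (a, b, c) @^-1` B (a, b, c)))%E.
Proof.
move=> mB; set E := fun c => Z (a, b, c) @^-1` B (a, b, c).
have mE c : measurable (E c) by rewrite -[E c]setTI; exact: measurable_hcoord.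
rewrite big_bool /= (_ : \bigcap_(c in setT) E c = E true `&` E false); last first.
  by apply/seteqP; split => w; [move=> h; split; exact: h|move=> [h1 h2] [] _].
have [ab|ba] := leqP a b; last first.
  by apply: (@prob_cap_cst _ _ _ _ _ 0) => // w; rewrite /Z /hcoord leqNgt ba.
have [im0|im0] := pselect (forall w, complex.Im (Y w a b) = 0).
  by apply: (@prob_cap_cst _ _ _ _ _ 0) => // w; rewrite /Z /hcoord ab /= im0.
have ltab : (a < b)%N.
  rewrite ltn_neqAle ab andbT; apply/eqP => /val_inj e; apply: im0 => w.
  by rewrite -e herm_diag_Im.
case: (iE ltab) => // ind.
have := mutually_independentT (E := E) ind; rewrite big_bool /=.
rewrite (_ : \bigcap_(c in setT) E c = E true `&` E false); last first.
  by apply/seteqP; split => w; [move=> h; split; exact: h|move=> [h1 h2] [] _].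
apply => c; rewrite /E /Z /hcoord ab.
by have := @sigma_gen_preimage R d T unit (fun _ : unit => part c \o (fun w => Y w a b)) tt _ (mB (a, b, c)).
Qed.

(** Independence is assembled in two layers: between the entries with a <= b, and between the real
    and imaginary parts of one entry. Dummy coordinates are constant and give trivial events. *)
Lemma hcoord_rect_indep : rect_indep P Z.
Proof.
move=> B mB; pose E (ab : 'I_N * 'I_N) := \bigcap_(c in setT) (Z (ab, c) @^-1` B (ab, c)).
transitivity (\prod_ab P (E ab))%E; last first.
  transitivity (\prod_(ab : 'I_N * 'I_N) \prod_c P (Z (ab, c) @^-1` B (ab, c)))%E.
    by apply: eq_bigr => -[a b] _; exact: rect2.
  by rewrite pair_bigA; apply: eq_bigr => -[].
have -> : \bigcap_(i in setT) (Z i @^-1` B i) = \bigcap_(ab in setT) E ab.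
  by apply/seteqP; split => w h; [move=> ab _ c _; exact: h|move=> [ab c] _; exact: h].
apply: (prob_bigcap_trivial (A := [pred ab : 'I_N * 'I_N | (ab.1 <= ab.2)%N])) => [[a b]|].
  rewrite inE /= => nab.
  have cstE c : Z (a, b, c) @^-1` B (a, b, c) = (if 0 \in B (a, b, c) then setT else set0).
    have -> : Z (a, b, c) = cst 0 by apply/funext => w; rewrite /Z /hcoord (negbTE nab).
    exact: preimage_cst.
  have [h|h] := pselect (forall c, 0 \in B (a, b, c)).
    by left; apply/seteqP; split => // w _ c _; rewrite cstE h.
  right; have [c hc] : exists c, (0 \in B (a, b, c)) = false.
    by apply/not_existsP => h'; apply: h => c; case: (boolP (_ \in _)) (h' c) => // /negbTE.
  by rewrite -subset0 => w /(_ c I); rewrite cstE hc.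
apply: (mutually_independentT iY) => -[[a b] /= ab].
apply: sigma_gen_bigcap => c; rewrite /Z /hcoord ab.
by have := @sigma_gen_preimage R d T bool (fun b0 => part b0 \o (fun w => Y w a b)) c _ (mB (a, b, c)).
Qed.

End CoordinateIndependence.

Lemma joint_rect_indep (R : realType) (N : nat) d (T : measurableType d) (P : probability T R)
    (J : finType) (Y : J -> T -> 'M[R[i]]_N) :
  mutually_independent P (fun j => sigma_matrix (Y j)) ->
  (forall j, rect_indep P (fun k w => hcoord k (Y j w))) ->
  rect_indep P (fun (i : J * coord_idx N) w => hcoord i.2 (Y i.1 w)).
Proof.
move=> indJ ind B mB.
pose E j := \bigcap_(k in setT) ((fun w => hcoord k (Y j w)) @^-1` B (j, k)).
have -> : \bigcap_(i in setT) ((fun w => hcoord i.2 (Y i.1 w)) @^-1` B i) = \bigcap_(j in setT) E j.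
  by apply/seteqP; split => w h; [move=> j _ k _; exact: (h (j, k))|move=> [j k] _; exact: h].
rewrite (mutually_independentT indJ); last first.
  move=> j; apply: sigma_gen_bigcap => -[[a b] c]; rewrite /hcoord; case: (a <= b)%N; last exact: sigma_gen_cst.
  by have := @sigma_gen_preimage R d T _ (fun (x : 'I_N * 'I_N * bool) w => part x.2 (Y j w x.1.1 x.1.2)) (a, b, c) _ (mB (j, (a, b, c))).
transitivity (\prod_j \prod_k P ((fun w => hcoord k (Y j w)) @^-1` B (j, k)))%E.
  by apply: eq_bigr => j _; apply: ind => k; exact: mB.
by rewrite pair_bigA; apply: eq_bigr => -[].
Qed.

Section Symmetry.
Context (R : realType) (N : nat).
Local Notation C := R[i].
Implicit Types A : 'M[C]_N.

Lemma has_symmetry_real A a b : has_symmetry RealSymmetric A -> complex.Im (A a b) = 0.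
Proof. by move=> [/mxOverP /(_ a b) rA _]; by have /complex_realP[k ->] := rA. Qed.

Lemma has_symmetry_herm beta A : has_symmetry beta A -> A \is hermsymmx.
Proof.
case: beta => // sA; apply/hermP/matrixP => a b; rewrite !mxE.
have [_ /is_hermitianmxP h] := sA.
have := has_symmetry_real b a sA.
have := congr1 (fun M : 'M[C]_N => M a b) h; rewrite expr0 scale1r !mxE => ->.
by case: (A b a) => x y /= ->; exact: conjC_real.
Qed.

End Symmetry.

Section Laws.
Context (R : realType) (N : nat) d (T : measurableType d) (P : probability T R).
Local Notation C := R[i].
Hypothesis N0 : (0 < N)%N.
Let NR : 0 < N%:R :> R. Proof. by rewrite ltr0n. Qed.

(** The variance is chosen before [G], so all ensembles of one symmetry type share it; this is what
    will make the two self-energies equal. *)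
Lemma gauss_coord_law beta (k : coord_idx N) :
  (forall G, gaussian_ensemble P beta G -> forall w, hcoord k (G w) = 0) \/
  exists v, [/\ 0 < v, v <= 2 / N%:R &
    forall G, gaussian_ensemble P beta G -> centered_gaussian P v (fun w => hcoord k (G w))].
Proof.
case: k => -[a b] c; rewrite /hcoord; have [ab|_] := leqP a b; last by left.
have v1 : 0 < (2 * N%:R)^-1 :> R by rewrite invr_gt0 mulr_gt0.
have v2 : 0 < N%:R^-1 :> R by rewrite invr_gt0.
have v12 : N%:R^-1 <= 2 / N%:R :> R by rewrite mulr_natl mulr2n lerDl ltW.
have v3 : 1 / (2 * N%:R) <= 2 / N%:R :> R.
  apply: le_trans v12; have -> : 1 / (2 * N%:R) = N%:R^-1 / 2 :> R by rewrite div1r invfM mulrC.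
  by lra.
case: beta.
  case: c; last by left => G gG w; exact: has_symmetry_real (gauss_symm gG w).
  right; exists ((if a == b then 2 else 1) / N%:R); split.
  - by rewrite divr_gt0 //; case: ifP.
  - by case: ifP => //; rewrite div1r.
  - by move=> G gG; exact: gauss_goe gG erefl a b.
have [<-|ne] := eqVneq a b.
  case: c; last by left => G gG w; apply: herm_diag_Im => w'; exact: has_symmetry_herm (gauss_symm gG w').
  right; exists (1 / N%:R); split; rewrite ?div1r //.
  by move=> G gG; have := gauss_gue_diag gG erefl a; rewrite div1r.
right; exists (1 / (2 * N%:R)); split => //; first by rewrite div1r.
by move=> G gG; have [h1 h2 _] := gauss_gue_offdiag gG erefl ne; case: c.
Qed.

Lemma gauss_coord_ensemble beta G (k : coord_idx N) : gaussian_ensemble P beta G ->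
  gauss_coord P (2 / N%:R) (fun w => hcoord k (G w)).
Proof.
move=> gG; split; first exact: measurable_hcoord (gauss_meas gG) k.
case: (gauss_coord_law beta k) => [h|[v [v0 vN h]]]; first by left; exact: h.
right; exists (Num.sqrt v); split; [by rewrite sqrtr_gt0|by rewrite sqr_sqrtr // ltW|].
exact: h gG.
Qed.

Lemma gauss_second_moment_eq beta G G' (k : coord_idx N) :
  gaussian_ensemble P beta G -> gaussian_ensemble P beta G' ->
  \int[P]_w (hcoord k (G w) * hcoord k (G w)) = \int[P]_w (hcoord k (G' w) * hcoord k (G' w)).
Proof.
move=> gG gG'; case: (gauss_coord_law beta k) => [h|[v [v0 _ h]]].
  by apply: eq_Rintegral => w _; rewrite (h _ gG) (h _ gG').
have s0 : 0 < Num.sqrt v by rewrite sqrtr_gt0.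
have m2 : measurable_fun setT (fun x : R => x * x) by exact: measurable_funM.
have e H : gaussian_ensemble P beta H -> _ := fun gH =>
  gaussian_law (measurable_hcoord (gauss_meas gH) k) (h H gH) m2 (fun x => sqr_ge0 x).
by rewrite /Rintegral (e _ gG) (e _ gG').
Qed.

Lemma gauss_indep_parts beta G (a b : 'I_N) : gaussian_ensemble P beta G -> (a < b)%N ->
  indep_Re_Im P (fun w => G w a b) \/ forall w, complex.Im (G w a b) = 0.
Proof.
case: beta => gG ab; first by right => w; exact: has_symmetry_real (gauss_symm gG w).
left; have ne : a != b by apply/eqP => e; rewrite e ltnn in ab.
by case: (gauss_gue_offdiag gG erefl ne).
Qed.

Lemma gauss_rect_indep beta G : gaussian_ensemble P beta G ->
  rect_indep P (fun (k : coord_idx N) w => hcoord k (G w)).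
Proof.
move=> gG; apply: hcoord_rect_indep.
- by move=> w; exact: has_symmetry_herm (gauss_symm gG w).
- exact: gauss_meas gG.
- exact: gauss_indep gG.
- by move=> a b; exact: gauss_indep_parts gG.
Qed.

Section Wigner.
Variables (beta : symmetry_type) (c0 C0 : R) (Cp : nat -> R) (W : T -> 'M[C]_N).
Hypothesis wW : wigner_type P beta c0 C0 Cp W.

Let hW w : W w \is hermsymmx. Proof. exact: has_symmetry_herm (wigner_symm wW w). Qed.

Lemma wigner_rect_indep : rect_indep P (fun k w => hcoord k (W w)).
Proof.
apply: hcoord_rect_indep => //; [exact: wigner_meas wW|exact: wigner_indep wW|move=> a b ab].
case E : beta; first by right => w; have := wigner_symm wW w; rewrite E => /has_symmetry_real; exact.
by left; have ne : a != b by [apply/eqP => e; rewrite e ltnn in ab]; case: (wigner_cplx wW E ne).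
Qed.

Let mp c a b : measurable_fun setT (fun w => part c (W w a b)). Proof. exact: (wigner_meas wW). Qed.

Let cabs2 (z : C) : cabs z ^+ 2 = sqn z.
Proof. by case: z => x y; rewrite /= sqr_sqrtr // addr_ge0 ?sqr_ge0. Qed.

Let m4 a b : (\int[P]_w ((sqn (W w a b)) ^+ 2)%:E <= (Cp 4 / N%:R ^+ 2)%:E)%E.
Proof.
have := wigner_moments wW 4 a b; rewrite unlock.
have -> : (N%:R : R) `^ (- (4%:R / 2)) = (N%:R ^+ 2)^-1.
  have -> : 4%:R / 2 = 2%:R :> R by field.
  by rewrite powRN powR_mulrn.
by under eq_integral => w _ do rewrite -[4%N]/(2 * 2)%N exprM cabs2.
Qed.

Let msq a b : measurable_fun setT (fun w => sqn (W w a b)).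
Proof. by apply: measurable_funD; apply: measurable_funX; [exact: (mp true)|exact: (mp false)]. Qed.

Let i4 a b : P.-integrable setT (EFin \o (fun w => sqn (W w a b) ^+ 2)).
Proof.
by apply: integrable_ge0_lt (m4 a b) => [|w]; [exact: measurable_funX|exact: sqr_ge0].
Qed.

Let i2 a b : P.-integrable setT (EFin \o (fun w => sqn (W w a b))).
Proof.
apply: (integrableR_le (g := fun w => 1 + sqn (W w a b) ^+ 2)) => // [w|]; last first.
  by apply: integrableRD => //; exact: integrableR_cst.
rewrite ger0_norm ?sqn_ge0 //; move: (sqn _) => x; have := sqr_ge0 (x - 1); nra.
Qed.

Let part_sqr_le c (z : C) : part c z ^+ 2 <= sqn z.
Proof. by rewrite /sqn; case: c; rewrite /= ?lerDl ?lerDr sqr_ge0. Qed.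

Let ip2 c a b : P.-integrable setT (EFin \o (fun w => part c (W w a b) ^+ 2)).
Proof.
apply: (integrableR_le (g := fun w => sqn (W w a b))) => // [|w]; first exact: measurable_funX.
by rewrite ger0_norm ?sqr_ge0.
Qed.

Let ip4 c a b : P.-integrable setT (EFin \o (fun w => part c (W w a b) ^+ 4)).
Proof.
apply: (integrableR_le (g := fun w => sqn (W w a b) ^+ 2)) => // [|w]; first exact: measurable_funX.
rewrite -[4%N]/(2 * 2)%N exprM ger0_norm ?sqr_ge0 // lerXn2r // nnegrE ?sqr_ge0 ?sqn_ge0 //.
Qed.

Let ip1 c a b : P.-integrable setT (EFin \o (fun w => part c (W w a b))).
Proof.
apply: (integrableR_le (g := fun w => 1 + part c (W w a b) ^+ 2)) => // [w|]; last first.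
  by apply: integrableRD => //; exact: integrableR_cst.
move: (part _ _) => x; have := sqr_ge0 (x - 1); have := sqr_ge0 (x + 1).
by rewrite ler_norml => *; apply/andP; split; nra.
Qed.

Let mean0 c a b : \int[P]_w part c (W w a b) = 0.
Proof.
have := wigner_mean wW a b; rewrite /cexpect unlock => /eqP; rewrite eq_complex /= => /andP[/eqP h1 /eqP h2].
by case: c.
Qed.

(** For complex off-diagonal entries, E w^2 = 0 equates the second moments of the real and imaginary
    parts; in all other cases the imaginary part vanishes. *)
Let re_var a b : c0 / 2 / N%:R <= \int[P]_w (part true (W w a b) ^+ 2).
Proof.
have /andP[+ _] := wigner_var wW a b; rewrite unlock.
under eq_integral => w _ do rewrite cabs2.
have -> : (\int[P]_w (sqn (W w a b))%:E = (\int[P]_w sqn (W w a b))%:E)%E.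
  by rewrite /Rintegral fineK //; exact: integrable_fin_num (i2 a b).
rewrite lee_fin.
have -> : \int[P]_w sqn (W w a b) = \int[P]_w (part true (W w a b) ^+ 2) + \int[P]_w (part false (W w a b) ^+ 2).
  by rewrite -RintegralD.
have p0 : 0 <= \int[P]_w (part true (W w a b) ^+ 2) by apply: Rintegral_ge0 => w _; exact: sqr_ge0.
have -> : c0 / 2 / N%:R = (c0 / N%:R) / 2 by rewrite mulrAC.
have le_im : \int[P]_w (part false (W w a b) ^+ 2) <= \int[P]_w (part true (W w a b) ^+ 2).
  have im0 : (forall w, complex.Im (W w a b) = 0) -> \int[P]_w (part false (W w a b) ^+ 2) <= \int[P]_w (part true (W w a b) ^+ 2).
    move=> z; rewrite (_ : \int[P]_w (part false (W w a b) ^+ 2) = 0) //.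
    under eq_Rintegral do rewrite /= z expr0n.
    exact: Rintegral_prob_cst.
  case E : beta; first by apply: im0 => w; have := wigner_symm wW w; rewrite E => /has_symmetry_real; exact.
  have [e|ne] := eqVneq a b; first by apply: im0 => w; rewrite -e; exact: (herm_diag_Im hW).
  have [_ /eqP] := wigner_cplx wW E ne; rewrite /cexpect unlock eq_complex /= => /andP[/eqP h _].
  have : \int[P]_w (part true (W w a b) ^+ 2 - part false (W w a b) ^+ 2) = 0.
    rewrite -[RHS]h; congr fine; apply: eq_integral => w _; congr EFin.
    by rewrite /=; case: (W w a b) => x y; rewrite expr2 /=; ring.
  by rewrite RintegralB // => /eqP; rewrite subr_eq0 => /eqP ->.
move: le_im p0; move: (\int[P]_w _) (\int[P]_w _) (c0 / N%:R) => p q u; lra.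
Qed.

Let re_m4 a b : \int[P]_w (part true (W w a b) ^+ 4) <= Cp 4 / N%:R ^+ 2.
Proof.
have := m4 a b.
have -> : (\int[P]_w (sqn (W w a b) ^+ 2)%:E = (\int[P]_w (sqn (W w a b) ^+ 2))%:E)%E.
  by rewrite /Rintegral fineK //; exact: integrable_fin_num (i4 a b).
rewrite lee_fin; apply: le_trans; apply: le_Rintegral => // w _.
rewrite -[4%N]/(2 * 2)%N exprM lerXn2r // nnegrE ?sqr_ge0 ?sqn_ge0 //.
Qed.

Let row_coord a b : exists a' b' : 'I_N, (fun w => hcoord (row_idx a b) (W w)) = (fun w => part true (W w a' b')).
Proof.
rewrite /row_idx; case: leqP => ab; [exists a, b|exists b, a]; apply/funext => w; rewrite /hcoord.
  by rewrite ab.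
by rewrite (ltnW ab).
Qed.

Lemma wigner_row_family : row_family P (fun k w => hcoord k (W w)) (c0 / 2 / N%:R) (Cp 4 / N%:R ^+ 2).
Proof.
split=> [k|a b|a b|a b|a b|a b|a b]; first exact: measurable_hcoord (wigner_meas wW) k.
all: have [a' [b' E]] := row_coord a b.
- by rewrite E.
- have -> : (fun w => hcoord (row_idx a b) (W w) ^+ 2) = (fun w => part true (W w a' b') ^+ 2).
    by apply/funext => w; have := congr1 (fun f => f w) E => /= ->.
  exact: ip2.
- have -> : (fun w => hcoord (row_idx a b) (W w) ^+ 4) = (fun w => part true (W w a' b') ^+ 4).
    by apply/funext => w; have := congr1 (fun f => f w) E => /= ->.
  exact: ip4.
- by rewrite (congr1 (fun f => \int[P]_w f w) E) mean0.
- by rewrite (congr1 (fun f => \int[P]_w (f w ^+ 2)) E); exact: re_var.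
- by rewrite (congr1 (fun f => \int[P]_w (f w ^+ 4)) E); exact: re_m4.
Qed.

Lemma wigner_coord_moments k :
  [/\ measurable_fun setT (fun w => hcoord k (W w)),
      P.-integrable setT (EFin \o (fun w => hcoord k (W w) ^+ 4)) &
      \int[P]_w hcoord k (W w) = 0].
Proof.
split; first exact: measurable_hcoord (wigner_meas wW) k.
  case: k => -[a b] c; rewrite /hcoord; case: (a <= b)%N; first exact: ip4.
  by under eq_fun do rewrite expr0n; exact: integrableR_cst.
case: k => -[a b] c; rewrite /hcoord; case: (a <= b)%N; first exact: mean0.
exact: Rintegral_prob_cst.
Qed.

End Wigner.

End Laws.

(** * The Dyson equation and the density of states *)

Section SelfEnergy.
Context (R : realType) (N : nat) d (T : measurableType d) (P : probability T R).
Local Notation C := R[i].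

Lemma cexpect_sum (I : finType) (r : I -> T -> R) (c : I -> C) :
  (forall i, P.-integrable setT (EFin \o r i)) ->
  cexpect P (fun w => \sum_i (r i w)%:C * c i) = \sum_i (\int[P]_w r i w)%:C * c i.
Proof.
move=> ir.
have E b : \int[P]_w part b (\sum_i (r i w)%:C * c i) = part b (\sum_i (\int[P]_w r i w)%:C * c i).
  have pE (f : I -> R) : part b (\sum_i (f i)%:C * c i) = \sum_i part b (c i) * f i.
    rewrite (big_morph (part b) (id1 := 0) (op1 := +%R)); first by apply: eq_bigr => i _; rewrite partZ mulrC.
      by move=> x y; rewrite partD.
    by case: b.
  under eq_Rintegral do rewrite pE.
  rewrite Rintegral_sum => [|i]; last exact: integrableRZ.
  by rewrite pE; apply: eq_bigr => i _; rewrite RintegralZl.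
rewrite /cexpect unlock; apply/eqP; rewrite eq_complex /=.
by apply/andP; split; apply/eqP; [exact: (E true)|exact: (E false)].
Qed.

(** The self-energy of a matrix whose real coordinates are uncorrelated with second moments
    [sigma]. *)
Definition energy_op (sigma : coord_idx N -> R) (Q : 'M[C]_N) : 'M[C]_N :=
  \sum_q (sigma q)%:C *: (hbasis R q *m Q *m hbasis R q).

Lemma self_energyE (W : T -> 'M[C]_N) Q : (forall w, W w \is hermsymmx) ->
  (forall q q', P.-integrable setT (EFin \o (fun w => hcoord q (W w) * hcoord q' (W w)))) ->
  (forall q q', q != q' -> \int[P]_w (hcoord q (W w) * hcoord q' (W w)) = 0) ->
  self_energy P W Q = energy_op (fun q => \int[P]_w (hcoord q (W w) * hcoord q (W w))) Q.
Proof.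
move=> hW iX oX; apply/matrixP => a b; rewrite mxE.
pose B (p : coord_idx N * coord_idx N) := hbasis R p.1 *m Q *m hbasis R p.2.
transitivity (\sum_p (\int[P]_w (hcoord p.1 (W w) * hcoord p.2 (W w)))%:C * B p a b).
  rewrite -cexpect_sum; last by move=> p; exact: iX.
  congr (cexpect _ _); apply/funext => w.
  have E : W w *m Q *m W w = \sum_p (hcoord p.1 (W w) * hcoord p.2 (W w))%:C *: B p.
    rewrite -{1 2}(sum_hstep (hW w)) /hstep !mulmx_suml.
    transitivity (\sum_q \sum_q' (hcoord q (W w) * hcoord q' (W w))%:C *: B (q, q')).
      apply: eq_bigr => q _; rewrite mulmx_sumr; apply: eq_bigr => q' _.
      by rewrite -!scalemxAl -scalemxAr scalerA -rmorphM.
    by rewrite pair_bigA; apply: eq_bigr => -[].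
  by rewrite E summxE; apply: eq_bigr => p _; rewrite mxE.
rewrite /energy_op summxE.
rewrite -(pair_bigA _ (fun q q' => (\int[P]_w (hcoord q (W w) * hcoord q' (W w)))%:C * B (q, q') a b)) /=.
apply: eq_bigr => q _; rewrite (bigD1 q) //= big1 ?addr0; first by rewrite [RHS]mxE.
by move=> q' ne; rewrite oX 1?eq_sym // mul0r.
Qed.

End SelfEnergy.

Section PerturbedCoordinates.
Context (R : realType) (N : nat) d (T : measurableType d) (P : probability T R).
Local Notation C := R[i].
Local Notation JK := (('I_3 * coord_idx N)%type : finType).
Variable Y : 'I_3 -> T -> 'M[C]_N.
Local Notation Z := (fun (i : JK) w => hcoord i.2 (Y i.1 w)).
Hypothesis iZ : rect_indep P Z.
Hypothesis mZ : forall i : JK, measurable_fun setT (Z i).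
Hypothesis Z4 : forall i : JK, P.-integrable setT (EFin \o (fun w => Z i w ^+ 4)).
Hypothesis Z0 : forall i : JK, \int[P]_w Z i w = 0.

Lemma hcoordD (k : coord_idx N) (X X' : 'M[C]_N) : hcoord k (X + X') = hcoord k X + hcoord k X'.
Proof. by case: k => -[a b] c; rewrite /hcoord; case: ifP => _; rewrite ?addr0 // mxE partD. Qed.

Lemma hcoordZ (k : coord_idx N) (a : R) (X : 'M[C]_N) : hcoord k (a%:C *: X) = a * hcoord k X.
Proof. by case: k => -[a' b] c; rewrite /hcoord; case: ifP => _; rewrite ?mulr0 // mxE partZ. Qed.

Variables (a : R) (j : 'I_3).
Hypothesis j0 : j != ord0.
Let X q w := hcoord q (Y ord0 w + a%:C *: Y j w).

Let prodE q q' w : X q w * X q' w =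
  Z (ord0, q) w * Z (ord0, q') w + a * (Z (ord0, q) w * Z (j, q') w) +
  a * (Z (j, q) w * Z (ord0, q') w) + a ^+ 2 * (Z (j, q) w * Z (j, q') w).
Proof. by rewrite /X !hcoordD !hcoordZ /=; ring. Qed.

Let iZZ (i i' : JK) : P.-integrable setT (EFin \o (fun w => Z i w * Z i' w)).
Proof. exact: (integrable_mul4 (mZ i) (mZ i') (Z4 i) (Z4 i')). Qed.

Let ZZ0 (i i' : JK) : i != i' -> \int[P]_w (Z i w * Z i' w) = 0.
Proof. by move=> ii; apply: (indep_mul_eq0 mZ iZ ii). Qed.

Lemma perturbed_integrable q q' : P.-integrable setT (EFin \o (fun w => X q w * X q' w)).
Proof.
under eq_fun do rewrite prodE.
by do ?[apply: integrableRD | apply: integrableRZ]; exact: iZZ.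
Qed.

Let integral_prod q q' : \int[P]_w (X q w * X q' w) =
  \int[P]_w (Z (ord0, q) w * Z (ord0, q') w) + a * \int[P]_w (Z (ord0, q) w * Z (j, q') w) +
  a * \int[P]_w (Z (j, q) w * Z (ord0, q') w) + a ^+ 2 * \int[P]_w (Z (j, q) w * Z (j, q') w).
Proof.
under eq_Rintegral do rewrite prodE.
have iaZ c (i i' : JK) : P.-integrable setT (EFin \o (fun w => c * (Z i w * Z i' w))) by exact: integrableRZ (iZZ i i').
have i2 := integrableRD (iZZ (ord0, q) (ord0, q')) (iaZ a (ord0, q) (j, q')).
have i3 := integrableRD i2 (iaZ a (j, q) (ord0, q')).
rewrite (RintegralD measurableT i3 (iaZ _ _ _)) (RintegralD measurableT i2 (iaZ _ _ _)).
rewrite (RintegralD measurableT (iZZ _ _) (iaZ _ _ _)).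
by rewrite (RintegralZl _ measurableT (iZZ _ _)) (RintegralZl _ measurableT (iZZ _ _)) (RintegralZl _ measurableT (iZZ _ _)).
Qed.

Lemma perturbed_orthogonal q q' : q != q' -> \int[P]_w (X q w * X q' w) = 0.
Proof.
move=> qq; have ne (i i' : 'I_3) : (i, q) != (i', q') :> JK by rewrite xpair_eqE (negbTE qq) andbF.
by rewrite integral_prod !ZZ0 // !mulr0 !addr0.
Qed.

Lemma perturbed_variance q : \int[P]_w (X q w * X q w) =
  \int[P]_w (hcoord q (Y ord0 w) * hcoord q (Y ord0 w)) + a ^+ 2 * \int[P]_w (hcoord q (Y j w) * hcoord q (Y j w)).
Proof.
have ne : (ord0, q) != (j, q) :> JK by rewrite xpair_eqE eq_sym (negbTE j0).
have ne' : (j, q) != (ord0, q) :> JK by rewrite eq_sym.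
by rewrite integral_prod (ZZ0 ne) (ZZ0 ne') !mulr0 !addr0.
Qed.

End PerturbedCoordinates.

Section DyadicSums.
Context (R : realType) (N : nat).
Local Notation C := R[i].
Implicit Types (X Y M : 'M[C]_N).

Lemma delta_mul_delta Y (a b c e : 'I_N) :
  delta_mx a b *m Y *m delta_mx c e = Y b c *: delta_mx a e :> 'M[C]_N.
Proof.
apply/matrixP => i j; rewrite !mxE (bigD1 c) //= big1 ?addr0 => [|k kc]; last first.
  by rewrite [X in _ * X]mxE (negbTE kc) mulr0.
rewrite !mxE eqxx /= (bigD1 b) //= big1 ?addr0 => [|k kb]; last by rewrite mxE (negbTE kb) andbF mul0r.
by rewrite mxE eqxx andbT; case: (i == a); case: (j == e); rewrite ?mul1r ?mulr1 ?mul0r ?mulr0.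
Qed.

Definition sym_delta (a b : 'I_N) : 'M[C]_N := delta_mx a b + delta_mx b a.

(** The real symmetric directions alone already produce the trace; the transpose that accompanies it
    contributes a nonnegative amount where this is used. *)
Lemma sum_sym_delta Y : \sum_a \sum_b sym_delta a b *m Y *m sym_delta a b =
  (2 * \tr Y)%:M + 2 *: Y^T.
Proof.
have E a b : sym_delta a b *m Y *m sym_delta a b =
   (Y b a *: delta_mx a b + Y a a *: delta_mx b b) + (Y b b *: delta_mx a a + Y a b *: delta_mx b a).
  by rewrite /sym_delta mulmxDr !mulmxDl !delta_mul_delta.
have tE : \sum_a \sum_b Y b a *: delta_mx a b = Y^T.
  by rewrite [RHS]matrix_sum_delta; apply: eq_bigr => a _; apply: eq_bigr => b _; rewrite mxE.
have dE : \sum_a \sum_b Y b b *: delta_mx a a = (\tr Y)%:M :> 'M[C]_N.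
  under eq_bigr do rewrite -scaler_suml.
  by rewrite scalar_mx_sum_delta.
under eq_bigr do under eq_bigr do rewrite E.
under eq_bigr do rewrite big_split /= big_split /= [X in _ + X]big_split /=.
rewrite big_split /= big_split /= [X in _ + X]big_split /= tE dE.
rewrite [X in _ + X + _]exchange_big dE [X in _ + (_ + X)]exchange_big /= tE.
move: (\tr Y) => t.
by apply/matrixP => i j; rewrite !mxE; case: (i == j); rewrite ?mulr1n ?mulr0n; ring.
Qed.

End DyadicSums.

Section TraceBound.
Context (R : realType) (N : nat).
Local Notation C := R[i].
Implicit Types (X Y M : 'M[C]_N).

Lemma posdef_trace_ge0 Y X : posdefmx Y -> 0 <= \tr (X *m Y *m X ^t*).
Proof.
move=> pY; apply: sumr_ge0 => i _; pose v := (row i X) ^t*.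
have -> : (X *m Y *m X ^t*) i i = (v ^t* *m Y *m v) 0 0.
  rewrite /v trmxCK; transitivity ((row i (X *m Y *m X ^t*)) 0 i); first by rewrite [RHS]mxE.
  by rewrite !row_mul [LHS]mxE [RHS]mxE; apply: eq_bigr => k _; congr (_ * _); rewrite !mxE.
have [->|v0] := eqVneq v 0; first by rewrite mulmx0 mxE.
exact/ltW/pY.
Qed.

Lemma posdef_diag_gt0 Y i : posdefmx Y -> 0 < Y i i.
Proof.
move=> pY; pose e : 'cV[C]_N := delta_mx i 0.
have -> : Y i i = (e ^t* *m Y *m e) 0 0.
  by rewrite /e trmx_delta map_delta_mx -rowE -colE !mxE.
by apply: pY; apply/eqP => /matrixP /(_ i 0) /eqP; rewrite !mxE !eqxx oner_eq0.
Qed.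

Lemma energy_op_adj (sigma : coord_idx N -> R) Y : (energy_op sigma Y) ^t* = energy_op sigma (Y ^t*).
Proof.
have S : {morph (fun X : 'M[C]_N => X ^t*) : X X' / X + X' >-> X + X'} by exact: adjmxD.
rewrite /energy_op (big_morph (fun X : 'M[C]_N => X ^t*) S (_ : (0 : 'M[C]_N) ^t* = 0)); last first.
  by rewrite trmx0 map_mx0.
apply: eq_bigr => q _; rewrite adjmxZ conjC_real !trmx_mul !map_mxM hbasis_adj mulmxA //.
Qed.

Lemma energy_opB (sigma : coord_idx N -> R) X Y : energy_op sigma (X - Y) = energy_op sigma X - energy_op sigma Y.
Proof.
by rewrite /energy_op -sumrB; apply: eq_bigr => q _; rewrite mulmxBr mulmxBl scalerBr.
Qed.

Lemma energy_opZ (sigma : coord_idx N -> R) c Y : energy_op sigma (c *: Y) = c *: energy_op sigma Y.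
Proof.
rewrite /energy_op scaler_sumr; apply: eq_bigr => q _.
by rewrite -scalemxAr -scalemxAl !scalerA mulrC.
Qed.

Variables (sigma : coord_idx N -> R) (u : R).
Hypotheses (u0 : 0 < u) (s0 : forall q, 0 <= sigma q) (su : forall a b, u <= sigma (row_idx a b)).

(** All terms are nonnegative, so it is enough to keep the real coordinates, whose variances are at
    least u, and to compare them with the full symmetric family of [sum_sym_delta]. *)
Lemma energy_trace_ge Y M : posdefmx Y ->
  (u / 2)%:C * (\tr Y * (hs M)%:C) <= \tr (M *m energy_op sigma Y *m M ^t*).
Proof.
move=> pY; pose h X := \tr (X *m Y *m X ^t*); have h0 X : 0 <= h X by exact: posdef_trace_ge0.
have ->  : \tr (M *m energy_op sigma Y *m M ^t*) = \sum_q (sigma q)%:C * h (M *m hbasis R q).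
  rewrite /energy_op mulmx_sumr mulmx_suml raddf_sum; apply: eq_bigr => q _.
  rewrite -scalemxAr -scalemxAl; apply: etrans (mxtraceZ _ _) _; congr (_ * \tr _).
  by rewrite trmx_mul map_mxM hbasis_adj !mulmxA.
pose g (a b : 'I_N) := if (a <= b)%N then (sigma (a, b, true))%:C * h (M *m hbasis R (a, b, true)) else 0.
have sC q : 0 <= (sigma q)%:C :> C by rewrite ler0c.
have gle : \sum_a \sum_b g a b <= \sum_q (sigma q)%:C * h (M *m hbasis R q).
  have -> : \sum_q (sigma q)%:C * h (M *m hbasis R q) =
    \sum_a \sum_b \sum_c (sigma (a, b, c))%:C * h (M *m hbasis R (a, b, c)).
    by rewrite pair_bigA pair_bigA; apply: eq_bigr => -[[a b] c].
  apply: ler_sum => a _; apply: ler_sum => b _; rewrite big_bool /= /g.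
  case: ifP => _; last by rewrite addr_ge0 // mulr_ge0.
  by rewrite lerDl mulr_ge0.
pose h' (a b : 'I_N) := h (M *m sym_delta R a b).
have h'C a b : h' a b = h' b a by rewrite /h' /sym_delta addrC.
have u4 : 0 <= (u / 4)%:C :> C by rewrite ler0c divr_ge0 // ltW.
(* On the diagonal [sym_delta] is twice the basis element, which gives a factor 4 and dictates the
   constant u/4. *)
have pairle a b : (u / 4)%:C * (h' a b + h' b a) <= g a b + g b a.
  wlog ab : a b / (a <= b)%N.
    move=> w; case: (leqP a b) => [ab|/ltnW ba]; first exact: w.
    by have hba := w b a ba; rewrite (addrC (h' a b)) (addrC (g a b)); exact: hba.
  have uab : (u%:C : C) <= (sigma (a, b, true))%:C.
    by rewrite lecR; have := su a b; rewrite /row_idx ab.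
  rewrite [h' b a]h'C /g ab; have [e|ne] := eqVneq a b.
    rewrite -e leqnn /h' /sym_delta /hbasis eqxx.
    have -> : h (M *m (delta_mx a a + delta_mx a a)) = 4 * h (M *m delta_mx a a).
      rewrite /h mulmxDr adjmxD mulmxDl mulmxDl !mulmxDr !raddfD /=; move: (\tr _) => x; ring.
    rewrite -e in uab.
    have -> : (u / 4)%:C * (4 * h (M *m delta_mx a a) + 4 * h (M *m delta_mx a a)) =
      u%:C * h (M *m delta_mx a a) + u%:C * h (M *m delta_mx a a).
      by rewrite rmorphM fmorphV rmorph_nat /=; field.
    by rewrite lerD // ler_wpM2r.
  have ba : (b <= a)%N = false.
    by apply/negbTE; rewrite -ltnNge ltn_neqAle ab andbT; apply: contra ne => /eqP/val_inj ->.
  have lab : (a < b)%N by rewrite ltnNge ba.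
  rewrite ba addr0 /hbasis (negbTE ne) lab -/(sym_delta R a b) -/(h' a b).
  apply: (@le_trans _ _ (u%:C * h' a b)); last by rewrite ler_wpM2r //; exact: h0.
  have -> : (u / 4)%:C * (h' a b + h' a b) = (u / 2)%:C * h' a b.
    by rewrite !rmorphM !fmorphV !rmorph_nat /=; field.
  apply: ler_wpM2r; first exact: h0.
  by rewrite lecR ler_pdivrMr // mulr_natr mulr2n lerDl ltW.
apply: le_trans gle; rewrite -(ler_pM2l (ltr0n C 2)).
have -> : 2 * \sum_a \sum_b g a b = \sum_a \sum_b (g a b + g b a).
  under [RHS]eq_bigr do rewrite big_split /=.
  by rewrite big_split /= [X in _ = _ + X]exchange_big mulr_natl mulr2n.
apply: le_trans (ler_sum _ (fun a _ => ler_sum _ (fun b _ => pairle a b))).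
have -> : \sum_a \sum_b (u / 4)%:C * (h' a b + h' b a) = (u / 2)%:C * \sum_a \sum_b h' a b.
  have -> : \sum_a \sum_b (u / 4)%:C * (h' a b + h' b a) = \sum_a \sum_b (u / 2)%:C * h' a b.
    apply: eq_bigr => a _; apply: eq_bigr => b _; rewrite [h' b a]h'C.
    by rewrite !rmorphM !fmorphV !rmorph_nat /=; field.
  by under eq_bigr do rewrite -mulr_sumr; rewrite -mulr_sumr.
have -> : \sum_a \sum_b h' a b = \tr (M *m ((2 * \tr Y)%:M + 2 *: Y^T) *m M ^t*).
  rewrite -sum_sym_delta mulmx_sumr mulmx_suml raddf_sum; apply: eq_bigr => a _.
  rewrite mulmx_sumr mulmx_suml raddf_sum; apply: eq_bigr => b _.
  have e : (M *m sym_delta R a b) ^t* = sym_delta R a b *m M ^t*.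
    by rewrite trmx_mul map_mxM; congr (_ *m _); rewrite /sym_delta adjmxD !adj_delta addrC.
  by rewrite /h' /h e !mulmxA.
have hT : 0 <= \tr (M *m Y^T *m M ^t*).
  have e : M *m Y^T *m M ^t* = (map_mx Num.conj M *m Y *m (map_mx Num.conj M) ^t*)^T.
    rewrite !trmx_mul mulmxA; congr (_ *m _ *m _).
      by apply/matrixP => i j; rewrite !mxE conjCK.
    by apply/matrixP => i j; rewrite !mxE.
  by rewrite e mxtrace_tr; exact: posdef_trace_ge0.
rewrite mulmxDr mulmxDl mxtraceD -scalemxAr -scalemxAl mxtraceZ mul_mx_scalar -scalemxAl mxtraceZ -hs_trE.
rewrite mulrCA; apply: ler_wpM2l; first by rewrite ler0c divr_ge0 // ltW.
by rewrite mulrA lerDl; apply: mulr_ge0 => //; exact: ler0n.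
Qed.

Hypothesis N0 : (0 < N)%N.

(** The imaginary part Y of M satisfies Y = M (Im z + S[Y]) M^*. Taking traces, [energy_trace_ge]
    lets tr Y cancel and leaves hs M <= 2/u; Cauchy-Schwarz on the diagonal of Y finishes. No
    operator-norm bound on M is involved. *)
Lemma MDE_trace_bound A z M : A \is hermsymmx -> 0 < complex.Im z -> M \in unitmx ->
  - invmx M = z%:M - A + energy_op sigma M -> posdefmx ((complex.Im z)%:C *: Im_mx M) ->
  cabs (ntr (Im_mx M)) <= Num.sqrt (2 / (u * N%:R)).
Proof.
move=> /hermP hA z0 uM eM pM; pose Y := Im_mx M.
have pY : posdefmx Y.
  move=> v v0; have := pM v v0; rewrite -scalemxAr -scalemxAl mxE pmulr_rgt0 //.
  by rewrite ltcR.
have two_i : (2 * 'i%C) != 0 :> C.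
  by rewrite mulf_neq0 ?pnatr_eq0 //; apply/eqP => /eqP; rewrite eq_complex /= oner_eq0 andbF.
have YE : Y = M *m ((complex.Im z)%:C%:M + energy_op sigma Y) *m M ^t*.
  have adjM (X X' : 'M[C]_N) : (X *m X') ^t* = X' ^t* *m X ^t* by rewrite trmx_mul map_mxM.
  have adjN (X : 'M[C]_N) : (- X) ^t* = - X ^t* by rewrite raddfN /= map_mxN.
  have e1 : - M ^t* = M *m (z%:M - A + energy_op sigma M) *m M ^t*.
    by rewrite -eM mulmxN mulmxV // mulNmx mul1mx.
  have e2 : - M = M *m ((Num.conj z)%:M - A + energy_op sigma (M ^t*)) *m M ^t*.
    have e : (- M ^t*) ^t* = (M *m (z%:M - A + energy_op sigma M) *m M ^t*) ^t* by rewrite e1.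
    rewrite adjN trmxCK !adjM trmxCK !adjmxD adjN hA energy_op_adj tr_scalar_mx map_scalar_mx mulmxA in e.
    exact: e.
  have e3 : M - M ^t* = M *m ((z - Num.conj z)%:M + energy_op sigma (M - M ^t*)) *m M ^t*.
    transitivity (M *m (z%:M - A + energy_op sigma M) *m M ^t* -
                  M *m ((Num.conj z)%:M - A + energy_op sigma (M ^t*)) *m M ^t*).
      have e : M - M ^t* = - M ^t* - - M by rewrite opprK addrC.
      exact: (etrans e (congr2 (fun p q : 'M[C]_N => p - q) e1 e2)).
    rewrite -mulmxBl -mulmxBr; congr (_ *m _ *m _).
    have -> : (z - Num.conj z)%:M = z%:M - (Num.conj z)%:M :> 'M[C]_N by exact: raddfB.
    have zm (V : zmodType) (p q w a b : V) : p - w + a - (q - w + b) = p - q + (a - b).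
      by rewrite opprD addrACA; congr (_ + _); rewrite opprB addrA subrK.
    by rewrite energy_opB; exact: zm.
  rewrite /Y /Im_mx {1}e3 scalemxAl scalemxAr scalerDr -energy_opZ scale_scalar_mx.
  congr (_ *m (_%:M + _) *m _); apply: (mulfI two_i); rewrite mulrA mulfV // mul1r.
  by case: (z) => x y; apply/eqP; rewrite eq_complex /=; apply/andP; split; apply/eqP; ring.
pose m i := complex.Im (M i i); pose tau := \sum_i m i.
have Yii i : Y i i = (m i)%:C.
  rewrite /Y /Im_mx mxE [X in _ * X]mxE [X in _ + X]mxE [X in - X]mxE [X in Num.conj X]mxE /m.
  apply: (mulfI two_i); rewrite mulrA mulfV // mul1r.
  by case: (M i i) => x y; apply/eqP; rewrite eq_complex /=; apply/andP; split; apply/eqP; ring.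
have m0 i : 0 < m i by have := posdef_diag_gt0 i pY; rewrite Yii ltcR.
have trE : \tr Y = tau%:C by rewrite /tau rmorph_sum /=; apply: eq_bigr => i _; exact: Yii.
have tau0 : 0 < tau.
  by rewrite /tau (bigD1 (Ordinal N0)) //= ltr_pwDl // sumr_ge0 // => i _; exact: ltW.
have hsM : u / 2 * hs M <= 1.
  rewrite -(ler_pM2r tau0) mul1r -lecR -trE YE mulmxDr mulmxDl mxtraceD mul_mx_scalar -scalemxAl mxtraceZ -hs_trE.
  have h := energy_trace_ge M pY; apply: (@le_trans _ _ (\tr (M *m energy_op sigma Y *m M ^t*))).
    have -> : (u / 2 * hs M * tau)%:C = (u / 2)%:C * (\tr Y * (hs M)%:C).
      by rewrite trE -!rmorphM -mulrA [hs M * _]mulrC.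
    exact: h.
  by rewrite lerDr mulr_ge0 // ler0c ?hs_ge0 // ltW.
have m2 : \sum_i m i ^+ 2 <= hs M.
  apply: ler_sum => i _; rewrite (bigD1 i) //=; apply: ler_wpDr.
    by apply: sumr_ge0 => j _; exact: sqn_ge0.
  by rewrite /sqn lerDr sqr_ge0.
have NR : 0 < N%:R :> R by rewrite ltr0n.
have cs : tau ^+ 2 / N%:R <= \sum_i m i ^+ 2.
  rewrite -subr_ge0; have <- : \sum_i (m i - tau / N%:R) ^+ 2 = \sum_i m i ^+ 2 - tau ^+ 2 / N%:R.
    under eq_bigr do rewrite sqrrB.
    rewrite big_split /= sumrB sumr_const card_ord sumrMnl -mulr_suml -/tau -mulr_natl.
    by field; rewrite gt_eqF.
  by apply: sumr_ge0 => i _; exact: sqr_ge0.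
have -> : ntr Y = (tau / N%:R)%:C.
  by rewrite /ntr trE rmorphM fmorphV rmorph_nat mulrC.
rewrite /= ler_wsqrtr // expr0n addr0 ler_pdivlMr ?mulr_gt0 //.
have -> : (tau / N%:R) ^+ 2 * (u * N%:R) = u * (tau ^+ 2 / N%:R).
  by field; rewrite gt_eqF.
apply: (@le_trans _ _ (u * hs M)); first by rewrite ler_pM2l // (le_trans cs).
by move: hsM; move: (hs M) => x; lra.
Qed.

End TraceBound.

Section DensityBound.
Context (R : realType) (N : nat) d (T : measurableType d) (P : probability T R).
Local Notation C := R[i].
Variables (A : 'M[C]_N) (W : T -> 'M[C]_N) (sigma : coord_idx N -> R) (u : R).
Hypotheses (N0 : (0 < N)%N) (hA : A \is hermsymmx).
Hypotheses (u0 : 0 < u) (s0 : forall q, 0 <= sigma q) (su : forall a b, u <= sigma (row_idx a b)).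
Hypothesis SE : forall Q, self_energy P W Q = energy_op sigma Q.

Lemma scdos_nonreal_le z : 0 < complex.Im z -> scdos_nonreal P A W z <= Num.sqrt (2 / (u * N%:R)).
Proof.
move=> z0; set B := Num.sqrt _; have B0 : 0 <= B by exact: sqrtr_ge0.
have h : cabs (ntr (Im_mx (MDE_sol P A W z))) <= B.
  rewrite /MDE_sol; case: xgetP => [M _ [uM eM pM]|_].
    by apply: (MDE_trace_bound u0 s0 su N0 hA z0 uM _ pM); rewrite eM SE.
  (* Without a solution of the equation, [MDE_sol] takes the default value 0, which has density
     0. *)
  have -> : ntr (Im_mx (0 : 'M[C]_N)) = 0.
    by rewrite /ntr /Im_mx trmx0 map_mx0 subrr scaler0 mxtrace0 mulr0.
  by rewrite /= expr0n addr0 sqrtr0.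
have pi1 : 1 <= pi :> R by apply: le_trans (pi_ge2 R); rewrite ler1n.
have pi0 : 0 < pi :> R by exact: lt_le_trans pi1.
rewrite /scdos_nonreal; apply: (@le_trans _ _ (pi^-1 * B)).
  by rewrite ler_wpM2l // invr_ge0 ltW.
by rewrite ler_piMl // invf_le1.
Qed.

Lemma scdos_real_le E : scdos P A W E%:C <= Num.sqrt (2 / (u * N%:R)).
Proof.
rewrite /scdos /= eqxx /=.
have [c|nc] := pselect (cvg (scdos_nonreal P A W (E +i* eta) @[eta --> (0 : R)^'+])).
  apply: limr_le => //; near=> eta; apply: scdos_nonreal_le.
  by near: eta; exact: nbhs_right_gt.
(* Where the limit does not exist, [lim] takes the default value 0. *)
by rewrite dvgP //; exact: sqrtr_ge0.
Unshelve. all: by end_near. Qed.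

End DensityBound.

Section EigenvalueSums.
Context (R : realType) (N : nat).
Local Notation C := R[i].
Implicit Types (H : 'M[C]_N).

Lemma sum_eigs H (G : R -> R) : \sum_(i < N) G (eigs H)`_i = \sum_i G (lam H i).
Proof.
have sz : size (eigs H) = N by rewrite size_sort size_map size_enum_ord.
transitivity (\sum_(x <- eigs H) G x); first by rewrite (big_nth 0) sz big_mkord.
have /permPl p := perm_sort <=%R [seq complex.Re (spectral_diag H 0 i) | i <- enum 'I_N].
by rewrite (perm_big _ p) big_map big_enum.
Qed.

End EigenvalueSums.

(** * Correlation functions *)

Section FinfunSums.
Context (N : nat).

Lemma sum_ffun1 (V : nmodType) (K : 'I_N -> V) :
  \sum_(i : {ffun 'I_1 -> 'I_N} | injectiveb i) K (i ord0) = \sum_a K a.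
Proof.
rewrite (reindex (fun a : 'I_N => [ffun _ : 'I_1 => a])) /=; last first.
  exists (fun i : {ffun 'I_1 -> 'I_N} => i ord0) => [a _|i _]; first by rewrite ffunE.
  by apply/ffunP => k; rewrite ffunE (ord1 k).
apply: eq_big => [a|a _]; last by rewrite ffunE.
by apply/injectiveP => k l _; rewrite !ord1.
Qed.

Lemma sum_ffun0 (V : nmodType) (x : V) :
  \sum_(i : {ffun 'I_0 -> 'I_N} | injectiveb i) x = x.
Proof.
rewrite (eq_bigl xpredT) => [|i]; last by apply/injectiveP => -[].
by rewrite sumr_const card_ffun !card_ord expn0.
Qed.

Lemma sum_ffun2 (V : nmodType) (K : 'I_N -> 'I_N -> V) :
  \sum_(i : {ffun 'I_2 -> 'I_N} | injectiveb i) K (i ord0) (i ord_max) = \sum_a \sum_(b | b != a) K a b.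
Proof.
rewrite pair_big_dep /=.
rewrite (reindex (fun p : 'I_N * 'I_N => [ffun k : 'I_2 => if k == ord0 then p.1 else p.2])) /=; last first.
  exists (fun i : {ffun 'I_2 -> 'I_N} => (i ord0, i ord_max)) => [[a b] _|i _]; first by rewrite !ffunE.
  apply/ffunP => k; rewrite ffunE; case: eqP => [-> //|k0] /=; congr (i _).
  by apply/val_inj; case: k k0 => -[|[|//]] // h /eqP; rewrite -val_eqE.
apply: eq_big => [[a b]|[a b] _]; last by rewrite !ffunE.
apply/injectiveP/idP => [h|/= ba k l].
  by apply/eqP => /= e; have := h ord0 ord_max; rewrite !ffunE /= e => /(_ erefl) /(congr1 val).
rewrite !ffunE; have k2 (j : 'I_2) : j != ord0 -> j = ord_max.
  by case: j => -[|[|//]] // p _; apply: val_inj.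
have [->|/k2 ->] := eqVneq k ord0; have [->|/k2 ->] := eqVneq l ord0 => //= e; exfalso; move: ba.
  by rewrite e eqxx.
by rewrite e eqxx.
Qed.

Lemma sum_offdiag (V : zmodType) (X : Type) (K : X -> X -> V) (x : 'I_N -> X) :
  \sum_a \sum_(b | b != a) K (x a) (x b) = \sum_a \sum_b K (x a) (x b) - \sum_a K (x a) (x a).
Proof.
by rewrite -sumrB; apply: eq_bigr => a _; rewrite [\sum_b K _ _](bigD1 a) //= addrC addrK.
Qed.

End FinfunSums.

Section Correlations.
Context (R : realType) (N : nat) d (T : measurableType d) (P : probability T R).
Local Notation C := R[i].
Variables (H1 H2 : T -> 'M[C]_N) (F : 'rV[R]_2 -> R) (E s : R).
Hypothesis N0 : (0 < N)%N.
Let F2 u v := F (row2 u v).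
Let f := rescale s E F2.

Let NR : N%:R != 0 :> R. Proof. by rewrite pnatr_eq0 -lt0n. Qed.

Let fact1 : (N - 1)`!%:R / N`!%:R = N%:R^-1 :> R.
Proof.
by case: N N0 => // n _; rewrite subn1 /= factS natrM invfM mulrCA mulfV ?mulr1 // pnatr_eq0 -lt0n fact_gt0.
Qed.

Let fact0 : (N - 0)`!%:R / N`!%:R = 1 :> R.
Proof. by rewrite subn0 divff // pnatr_eq0 -lt0n fact_gt0. Qed.

Lemma rescaled_correlation11 :
  rescaled_integral (correlation P H1 H2 1 1) E s F =
  s ^+ 2 * \int[P]_w (N%:R^-1 * N%:R^-1 * pair_stat f (H1 w) (H2 w)).
Proof.
rewrite /rescaled_integral /correlation unlock; congr (_ * _); apply: eq_Rintegral => w _.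
rewrite fact1; congr (_ * _).
transitivity (\sum_(i : {ffun 'I_1 -> 'I_N} | injectiveb i) \sum_(j : {ffun 'I_1 -> 'I_N} | injectiveb j)
   f (eigs (H1 w))`_(i ord0) (eigs (H2 w))`_(j ord0)).
  apply: eq_bigr => i _; apply: eq_bigr => j _; rewrite /f /rescale /F2; congr F.
  apply/rowP => k; rewrite !mxE; case: splitP => l kl; rewrite !mxE ord1.
    by have -> : k == 0 by rewrite -val_eqE /= kl ord1.
  by have -> : (k == 0) = false by rewrite -val_eqE /= kl ord1.
rewrite (sum_ffun1 (fun a => \sum_(j : {ffun 'I_1 -> 'I_N} | injectiveb j) f (eigs (H1 w))`_a (eigs (H2 w))`_(j ord0))).
under eq_bigr => a _ do rewrite (sum_ffun1 (fun b => f (eigs (H1 w))`_a (eigs (H2 w))`_b)) (sum_eigs _ (f _)).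
exact: (sum_eigs _ (fun x => \sum_j f x (lam (H2 w) j))).
Qed.

Lemma rescaled_correlation10 :
  rescaled_integral (correlation P H1 H2 1 0) E s (fun x => F (const_mx (x 0 0))) =
  s * \int[P]_w (N%:R^-1 * trf (fun t => f t t) (H1 w)).
Proof.
rewrite /rescaled_integral /correlation unlock; congr (_ * _); apply: eq_Rintegral => w _.
rewrite fact1 fact0 mulr1; congr (_ * _).
transitivity (\sum_(i : {ffun 'I_1 -> 'I_N} | injectiveb i)
   f (eigs (H1 w))`_(i ord0) (eigs (H1 w))`_(i ord0)).
  apply: eq_bigr => i _; rewrite -[RHS](sum_ffun0 N); apply: eq_bigr => j _; rewrite /f /rescale /F2; congr F.
  apply/rowP => k; rewrite !mxE if_same; case: splitP => l kl; last by case: l kl.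
  by rewrite mxE ord1.
rewrite (sum_ffun1 (fun a => f (eigs (H1 w))`_a (eigs (H1 w))`_a)).
exact: (sum_eigs _ (fun x => f x x)).
Qed.

Lemma rescaled_correlation20 :
  rescaled_integral (correlation P H1 H2 2 0) E s F =
  s ^+ 2 * \int[P]_w ((N - 2)`!%:R / N`!%:R * (pair_stat f (H1 w) (H1 w) - trf (fun t => f t t) (H1 w))).
Proof.
rewrite /rescaled_integral /correlation unlock; congr (_ * _); apply: eq_Rintegral => w _.
rewrite fact0 mulr1; congr (_ * _).
transitivity (\sum_(i : {ffun 'I_2 -> 'I_N} | injectiveb i)
   f (eigs (H1 w))`_(i ord0) (eigs (H1 w))`_(i ord_max)).
  apply: eq_bigr => i _; rewrite -[RHS](sum_ffun0 N); apply: eq_bigr => j _; rewrite /f /rescale /F2; congr F.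
  apply/rowP => k; rewrite !mxE; case: splitP => l kl; last by case: l kl.
  rewrite !mxE; have [k0|k0] := eqVneq k 0.
    by have -> : l = ord0 by apply: val_inj; rewrite /= -kl k0.
  have -> // : l = ord_max; apply: val_inj; rewrite /= -kl.
  by case: k k0 {kl} => -[|[|//]] // p /eqP; rewrite -val_eqE.
rewrite (sum_ffun2 (fun a b => f (eigs (H1 w))`_a (eigs (H1 w))`_b)) sum_offdiag.
under [X in X - _]eq_bigr => a _ do rewrite (sum_eigs _ (f _)).
by rewrite (sum_eigs _ (fun x => \sum_j f x (lam (H1 w) j))) (sum_eigs _ (fun x => f x x)).
Qed.

End Correlations.

(** * The three matrices of the model and their density of states *)

Section PerturbedModel.
Context (R : realType) (N : nat) d (T : measurableType d) (P : probability T R).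
Local Notation C := R[i].
Local Notation JK := (('I_3 * coord_idx N)%type : finType).
Hypothesis N0 : (0 < N)%N.
Variables (beta : symmetry_type) (c0 C0 : R) (Cp : nat -> R) (Y : 'I_3 -> T -> 'M[C]_N).
Hypothesis wY : wigner_type P beta c0 C0 Cp (Y ord0).
Hypothesis gY : forall c, gaussian_ensemble P beta (Y (gslot c)).
Hypothesis indY : mutually_independent P (fun j => sigma_matrix (Y j)).

Definition coords (i : JK) (w : T) : R := hcoord i.2 (Y i.1 w).

Let slot_case (Q : 'I_3 -> Prop) : Q ord0 -> (forall c, Q (gslot c)) -> forall j, Q j.
Proof.
move=> h0 hg [[|[|[|//]]] lt3].
- by rewrite (_ : Ordinal lt3 = ord0) //; exact: val_inj.
- by rewrite (_ : Ordinal lt3 = gslot true) //; apply: val_inj; rewrite /= inordK.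
- by rewrite (_ : Ordinal lt3 = gslot false) //; apply: val_inj; rewrite /= inordK.
Qed.

Lemma model_herm j w : Y j w \is hermsymmx.
Proof.
move: j; apply: slot_case => [|c]; first exact: has_symmetry_herm (wigner_symm wY w).
exact: has_symmetry_herm (gauss_symm (gY c) w).
Qed.

Lemma coords_indep : rect_indep P coords.
Proof.
apply: (joint_rect_indep indY); apply: slot_case => [|c]; first exact: wigner_rect_indep wY.
exact: gauss_rect_indep (gY c).
Qed.

Lemma coords_gauss c k : gauss_coord P (2 / N%:R) (coords (gslot c, k)).
Proof. exact: (gauss_coord_ensemble N0 k (gY c)). Qed.

Lemma coords_meas i : measurable_fun setT (coords i).
Proof.
case: i => j k; move: j; apply: slot_case => [|c]; last exact: gc_meas (coords_gauss c k).
by have [] := wigner_coord_moments wY k.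
Qed.

Lemma coords_int4 i : P.-integrable setT (EFin \o (fun w => coords i w ^+ 4)).
Proof.
case: i => j k; move: j; apply: slot_case => [|c]; last exact: (gc_integrable (coords_gauss c k) (ltn0Sn 3)).
by have [] := wigner_coord_moments wY k.
Qed.

Lemma coords_mean0 i : \int[P]_w coords i w = 0.
Proof.
case: i => j k; move: j; apply: slot_case => [|c]; last exact: gc_mean0 (coords_gauss c k).
by have [] := wigner_coord_moments wY k.
Qed.

Lemma coord_mx_coords j w : coord_mx coords j w = Y j w.
Proof. exact: sum_hstep (model_herm j w). Qed.

Variable a : R.

Definition coord_var q := \int[P]_w (hcoord q (Y ord0 w) * hcoord q (Y ord0 w)) +
  a ^+ 2 * \int[P]_w (hcoord q (Y (gslot true) w) * hcoord q (Y (gslot true) w)).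

Let gslot0 c : gslot c != ord0.
Proof. by rewrite -val_eqE; case: c; rewrite /= inordK. Qed.

Lemma model_self_energy c Q :
  self_energy P (fun w => Y ord0 w + a%:C *: Y (gslot c) w) Q = energy_op coord_var Q.
Proof.
rewrite self_energyE.
- congr energy_op; apply/funext => q.
  rewrite (perturbed_variance coords_indep coords_meas coords_int4 coords_mean0 a (gslot0 c) q).
  by rewrite /coord_var (gauss_second_moment_eq N0 q (gY c) (gY true)).
- by move=> w; apply: hermD; [exact: model_herm|apply: hermZ; exact: model_herm].
- by move=> q q'; exact: (perturbed_integrable coords_meas coords_int4).
- by move=> q q'; exact: (perturbed_orthogonal coords_indep coords_meas coords_int4 coords_mean0).
Qed.

Lemma coord_var_ge0 q : 0 <= coord_var q.
Proof.
have p (X : T -> R) : 0 <= \int[P]_w (X w * X w) by apply: Rintegral_ge0 => w _; exact: sqr_ge0.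
by rewrite /coord_var addr_ge0 ?p // mulr_ge0 ?sqr_ge0 ?p.
Qed.

Lemma coord_var_row b b' : c0 / 2 / N%:R <= coord_var (row_idx b b').
Proof.
have p (X : T -> R) : 0 <= \int[P]_w (X w * X w) by apply: Rintegral_ge0 => w _; exact: sqr_ge0.
apply: ler_wpDr; first by rewrite mulr_ge0 ?sqr_ge0 ?p.
exact: (rf_var (wigner_row_family wY) b b').
Qed.

(** For fixed A the density depends on the random part only through its self-energy. *)
Lemma model_scdos_eq A z : scdos P A (fun w => Y ord0 w + a%:C *: Y (gslot true) w) z =
  scdos P A (fun w => Y ord0 w + a%:C *: Y (gslot false) w) z.
Proof.
have E : self_energy P (fun w => Y ord0 w + a%:C *: Y (gslot true) w) =
  self_energy P (fun w => Y ord0 w + a%:C *: Y (gslot false) w).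
  by apply/funext => Q; rewrite !model_self_energy.
by rewrite /scdos /scdos_nonreal /MDE_sol /MDE_solution E.
Qed.

Lemma model_scdos_le A E : 0 < c0 -> A \is hermsymmx ->
  scdos P A (fun w => Y ord0 w + a%:C *: Y (gslot true) w) E%:C <= Num.sqrt (2 / (c0 / 2)).
Proof.
move=> c0p hA; have NR : 0 < N%:R :> R by rewrite ltr0n.
have u0 : 0 < c0 / 2 / N%:R by rewrite divr_gt0 // divr_gt0.
have h := scdos_real_le N0 hA u0 coord_var_ge0 coord_var_row (model_self_energy true) E.
by move: h; rewrite divfK // gt_eqF.
Qed.

End PerturbedModel.

(** * Harmonic sums, the correlation estimate and the final rate *)

Section Harmonic.
Context (R : realType).

Lemma harmonic_ln n : \sum_(j < n.+1) (1 + j%:R)^-1 <= 1 + ln (n.+1%:R) :> R.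
Proof.
elim: n => [|n IH]; first by rewrite big_ord_recr big_ord0 /= ln1 !addr0 add0r invr1.
rewrite big_ord_recr /=; apply: le_trans (lerD IH (lexx _)) _; rewrite -addrA lerD2l.
have p1 : 0 < n.+1%:R :> R by rewrite ltr0n.
have p2 : 0 < n.+2%:R :> R by rewrite ltr0n.
have e : 1 + n.+1%:R = n.+2%:R :> R by rewrite nat1r.
have q : 0 < 1 - n.+2%:R^-1 :> R by rewrite subr_gt0 invf_lt1 // ltr1n.
have -> : ln n.+1%:R = ln n.+2%:R + ln (1 - n.+2%:R^-1) :> R.
  by rewrite -lnM ?posrE // mulrBr mulr1 mulfV ?gt_eqF // -e addrC addKr.
have h : ln (1 - n.+2%:R^-1) <= - n.+2%:R^-1 :> R by apply: le_ln1Dx; rewrite ltrN2 invf_lt1 // ltr1n.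
by apply: le_trans (lerD (lerD (lexx _) h) (lexx _)) _; rewrite e subrK.
Qed.

(** The logarithm is traded for a power by delta ln x = ln (x^delta) <= x^delta; the factor 2
    absorbs N + 1 <= 2 N. *)
Lemma harmonic_powR (delta : R) N : 0 < delta <= 1 -> (0 < N)%N ->
  \sum_(j < N.+1) (1 + j%:R)^-1 <= (1 + 2 / delta) * N%:R `^ delta.
Proof.
move=> /andP[d0 d1] N0; have N1 : 1 <= N%:R :> R by rewrite ler1n.
have x1 := powR_ge1 N1 (ltW d0).
apply: le_trans (harmonic_ln N) _; rewrite mulrDl mul1r; apply: lerD => //.
rewrite mulrAC ler_pdivlMr // mulrC -ln_powR.
have N2 : 0 < N.+1%:R `^ delta :> R by rewrite powR_gt0 // ltr0n.
apply: (@le_trans _ _ (N.+1%:R `^ delta)).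
  move: N2; move: (N.+1%:R `^ delta) => y y0.
  have h : ln (1 + (y - 1)) <= y - 1 by apply: le_ln1Dx; lra.
  by move: h; rewrite addrC subrK; lra.
apply: (@le_trans _ _ ((2 * N%:R) `^ delta)).
  apply: ge0_ler_powR; [exact: ltW|by rewrite nnegrE|by rewrite nnegrE mulr_ge0|].
  by rewrite mulr_natl mulr2n -natr1 lerD2l.
rewrite powRM // ler_wpM2r ?powR_ge0 //.
by rewrite -[leRHS]powRr1 //; apply: ler_powR => //; rewrite ler1n.
Qed.

End Harmonic.

Section CorrelationEstimate.
Context (R : realType) (N : nat) d (T : measurableType d) (P : probability T R).
Local Notation C := R[i].
Hypothesis N0 : (0 < N)%N.
Variables (beta : symmetry_type) (c0 C0 : R) (Cp : nat -> R) (Y : 'I_3 -> T -> 'M[C]_N).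
Hypothesis wY : wigner_type P beta c0 C0 Cp (Y ord0).
Hypothesis gY : forall c, gaussian_ensemble P beta (Y (gslot c)).
Hypothesis indY : mutually_independent P (fun j => sigma_matrix (Y j)).
Variables (F : 'rV[R]_2 -> R) (M r : R) (D : nat -> nat -> R -> R -> R).
Let F2 u v := F (row2 u v).
Hypothesis tf : test_fun F2 M r D.
Variables (E rho eta B1 a : R) (A : 'M[C]_N).
Let s := rho * N%:R.
Hypotheses (rho0 : 0 < rho) (eta0 : 0 < eta) (eta_r : r <= s * eta) (eta_1 : 1 <= s * eta).
Hypothesis hB : forall E' x, convol (@hstep R N) P (fun k w => hcoord k (Y ord0 w)) (enum (coord_idx N))
  (fun x => cnt E' eta x ^+ 3) x <= B1.
Hypotheses (a0 : 0 < a) (hA : A \is hermsymmx).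

Let H c w := A + (Y ord0 w + a%:C *: Y (gslot c) w).
Let f := rescale s E F2.
Let Z := coords Y.

Let NR : 0 < N%:R :> R. Proof. by rewrite ltr0n. Qed.
Let s0 : 0 < s. Proof. exact: mulr_gt0. Qed.
Let mZ := coords_meas N0 wY gY.
Let iZ := coords_indep wY gY indY.
Let hH := model_herm wY gY.

Let herm_H c w : H c w \is hermsymmx.
Proof. by apply: hermD => //; apply: hermD; [exact: hH|apply: hermZ; exact: hH]. Qed.

Let perturbedE b w : perturbed Z b a (A, A) w = (H true w, H b w).
Proof. by rewrite /perturbed /= !(coord_mx_coords wY gY). Qed.

Let pair_obsE b w : pair_obs f (perturbed Z b a (A, A) w) = pair_stat f (H true w) (H b w).
Proof. by rewrite perturbedE /pair_obs /= !hermpart_id. Qed.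

Let M0 : 0 <= M. Proof. exact: le_trans (normr_ge0 _) (@tf_bound _ _ _ _ _ tf 0 0 0 0 isT isT). Qed.

Let f_bound u v : `|f u v| <= M * ((`|s * (u - E)| <= r)%R%:R * (`|s * (v - E)| <= r)%R%:R).
Proof.
rewrite /f /rescale -(tf0 tf).
have [h|h] := leP `|s * (u - E)| r; last by rewrite (tf_out1 tf _ _ _ h) normr0 mul0r mulr0.
have [h'|h'] := leP `|s * (v - E)| r; last by rewrite (tf_out2 tf _ _ _ h') normr0 mulr0 mulr0.
by rewrite !mulr1; exact: (tf_bound tf).
Qed.

Let pair_int b : P.-integrable setT (EFin \o (fun w => pair_stat f (H true w) (H b w))).
Proof.
have [M' [L' bl]] := pair_obs_lip N tf E s0 b.
apply: (bounded_integrable P (M := M')) => [|w].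
  by apply: eq_measurable_fun (perturbed_measurable mZ a (A, A) bl) => w _; exact: pair_obsE.
by rewrite -pair_obsE; case: bl => h _; exact: h.
Qed.

Let diag_int : P.-integrable setT (EFin \o (fun w => trf (fun t => f t t) (H true w))).
Proof.
have [M' [r' tf']] := rescale_test_fun tf E s0.
have M'0 : 0 <= M' by exact: le_trans (normr_ge0 _) (@tf_bound _ _ _ _ _ tf' 0 0 0 0 isT isT).
have fb u : `|f u u| <= M' by rewrite /f -(tf0 tf'); exact: (tf_bound tf').
have fl u v : `|f u u - f v v| <= (M' + M') * `|u - v|.
  have -> : f u u - f v v = (f u u - f v u) + (f v u - f v v) by rewrite addrA subrK.
  rewrite mulrDl; apply: le_trans (ler_normD _ _) _; rewrite /f -(tf0 tf'); apply: lerD.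
    apply: (@derive_bound_lip _ (fun t => rescale_der D s E 0 0 t u) (fun t => rescale_der D s E 1 0 t u)) => t.
      exact: (tf1 tf').
    exact: (tf_bound tf').
  apply: (@derive_bound_lip _ (fun t => rescale_der D s E 0 0 v t) (fun t => rescale_der D s E 0 1 v t)) => t.
    exact: (tf2 tf').
  exact: (tf_bound tf').
have bl := slot_bounded_lip true true (mulr_ge0 (addr_ge0 M'0 M'0) (addr_ge0 (ler0n R N) (ler0n R 4)))
  (trf_bounded_lip N fb (addr_ge0 M'0 M'0) fl).
have e w : trf (fun t => f t t) (hermpart (perturbed Z true a (A, A) w).1) = trf (fun t => f t t) (H true w).
  by rewrite perturbedE /= hermpart_id.
apply: (bounded_integrable P (M := N%:R * M')) => [|w].
  by apply: eq_measurable_fun (perturbed_measurable mZ a (A, A) bl) => w _; exact: e.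
by rewrite -e; case: bl => h _; exact: h.
Qed.

Let I12 := \int[P]_w pair_stat f (H true w) (H false w).
Let I11 := \int[P]_w pair_stat f (H true w) (H true w).
Let ID := \int[P]_w trf (fun t => f t t) (H true w).

Let coupling : `|I12 - I11| <= 2 * (a ^+ 2 * (flow_rate (2 / N%:R) M r s * drift_const N B1)).
Proof.
have v0 : 0 <= 2 / N%:R :> R by rewrite divr_ge0.
have h := pair_coupling N0 v0 mZ iZ (coords_gauss N0 gY) tf E s0 eta0 eta_r eta_1 hB (A, A) a0.
rewrite /I12 /I11.
have e b : \int[P]_w pair_stat f (H true w) (H b w) = \int[P]_w pair_obs f (perturbed Z b a (A, A) w).
  by apply: eq_Rintegral => w _; rewrite pair_obsE.
apply: le_trans h; rewrite le_eqVlt; apply/orP; left; apply/eqP.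
exact: (congr2 (fun p q : R => `|p - q|) (e false) (e true)).
Qed.

Let offdiagE w : pair_stat f (H true w) (H true w) - trf (fun t => f t t) (H true w) =
  \sum_i \sum_(j | j != i) f (lam (H true w) i) (lam (H true w) j).
Proof. by rewrite sum_offdiag. Qed.

(** Only pairs of eigenvalues near E contribute, at most the square of a count, which is below 1
    plus its cube. *)
Let offdiag_le : `|I11 - ID| <= M * (1 + B1).
Proof.
rewrite /I11 /ID -RintegralB //.
have [[Mc [Lc bc]] _] := @cube_bound R N d T P Z eta B1 eta0 hB true true E.
have ic : P.-integrable setT (EFin \o (fun w => cnt E eta (H true w) ^+ 3)).
  apply: (bounded_integrable P (M := Mc)) => [|w].
    by apply: eq_measurable_fun (perturbed_measurable mZ a (A, A) bc) => w _; rewrite perturbedE.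
  by case: bc => h _; have := h (perturbed Z true a (A, A) w); rewrite perturbedE.
have i1 : P.-integrable setT (EFin \o (fun w => 1 + cnt E eta (H true w) ^+ 3)).
  by apply: integrableRD => //; exact: integrableR_cst.
have id : P.-integrable setT (EFin \o (fun w => pair_stat f (H true w) (H true w) - trf (fun t => f t t) (H true w))).
  exact: integrableRB.
apply: (@le_trans _ _ (\int[P]_w (M * (1 + cnt E eta (H true w) ^+ 3)))).
  apply: le_trans (le_normr_Rintegral _ _) _ => //.
  apply: le_Rintegral => //; [exact: integrableR_norm|exact: integrableRZ|].
  move=> w _; rewrite offdiagE.
  have nc := near_count_le E s0 eta0 eta_r (H true w); rewrite hermpart_id // in nc.
  apply: (@le_trans _ _ (M * (near_count r s E (H true w) * near_count r s E (H true w)))).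
    rewrite /near_count mulr_suml mulr_sumr; apply: le_trans (ler_norm_sum _ _ _) _; apply: ler_sum => i _.
    rewrite mulr_sumr mulr_sumr; apply: le_trans (ler_norm_sum _ _ _) _.
    rewrite [leRHS](bigID (fun j => j != i)) /=; apply: ler_wpDr.
      by apply: sumr_ge0 => j _; rewrite mulr_ge0 // mulr_ge0.
    by apply: ler_sum => j _; exact: f_bound.
  rewrite ler_wpM2l //; have n0 := near_count_ge0 r s E (H true w).
  move: nc n0; move: (near_count _ _ _ _) (cnt _ _ _) => p q pq p0.
  apply: (@le_trans _ _ (q * q)); first by rewrite ler_pM.
  have q0 : 0 <= q by exact: le_trans pq.
  have -> : q ^+ 3 = q * (q * q) by ring.
  have := mulr_ge0 q0 (sqr_ge0 (q - 1)); have := sqr_ge0 (q - 1); nra.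
rewrite RintegralZl // RintegralD //; last exact: integrableR_cst.
rewrite ler_wpM2l // Rintegral_prob_cst lerD2l.
have := cube_expectation mZ iZ E eta0 hB true a (A, A) true.
by under eq_Rintegral do rewrite perturbedE.
Qed.

Let offdiag1 : N = 1%N -> I11 = ID.
Proof.
move=> N1; apply: eq_Rintegral => w _; apply/eqP; rewrite -subr_eq0 offdiagE; apply/eqP.
apply: big1 => i _; rewrite big1 // => j /eqP ji; exfalso; apply: ji; apply: val_inj.
by case: i j => i hi [j hj] /=; move: hi hj; rewrite N1; case: i => //; case: j.
Qed.

(** Besides the coupling error there is only the gap between 1/N^2 and 1/(N (N - 1)) on the
    off-diagonal pairs; the diagonal pairs match exactly. *)
Lemma correlation_difference :
  `|rescaled_integral (correlation P (H true) (H false) 1 1) E s F -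
    (rho * rescaled_integral (correlation P (H true) (H false) 1 0) E s (fun x => F (const_mx (x 0 0))) +
     rescaled_integral (correlation P (H true) (H false) 2 0) E s F)| <=
  rho ^+ 2 * (2 * (a ^+ 2 * (flow_rate (2 / N%:R) M r s * drift_const N B1))) +
  2 * rho ^+ 2 / N%:R * (M * (1 + B1)).
Proof.
rewrite rescaled_correlation11 // rescaled_correlation10 // rescaled_correlation20 // -/F2 -/f.
have io : P.-integrable setT (EFin \o (fun w => pair_stat f (H true w) (H true w) - trf (fun t => f t t) (H true w))).
  exact: integrableRB.
set kap := (N - 2)`!%:R / N`!%:R.
have e1 : \int[P]_w (N%:R^-1 * N%:R^-1 * pair_stat f (H true w) (H false w)) = N%:R^-1 * N%:R^-1 * I12.
  exact: (RintegralZl _ measurableT (pair_int false)).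
have e2 : \int[P]_w (N%:R^-1 * trf (fun t => f t t) (H true w)) = N%:R^-1 * ID.
  exact: (RintegralZl _ measurableT diag_int).
have e3 : \int[P]_w (kap * (pair_stat f (H true w) (H true w) - trf (fun t => f t t) (H true w))) = kap * (I11 - ID).
  have eB : \int[P]_w (pair_stat f (H true w) (H true w) - trf (fun t => f t t) (H true w)) = I11 - ID.
    exact: (RintegralB measurableT (pair_int true) diag_int).
  by apply: etrans (RintegralZl _ measurableT io) _; rewrite eB.
rewrite e1 e2 e3.
have -> : s ^+ 2 * (N%:R^-1 * N%:R^-1 * I12) - (rho * (s * (N%:R^-1 * ID)) + s ^+ 2 * (kap * (I11 - ID))) =
  rho ^+ 2 * (I12 - I11) + (rho ^+ 2 - s ^+ 2 * kap) * (I11 - ID).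
  by rewrite /s; move: NR; move: (N%:R : R) => y y0; field; rewrite gt_eqF.
apply: le_trans (ler_normD _ _) _; apply: lerD.
  by rewrite normrM ger0_norm ?sqr_ge0 // ler_wpM2l ?sqr_ge0 //; exact: coupling.
(* For N = 1 the truncated subtraction in (N - 2)! makes [kap] equal to 1, but there are no
   off-diagonal pairs. *)
have [N1|N2] := leqP N 1.
  have eN : N = 1%N by apply/eqP; rewrite eqn_leq N1.
  rewrite (offdiag1 eN) subrr mulr0 normr0 mulr_ge0 //; first by rewrite divr_ge0 // mulr_ge0 // sqr_ge0.
  by apply: le_trans offdiag_le.
rewrite normrM; apply: ler_pM => //.
have -> : rho ^+ 2 - s ^+ 2 * kap = - (rho ^+ 2 / (N%:R - 1)).
  rewrite /kap /s; case: N N2 => [|[|n]] // _.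
  rewrite subn2 /= !factS !natrM -[n.+2%:R]natr1.
  have f0 : n`!%:R != 0 :> R by rewrite pnatr_eq0 -lt0n fact_gt0.
  have n1 : n.+1%:R != 0 :> R by rewrite pnatr_eq0.
  have n2 : n.+1%:R + 1 != 0 :> R by rewrite natr1 pnatr_eq0.
  by rewrite addrK; move: (n.+1%:R : R) (n`!%:R : R) f0 n1 n2 => y z z0 y0 y1; field; rewrite z0 y0 y1.
rewrite normrN ger0_norm; last by rewrite divr_ge0 ?sqr_ge0 // subr_ge0 ler1n.
have N2' : 2 <= N%:R :> R by rewrite ler_nat.
rewrite ler_pdivrMr; last by lra.
rewrite [leRHS]mulrAC ler_pdivlMr //.
by move: N2' (sqr_ge0 rho); move: (N%:R : R) (rho ^+ 2) => y p y2 p0; nra.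
Qed.

End CorrelationEstimate.

(** With n = N^(e/8), the third moments contribute n^3 and the harmonic sum n, in total n^4 =
    N^(e/2). The flow error alpha N N^(e/2) is then at most N^(-e/2), and the normalisation error
    N^(e/2)/N obeys the same bound because e <= 1. *)
Lemma error_rate (R : realType) N (e eps M r C1 B B1 rho alpha : R) :
  (0 < N)%N -> 0 < e <= 1 -> e <= eps -> 0 <= M -> 0 <= r -> 0 < C1 -> 0 < rho -> rho <= B ->
  0 < alpha -> alpha < N%:R `^ (- 1 - eps) ->
  B1 = C1 * (N%:R `^ (e / 8)) ^+ 3 ->
  rho ^+ 2 * (2 * (alpha * (flow_rate (2 / N%:R) M r (rho * N%:R) * drift_const N B1))) +
  2 * rho ^+ 2 / N%:R * (M * (1 + B1)) <=
  (B ^+ 4 * (256 * (12 * M * (1 + r)) * (1 + 2 * C1 + 4 * C1 * (1 + 2 / (e / 8)))) +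
   2 * B ^+ 2 * (M * (1 + C1))) * N%:R `^ (- (e / 2)).
Proof.
move=> N0 /andP[e0 e1] eeps M0 r0 C10 rho0 rhoB al0 al1 ->.
have NR : 1 <= N%:R :> R by rewrite ler1n.
have N0R : 0 < N%:R :> R by rewrite ltr0n.
have d0 : 0 < e / 8 by rewrite divr_gt0.
have n1 := powR_ge1 NR (ltW d0).
have harm : \sum_(j < N.+1) (1 + j%:R)^-1 <= (1 + 2 / (e / 8)) * N%:R `^ (e / 8).
  by apply: harmonic_powR => //; rewrite d0; lra.
have n4 : (N%:R `^ (e / 8)) ^+ 4 = N%:R `^ (e / 2).
  by rewrite -powR_mulrn ?powR_ge0 // -powRrM; congr (_ `^ _); field.
have pD u v : N%:R `^ (u + v) = N%:R `^ u * N%:R `^ v :> R.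
  by apply: powRD; rewrite (gt_eqF N0R); apply/implyP.
have N1 : N%:R `^ 1 = N%:R :> R by rewrite powRr1 // ltW.
have key1 : alpha * N%:R * N%:R `^ (e / 2) <= N%:R `^ (- (e / 2)).
  apply: (@le_trans _ _ (N%:R `^ (- 1 - e) * N%:R * N%:R `^ (e / 2))).
    apply: ler_wpM2r; first exact: powR_ge0.
    apply: ler_wpM2r; first exact: ltW.
    apply: le_trans (ltW al1) _.
    by apply: ler_powR => //; lra.
  rewrite -{2}N1 -!pD; apply: ler_powR => //; lra.
have key2 : N%:R `^ (e / 2) / N%:R <= N%:R `^ (- (e / 2)).
  rewrite -{2}N1 -powRN -pD; apply: ler_powR => //; lra.
have K0 : 0 < 1 + 2 / (e / 8) by rewrite addr_gt0 // divr_gt0.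
rewrite -n4 in key1 key2.
have drift : drift_const N (C1 * (N%:R `^ (e / 8)) ^+ 3) <=
    (1 + 2 * C1 + 4 * C1 * (1 + 2 / (e / 8))) * (N%:R `^ (e / 8)) ^+ 4.
  rewrite /drift_const -mulr_suml.
  move: harm n1 K0; move: (\sum_(j < N.+1) _) (1 + 2 / (e / 8)) (N%:R `^ (e / 8)) => S K n harm n1 K0.
  have n0 : 0 < n by exact: lt_le_trans n1.
  have n3 : 1 <= n ^+ 3 by exact: exprn_ege1.
  have n34 : n ^+ 3 <= n ^+ 4 by rewrite [leRHS]exprS ler_peMl // (le_trans _ n3).
  apply: (@le_trans _ _ (1 + C1 * n ^+ 3 + C1 * n ^+ 3 +
     K * n * (C1 * n ^+ 3 + C1 * n ^+ 3 + C1 * n ^+ 3 + C1 * n ^+ 3))).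
    rewrite lerD2l ler_wpM2r //.
    by rewrite !addr_ge0 // mulr_ge0 // ?ltW // exprn_gt0.
  have -> : K * n * (C1 * n ^+ 3 + C1 * n ^+ 3 + C1 * n ^+ 3 + C1 * n ^+ 3) = 4 * C1 * K * n ^+ 4 by ring.
  have -> : (1 + 2 * C1 + 4 * C1 * K) * n ^+ 4 = n ^+ 4 + C1 * n ^+ 4 + C1 * n ^+ 4 + 4 * C1 * K * n ^+ 4 by ring.
  rewrite lerD2r.
  have h1 : C1 * n ^+ 3 <= C1 * n ^+ 4 by rewrite ler_pM2l.
  apply: lerD => //; apply: lerD => //.
  exact: le_trans n34.
rewrite [leRHS]mulrDl /flow_rate; have n1' := n1; move: drift key1 key2 n1'; move: (N%:R `^ (- (e / 2))) (drift_const _ _) => X dr drift key1 key2 n1'.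
have B0 : 0 < B by exact: lt_le_trans rhoB.
have rB k : rho ^+ k <= B ^+ k by rewrite lerXn2r // nnegrE ltW.
set Kd := 1 + 2 * C1 + 4 * C1 * _ in drift *.
have Kd0 : 0 < Kd by rewrite /Kd; have := mulr_gt0 C10 K0; lra.
have G0 : 0 <= 256 * (12 * M * (1 + r)).
  apply: mulr_ge0; first exact: ler0n.
  by apply: mulr_ge0; [apply: mulr_ge0; first exact: ler0n|exact: addr_ge0].
move: key1 key2 drift n1'; move: (N%:R `^ (e / 8)) => n key1 key2 drift n1'.
have n0 : 0 < n by exact: lt_le_trans n1'.
apply: lerD.
  (* 256 is 2 times 64 times 2: two flows are compared, the eigenframe variance carries 64, and v =
     2/N. *)
  have -> : rho ^+ 2 * (2 * (alpha * (64 * (2 / N%:R) * ((rho * N%:R) ^+ 2 * (12 * M * (1 + r))) * dr))) =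
     rho ^+ 4 * (256 * (12 * M * (1 + r)) * (alpha * N%:R * dr)).
    by move: N0R; move: (N%:R : R) => y y0; field; rewrite gt_eqF.
  have X0 : 0 <= X.
    apply: le_trans key1; rewrite mulr_ge0 ?exprn_ge0 ?ltW // mulr_gt0 //.
  rewrite -[leRHS]mulrA; apply: (@le_trans _ _ (rho ^+ 4 * (256 * (12 * M * (1 + r)) * Kd * X))).
    rewrite ler_pM2l ?exprn_gt0 // -[leRHS]mulrA; apply: ler_wpM2l => //.
    apply: (@le_trans _ _ (alpha * N%:R * (Kd * n ^+ 4))).
      by apply: ler_wpM2l => //; rewrite mulr_ge0 // ltW.
    by rewrite mulrCA ler_wpM2l // ltW.
  apply: ler_wpM2r; last exact: rB.
  by apply: mulr_ge0; [apply: mulr_ge0; [exact: G0|exact: ltW]|exact: X0].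
apply: (@le_trans _ _ (2 * B ^+ 2 / N%:R * (M * ((1 + C1) * n ^+ 4)))).
  apply: ler_pM.
  - by rewrite divr_ge0 ?mulr_ge0 ?sqr_ge0 // ltW.
  - by rewrite mulr_ge0 // addr_ge0 // mulr_ge0 ?exprn_ge0 // ltW.
  - by rewrite ler_wpM2r ?invr_ge0 ?(ltW N0R) // ler_wpM2l.
  - rewrite ler_wpM2l // mulrDl mul1r; have n3 : n ^+ 3 <= n ^+ 4.
      by rewrite [leRHS]exprS ler_peMl // exprn_ge0 // ltW.
    by apply: lerD; [exact: exprn_ege1|rewrite ler_wpM2l // ltW].
have -> : 2 * B ^+ 2 / N%:R * (M * ((1 + C1) * n ^+ 4)) = 2 * B ^+ 2 * (M * (1 + C1)) * (n ^+ 4 / N%:R) by ring.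
rewrite ler_wpM2l //.
by rewrite !mulr_ge0 ?sqr_ge0 // ltW // addr_gt0.
Qed.

Theorem mainTheorem2 (R : realType) (eps : R) (eps_gt0 : 0 < eps) :
  exists c : R, 0 < c /\
  forall (beta : symmetry_type) (kappa c0 C0 : R) (Cp : nat -> R),
    0 < kappa -> 0 < c0 -> 0 < C0 -> (forall p, 0 < Cp p) ->
  forall F : 'rV[R]_2 -> R, Cinfty_c F ->
  exists C : R, forall N : nat, (0 < N)%N ->
  forall (d : measure_display) (T : measurableType d) (P : probability T R)
    (W WG1 WG2 : T -> 'M[R[i]]_N),
    wigner_type P beta c0 C0 Cp W ->
    gaussian_ensemble P beta WG1 ->
    gaussian_ensemble P beta WG2 ->
    mutually_independent P
      (fun k : 'I_3 => sigma_matrix (tnth [tuple W; WG1; WG2] k)) ->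
  forall (alpha : R) (A : 'M[R[i]]_N),
    0 < alpha < N%:R `^ (- 1 - eps) ->
    has_symmetry beta A -> opnorm A <= C0 ->
  let W1 := fun w => W w + (Num.sqrt alpha)%:C *: WG1 w in
  let W2 := fun w => W w + (Num.sqrt alpha)%:C *: WG2 w in
  let H1 := fun w => A + W1 w in
  let H2 := fun w => A + W2 w in
  (forall z : R[i], scdos P A W1 z = scdos P A W2 z) /\
  (forall E : R,
     let rho := scdos P A W1 E%:C in
     kappa <= rho ->
     let s := rho * N%:R in
     `| rescaled_integral (correlation P H1 H2 1 1) E s F
        - (rho * rescaled_integral (correlation P H1 H2 1 0) E s
                   (fun x => F (const_mx (x 0 0)))
           + rescaled_integral (correlation P H1 H2 2 0) E s F) |
     <= C * N%:R `^ (- c)).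
Proof.
(* The cap at 1 accounts for the normalisation error, which limits the rate when eps is large. *)
pose e := Num.min eps 1.
have e0 : 0 < e by rewrite lt_min eps_gt0 ltr01.
have e1 : 0 < e <= 1 by rewrite e0 ge_min lexx orbT.
have eeps : e <= eps by rewrite ge_min lexx.
exists (e / 2); split; first by rewrite divr_gt0.
move=> beta kappa c0 C0 Cp kappa0 c00 C00 Cp0 F FC.
have [M [r [D tf]]] := Cinfty_c_test_fun FC.
have r0 := tf_r tf.
have M0 : 0 <= M by exact: le_trans (normr_ge0 _) (@tf_bound _ _ _ _ _ tf 0 0 0 0 isT isT).
(* The window width in units of 1/N: as rho >= kappa, its rescaled half-width rho N eta is at least
   1 + r, so it covers the support of the test function and one unit of spacing. *)
have wd0 : 0 < (1 + r) / kappa by rewrite divr_gt0 // ltr_pwDl.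
have [C1 [C10 count]] := count_bound (divr_gt0 e0 (ltr0n R 8)) (divr_gt0 c00 (ltr0n R 2)) (Cp0 4) wd0.
(* The square root is the upper bound on the density of states, in the role of [B] in
   [error_rate]. *)
exists (Num.sqrt (2 / (c0 / 2)) ^+ 4 * (256 * (12 * M * (1 + r)) * (1 + 2 * C1 + 4 * C1 * (1 + 2 / (e / 8)))) +
  2 * Num.sqrt (2 / (c0 / 2)) ^+ 2 * (M * (1 + C1))) => N N0 d T P W WG1 WG2 wW gG1 gG2 ind alpha A /andP[al0 al1] sA _.
pose Y k := tnth [tuple W; WG1; WG2] k.
have Y0 : Y ord0 = W by [].
have Y1 : Y (gslot true) = WG1 by rewrite /Y (tnth_nth W) /= inordK.
have Y2 : Y (gslot false) = WG2 by rewrite /Y (tnth_nth W) /= inordK.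
have wY : wigner_type P beta c0 C0 Cp (Y ord0) by [].
have gY c : gaussian_ensemble P beta (Y (gslot c)) by case: c; rewrite ?Y1 ?Y2.
rewrite -Y0 -Y1 -Y2 => {}W1 {}W2 H1 H2.
have hA := has_symmetry_herm sA.
split=> [z|E rho le_rho]; first exact: (model_scdos_eq N0 wY gY ind).
cbv zeta; pose s := rho * N%:R; rewrite -/s.
have rho0 : 0 < rho by exact: lt_le_trans le_rho.
have N0R : 0 < N%:R :> R by rewrite ltr0n.
have a0 : 0 < Num.sqrt alpha by rewrite sqrtr_gt0.
have rhoB : rho <= Num.sqrt (2 / (c0 / 2)).
  exact: (model_scdos_le N0 wY gY ind (Num.sqrt alpha) E c00 hA).
pose eta := (1 + r) / kappa / N%:R.
have eta0 : 0 < eta by rewrite divr_gt0.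
have le_eta : 1 + r <= s * eta.
  have -> : s * eta = rho * ((1 + r) / kappa) by rewrite /s /eta; field; rewrite !gt_eqF.
  by rewrite mulrCA ler_peMr ?ler_pdivlMr ?mul1r // addr_ge0.
have eta_r : r <= s * eta by lra.
have eta_1 : 1 <= s * eta by lra.
have hB := count N N0 d T P _ (wigner_row_family wY).
have main := correlation_difference N0 wY gY ind tf E rho0 eta0 eta_r eta_1 hB a0 hA.
apply: (le_trans main).
rewrite [Num.sqrt alpha ^+ 2]sqr_sqrtr ?(ltW al0) //.
exact: (error_rate N0 e1 eeps M0 r0 C10 rho0 rhoB al0 al1 erefl).
Qed.
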